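(* Let $F=\operatorname{diag}(F_{11},F_{22})$, $G=\operatorname{diag}(G_{11},G_{22})$ and $\Delta=\Delta^H=[\Delta_{ij}]_{i,j=1}^4\ge 0$ be as described in the context, so that $G=G^H\ge0$, $\big(\Lambda(F_{11})\cup\Lambda(-F_{11}^H)\big)\cap\big(\Lambda(F_{22})\cup\Lambda(-F_{22}^H)\big)=\emptyset$, and for all sufficiently small $t\ge 0$ the Hamiltonian matrix $\widetilde H_1(t)$ defined in the context exists. Suppose that $(F_{11},G_{11})$ is controllable and $(F_{11},\Delta_{11})$ is observable, and assume that $F_{11}$ has a single eigenvalue, the purely imaginary number $\imath\alpha$ ($\alpha\in\mathbb R$), with exactly $s_\rho$ Jordan blocks of size $\rho\times\rho$ for $\rho=1,\ldots,k$ (where $s_\rho$ may be $0$, and there are no Jordan blocks of size larger than $k$). Then for sufficiently small $t>0$ all the eigenvalues of $\widetilde H_1(t)$ are semisimple. For each $\rho\in\{1,\ldots,k\}$ there are exactly $s_\rho$ purely imaginary eigenvalues of the form $$\lambda_{i,+}^{(\rho)}(t)=\imath\big(\alpha+(t\gamma_i^{(\rho)})^{\frac1{2\rho}}\big)+\mathcal O(t^{\frac1\rho}),\qquad i=1,\ldots,s_\rho,$$ and exactly $s_\rho$ purely imaginary eigenvalues of the form $$\lambda_{i,-}^{(\rho)}(t)=\imath\big(\alpha-(t\gamma_i^{(\rho)})^{\frac1{2\rho}}\big)+\mathcal O(t^{\frac1\rho}),\qquad i=1,\ldots,s_\rho,$$ where $\gamma_i^{(\rho)}>0$ for $i=1,\ldots,s_\rho$.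 Suppose moreover that the columns of the full column rank matrices $V_+^{(\rho)}(t)$ and $V_-^{(\rho)}(t)$ span the invariant subspaces of $\widetilde H_1(t)$ corresponding to $\{\lambda_{i,+}^{(\rho)}(t)\}_{i=1}^{s_\rho}$ and $\{\lambda_{i,-}^{(\rho)}(t)\}_{i=1}^{s_\rho}$, respectively. Then $$\imath\,(V_+^{(\rho)}(t))^HJ_1V_+^{(\rho)}(t)<0,\qquad \imath\,(V_-^{(\rho)}(t))^HJ_1V_-^{(\rho)}(t)>0.$$
   Context: Notation. $\imath=\sqrt{-1}$; $A^H$ is the conjugate transpose; $\Lambda(A)$ is the spectrum of $A$; $A>0$ ($A<0$, $A\ge0$) means Hermitian positive definite (negative definite, positive semidefinite). $\mathcal O(\cdot)$ refers to $t\to0^+$; the $\gamma_i^{(\rho)}$ do not depend on $t$; eigenvalues are counted with multiplicity. ''Purely imaginary'' means zero real part (zero included). A pair $(A,B)$ with $A\in\mathbb C^{n\times n}$ is controllable if $\operatorname{rank}[\,sI-A\;\;B\,]=n$ for all $s\in\mathbb C$, and $(A,C)$ is observable if $\operatorname{rank}\begin{bmatrix}sI-A\\ C\end{bmatrix}=n$ for all $s\in\mathbb C$. With $J$ denoting a matrix $\begin{bmatrix}0&I\\ -I&0\end{bmatrix}$, a matrix $A$ is Hamiltonian if $(JA)^H=JA$ and skew-Hamiltonian if $(JA)^H=-JA$. Setting. Let $F_{11},G_{11}\in\mathbb C^{n_1\times n_1}$ and $F_{22},G_{22}\in\mathbb C^{n_2\times n_2}$, with $$F=\begin{bmatrix}F_{11}&0\\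 0&F_{22}\end{bmatrix},\quad G=\begin{bmatrix}G_{11}&0\\ 0&G_{22}\end{bmatrix}=G^H\ge0,$$ and $(\Lambda(F_{11})\cup\Lambda(-F_{11}^H))\cap(\Lambda(F_{22})\cup\Lambda(-F_{22}^H))=\emptyset$. Let $$\Delta=\begin{bmatrix}\Delta_{11}&\Delta_{21}^H&\Delta_{31}^H&\Delta_{41}^H\\ \Delta_{21}&\Delta_{22}&\Delta_{32}^H&\Delta_{42}^H\\ \Delta_{31}&\Delta_{32}&\Delta_{33}&\Delta_{43}^H\\ \Delta_{41}&\Delta_{42}&\Delta_{43}&\Delta_{44}\end{bmatrix}\ge0$$ be Hermitian, with block rows and columns of sizes $n_1,n_2,n_1,n_2$. The perturbed Hamiltonian matrix under study is $H(t)=\begin{bmatrix}F&G\\ 0&-F^H\end{bmatrix}+tJ\Delta$, $t\ge0$, where $J=\begin{bmatrix}0&I\\ -I&0\end{bmatrix}$ with $I$ of size $n_1+n_2$. Let $J_i=\begin{bmatrix}0&I_{n_i}\\ -I_{n_i}&0\end{bmatrix}$, $i=1,2$. Interchanging the middle two block rows and columns, $H(t)$ becomes $$\begin{bmatrix}H_1(t)&tJ_1L^HJ_2\\ tL&H_2(t)\end{bmatrix},$$ where $$H_1(t)=\begin{bmatrix}F_{11}+t\Delta_{31}&G_{11}+t\Delta_{33}\\ -t\Delta_{11}&-(F_{11}+t\Delta_{31})^H\end{bmatrix},\quad H_2(t)=\begin{bmatrix}F_{22}+t\Delta_{42}&G_{22}+t\Delta_{44}\\ -t\Delta_{22}&-(F_{22}+t\Delta_{42})^H\end{bmatrix},\quad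 L=\begin{bmatrix}\Delta_{41}&\Delta_{43}\\ -\Delta_{21}&-\Delta_{32}^H\end{bmatrix}.$$ Definition of $\widetilde H_1(t)$. For sufficiently small $t\ge0$, the quadratic matrix equation $$H_2(t)Y(t)-Y(t)H_1(t)-tY(t)J_1L^HJ_2Y(t)+tL=0$$ has a unique solution $Y(t)$ with $\|Y(t)\|=\mathcal O(t)$. The matrix $I-J_1Y(t)^HJ_2Y(t)=I+\mathcal O(t^2)$ is skew-Hamiltonian (with respect to $J_1$); let $S_1(t)=I+\mathcal O(t^2)$ be its principal square root, which is again skew-Hamiltonian. Then $$\widetilde H_1(t)=S_1(t)\big(H_1(t)+tJ_1L^HJ_2Y(t)\big)S_1(t)^{-1},$$ which is a Hamiltonian matrix (with respect to $J_1$) of size $2n_1\times 2n_1$; it is the diagonal block of $H(t)$, after a symplectic block diagonalization, whose eigenvalues are the perturbations of those of $F_{11}$ and $-F_{11}^H$. *)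

(* Defs.v *)
From mathcomp Require Import all_boot all_order all_algebra.
From mathcomp Require Import all_classical all_reals all_analysis.
From mathcomp.real_closed Require Export complex.

Set Implicit Arguments.
Unset Strict Implicit.
Unset Printing Implicit Defensive.

Import Order.TTheory GRing.Theory Num.Theory.
Import numFieldNormedType.Exports.

Local Open Scope ring_scope.
Local Open Scope complex_scope.
Local Open Scope sesquilinear_scope.
Local Open Scope classical_set_scope.

Section Matrices.
Variable R : realType.
Local Notation C := R[i].

(* On [R[i]], [0 <= z] and [0 < z] include that [z] is real. *)
Definition psdmx n (A : 'M[C]_n) : Prop :=
  A \is hermsymmx /\ forall x : 'cV[C]_n, 0 <= (x^t* *m A *m x) 0 0.

Definition posdefmx n (A : 'M[C]_n) : Prop :=
  A \is hermsymmx /\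
  forall x : 'cV[C]_n, x != 0 -> 0 < (x^t* *m A *m x) 0 0.

Definition negdefmx n (A : 'M[C]_n) : Prop :=
  A \is hermsymmx /\
  forall x : 'cV[C]_n, x != 0 -> (x^t* *m A *m x) 0 0 < 0.

Definition controllable n m (A : 'M[C]_n) (B : 'M[C]_(n, m)) : Prop :=
  forall s : C, \rank (row_mx (s%:M - A) B) = n.

Definition observable n m (A : 'M[C]_n) (B : 'M[C]_(m, n)) : Prop :=
  forall s : C, \rank (col_mx (s%:M - A) B) = n.

Definition Jmx n : 'M[C]_(n + n) := block_mx 0 1%:M (- 1%:M) 0.

Definition jordan_block (a : C) p : 'M[C]_p :=
  \matrix_(i, j) (a *+ (i == j) + (j == i.+1 :> nat)%:R).

(* [A] is similar to a Jordan matrix all of whose blocks have eigenvalue [a]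
   and size at most [k], with exactly [s r] blocks of size [r] for
   [r = 1, .., k].  The change of basis [P] and its inverse [Q] are rectangular
   only because the sizes [n] and [\sum_i p i] are not convertible. *)
Definition single_jordan_structure n (A : 'M[C]_n) (a : C) (k : nat)
    (s : nat -> nat) : Prop :=
  exists (m : nat) (p : 'I_m -> nat)
         (P : 'M[C]_(n, \sum_i p i)) (Q : 'M[C]_(\sum_i p i, n)),
    [/\ forall i, (0 < p i <= k)%N,
        forall r, (0 < r <= k)%N -> #|[pred i | p i == r]| = s r,
        P *m Q = 1%:M, Q *m P = 1%:M &
        A = P *m \mxdiag_i jordan_block a (p i) *m Q].

Definition semisimple_eigenvalue n (A : 'M[C]_n) (z : C) : Prop :=
  eigenvalue A z /\ mup z (char_poly A) = \rank (eigenspace A z).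

Definition principal_sqrtmx n (X S : 'M[C]_n) : Prop :=
  S *m S = X /\ forall z : C, eigenvalue S z -> 0 < complex.Re z.

(* The columns of [V] are a basis of an invariant subspace of [A], and the
   eigenvalues of [A] on that subspace are the [lam i], with multiplicity. *)
Definition invariant_basis n p (A : 'M[C]_n) (lam : 'I_p -> C)
    (V : 'M[C]_(n, p)) : Prop :=
  \rank V = p /\
  exists B : 'M[C]_p,
    A *m V = V *m B /\ char_poly B = \prod_i ('X - (lam i)%:P).

Definition bigO_at_right0 (f : R -> C) (g : R -> R) : Prop :=
  exists c : R, \forall t \near (0 : R)^'+, `|f t| <= (c * g t)%:C.

End Matrices.

Arguments Jmx {R} n.

Section PerturbedHamiltonian.
Variables (R : realType) (n1 n2 : nat).
Local Notation C := R[i].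
Variables (F11 G11 : 'M[C]_n1) (F22 G22 : 'M[C]_n2).
Variable Delta : 'M[C]_((n1 + n2) + (n1 + n2)).

Definition D11 : 'M[C]_n1 := ulsubmx (ulsubmx Delta).
Definition D21 : 'M[C]_(n2, n1) := dlsubmx (ulsubmx Delta).
Definition D22 : 'M[C]_n2 := drsubmx (ulsubmx Delta).
Definition D31 : 'M[C]_n1 := ulsubmx (dlsubmx Delta).
Definition D32 : 'M[C]_(n1, n2) := ursubmx (dlsubmx Delta).
Definition D41 : 'M[C]_(n2, n1) := dlsubmx (dlsubmx Delta).
Definition D42 : 'M[C]_n2 := drsubmx (dlsubmx Delta).
Definition D33 : 'M[C]_n1 := ulsubmx (drsubmx Delta).
Definition D43 : 'M[C]_(n2, n1) := dlsubmx (drsubmx Delta).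
Definition D44 : 'M[C]_n2 := drsubmx (drsubmx Delta).

Definition H1 (t : R) : 'M[C]_(n1 + n1) :=
  block_mx (F11 + t%:C *: D31) (G11 + t%:C *: D33)
           (- (t%:C *: D11)) (- (F11 + t%:C *: D31)^t*).

Definition H2 (t : R) : 'M[C]_(n2 + n2) :=
  block_mx (F22 + t%:C *: D42) (G22 + t%:C *: D44)
           (- (t%:C *: D22)) (- (F22 + t%:C *: D42)^t*).

Definition Lmx : 'M[C]_(n2 + n2, n1 + n1) :=
  block_mx D41 D43 (- D21) (- D32^t*).

Definition J1LJ2 : 'M[C]_(n1 + n1, n2 + n2) :=
  Jmx n1 *m Lmx^t* *m Jmx n2.

(* [Y] is a solution, for all small [t >= 0], of the quadratic matrix equation
   with [|Y t| = O(t)]; this determines [Y t] for all small [t >= 0]. *)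
Definition riccati_solution (Y : R -> 'M[C]_(n2 + n2, n1 + n1)) : Prop :=
  (\forall t \near (0 : R), 0 <= t ->
     H2 t *m Y t - Y t *m H1 t - t%:C *: (Y t *m J1LJ2 *m Y t)
       + t%:C *: Lmx = 0) /\
  exists c : R, \forall t \near (0 : R), 0 <= t -> mx_norm (Y t) <= (c * t)%:C.

(* [Ht t] is the matrix $\widetilde H_1(t)$ for all small [t >= 0]. *)
Definition is_Htilde1 (Ht : R -> 'M[C]_(n1 + n1)) : Prop :=
  exists (Y : R -> 'M[C]_(n2 + n2, n1 + n1)) (S : R -> 'M[C]_(n1 + n1)),
    [/\ riccati_solution Y,
        \forall t \near (0 : R), 0 <= t ->
          principal_sqrtmx (1%:M - Jmx n1 *m (Y t)^t* *m Jmx n2 *m Y t) (S t) &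
        \forall t \near (0 : R), 0 <= t ->
          Ht t = S t *m (H1 t + t%:C *: (J1LJ2 *m Y t)) *m invmx (S t)].

End PerturbedHamiltonian.

(* Main.v *)
Require Import Defs.
From mathcomp Require Import all_boot all_order all_algebra.
From mathcomp Require Import all_classical all_reals all_analysis.
From mathcomp Require Import ring lra zify.

Set Implicit Arguments.
Unset Strict Implicit.
Unset Printing Implicit Defensive.

Import Order.TTheory GRing.Theory Num.Theory.
Import numFieldNormedType.Exports.

Local Open Scope ring_scope.
Local Open Scope complex_scope.
Local Open Scope sesquilinear_scope.
Local Open Scope classical_set_scope.

(* Write Delta = d^H d and P(x, t) = - J (H(t) - i (alpha + x)) for real x, so that
   P(x, t) = P(x, 0) + t Delta is Hermitian.  For x <> 0 small, P(x, 0) is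
   invertible and ker P(x, t) is isomorphic to ker (Q(x) - 1/t), where
   Q(x) = - d P(x, 0)^-1 d^H is Hermitian.  The Jordan structure of F11 gives
   Q(x) = Z D^-1 B D^-1 Z^H + W with D = diag(x^(p j)), Z having orthonormal
   columns at x = 0 and B(0) = diag(g) > 0 (controllability and observability).
   Hence the large eigenvalues of Q(x) are g_j x^(- 2 p j) (1 + O(x)), and they are
   strictly monotone in x near the level 1/t: each branch crosses that level
   exactly once for x > 0 and once for x < 0, at |x| close to
   (t g_j)^(1 / (2 p j)).  The form x^H (i J) x on ker P(x, t) is a positive
   multiple of the derivative of Q on ker (Q(x) - 1/t), which gives the signs.

   Semisimplicity is algebraic.  Let q(lambda, t) be a polynomial vanishing, for
   lambda on the line i (alpha + x), at the zeros t of det (lambda - H(t)), and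
   coprime to its derivative in lambda.  On that line the pencil in t is
   diagonalizable (Q is Hermitian), so q adj(lambda - H(t)) is divisible by
   det (lambda - H(t)) up to a factor c(lambda); thus q annihilates generalized
   eigenvectors, and since its roots in lambda are simple for all but finitely many
   lambda, there are only eigenvectors. *)

(** The branches of eigenvalues of [Q(x)] may meet, so they are never followed as functions of [x].
    Two integers, the numbers of eigenvalues above and at or above the level, are studied instead:
    min-max bounds locate their jumps, the sign of the derivative shows that they only jump
    downwards as [x > 0] grows, and a branch is the supremum of the points where a count is still
    large. Conjugation by [D] stays bounded as [x] tends to [0] only for matrices that are
    triangular along the order of the exponents [p j]; hence the sorted Jordan sizes and the
    Cholesky factors. The same factors, up to signs, serve [x < 0], so both families share the
    constants [g_j]. At [x = 0] the matrix [P(0, 0)] is singular and [Q] is meaningless; there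
    [det P(0, t)] is a polynomial in [t] which does not vanish at [t = i], hence not for small
    [t > 0], and controllability and observability enter a second time. All of this concerns the
    full [H(t)]; an injective [W] with [H(t) W = W Ht(t)] and [W^H J W = J_1], built from the graph
    of the Riccati solution, carries it over to [Ht(t)]. *)

Section Modulus.
Variable R : realType.
Local Notation C := R[i].
Implicit Types z w : C.

(** The norm of [R[i]] takes its values in [R[i]], where the order is partial; a modulus with values
    in [R] opens the estimates to [lra] and [nra]. *)
Definition cabs z : R := Normc.normc z.

Lemma normCE z : `|z| = (cabs z)%:C. Proof. by []. Qed.

Lemma cabs_ge0 z : 0 <= cabs z.
Proof. by rewrite -ler0c -normCE. Qed.

Lemma cabs0 : cabs 0 = 0. Proof. exact: Normc.normc0. Qed.

Lemma cabs1 : cabs 1 = 1. Proof. exact: Normc.normc1. Qed.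

Lemma cabs_eq0 z : (cabs z == 0) = (z == 0).
Proof. by rewrite -[z == 0]normr_eq0 normCE -(inj_eq (@complexI R)). Qed.

Lemma cabs_gt0 z : (0 < cabs z) = (z != 0).
Proof. by rewrite lt_neqAle cabs_ge0 andbT eq_sym cabs_eq0. Qed.

Lemma cabsD z w : cabs (z + w) <= cabs z + cabs w.
Proof. exact: le_normcD. Qed.

Lemma cabsM z w : cabs (z * w) = cabs z * cabs w.
Proof. exact: Normc.normcM. Qed.

Lemma cabsN z : cabs (- z) = cabs z.
Proof. exact: normcN. Qed.

Lemma cabsX z n : cabs (z ^+ n) = cabs z ^+ n.
Proof. by elim: n => [|n IH]; rewrite ?expr0 ?cabs1 // !exprS cabsM IH. Qed.

Lemma cabsJ z : cabs (Num.conj z) = cabs z.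
Proof. by apply: (@complexI R); rewrite -!normCE norm_conjC. Qed.

Lemma cabsR (x : R) : cabs x%:C = `|x|.
Proof. by rewrite /cabs /Normc.normc /= expr0n addr0 sqrtr_sqr. Qed.

Lemma cabs_sum (I : Type) (r : seq I) (P : pred I) (F : I -> C) :
  cabs (\sum_(i <- r | P i) F i) <= \sum_(i <- r | P i) cabs (F i).
Proof.
elim/big_ind2: _ => [|z a w b hz hw|//]; first by rewrite cabs0.
exact: le_trans (cabsD _ _) (lerD hz hw).
Qed.

Lemma ler_Re_cabs z : complex.Re z <= cabs z.
Proof.
apply: le_trans (ler_norm _) _; rewrite -lecR -normCE.
exact: normc_ge_Re.
Qed.

Lemma ler_absRe_cabs z : `|complex.Re z| <= cabs z.
Proof. by rewrite -lecR -normCE; exact: normc_ge_Re. Qed.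

Lemma cabs_sqr z : ((cabs z) ^+ 2)%:C = Num.conj z * z.
Proof. by rewrite rmorphXn /= -normCE normCK mulrC. Qed.

Lemma ReD z w : complex.Re (z + w) = complex.Re z + complex.Re w.
Proof. by case: z w => [? ?] [? ?]. Qed.

Lemma ReN z : complex.Re (- z) = - complex.Re z.
Proof. by case: z. Qed.

Lemma ReZ (a : R) z : complex.Re (a%:C * z) = a * complex.Re z.
Proof. by case: z => ? ? /=; rewrite mul0r subr0. Qed.

Lemma Re_sum (I : Type) (r : seq I) (P : pred I) (F : I -> C) :
  complex.Re (\sum_(i <- r | P i) F i) = \sum_(i <- r | P i) complex.Re (F i).
Proof. by elim/big_ind2: _ => // z a w b hz hw; rewrite ReD hz hw. Qed.

Lemma ReJ z : complex.Re (Num.conj z) = complex.Re z.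
Proof. by case: z. Qed.

Lemma conjR (x : R) : Num.conj (x%:C : C) = x%:C.
Proof. exact: conjc_real. Qed.

End Modulus.

(** * Conjugate transposes and Hermitian matrices *)

Section Adjoint.
Variable R : realType.
Local Notation C := R[i].

Lemma adjE m n (A : 'M[C]_(m, n)) i j : (A^t*) i j = Num.conj (A j i).
Proof. by rewrite !mxE. Qed.

Lemma adjK m n (A : 'M[C]_(m, n)) : (A^t*)^t* = A.
Proof. exact: trmxCK. Qed.

Lemma adjD m n (A B : 'M[C]_(m, n)) : (A + B)^t* = A^t* + B^t*.
Proof. by apply/matrixP => i j; rewrite !mxE rmorphD. Qed.

Lemma adjN m n (A : 'M[C]_(m, n)) : (- A)^t* = - A^t*.
Proof. by apply/matrixP => i j; rewrite !mxE rmorphN. Qed.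

Lemma adjB m n (A B : 'M[C]_(m, n)) : (A - B)^t* = A^t* - B^t*.
Proof. by rewrite adjD adjN. Qed.

Lemma adjZ m n (a : C) (A : 'M[C]_(m, n)) : (a *: A)^t* = Num.conj a *: A^t*.
Proof. by apply/matrixP => i j; rewrite !mxE rmorphM. Qed.

Lemma adjZr m n (a : R) (A : 'M[C]_(m, n)) : (a%:C *: A)^t* = a%:C *: A^t*.
Proof. by rewrite adjZ conjR. Qed.

Lemma adj0 m n : (0 : 'M[C]_(m, n))^t* = 0.
Proof. by apply/matrixP => i j; rewrite !mxE rmorph0. Qed.

Lemma adj1 n : (1%:M : 'M[C]_n)^t* = 1%:M.
Proof. by rewrite trmx1 map_mx1. Qed.

Lemma adjM m n p (A : 'M[C]_(m, n)) (B : 'M[C]_(n, p)) :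
  (A *m B)^t* = B^t* *m A^t*.
Proof. by rewrite trmx_mul map_mxM. Qed.

Lemma adj_scalar n (a : C) : (a%:M : 'M[C]_n)^t* = (Num.conj a)%:M.
Proof. by rewrite tr_scalar_mx map_scalar_mx. Qed.

Lemma adj_block m1 m2 n1 n2 (A : 'M[C]_(m1, n1)) B D (E : 'M[C]_(m2, n2)) :
  (block_mx A B D E)^t* = block_mx (A^t*) (D^t*) (B^t*) (E^t*).
Proof. by rewrite tr_block_mx map_block_mx. Qed.

Lemma adj_col_mx m1 m2 n (A : 'M[C]_(m1, n)) (B : 'M[C]_(m2, n)) :
  (col_mx A B)^t* = row_mx (A^t*) (B^t*).
Proof. by rewrite tr_col_mx map_row_mx. Qed.

Lemma adj_row_mx m n1 n2 (A : 'M[C]_(m, n1)) (B : 'M[C]_(m, n2)) :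
  (row_mx A B)^t* = col_mx (A^t*) (B^t*).
Proof. by rewrite tr_row_mx map_col_mx. Qed.

Definition herm n (A : 'M[C]_n) := A^t* = A.

Lemma hermsymmx_herm n (A : 'M[C]_n) : A \is hermsymmx <-> herm A.
Proof.
split; first by move/is_hermitianmxP; rewrite expr0 scale1r /herm => <-.
by move=> hA; apply/is_hermitianmxP; rewrite expr0 scale1r hA.
Qed.

End Adjoint.

(** * An entrywise norm, Euclidean squares and quadratic forms *)

Section MatrixNorm.
Variable R : realType.
Local Notation C := R[i].

(** This norm is submultiplicative and invariant under the adjoint, for all rectangular formats at
    once; the value of the constants is immaterial below. *)
Definition nrm m n (A : 'M[C]_(m, n)) : R := \sum_i \sum_j cabs (A i j).

Lemma nrm_ge0 m n (A : 'M[C]_(m, n)) : 0 <= nrm A.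
Proof. by apply: sumr_ge0 => i _; apply: sumr_ge0 => j _; exact: cabs_ge0. Qed.

Lemma nrm0 m n : nrm (0 : 'M[C]_(m, n)) = 0.
Proof. by rewrite /nrm big1 // => i _; rewrite big1 // => j _; rewrite mxE cabs0. Qed.

Lemma cabs_le_nrm m n (A : 'M[C]_(m, n)) i j : cabs (A i j) <= nrm A.
Proof.
rewrite /nrm (bigD1 i) //= (bigD1 j) //= -!addrA ler_wpDr //.
rewrite addr_ge0 ?sumr_ge0 // => k _; rewrite ?cabs_ge0 //.
by apply: sumr_ge0 => l _; exact: cabs_ge0.
Qed.

Lemma nrm_eq0 m n (A : 'M[C]_(m, n)) : (nrm A == 0) = (A == 0).
Proof.
apply/eqP/eqP => [h|->]; last exact: nrm0.
apply/matrixP => i j; rewrite mxE; apply/eqP; rewrite -cabs_eq0.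
by rewrite eq_le cabs_ge0 andbT -h cabs_le_nrm.
Qed.

Lemma nrm_gt0 m n (A : 'M[C]_(m, n)) : (0 < nrm A) = (A != 0).
Proof. by rewrite lt_neqAle nrm_ge0 andbT eq_sym nrm_eq0. Qed.

Lemma nrmD m n (A B : 'M[C]_(m, n)) : nrm (A + B) <= nrm A + nrm B.
Proof.
rewrite /nrm -big_split ler_sum // => i _; rewrite -big_split ler_sum // => j _.
by rewrite mxE cabsD.
Qed.

Lemma nrmN m n (A : 'M[C]_(m, n)) : nrm (- A) = nrm A.
Proof. by apply: eq_bigr => i _; apply: eq_bigr => j _; rewrite mxE cabsN. Qed.

Lemma nrmB m n (A B : 'M[C]_(m, n)) : nrm (A - B) <= nrm A + nrm B.
Proof. by rewrite -(nrmN B) nrmD. Qed.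

Lemma nrmZ m n (a : C) (A : 'M[C]_(m, n)) : nrm (a *: A) = cabs a * nrm A.
Proof.
rewrite /nrm mulr_sumr; apply: eq_bigr => i _; rewrite mulr_sumr.
by apply: eq_bigr => j _; rewrite mxE cabsM.
Qed.

Lemma nrmM m n p (A : 'M[C]_(m, n)) (B : 'M[C]_(n, p)) :
  nrm (A *m B) <= nrm A * nrm B.
Proof.
rewrite {1 2}/nrm mulr_suml ler_sum // => i _.
apply: (@le_trans _ _ (\sum_j \sum_k cabs (A i k) * cabs (B k j))).
  apply: ler_sum => j _; rewrite mxE; apply: le_trans (cabs_sum _ _ _) _.
  by under eq_bigr do rewrite cabsM.
rewrite exchange_big mulr_suml ler_sum // => k _.
rewrite -mulr_sumr ler_wpM2l ?cabs_ge0 //.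
rewrite /nrm (bigD1 k) //= ler_wpDr // sumr_ge0 // => l _.
by apply: sumr_ge0 => j _; exact: cabs_ge0.
Qed.

Lemma nrm_adj m n (A : 'M[C]_(m, n)) : nrm (A^t*) = nrm A.
Proof.
rewrite /nrm exchange_big; apply: eq_bigr => i _; apply: eq_bigr => j _.
by rewrite adjE cabsJ.
Qed.

Lemma nrm_le_card m n (A : 'M[C]_(m, n)) (c : R) :
  (forall i j, cabs (A i j) <= c) -> nrm A <= (m * n)%:R * c.
Proof.
move=> h; apply: (@le_trans _ _ (\sum_(i < m) \sum_(j < n) c)).
  by apply: ler_sum => i _; apply: ler_sum => j _.
by rewrite !sumr_const !card_ord -mulrnA mulnC mulr_natl.
Qed.

Definition sq n (x : 'cV[C]_n) : R := \sum_i cabs (x i 0) ^+ 2.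

(** Taking the real part makes the form real-valued and additive in [A] for every matrix; for
    Hermitian [A] nothing is lost, by [qf_herm]. *)
Definition qf n (A : 'M[C]_n) (x : 'cV[C]_n) : R :=
  complex.Re ((x^t* *m A *m x) 0 0).

Lemma sq_ge0 n (x : 'cV[C]_n) : 0 <= sq x.
Proof. by apply: sumr_ge0 => i _; rewrite sqr_ge0. Qed.

Lemma sqC n (x : 'cV[C]_n) : (sq x)%:C = (x^t* *m x) 0 0.
Proof.
rewrite mxE rmorph_sum; apply: eq_bigr => i _ /=.
by rewrite !mxE -cabs_sqr.
Qed.

Lemma sqE n (x : 'cV[C]_n) : sq x = complex.Re ((x^t* *m x) 0 0).
Proof. by rewrite -sqC. Qed.

Lemma sq_eq0 n (x : 'cV[C]_n) : (sq x == 0) = (x == 0).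
Proof.
apply/idP/eqP => [|->]; last first.
  by rewrite /sq big1 // => i _; rewrite mxE cabs0 expr0n.
rewrite psumr_eq0 => [/allP h|i _]; last exact: sqr_ge0.
apply/matrixP => i j; rewrite ord1 mxE; apply/eqP; rewrite -cabs_eq0.
by rewrite -sqrf_eq0; have := h i (mem_index_enum i); rewrite implyTb.
Qed.

Lemma sq_gt0 n (x : 'cV[C]_n) : (0 < sq x) = (x != 0).
Proof. by rewrite lt_neqAle sq_ge0 andbT eq_sym sq_eq0. Qed.

Lemma sq_le_nrm n (x : 'cV[C]_n) : sq x <= nrm x ^+ 2.
Proof.
have hx : nrm x = \sum_i cabs (x i 0).
  by apply: eq_bigr => i _; rewrite big_ord1.
rewrite hx expr2 mulr_suml ler_sum // => i _.
by rewrite expr2 ler_wpM2l ?cabs_ge0 // -hx cabs_le_nrm.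
Qed.

Lemma nrm_le_sq n (x : 'cV[C]_n) : nrm x ^+ 2 <= n%:R * sq x.
Proof.
have hx : nrm x = \sum_i cabs (x i 0).
  by apply: eq_bigr => i _; rewrite big_ord1.
have -> : nrm x ^+ 2 = \sum_i \sum_j cabs (x i 0) * cabs (x j 0).
  rewrite hx expr2 mulr_suml; apply: eq_bigr => i _.
  by rewrite mulr_sumr.
apply: (@le_trans _ _ (\sum_(i < n) \sum_(j < n)
    (cabs (x i 0) ^+ 2 / 2 + cabs (x j 0) ^+ 2 / 2))).
  apply: ler_sum => i _; apply: ler_sum => j _.
  have := sqr_ge0 (cabs (x i 0) - cabs (x j 0)); nra.
under eq_bigr do rewrite big_split /= sumr_const card_ord -mulr_suml -/(sq x).
rewrite big_split /= sumr_const card_ord sumrMnl -mulr_suml -/(sq x).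
rewrite -mulr_natl; lra.
Qed.

Lemma qfD n (A B : 'M[C]_n) x : qf (A + B) x = qf A x + qf B x.
Proof. by rewrite /qf mulmxDr mulmxDl mxE ReD. Qed.

Lemma qfN n (A : 'M[C]_n) x : qf (- A) x = - qf A x.
Proof. by rewrite /qf mulmxN mulNmx mxE ReN. Qed.

Lemma qfB n (A B : 'M[C]_n) x : qf (A - B) x = qf A x - qf B x.
Proof. by rewrite qfD qfN. Qed.

Lemma qfZ n (a : R) (A : 'M[C]_n) x : qf (a%:C *: A) x = a * qf A x.
Proof. by rewrite /qf -scalemxAr -scalemxAl mxE ReZ. Qed.

Lemma qf_le n (A : 'M[C]_n) x : `|qf A x| <= nrm A * nrm x ^+ 2.
Proof.
apply: le_trans (ler_absRe_cabs _) _; apply: le_trans (cabs_le_nrm _ _ _) _.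
apply: le_trans (nrmM _ _) _.
rewrite expr2 mulrA ler_wpM2r ?nrm_ge0 //.
by apply: le_trans (nrmM _ _) _; rewrite nrm_adj mulrC.
Qed.

Lemma qf_congr n m (A : 'M[C]_n) (V : 'M[C]_(n, m)) c :
  qf (V^t* *m A *m V) c = qf A (V *m c).
Proof. by rewrite /qf adjM !mulmxA. Qed.

Lemma qf_eigen n (A : 'M[C]_n) (a : R) x : A *m x = a%:C *: x -> qf A x = a * sq x.
Proof. by move=> h; rewrite /qf -mulmxA h -scalemxAr mxE -sqC -rmorphM. Qed.

Lemma qf_herm n (A : 'M[C]_n) x : herm A -> ((x^t* *m A *m x) 0 0) = (qf A x)%:C.
Proof.
move=> hA; set z := (_ *m _) 0 0.
have : Num.conj z = z.
  by rewrite -[in LHS]adjE /z !adjM adjK hA mulmxA.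
rewrite /qf -/z; case: z => a b [] /eqP; rewrite -subr_eq0 => h.
by congr (_ +i* _); apply/eqP; move: h; rewrite -opprD oppr_eq0 -mulr2n mulrn_eq0.
Qed.

End MatrixNorm.

(** * Eigenvalue counts of Hermitian matrices and their perturbation *)

Section SpectralCount.
Variable R : realType.
Local Notation C := R[i].

Lemma kernel_nontrivial k r (M : 'M[C]_(k, r)) : (k < r)%N ->
  exists2 c : 'cV[C]_r, c != 0 & M *m c = 0.
Proof.
move=> lt_kr; have : kermx M^T != 0.
  rewrite kermx_eq0 /row_free neq_ltn mxrank_tr.
  by rewrite (leq_ltn_trans (rank_leq_row _) lt_kr).
rewrite -nz_row_eq0 => nz; exists (nz_row (kermx M^T))^T.
  by rewrite -(inj_eq trmx_inj) trmxK trmx0.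
apply: trmx_inj; rewrite trmx_mul trmxK trmx0.
by apply/sub_kermxP; exact: nz_row_sub.
Qed.

Lemma rank_diag_mx n (d : 'rV[C]_n) :
  \rank (diag_mx d) = #|[pred i | d 0 i != 0]|.
Proof.
set S := [pred i | d 0 i != 0]; set f := @enum_val _ S.
have fS i : f i \in S by exact: enum_valP.
have -> : diag_mx d = (colsub f 1%:M) *m (rowsub f (diag_mx d)).
  apply/matrixP => i j; rewrite !mxE.
  under eq_bigr do rewrite !mxE.
  have [Si|nSi] := boolP (i \in S).
    rewrite (bigD1 (enum_rank_in Si i)) //= /f enum_rankK_in // eqxx mul1r.
    rewrite big1 ?addr0 // => k hk; rewrite [i == f k](_ : _ = false) ?mul0r //.
    by apply: contraNF hk => /eqP ik; rewrite -(inj_eq enum_val_inj) enum_rankK_in // ik.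
  rewrite big1; last first.
    move=> k _; rewrite [i == f k](_ : _ = false) ?mul0r //.
    by apply/negP => /eqP ik; move: nSi; rewrite ik fS.
  by move: nSi; rewrite inE negbK => /eqP ->; rewrite mul0rn.
apply/eqP; rewrite eqn_leq; apply/andP; split.
  by apply: leq_trans (mxrankM_maxl _ _) _; exact: rank_leq_col.
(* Lower bound: [L *m M *m N] is an identity matrix of size [#|S|], where [N] divides by the nonzero
   entries, and products do not increase the rank. *)
set M := (X in \rank X); pose L : 'M[C]_(#|S|, n) := rowsub f 1%:M.
pose N : 'M[C]_(n, #|S|) := \matrix_(i, k) ((d 0 i)^-1 *+ (i == f k)).
suff e : L *m M *m N = 1%:M.
  have := mxrank1 C #|S|; rewrite -e => {1}<-.
  by apply: leq_trans (mxrankM_maxl _ _) (mxrankM_maxr _ _).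
have -> : L *m M = rowsub f (diag_mx d).
  rewrite /M mulmxA; suff -> : L *m colsub f 1%:M = 1%:M by rewrite mul1mx.
  apply/matrixP => i j; rewrite !mxE (bigD1 (f i)) //= !mxE eqxx mul1r.
  rewrite big1 ?addr0 ?(inj_eq enum_val_inj) // => k ki.
  by rewrite !mxE eq_sym (negbTE ki) mul0r.
apply/matrixP => i j; rewrite !mxE (bigD1 (f i)) //= !mxE eqxx mulr1n.
rewrite big1 ?addr0; last by move=> k ki; rewrite !mxE eq_sym (negbTE ki) mul0r.
rewrite (inj_eq enum_val_inj) mulrnAr mulfV //.
exact: (fS i).
Qed.

Definition evs n (A : 'M[C]_n) (i : 'I_n) : R := complex.Re (spectral_diag A 0 i).
(** For Hermitian [A], the difference [ncge A th - ncgt A th] is the multiplicity of [th] as an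
    eigenvalue, by [rank_sub_herm]; these two counts carry all the spectral information that the
    crossing argument consumes. *)
Definition ncge n (A : 'M[C]_n) (th : R) := #|[pred i | th <= evs A i]|.
Definition ncgt n (A : 'M[C]_n) (th : R) := #|[pred i | th < evs A i]|.

Lemma spectralP n (A : 'M[C]_n) : herm A ->
  exists (U : 'M[C]_n) (d : 'I_n -> R),
  [/\ U^t* *m U = 1%:M, U *m U^t* = 1%:M,
      A = U^t* *m diag_mx (\row_i (d i)%:C) *m U,
      forall th, ncge A th = #|[pred i | th <= d i]| &
      forall th, ncgt A th = #|[pred i | th < d i]|].
Proof.
move=> /hermsymmx_herm hA; exists (spectralmx A), (evs A).
have hU : spectralmx A *m (spectralmx A)^t* = 1%:M.
  by apply/unitarymxP; exact: spectral_unitarymx.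
split=> //; first exact: mulmx1C.
have /hermitian_normalmx /orthomx_spectralP e := hA.
have -> : \row_i (evs A i)%:C = spectral_diag A.
  apply/rowP => i; rewrite mxE /evs RRe_real //.
  by have /mxOverP h := hermitian_spectral_diag_real hA; exact: h.
by rewrite -(invmx_unitary (spectral_unitarymx A)).
Qed.

Lemma rank_sub_herm n (A : 'M[C]_n) (th : R) : herm A ->
  (\rank (A - th%:C%:M)%R + ncge A th = n + ncgt A th)%N.
Proof.
move=> /spectralP[U [d [hU1 hU2 -> -> ->]]].
have -> : U^t* *m diag_mx (\row_i (d i)%:C) *m U - th%:C%:M =
    U^t* *m diag_mx (\row_i (d i - th)%:C) *m U.
  have -> : th%:C%:M = U^t* *m th%:C%:M *m U.
    by rewrite -mulmxA -scalar_mxC mulmxA hU1 mul1mx.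
  rewrite -mulmxBl -mulmxBr; congr (mulmx (mulmx _ _) _).
  apply/matrixP => i j; rewrite !mxE rmorphB /=.
  by case: (i == j); rewrite ?mulr1n ?mulr0n ?subr0.
have [uU' uU] := mulmx1_unit hU1.
rewrite mxrankMfree ?row_free_unit // eqmxMfull ?row_full_unit // rank_diag_mx.
rewrite -(cardID [pred i | th < d i] [pred i | th <= d i]).
have -> : #|[predI [pred i | th <= d i] & [pred i | th < d i]]| =
    #|[pred i | th < d i]|.
  by apply: eq_card => i; rewrite !inE; case: ltgtP.
rewrite addnA addnAC; congr (_ + _)%N; rewrite -[RHS]card_ord.
rewrite -(cardC [pred i | d i == th]) addnC; congr (_ + _)%N; apply: eq_card => i;
  rewrite !inE ?mxE /=; first by case: ltgtP.
by rewrite -(inj_eq (@complexI R)) -[_ == _ in RHS]subr_eq0 rmorphB.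
Qed.

Lemma sq_unitary n m (U : 'M[C]_(n, m)) x : U^t* *m U = 1%:M -> sq (U *m x) = sq x.
Proof. by move=> hU; rewrite !sqE adjM mulmxA -(mulmxA (x^t*)) hU mulmx1. Qed.

Lemma qf_diag n (d : 'I_n -> R) (x : 'cV[C]_n) :
  qf (diag_mx (\row_i (d i)%:C)) x = \sum_i d i * cabs (x i 0) ^+ 2.
Proof.
rewrite /qf -mulmxA mxE Re_sum; apply: eq_bigr => i _.
by rewrite mul_diag_mx !mxE mulrCA -cabs_sqr -rmorphM.
Qed.

Lemma spectral_span n (U : 'M[C]_n) (P : pred 'I_n) :
  U^t* *m U = 1%:M -> U *m U^t* = 1%:M ->
  exists V : 'M[C]_(n, #|P|), V^t* *m V = 1%:M /\
    forall (c : 'cV[C]_#|P|) i, ~~ P i -> (U *m (V *m c)) i 0 = 0.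
Proof.
move=> hU1 hU2; pose f := @enum_val _ P.
exists (U^t* *m colsub f 1%:M); split.
  rewrite adjM adjK mulmxA -(mulmxA _ U) hU2 mulmx1.
  apply/matrixP => i j; rewrite !mxE (bigD1 (f i)) //= !mxE eqxx conjC1 mul1r.
  rewrite big1 ?addr0 ?(inj_eq enum_val_inj) // => k ki.
  by rewrite !mxE (negbTE ki) conjC0 mul0r.
move=> c i nPi; rewrite !mulmxA hU2 mul1mx mxE big1 // => k _.
rewrite !mxE [i == f k](_ : _ = false) ?mul0r //.
by apply: contraNF nPi => /eqP ->; exact: enum_valP.
Qed.

(** Half of the Courant-Fischer principle: if [r] exceeded the number of eigenvalues above [th],
    some nonzero [c] would make [V *m c] orthogonal to all their eigenvectors, and there the form is
    at most [th] times the squared length. *)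
Lemma count_lower n (A : 'M[C]_n) th r (V : 'M[C]_(n, r)) : herm A ->
  (forall c : 'cV_r, c != 0 -> th * sq (V *m c) < qf A (V *m c)) ->
  (r <= ncgt A th)%N.
Proof.
move=> /spectralP[U [d [hU1 hU2 -> _ ->]]] h; rewrite leqNgt; apply/negP => hr.
have [c c0 hc] := kernel_nontrivial
  (rowsub (@enum_val _ [pred i | th < d i]) (U *m V)) hr.
have {}hc i : th < d i -> (U *m (V *m c)) i 0 = 0.
  move=> Pi; have {Pi}Pi : i \in [pred i | th < d i] by [].
  have := congr1 (fun M : 'cV_ _ => M (enum_rank_in Pi i) 0) hc.
  rewrite mxE [RHS]mxE => e; rewrite mulmxA mxE -[RHS]e.
  by apply: eq_bigr => k _; rewrite !mxE enum_rankK_in.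
have := h c c0; apply/negP; rewrite -leNgt qf_congr -(sq_unitary _ hU1) qf_diag.
rewrite /sq mulr_sumr ler_sum // => i _.
have [/hc->|hd] := ltP th (d i); first by rewrite cabs0 expr0n !mulr0.
by rewrite ler_wpM2r // sqr_ge0.
Qed.

Lemma count_upper n (A : 'M[C]_n) th r (V : 'M[C]_(n, r)) : herm A ->
  (forall c : 'cV_r, c != 0 -> qf A (V *m c) < th * sq (V *m c)) ->
  (ncge A th + r <= n)%N.
Proof.
move=> /spectralP[U [d [hU1 hU2 -> -> _]]] h; rewrite leqNgt; apply/negP => hr.
have {}hr : (#|[pred i | (d i < th)%R]| < r)%N.
  rewrite -(ltn_add2l #|[pred i | (th <= d i)%R]|); apply: leq_ltn_trans hr.
  rewrite -[X in (_ <= X)%N]card_ord -(cardC [pred i | th <= d i]) leq_add2l.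
  by apply: subset_leq_card; apply/fintype.subsetP => i; rewrite !inE ltNge.
have [c c0 hc] := kernel_nontrivial
  (rowsub (@enum_val _ [pred i | d i < th]) (U *m V)) hr.
have {}hc i : d i < th -> (U *m (V *m c)) i 0 = 0.
  move=> Pi; have {Pi}Pi : i \in [pred i | d i < th] by [].
  have := congr1 (fun M : 'cV_ _ => M (enum_rank_in Pi i) 0) hc.
  rewrite mxE [RHS]mxE => e; rewrite mulmxA mxE -[RHS]e.
  by apply: eq_bigr => k _; rewrite !mxE enum_rankK_in.
have := h c c0; apply/negP; rewrite -leNgt qf_congr -(sq_unitary _ hU1) qf_diag.
rewrite /sq mulr_sumr ler_sum // => i _.
have [/hc->|hd] := ltP (d i) th; first by rewrite cabs0 expr0n !mulr0.
by rewrite ler_wpM2r // sqr_ge0.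
Qed.

(** Starting the minimum at [1] keeps [g] positive when no index satisfies [P]. *)
Lemma finite_gap n (P : pred 'I_n) (f : 'I_n -> R) :
  (forall i, P i -> 0 < f i) -> exists2 g, 0 < g & forall i, P i -> g <= f i.
Proof.
move=> h; exists (\big[Num.min/1]_(i | P i) f i).
  by elim/big_ind: _ => // x y hx hy; rewrite lt_min hx.
by move=> i Pi; rewrite (bigD1 i) //= ge_min lexx.
Qed.

Lemma unitary_inj n m (V : 'M[C]_(n, m)) (c : 'cV_m) :
  V^t* *m V = 1%:M -> c != 0 -> V *m c != 0.
Proof.
move=> hV; apply: contra => /eqP h.
by rewrite -[c]mul1mx -hV -mulmxA h mulmx0.
Qed.

(** On the span of the eigenvectors with eigenvalue at least [th], the component [x1] outside the
    eigenspace of [th] gains a fixed gap [g]. Under perturbation the first-order term acts in favour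
    of [x0], while the gap protects [x1]. *)
Lemma span_ge n (A : 'M[C]_n) th : herm A ->
  exists (g : R) (V : 'M[C]_(n, ncge A th)), 0 < g /\
    forall c : 'cV_ _, c != 0 -> V *m c != 0 /\
      exists x0 x1, [/\ V *m c = x0 + x1, A *m x0 = th%:C *: x0 &
        th * sq (V *m c) + g * sq x1 <= qf A (V *m c)].
Proof.
move=> /spectralP[U [d [hU1 hU2 -> -> _]]].
have [|g g0 hg] := @finite_gap _ [pred i | th < d i] (fun i => d i - th).
  by move=> i /=; rewrite subr_gt0.
have [V [hV hVc]] := spectral_span [pred i | th <= d i] hU1 hU2.
exists g, V; split=> // c c0; split; first exact: unitary_inj hV c0.
pose y := U *m (V *m c); pose y0 : 'cV[C]_n := \col_i (y i 0 *+ (d i == th)).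
exists (U^t* *m y0), (U^t* *m (y - y0)); split.
- by rewrite -mulmxDr addrC subrK /y mulmxA hU1 mul1mx.
- rewrite -!mulmxA (mulmxA U) hU2 mul1mx scalemxAr; congr (_ *m _).
  apply/matrixP => i j; rewrite ord1 mul_diag_mx !mxE.
  by case: eqP => [->|]; rewrite // !mulr0n !mulr0.
rewrite qf_congr -(sq_unitary (V *m c) hU1) qf_diag.
have -> : sq (U^t* *m (y - y0)) = sq (y - y0) by apply: sq_unitary; rewrite adjK.
rewrite /sq !mulr_sumr -big_split ler_sum //= => i _.
rewrite -/y [(y - y0) i 0]mxE [(- y0) i 0]mxE [y0 i 0]mxE.
have [h|h] := boolP (th <= d i); last first.
  by rewrite /y (hVc c i h) mul0rn subr0 cabs0 expr0n !mulr0 addr0.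
have [->|ne] := eqVneq (d i) th; first by rewrite subrr cabs0 expr0n mulr0 addr0.
rewrite mulr0n subr0 -mulrDl ler_wpM2r ?sqr_ge0 // -lerBrDl hg //=.
by rewrite lt_neqAle eq_sym ne.
Qed.

Lemma span_lt n (A : 'M[C]_n) th : herm A ->
  exists (g : R) (V : 'M[C]_(n, (n - ncge A th)%N)), 0 < g /\
    forall c : 'cV_ _, c != 0 -> V *m c != 0 /\
      qf A (V *m c) <= (th - g) * sq (V *m c).
Proof.
move=> /spectralP[U [d [hU1 hU2 -> -> _]]].
have [|g g0 hg] := @finite_gap _ [pred i | d i < th] (fun i => th - d i).
  by move=> i /=; rewrite subr_gt0.
have [V [hV hVc]] := spectral_span [pred i | d i < th] hU1 hU2.
have e : (n - #|[pred i | (th <= d i)%R]| = #|[pred i | (d i < th)%R]|)%N.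
  rewrite -[X in (X - _)%N]card_ord -(cardC [pred i | th <= d i]) addKn.
  by apply: eq_card => i; rewrite !inE ltNge.
rewrite e; exists g, V; split=> // c c0; split; first exact: unitary_inj hV c0.
rewrite qf_congr -(sq_unitary (V *m c) hU1) qf_diag.
rewrite /sq !mulr_sumr ler_sum //= => i _.
have [h|h] := boolP (d i < th); last by rewrite (hVc c i h) cabs0 expr0n !mulr0.
by rewrite ler_wpM2r ?sqr_ge0 // lerBrDl -lerBrDr hg.
Qed.

Lemma span_gt n (A : 'M[C]_n) th : herm A ->
  exists (V : 'M[C]_(n, ncgt A th)),
    forall c : 'cV_ _, c != 0 -> th * sq (V *m c) < qf A (V *m c).
Proof.
move=> /spectralP[U [d [hU1 hU2 -> _ ->]]].
have [|g g0 hg] := @finite_gap _ [pred i | th < d i] (fun i => d i - th).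
  by move=> i /=; rewrite subr_gt0.
have [V [hV hVc]] := spectral_span [pred i | th < d i] hU1 hU2.
exists V => c c0; have /(unitary_inj hV) := c0; rewrite -sq_gt0 => x0.
apply: (@lt_le_trans _ _ ((th + g) * sq (V *m c))); first by rewrite ltr_pM2r // ltrDl.
rewrite qf_congr -(sq_unitary (V *m c) hU1) qf_diag.
rewrite /sq !mulr_sumr ler_sum //= => i _.
have [h|h] := boolP (th < d i); last by rewrite (hVc c i h) cabs0 expr0n !mulr0.
by rewrite ler_wpM2r ?sqr_ge0 // -lerBrDl hg.
Qed.

Lemma hermN n (A : 'M[C]_n) : herm A -> herm (- A).
Proof. by rewrite /herm adjN => ->. Qed.

Lemma ncge_le n (A : 'M[C]_n) th : (ncge A th <= n)%N.
Proof. by rewrite -[X in (_ <= X)%N]card_ord max_card. Qed.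

Lemma ncgt_ncge n (A : 'M[C]_n) th : (ncgt A th <= ncge A th)%N.
Proof. by apply: subset_leq_card; apply/fintype.subsetP => i; rewrite !inE => /ltW. Qed.

Lemma ncgtN n (A : 'M[C]_n) th : herm A -> ncgt (- A) (- th) = (n - ncge A th)%N.
Proof.
move=> hA; apply/eqP; rewrite eqn_leq; apply/andP; split.
  have [V hV] := span_gt (- th) (hermN hA).
  rewrite -(leq_add2l (ncge A th)) subnKC ?ncge_le //; apply: (count_upper (V := V) hA).
  by move=> c /hV; rewrite qfN mulNr ltrN2.
have [g [V [g0 hV]]] := span_lt th hA.
apply: (count_lower (V := V) (hermN hA)) => c /hV[x0 h]; rewrite qfN mulNr ltrN2.
by apply: le_lt_trans h _; rewrite ltr_pM2r ?sq_gt0 // gtrBl.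
Qed.

Lemma qf_add_ge n (A : 'M[C]_n) x y :
  qf A x - 2 * nrm A * nrm x * nrm y - nrm A * nrm y ^+ 2 <= qf A (x + y).
Proof.
have b2 (u v : 'cV[C]_n) :
    - (nrm A * nrm u * nrm v) <= complex.Re ((u^t* *m A *m v) 0 0).
  rewrite lerNl; apply: le_trans (ler_norm _) _; rewrite normrN.
  apply: le_trans (ler_absRe_cabs _) _; apply: le_trans (cabs_le_nrm _ _ _) _.
  apply: le_trans (nrmM _ _) _; rewrite ler_wpM2r ?nrm_ge0 //.
  by apply: le_trans (nrmM _ _) _; rewrite nrm_adj mulrC.
have -> : qf A (x + y) = (qf A x + complex.Re ((x^t* *m A *m y) 0 0)) +
    (complex.Re ((y^t* *m A *m x) 0 0) + qf A y).
  have addE (u v w z : 'M[C]_1) : complex.Re ((u + v + (w + z)) 0 0) =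
      complex.Re (u 0 0) + complex.Re (v 0 0) + (complex.Re (w 0 0) + complex.Re (z 0 0)).
    by rewrite !mxE !ReD.
  by rewrite /qf adjD mulmxDl mulmxDl mulmxDr mulmxDr; exact: addE.
have lem (a b d p q r t : R) : - (a * b * d) <= p -> - (a * d * b) <= q ->
    - (a * d * d) <= r -> t - 2 * a * b * d - a * d ^+ 2 <= t + p + (q + r).
  by rewrite expr2; lra.
by apply: lem; apply: b2.
Qed.

(** Here [x] and [y] are the sizes of the components inside and outside the eigenspace. The
    inequality [2 a x y <= c x^2 / 2 + 2 a^2 y^2 / c] absorbs the cross term, half of the remaining
    gain in [x^2] absorbs the remainder once [8 C1 s < c], and the gap absorbs the terms in [y^2]
    once [s K < g]. *)
Lemma perturb_estimate (g c a C1 : R) : 0 < g -> 0 < c -> 0 <= a -> 0 <= C1 ->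
  exists2 s0, 0 < s0 & forall s x y, 0 < s < s0 -> 0 <= x -> 0 <= y -> 0 < x + y ->
    0 < g * y ^+ 2 + s * (c * x ^+ 2 - 2 * a * x * y - a * y ^+ 2)
        - C1 * s ^+ 2 * (x + y) ^+ 2.
Proof.
move=> g0 c0 a0 C0; pose K := 2 * a ^+ 2 / c + a + c.
have K0 : 0 < K.
  by rewrite /K ltr_wpDl // addr_ge0 // divr_ge0 ?(ltW c0) // mulr_ge0 ?sqr_ge0.
have M0 : 0 < 8 * C1 + 1 by rewrite ltr_wpDl // mulr_ge0.
exists (Num.min (c / (8 * C1 + 1)) (g / K)); first by rewrite lt_min !divr_gt0.
move=> s x y /andP[s0]; rewrite lt_min 2?ltr_pdivlMr // => /andP[h1 h2] x0 y0 xy.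
have e : a * x * y <= c / 4 * x ^+ 2 + a ^+ 2 / c * y ^+ 2.
  rewrite -subr_ge0 (_ : _ - _ = c * (x / 2 - a / c * y) ^+ 2); last by field; rewrite gt_eqF.
  by rewrite mulr_ge0 ?sqr_ge0 // ltW.
have hc : C1 * s * (x + y) ^+ 2 <= c / 4 * (x ^+ 2 + y ^+ 2).
  apply: (@le_trans _ _ (C1 * s * (2 * (x ^+ 2 + y ^+ 2)))).
    rewrite ler_wpM2l ?mulr_ge0 ?(ltW s0) //.
    by have := sqr_ge0 (x - y); nra.
  rewrite mulrA ler_wpM2r ?addr_ge0 ?sqr_ge0 //; lra.
have {}hc : C1 * s ^+ 2 * (x + y) ^+ 2 <= s * (c / 4 * (x ^+ 2 + y ^+ 2)).
  have -> : C1 * s ^+ 2 * (x + y) ^+ 2 = s * (C1 * s * (x + y) ^+ 2) by ring.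
  by rewrite ler_pM2l.
have e' : s * (c * x ^+ 2 - 2 * a * x * y - a * y ^+ 2) >=
    s * (c / 2 * x ^+ 2 - (2 * a ^+ 2 / c + a) * y ^+ 2).
  by rewrite ler_pM2l // -subr_ge0; move: e; rewrite -subr_ge0; lra.
have h3 : s * K * y ^+ 2 <= g * y ^+ 2 by rewrite ler_wpM2r ?sqr_ge0 // ltW.
have hx : 0 < s * (c / 4 * x ^+ 2) + (g - s * K) * y ^+ 2 + s * (c / 4 * 3 * y ^+ 2).
  have [y1|y1] := ltP 0 y.
    rewrite ltr_wpDl // ?mulr_gt0 ?exprn_gt0 ?divr_gt0 //.
    by rewrite !addr_ge0 ?mulr_ge0 ?sqr_ge0 ?divr_ge0 ?(ltW s0) ?(ltW c0) // subr_ge0 ltW // mulrC.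
  have x1 : 0 < x by lra.
  rewrite -!addrA ltr_wpDr // ?mulr_gt0 ?exprn_gt0 ?divr_gt0 //.
  by rewrite !addr_ge0 ?mulr_ge0 ?sqr_ge0 ?divr_ge0 ?(ltW s0) ?(ltW c0) // subr_ge0 ltW // mulrC.
apply: lt_le_trans hx _; move: e' hc; rewrite -subr_ge0 => e'; rewrite -subr_ge0 => hc.
rewrite -subr_ge0; apply: le_trans (addr_ge0 e' hc) _.
by rewrite le_eqVlt; apply/orP; left; apply/eqP; rewrite /K; field; rewrite gt_eqF.
Qed.

(* The eigenvalue [th] moves upwards to first order. *)
Lemma count_perturb_up n (A0 A1 : 'M[C]_n) (A : R -> 'M[C]_n) th (c C1 e : R) :
  herm A0 -> 0 < c -> 0 < e ->
  (forall y, A0 *m y = th%:C *: y -> c * sq y <= qf A1 y) ->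
  (forall s, 0 < s < e -> herm (A s) /\
     nrm (A s - A0 - s%:C *: A1) <= C1 * s ^+ 2) ->
  exists2 s0, 0 < s0 & forall s, 0 < s < s0 -> (ncge A0 th <= ncgt (A s) th)%N.
Proof.
move=> hA0 c0 e0 hpos hA; have [g [V [g0 hV]]] := span_ge th hA0.
have N0 : 0 < n%:R + 1 :> R by rewrite ltr_wpDl.
have [|||| s0 s00 hs] := @perturb_estimate (g / (n%:R + 1)) (c / (n%:R + 1)) (nrm A1) `|C1|.
- by rewrite divr_gt0.
- by rewrite divr_gt0.
- exact: nrm_ge0.
- exact: normr_ge0.
exists (Num.min e s0); first by rewrite lt_min e0.
move=> s; rewrite lt_min => /andP[sp /andP[se ss]].
have [hAs hE] := hA s (introT andP (conj sp se)).
apply: (count_lower (V := V) hAs) => b /hV[x0 [y0 [y1 [e1 hy0 hq]]]].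
have sn (y : 'cV[C]_n) : nrm y ^+ 2 / (n%:R + 1) <= sq y.
  rewrite ler_pdivrMr //; apply: le_trans (nrm_le_sq y) _.
  by rewrite mulrC ler_wpM2l ?sq_ge0 // lerDl.
have -> : A s = (A s - A0 - s%:C *: A1) + s%:C *: A1 + A0.
  by rewrite subrK subrK.
rewrite qfD qfD qfZ; set E := (A s - _ - _) in hE *.
have hqE : - (`|C1| * s ^+ 2 * (nrm y0 + nrm y1) ^+ 2) <= qf E (V *m b).
  have := qf_le E (V *m b); rewrite ler_norml => /andP[h _]; apply: le_trans h.
  rewrite lerN2 ler_pM ?nrm_ge0 ?sqr_ge0 //.
    by apply: le_trans hE _; rewrite ler_wpM2r ?sqr_ge0 ?ler_norm.
  by rewrite e1 ler_sqr ?nnegrE ?addr_ge0 ?nrm_ge0 ?nrmD.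
have hq1 := qf_add_ge A1 y0 y1.
have xy : 0 < nrm y0 + nrm y1.
  by apply: lt_le_trans (nrmD _ _); rewrite -e1 nrm_gt0.
have := hs s _ _ (introT andP (conj sp ss)) (nrm_ge0 y0) (nrm_ge0 y1) xy.
have s1 : s * (c * sq y0 - 2 * nrm A1 * nrm y0 * nrm y1 - nrm A1 * nrm y1 ^+ 2)
   <= s * qf A1 (V *m b).
  rewrite e1 (ler_pM2l sp); apply: le_trans hq1.
  exact: lerB (lerB (hpos _ hy0) (lexx _)) (lexx _).
have s2 : s * (c / (n%:R + 1) * nrm y0 ^+ 2) <= s * (c * sq y0).
  by rewrite ler_pM2l // mulrAC -mulrA ler_pM2l.
have s3 : g / (n%:R + 1) * nrm y1 ^+ 2 <= g * sq y1.
  by rewrite mulrAC -mulrA ler_pM2l.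
clear -hq hqE s1 s2 s3; move: hq hqE s1 s2 s3.
move: (qf _ _) (qf _ _) (qf _ _) (sq _) (sq _) (sq _) (nrm _) (nrm _) (nrm _).
move: (c / _) (g / _) (`|C1|) => c' g' C2 q1 q2 q3 z1 z2 z3 z4 z5 z6.
lra.
Qed.

Lemma count_perturb_down n (A0 A1 : 'M[C]_n) (A : R -> 'M[C]_n) th (c C1 e : R) :
  herm A0 -> 0 < c -> 0 < e ->
  (forall y, A0 *m y = th%:C *: y -> qf A1 y <= - (c * sq y)) ->
  (forall s, 0 < s < e -> herm (A s) /\
     nrm (A s - A0 - s%:C *: A1) <= C1 * s ^+ 2) ->
  exists2 s0, 0 < s0 & forall s, 0 < s < s0 -> (ncge (A s) th <= ncgt A0 th)%N.
Proof.
move=> hA0 c0 e0 hneg hA.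
have [||s0 s00 hs] := @count_perturb_up n (- A0) (- A1) (fun s => - A s) (- th) c C1 e
    (hermN hA0) c0 e0.
- move=> y; rewrite mulNmx rmorphN scaleNr => /oppr_inj /hneg.
  by rewrite qfN lerNr.
- move=> s /hA[h1 h2]; split; first exact: hermN.
  by rewrite -nrmN scalerN !opprD !opprK.
exists (Num.min e s0); first by rewrite lt_min e0.
move=> s; rewrite lt_min => /andP[sp /andP[se ss]].
have [hAs _] := hA s (introT andP (conj sp se)).
have := hs s (introT andP (conj sp ss)); rewrite ncgtN //.
have := ncgtN (- th) (hermN hA0); rewrite !opprK => ->; have := ncge_le (- A0) (- th).
move=> h1; rewrite leq_subRL ?ncge_le // => h2; by rewrite leq_subRL // addnC.
Qed.

(** Eigenvalues below [th] keep a distance [g] from it; a perturbation smaller than [g / (n + 1)] in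
    norm changes the form by less than [g * sq], because [nrm x ^+ 2 <= n * sq x]. *)
Lemma ncge_semicont n (A0 : 'M[C]_n) th : herm A0 ->
  exists2 e, 0 < e & forall A, herm A -> nrm (A - A0) < e ->
    (ncge A th <= ncge A0 th)%N.
Proof.
move=> hA0; have [g [V [g0 hV]]] := span_lt th hA0.
have N0 : 0 < n%:R + 1 :> R by rewrite ltr_wpDl.
exists (g / (n%:R + 1)); first by rewrite divr_gt0.
move=> A hA; rewrite ltr_pdivlMr // => hE.
rewrite -(leq_add2r (n - ncge A0 th)) subnKC ?ncge_le //; apply: (count_upper (V := V) hA).
move=> c /hV[x0 h]; rewrite -(subrK A0 A) qfD.
have hp : 0 < sq (V *m c) by rewrite sq_gt0.
have : qf (A - A0) (V *m c) < g * sq (V *m c).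
  2: by move: h; move: (qf _ _) (qf _ _) (sq _); clear => a b d; lra.
apply: le_lt_trans (ler_norm _) _; apply: le_lt_trans (qf_le _ _) _.
apply: (@le_lt_trans _ _ (nrm (A - A0) * (n%:R * sq (V *m c)))).
  by rewrite ler_wpM2l ?nrm_ge0 ?nrm_le_sq.
apply: (@le_lt_trans _ _ (nrm (A - A0) * (n%:R + 1) * sq (V *m c))).
  by rewrite -mulrA ler_wpM2l ?nrm_ge0 // ler_wpM2r ?(ltW hp) // lerDl.
by rewrite ltr_pM2r.
Qed.

Lemma ncgt_semicont n (A0 : 'M[C]_n) th : herm A0 ->
  exists2 e, 0 < e & forall A, herm A -> nrm (A - A0) < e ->
    (ncgt A0 th <= ncgt A th)%N.
Proof.
move=> hA0; have [e e0 h] := ncge_semicont (- th) (hermN hA0).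
exists e => // A hA hE; have := h (- A) (hermN hA).
rewrite -opprD nrmN => /(_ hE).
have := ncgtN (- th) (hermN hA0); have := ncgtN (- th) (hermN hA).
by rewrite !opprK => -> -> ; apply: leq_sub2l.
Qed.

End SpectralCount.

Ltac mx_ring := apply/matrixP => ? ?; rewrite !mxE; ring.

(** Products are generalized first, so that only a linear identity between matrices is left to
    [ring], entry by entry. *)
Ltac mx_atoms := repeat match goal with |- context [?a *m ?b] => move: (a *m b) => ? end.

(** * Differentiable matrix curves with quadratic remainders *)

Section Calculus.
Variable R : realType.
Local Notation C := R[i].

(** Asking for a quadratic remainder gives product and inverse rules with explicit constants, and it
    is the form in which [count_perturb_up] takes its first-order data. *)
Definition hasD m n (A : R -> 'M[C]_(m, n)) (x : R) (A1 : 'M[C]_(m, n)) :=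
  exists K e, 0 < e /\ forall y, `|y - x| < e ->
    nrm (A y - A x - (y - x)%:C *: A1) <= K * (y - x) ^+ 2.

Lemma hasD_pos m n (A : R -> 'M[C]_(m, n)) x A1 : hasD A x A1 ->
  exists K e, [/\ 0 <= K, 0 < e, e <= 1 & forall y, `|y - x| < e ->
    nrm (A y - A x - (y - x)%:C *: A1) <= K * (y - x) ^+ 2 /\
    nrm (A y - A x) <= K * `|y - x|].
Proof.
move=> [K [e [e0 h]]]; exists (`|K| + nrm A1), (Num.min e 1); split.
- by rewrite addr_ge0 // nrm_ge0.
- by rewrite lt_min e0 ltr01.
- by rewrite ge_min lexx orbT.
move=> y; rewrite lt_min => /andP[/h hy y1]; split.
  apply: le_trans hy _; rewrite ler_wpM2r ?sqr_ge0 //.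
  by apply: le_trans (ler_norm _) _; rewrite lerDl nrm_ge0.
rewrite -[A y - A x](subrK ((y - x)%:C *: A1)).
apply: le_trans (nrmD _ _) _; rewrite nrmZ cabsR mulrDl [nrm A1 * _]mulrC lerD2r.
apply: le_trans hy _; rewrite -real_normK ?num_real // expr2 mulrA.
rewrite ler_wpM2r //; apply: (@le_trans _ _ (`|K| * `|y - x|)).
  by rewrite ler_wpM2r // ler_norm.
by rewrite -[X in _ <= X]mulr1 ler_wpM2l // ltW.
Qed.

Lemma hasD_ext m n (A B : R -> 'M[C]_(m, n)) x A1 (e : R) : 0 < e ->
  (forall y, `|y - x| < e -> A y = B y) -> hasD A x A1 -> hasD B x A1.
Proof.
move=> e0 hAB [K [e' [e'0 h]]]; exists K, (Num.min e e'); split.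
  by rewrite lt_min e0.
move=> y; rewrite lt_min => /andP[hy1 hy2].
by rewrite -!hAB ?subrr ?normr0 //; exact: h.
Qed.

Lemma hasD_const m n (A : 'M[C]_(m, n)) x : hasD (fun=> A) x 0.
Proof.
exists 0, 1; split=> // y _.
by rewrite subrr sub0r scaler0 oppr0 nrm0 mul0r.
Qed.

Lemma hasDD m n (A B : R -> 'M[C]_(m, n)) x A1 B1 :
  hasD A x A1 -> hasD B x B1 -> hasD (fun y => A y + B y) x (A1 + B1).
Proof.
move=> [K [e [e0 h]]] [K' [e' [e'0 h']]]; exists (K + K'), (Num.min e e'); split.
  by rewrite lt_min e0.
move=> y; rewrite lt_min => /andP[/h hy /h' hy'].
have -> : A y + B y - (A x + B x) - (y - x)%:C *: (A1 + B1) =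
    (A y - A x - (y - x)%:C *: A1) + (B y - B x - (y - x)%:C *: B1).
  by mx_ring.
by apply: le_trans (nrmD _ _) _; rewrite mulrDl lerD.
Qed.

Lemma hasDN m n (A : R -> 'M[C]_(m, n)) x A1 :
  hasD A x A1 -> hasD (fun y => - A y) x (- A1).
Proof.
move=> [K [e [e0 h]]]; exists K, e; split=> // y /h.
by rewrite -nrmN !opprD scalerN !opprK.
Qed.

Lemma hasDB m n (A B : R -> 'M[C]_(m, n)) x A1 B1 :
  hasD A x A1 -> hasD B x B1 -> hasD (fun y => A y - B y) x (A1 - B1).
Proof. by move=> hA /hasDN; exact: hasDD. Qed.

Lemma hasD_adj m n (A : R -> 'M[C]_(m, n)) x A1 :
  hasD A x A1 -> hasD (fun y => (A y)^t*) x (A1^t*).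
Proof.
move=> [K [e [e0 h]]]; exists K, e; split=> // y /h.
by rewrite -nrm_adj !adjB adjZr.
Qed.

Lemma hasDM m n p (A : R -> 'M[C]_(m, n)) (B : R -> 'M[C]_(n, p)) x A1 B1 :
  hasD A x A1 -> hasD B x B1 ->
  hasD (fun y => A y *m B y) x (A1 *m B x + A x *m B1).
Proof.
move=> /hasD_pos[K [e [K0 e0 e1 h]]] /hasD_pos[K' [e' [K'0 e'0 e'1 h']]].
exists (K * nrm (B x) + nrm (A x) * K' + K * K'), (Num.min e e'); split.
  by rewrite lt_min e0.
move=> y; rewrite lt_min => /andP[/h[hy1 hy2] /h'[hy1' hy2']].
have -> : A y *m B y - A x *m B x - (y - x)%:C *: (A1 *m B x + A x *m B1) =
    (A y - A x - (y - x)%:C *: A1) *m B x + A x *m (B y - B x - (y - x)%:C *: B1)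
    + (A y - A x) *m (B y - B x).
  rewrite !mulmxDl !mulmxDr !mulNmx !mulmxN !opprK.
  rewrite -!scalemxAl -!scalemxAr.
  move: (A x *m B x) (A y *m B x) (A x *m B y) (A y *m B y) (A1 *m B x) (A x *m B1).
  by move=> *; mx_ring.
rewrite !mulrDl; apply: le_trans (nrmD _ _) _; apply: lerD.
  apply: le_trans (nrmD _ _) _; apply: lerD; apply: le_trans (nrmM _ _) _.
    by rewrite mulrAC ler_wpM2r ?nrm_ge0.
  by rewrite -mulrA ler_wpM2l ?nrm_ge0.
apply: le_trans (nrmM _ _) _; rewrite -real_normK ?num_real // expr2.
by rewrite mulrACA ler_pM ?nrm_ge0.
Qed.

Lemma hasD_unique m n (A : R -> 'M[C]_(m, n)) x A1 A2 :
  hasD A x A1 -> hasD A x A2 -> A1 = A2.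
Proof.
move=> h1 h2; have [K [e [K0 e0 e1 h]]] := hasD_pos (hasDB h1 h2).
apply/eqP; rewrite -subr_eq0 -nrm_eq0 eq_le nrm_ge0 andbT leNgt; apply/negP => h0.
set a := nrm _ in h0; pose d := Num.min (e / 2) (a / (2 * (K + 1))).
have K1 : 0 < 2 * (K + 1) by rewrite mulr_gt0 // ltr_wpDl.
have d0 : 0 < d by rewrite lt_min !divr_gt0.
have [|hd _] := h (x + d).
  by rewrite addrC addKr gtr0_norm // gt_min gtr_pMr // invf_lt1 // ltr1n.
move: hd; rewrite !subrr !sub0r nrmN nrmZ addrC addKr cabsR gtr0_norm // expr2 mulrCA.
rewrite ler_pM2l // -/a => hd.
have : d * (2 * (K + 1)) <= a by rewrite -ler_pdivlMr // ge_min lexx orbT.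
have : 0 <= K * d by rewrite mulr_ge0 // ltW.
by move: hd d0 h0; nra.
Qed.

Lemma hasD_id x : hasD (fun y => y%:C%:M : 'M[C]_1) x 1%:M.
Proof.
exists 0, 1; split=> // y _; rewrite mul0r -raddfB -rmorphB /=.
by rewrite scale_scalar_mx mulr1 subrr nrm0.
Qed.

Lemma hasD_scale m n (F : R -> 'M[C]_1) (B : 'M[C]_(m, n)) x F1 :
  hasD F x F1 -> hasD (fun y => F y 0 0 *: B) x (F1 0 0 *: B).
Proof.
move=> [K [e [e0 h]]]; exists (K * nrm B), e; split=> // y /h hy.
rewrite scalerA -!scalerBl nrmZ mulrAC ler_wpM2r ?nrm_ge0 //.
apply: le_trans hy; rewrite [X in cabs X](_ : _ = (F y - F x - (y - x)%:C *: F1) 0 0).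
  exact: cabs_le_nrm.
by rewrite !mxE.
Qed.

Lemma hasD_exp k x : hasD (fun y => (y ^+ k)%:C%:M : 'M[C]_1) x
  (k%:R * x ^+ k.-1)%:C%:M.
Proof.
elim: k => [|k IH].
  rewrite (_ : _%:M = 0); first exact: (hasD_const 1%:M).
  by apply/matrixP => i j; rewrite !mxE mul0r mul0rn.
have := hasDM (hasD_id x) IH; rewrite mul1mx => h.
apply: hasD_ext ltr01 _ (_ : hasD _ x _) => [y _|].
  rewrite /= exprS rmorphM /= scalar_mxM; reflexivity.
suff <- : (x ^+ k)%:C%:M + x%:C%:M *m (k%:R * x ^+ k.-1)%:C%:M =
  (k.+1%:R * x ^+ k)%:C%:M :> 'M[C]_1 by [].
rewrite -scalar_mxM -raddfD -rmorphM -rmorphD /=; congr (_%:C)%:M.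
case: k {IH h} => [|k]; first by rewrite mul0r mulr0 addr0 mul1r.
by rewrite /= mulrCA -exprS [in RHS]mulrS mulrDl mul1r.
Qed.

Lemma hasD_monomial m n (B : 'M[C]_(m, n)) k x :
  hasD (fun y => (y ^+ k)%:C *: B) x ((k%:R * x ^+ k.-1)%:C *: B).
Proof.
have := hasD_scale B (hasD_exp k x); rewrite mxE eqxx mulr1n.
by apply: hasD_ext ltr01 _ => y _; rewrite mxE eqxx mulr1n.
Qed.

Lemma hasD_sum (I : Type) (r : seq I) m n (A : I -> R -> 'M[C]_(m, n)) x A1 :
  (forall i, hasD (A i) x (A1 i)) ->
  hasD (fun y => \sum_(i <- r) A i y) x (\sum_(i <- r) A1 i).
Proof.
move=> h; elim: r => [|i r IH].
  rewrite big_nil; apply: hasD_ext ltr01 _ (hasD_const 0 x) => y _.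
  by rewrite big_nil.
rewrite big_cons; apply: hasD_ext ltr01 _ (hasDD (h i) IH) => y _.
by rewrite big_cons.
Qed.

Lemma unitmx_ker n (A : 'M[C]_n) :
  (forall x : 'cV[C]_n, A *m x = 0 -> x = 0) -> A \in unitmx.
Proof.
move=> h; rewrite -unitmx_tr -row_free_unit -kermx_eq0; apply/eqP/row_matrixP => i.
rewrite row0; apply: trmx_inj; rewrite trmx0; apply: h.
apply: trmx_inj; rewrite trmx_mul trmxK trmx0; apply/sub_kermxP.
exact: row_sub.
Qed.

(** Within [1 / (2 (nrm B + 1))] of [A0], the product [B *m A] differs from the identity by at most
    one half in norm. This makes the kernel of [A] trivial and yields [nrm (invmx A) <= nrm B + nrm
    (invmx A) / 2], hence the factor 2 in the bound. *)
Lemma unitmx_near n (A0 : 'M[C]_n) : A0 \in unitmx ->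
  exists e K, 0 < e /\ forall A, nrm (A - A0) < e ->
    A \in unitmx /\ nrm (invmx A) <= K.
Proof.
move=> u0; set B := invmx A0; have B1 : 0 < 2 * (nrm B + 1).
  by rewrite mulr_gt0 // ltr_wpDl // nrm_ge0.
exists (2 * (nrm B + 1))^-1, (2 * nrm B); split; first by rewrite invr_gt0.
move=> A; rewrite -div1r ltr_pdivlMr // => hA.
have hB : nrm B * nrm (A - A0) <= 1 / 2.
  have := nrm_ge0 (A - A0); have := nrm_ge0 B; move: hA; move: (nrm B) (nrm _).
  by clear => a b; nra.
have eA : B *m A = 1%:M + B *m (A - A0) by rewrite mulmxBr mulVmx // addrC subrK.
have uA : A \in unitmx.
  apply: unitmx_ker => x hx; apply/eqP; rewrite -nrm_eq0 eq_le nrm_ge0 andbT.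
  have e : x = - (B *m (A - A0) *m x).
    apply/eqP; rewrite -addr_eq0; apply/eqP; rewrite -{1}[x]mul1mx -mulmxDl -eA.
    by rewrite -mulmxA hx mulmx0.
  have : nrm x <= 1 / 2 * nrm x.
    rewrite {1}e nrmN; apply: le_trans (nrmM _ _) _; rewrite ler_wpM2r ?nrm_ge0 //.
    exact: le_trans (nrmM _ _) hB.
  by move: (nrm x) => a; lra.
split=> //.
have e : invmx A = B - B *m (A - A0) *m invmx A.
  apply/eqP; rewrite eq_sym subr_eq; apply/eqP.
  by rewrite -{1}[invmx A]mul1mx -mulmxDl -eA mulmxK.
have : nrm (invmx A) <= nrm B + 1 / 2 * nrm (invmx A).
  rewrite {1}e; apply: le_trans (nrmB _ _) _; rewrite lerD2l.
  apply: le_trans (nrmM _ _) _; rewrite ler_wpM2r ?nrm_ge0 //.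
  exact: le_trans (nrmM _ _) hB.
by move: (nrm _) (nrm _) => a b; lra.
Qed.

Lemma invmx_diff n (A B : 'M[C]_n) : A \in unitmx -> B \in unitmx ->
  invmx A - invmx B = - (invmx A *m (A - B) *m invmx B).
Proof.
move=> uA uB; rewrite mulmxBr mulVmx // mulmxBl mul1mx -mulmxA mulmxV // mulmx1.
by rewrite opprB.
Qed.

Lemma hasD_inv n (A : R -> 'M[C]_n) x A1 : A x \in unitmx -> hasD A x A1 ->
  hasD (fun y => invmx (A y)) x (- (invmx (A x) *m A1 *m invmx (A x))).
Proof.
move=> u0 /hasD_pos[K [e [K0 e0 e1 h]]]; have [d [L [d0 hL]]] := unitmx_near u0.
exists (`|L| * (K * nrm (invmx (A x))) + `|L| * K * (nrm (invmx (A x)) * (nrm A1 * nrm (invmx (A x))))).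
exists (Num.min e (d / (K + 1))); have K1 : 0 < K + 1 by rewrite ltr_wpDl.
split; first by rewrite lt_min e0 divr_gt0.
move=> y; rewrite lt_min ltr_pdivlMr // => /andP[/h[hy1 hy2] yd].
have [uy ly] : A y \in unitmx /\ nrm (invmx (A y)) <= L.
  apply: hL; apply: le_lt_trans hy2 _; apply: le_lt_trans yd; rewrite mulrC.
  by rewrite ler_wpM2l ?normr_ge0 // lerDl.
have {}ly : nrm (invmx (A y)) <= `|L| by apply: le_trans ly _; exact: ler_norm.
set B := invmx (A x); set By := invmx (A y) in ly *.
have eq1 : By - B = - (By *m (A y - A x) *m B) by exact: invmx_diff.
have -> : By - B - (y - x)%:C *: (- (B *m A1 *m B)) =
    - (By *m ((A y - A x - (y - x)%:C *: A1) *m B))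
    + By *m (A y - A x) *m (B *m ((y - x)%:C *: A1 *m B)).
  have eq2 : By *m (A y - A x) *m B = B - By by rewrite -[RHS]opprB eq1 opprK.
  rewrite -!scalemxAl -!scalemxAr !mulmxA eq2 mulmxBl mulmxBr mulmxBl eq2 -!scalemxAr.
  rewrite mulmxBl -!scalemxAl.
  move: (By *m A1 *m B) (B *m A1 *m B) => u v; mx_ring.
rewrite mulrDl; apply: le_trans (nrmD _ _) _; apply: lerD.
  rewrite nrmN -mulrA; apply: le_trans (nrmM _ _) _; rewrite ler_pM ?nrm_ge0 //.
  by apply: le_trans (nrmM _ _) _; rewrite mulrAC ler_wpM2r ?nrm_ge0.
have b1 : nrm (By *m (A y - A x)) <= `|L| * (K * `|y - x|).
  by apply: le_trans (nrmM _ _) _; rewrite ler_pM ?nrm_ge0.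
have b2 : nrm (B *m ((y - x)%:C *: A1 *m B)) <= nrm B * (`|y - x| * nrm A1 * nrm B).
  apply: le_trans (nrmM _ _) _; rewrite ler_wpM2l ?nrm_ge0 //.
  by apply: le_trans (nrmM _ _) _; rewrite nrmZ cabsR.
apply: le_trans (nrmM _ _) _; apply: le_trans (ler_pM (nrm_ge0 _) (nrm_ge0 _) b1 b2) _.
rewrite -[X in _ <= _ * X]real_normK ?num_real // le_eqVlt; apply/orP; left; apply/eqP.
ring.
Qed.

(** The bounds on [A] and its derivative and the Lipschitz bound at [0] are uniform on a two-sided
    neighbourhood, whereas the remainder constant hidden in [hasD] may depend on [x]. The class is
    stable under sums, products, adjoints and inverses. *)
Definition C11 m n (A : R -> 'M[C]_(m, n)) :=
  exists e K A1, [/\ 0 < e, 0 <= K & forall x, `|x| < e ->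
    [/\ hasD A x (A1 x), nrm (A x) <= K, nrm (A1 x) <= K & nrm (A x - A 0) <= K * `|x|]].

Lemma C11_const m n (A : 'M[C]_(m, n)) : C11 (fun=> A).
Proof.
exists 1, (nrm A), (fun=> 0); split; rewrite ?nrm_ge0 //.
move=> x _; split; rewrite ?nrm0 ?subrr ?nrm0 ?nrm_ge0 ?mulr_ge0 ?nrm_ge0 //.
exact: hasD_const.
Qed.

Lemma C11D m n (A B : R -> 'M[C]_(m, n)) :
  C11 A -> C11 B -> C11 (fun x => A x + B x).
Proof.
move=> [e [K [A1 [e0 K0 h]]]] [e' [K' [B1 [e'0 K'0 h']]]].
exists (Num.min e e'), (K + K'), (fun x => A1 x + B1 x); split.
- by rewrite lt_min e0.
- exact: addr_ge0.
move=> x; rewrite lt_min => /andP[/h[hA a1 a2 a3] /h'[hB b1 b2 b3]]; split.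
- exact: hasDD.
- by apply: le_trans (nrmD _ _) _; exact: lerD.
- by apply: le_trans (nrmD _ _) _; exact: lerD.
have -> : A x + B x - (A 0 + B 0) = (A x - A 0) + (B x - B 0) by mx_ring.
by rewrite mulrDl; apply: le_trans (nrmD _ _) _; exact: lerD.
Qed.

Lemma C11N m n (A : R -> 'M[C]_(m, n)) : C11 A -> C11 (fun x => - A x).
Proof.
move=> [e [K [A1 [e0 K0 h]]]]; exists e, K, (fun x => - A1 x); split=> // x /h.
move=> [h1 h2 h3 h4]; rewrite -opprD !nrmN; split=> //; exact: hasDN.
Qed.

Lemma C11B m n (A B : R -> 'M[C]_(m, n)) :
  C11 A -> C11 B -> C11 (fun x => A x - B x).
Proof. by move=> hA /C11N; exact: C11D. Qed.

Lemma C11_adj m n (A : R -> 'M[C]_(m, n)) : C11 A -> C11 (fun x => (A x)^t*).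
Proof.
move=> [e [K [A1 [e0 K0 h]]]]; exists e, K, (fun x => (A1 x)^t*); split=> // x /h.
move=> [h1 h2 h3 h4]; rewrite -adjB !nrm_adj; split=> //; exact: hasD_adj.
Qed.

Lemma C11M m n p (A : R -> 'M[C]_(m, n)) (B : R -> 'M[C]_(n, p)) :
  C11 A -> C11 B -> C11 (fun x => A x *m B x).
Proof.
move=> [e [K [A1 [e0 K0 h]]]] [e' [K' [B1 [e'0 K'0 h']]]].
have [|_ a00 _ _] := h 0; first by rewrite normr0.
exists (Num.min e e'), (2 * (K * K')), (fun x => A1 x *m B x + A x *m B1 x); split.
- by rewrite lt_min e0.
- by rewrite !mulr_ge0.
move=> x; rewrite lt_min => /andP[/h[hA a1 a2 a3] /h'[hB b1 b2 b3]].
have dbl a : 2 * a = a + a :> R by rewrite mulr_natl mulr2n.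
have KK : 0 <= K * K' by rewrite mulr_ge0.
split; first exact: hasDM.
- apply: le_trans (nrmM _ _) _; rewrite dbl -[X in X <= _]addr0 lerD //.
  by rewrite ler_pM ?nrm_ge0.
- rewrite dbl; apply: le_trans (nrmD _ _) _; apply: lerD;
  by apply: le_trans (nrmM _ _) _; rewrite ler_pM ?nrm_ge0.
have -> : A x *m B x - A 0 *m B 0 = (A x - A 0) *m B x + A 0 *m (B x - B 0).
  by rewrite mulmxBl mulmxBr addrA subrK.
rewrite dbl mulrDl; apply: le_trans (nrmD _ _) _; apply: lerD;
  apply: le_trans (nrmM _ _) _.
  by rewrite mulrAC ler_pM ?nrm_ge0.
by rewrite -mulrA ler_pM ?nrm_ge0.
Qed.

Lemma C11_sum (I : Type) (r : seq I) m n (A : I -> R -> 'M[C]_(m, n)) :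
  (forall i, C11 (A i)) -> C11 (fun y => \sum_(i <- r) A i y).
Proof.
move=> h; elim: r => [|i r IH].
  have -> : (fun y => \sum_(i <- [::]) A i y) = (fun=> 0).
    by apply/funext => y; rewrite big_nil.
  exact: C11_const.
have -> : (fun y => \sum_(i <- i :: r) A i y) =
    (fun y => A i y + \sum_(i <- r) A i y).
  by apply/funext => y; rewrite big_cons.
exact: C11D.
Qed.

Lemma C11_id m n (B : 'M[C]_(m, n)) : C11 (fun y => y%:C *: B).
Proof.
exists 1, (nrm B), (fun=> B); split; rewrite ?nrm_ge0 // => x x1; split.
- by have := hasD_monomial B 1 x; rewrite expr0 mulr1 scale1r.
- by rewrite nrmZ cabsR -[X in _ <= X]mul1r ler_wpM2r ?nrm_ge0 // ltW.
- exact: lexx.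
- by rewrite -scalerBl -rmorphB subr0 nrmZ cabsR mulrC.
Qed.

Lemma C11_monomial m n (B : 'M[C]_(m, n)) k : C11 (fun y => (y ^+ k)%:C *: B).
Proof.
elim: k m n B => [|k IH] m n B.
  rewrite (_ : (fun _ => _) = (fun=> B)); first exact: C11_const.
  by apply/funext => y; rewrite expr0 scale1r.
rewrite (_ : (fun _ => _) = (fun y => (y%:C *: 1%:M) *m ((y ^+ k)%:C *: B))).
  exact: C11M (C11_id _) (IH _ _ _).
by apply/funext => y; rewrite -scalemxAl mul1mx scalerA -rmorphM exprS.
Qed.

Lemma C11_inv n (A : R -> 'M[C]_n) : C11 A -> A 0 \in unitmx ->
  C11 (fun x => invmx (A x)).
Proof.
move=> [e [K [A1 [e0 K0 h]]]] u0; have [d [L [d0 hL]]] := unitmx_near u0.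
have L0 : 0 <= L.
  by have [|_] := hL (A 0); [rewrite subrr nrm0|apply: le_trans (nrm_ge0 _)].
have K1 : 0 < K + 1 by rewrite ltr_wpDl.
exists (Num.min e (d / (K + 1))), (L + L * K * L),
  (fun x => - (invmx (A x) *m A1 x *m invmx (A x))); split.
- by rewrite lt_min e0 divr_gt0.
- by rewrite addr_ge0 ?mulr_ge0.
move=> x; rewrite lt_min ltr_pdivlMr // => /andP[/h[hA a1 a2 a3] xd].
have [ux lx] : A x \in unitmx /\ nrm (invmx (A x)) <= L.
  apply: hL; apply: le_lt_trans a3 _; apply: le_lt_trans xd; rewrite mulrC.
  by rewrite ler_wpM2l // lerDl.
have [_ l0] : A 0 \in unitmx /\ nrm (invmx (A 0)) <= L.
  by apply: hL; rewrite subrr nrm0.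
split; first exact: hasD_inv.
- by apply: le_trans lx _; rewrite lerDl !mulr_ge0.
- rewrite nrmN; apply: (@le_trans _ _ (L * K * L)); last by rewrite lerDr.
  apply: le_trans (nrmM _ _) _; rewrite ler_pM ?nrm_ge0 //.
  by apply: le_trans (nrmM _ _) _; rewrite ler_pM ?nrm_ge0.
rewrite invmx_diff // nrmN mulrDl; apply: (@le_trans _ _ (L * K * L * `|x|)).
  rewrite mulrAC; apply: le_trans (nrmM _ _) _; rewrite ler_pM ?nrm_ge0 //.
  by rewrite -mulrA; apply: le_trans (nrmM _ _) _; rewrite ler_pM ?nrm_ge0.
by rewrite lerDr mulr_ge0.
Qed.

Lemma C11_reflect m n (A : R -> 'M[C]_(m, n)) : C11 A -> C11 (fun x => A (- x)).
Proof.
move=> [e [K [A1 [e0 K0 h]]]]; exists e, K, (fun x => - A1 (- x)); split=> // x xe.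
have [|[K' [e' [e'0 h1]]] h2 h3] := h (- x); first by rewrite normrN.
rewrite normrN oppr0 nrmN => h4; split=> //; exists K', e'; split=> // y ye.
have := h1 (- y); rewrite -opprD normrN => /(_ ye).
by rewrite sqrrN rmorphN scaleNr scalerN.
Qed.

End Calculus.

(** * Curves [Z D^-1 B D^-1 Z^H + W]: size and monotonicity of their large eigenvalues *)

Section NormalForm.
Variable R : realType.
Local Notation C := R[i].

Definition dg m (f : 'I_m -> R) : 'M[C]_m := diag_mx (\row_j (f j)%:C).

Lemma dgM m (f h : 'I_m -> R) : dg f *m dg h = dg (fun j => f j * h j).
Proof.
by apply/matrixP => i j; rewrite mul_diag_mx !mxE rmorphM -mulrnAr.
Qed.

Lemma dg1 m (f : 'I_m -> R) : (forall j, f j = 1) -> dg f = 1%:M.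
Proof. by move=> h; apply/matrixP => i j; rewrite !mxE h. Qed.

Lemma adj_dg m (f : 'I_m -> R) : (dg f)^t* = dg f.
Proof.
apply/matrixP => i j; rewrite !mxE eq_sym.
by case: eqP => [->|_]; rewrite ?mulr1n ?mulr0n ?conjR ?conjC0.
Qed.

Lemma qf_dg m (f : 'I_m -> R) x : qf (dg f) x = \sum_i f i * cabs (x i 0) ^+ 2.
Proof. exact: qf_diag. Qed.

Lemma dg_mulE m (f : 'I_m -> R) (x : 'cV_m) i : (dg f *m x) i 0 = (f i)%:C * x i 0.
Proof. by rewrite mul_diag_mx !mxE. Qed.

Lemma sqB n (u v : 'cV[C]_n) :
  sq (u - v) = sq u + sq v - 2 * complex.Re ((v^t* *m u) 0 0).
Proof.
have e1 : complex.Re ((u^t* *m v) 0 0) = complex.Re ((v^t* *m u) 0 0).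
  by rewrite -[RHS]ReJ -adjE adjM adjK.
have addE (a b c d : 'M[C]_1) : complex.Re ((a - b - (c - d)) 0 0) =
    complex.Re (a 0 0) - complex.Re (b 0 0) - (complex.Re (c 0 0) - complex.Re (d 0 0)).
  by rewrite !mxE !(ReD, ReN).
rewrite [LHS]sqE adjB mulmxBl mulmxBr mulmxBr addE -!sqE e1.
by move: (sq u) (sq v) (complex.Re _) => a b c; ring.
Qed.

Lemma qf_gram n m (M : 'M[C]_(n, m)) c : qf (M^t* *m M) c = sq (M *m c).
Proof. by rewrite sqE /qf adjM !mulmxA. Qed.

Lemma qf1 n (c : 'cV[C]_n) : qf 1%:M c = sq c.
Proof. by rewrite sqE /qf mulmx1. Qed.

Lemma sq_partial_isometry n m (Z : 'M[C]_(n, m)) y :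
  Z^t* *m Z = 1%:M -> sq (Z^t* *m y) <= sq y.
Proof.
move=> hO; rewrite -subr_ge0.
suff -> : sq y - sq (Z^t* *m y) = sq (y - Z *m (Z^t* *m y)) by exact: sq_ge0.
rewrite sqB (sq_unitary _ hO) adjM adjM adjK -mulmxA.
have -> : complex.Re ((y ^t* *m Z *m (Z ^t* *m y)) 0 0) = sq (Z^t* *m y).
  by rewrite sqE adjM adjK.
by move: (sq y) (sq _) => a b; ring.
Qed.

Lemma diag_lower m (g : 'I_m -> R) : (forall i, 0 < g i) ->
  exists2 c, 0 < c & forall q : 'cV[C]_m, c * sq q <= qf (dg g) q.
Proof.
move=> g0; have [|c c0 hc] := @finite_gap _ _ predT g; first by move=> i _.
exists c => // q; rewrite qf_dg /sq mulr_sumr ler_sum // => i _.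
by rewrite ler_wpM2r ?sqr_ge0 // hc.
Qed.

Lemma C11_lip m n (A : R -> 'M[C]_(m, n)) : C11 A -> exists e K A1,
  [/\ 0 < e, e <= 1, 0 <= K & forall x, 0 < x < e ->
    [/\ hasD A x (A1 x), nrm (A x) <= K, nrm (A1 x) <= K & nrm (A x - A 0) <= K * x]].
Proof.
move=> [e [K [A1 [e0 K0 h]]]]; exists (Num.min e 1), K, A1; split=> //.
- by rewrite lt_min e0 ltr01.
- by rewrite ge_min lexx orbT.
move=> x; rewrite lt_min => /andP[x0 /andP[xe x1]].
have xx : `|x| = x by rewrite gtr0_norm.
by have := h x; rewrite xx => /(_ xe).
Qed.

(** The absolute Lipschitz bound on [B] becomes a relative one because [dg g] is bounded below by a
    positive multiple of the identity. A relative error is required, since the form is evaluated at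
    vectors blown up by [D^-1]. *)
Lemma diag_perturb m (B : R -> 'M[C]_m) (g : 'I_m -> R) :
  (forall i, 0 < g i) -> C11 B -> B 0 = dg g ->
  exists e K, [/\ 0 < e, 0 <= K & forall x, 0 < x < e -> forall q,
    `|qf (B x) q - qf (dg g) q| <= K * x * qf (dg g) q].
Proof.
move=> g0 hB B0; have [c c0 hc] := diag_lower g0.
have [e [K [B1 [e0 e1 K0 h]]]] := C11_lip hB.
exists e, (K * (m%:R / c)); split=> //.
  by rewrite mulr_ge0 // divr_ge0 // ltW.
move=> x xe q; have [_ _ _ hx] := h x xe.
rewrite -qfB; apply: le_trans (qf_le _ _) _.
rewrite -B0 (mulrAC K) -(mulrA (K * x)); apply: (@le_trans _ _ (K * x * nrm q ^+ 2)).
  by rewrite ler_wpM2r ?sqr_ge0.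
have [x0 _] := andP xe.
rewrite ler_wpM2l ?mulr_ge0 // ?(ltW x0) //.
apply: le_trans (nrm_le_sq q) _; rewrite -mulrA ler_wpM2l //.
by rewrite B0 ler_pdivlMl.
Qed.

(** At [x = 0] the product [Z Z^H] is an orthogonal projection and [Z^H Z] is the identity; both
    products are Lipschitz at [0]. *)
Lemma isometry_perturb n m (Z : R -> 'M[C]_(n, m)) :
  C11 Z -> (Z 0)^t* *m Z 0 = 1%:M ->
  exists e K, [/\ 0 < e, 0 <= K & forall x, 0 < x < e ->
    (forall y, sq ((Z x)^t* *m y) <= (1 + K * x) * sq y) /\
    (forall r, (1 - K * x) * sq r <= sq (Z x *m r) <= (1 + K * x) * sq r)].
Proof.
move=> hO Z0.
have [e [K [A1 [e0 e1 K0 h]]]] := C11_lip (C11M hO (C11_adj hO)).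
have [e' [K' [A1' [e'0 e'1 K'0 h']]]] := C11_lip (C11M (C11_adj hO) hO).
exists (Num.min e e'), (K * n%:R + K' * m%:R); split.
- by rewrite lt_min e0.
- by rewrite addr_ge0 ?mulr_ge0.
have aux k (M : 'M[C]_k) L x y : 0 <= L -> 0 < x -> nrm M <= L * x ->
    `|qf M y| <= L * k%:R * x * sq y.
  move=> L0 x0 hM; apply: le_trans (qf_le _ _) _.
  have -> : L * k%:R * x * sq y = L * x * (k%:R * sq y) by ring.
  apply: (@le_trans _ _ (L * x * nrm y ^+ 2)); first by rewrite ler_wpM2r ?sqr_ge0.
  by rewrite ler_wpM2l ?nrm_le_sq // mulr_ge0 // ltW.
move=> x; rewrite lt_min => /andP[x0 /andP[xe xe']].
have [_ _ _ hx] := h x (introT andP (conj x0 xe)).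
have [_ _ _ hx'] := h' x (introT andP (conj x0 xe')).
split=> [y|r].
  have e2 : sq ((Z x)^t* *m y) = sq ((Z 0)^t* *m y) +
      qf (Z x *m (Z x)^t* - Z 0 *m (Z 0)^t*) y.
    by rewrite qfB -{2}[Z x]adjK -{2}[Z 0]adjK !qf_gram addrC subrK.
  rewrite e2 mulrDl mul1r; apply: lerD; first exact: sq_partial_isometry.
  apply: le_trans (ler_norm _) _; apply: le_trans (aux _ _ _ _ _ K0 x0 hx) _.
  rewrite ler_wpM2r ?sq_ge0 // ler_wpM2r ?(ltW x0) // lerDl mulr_ge0 //.
have e2 : sq (Z x *m r) = sq r + qf ((Z x)^t* *m Z x - (Z 0)^t* *m Z 0) r.
  by rewrite qfB Z0 qf1 qf_gram addrC subrK.
have := aux _ _ _ _ r K'0 x0 hx'; rewrite ler_norml => /andP[h1 h2].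
have h3 : K' * m%:R * x * sq r <= (K * n%:R + K' * m%:R) * x * sq r.
  by rewrite ler_wpM2r ?sq_ge0 // ler_wpM2r ?(ltW x0) // lerDr mulr_ge0.
rewrite e2 mulrBl mul1r [(1 + _) * _]mulrDl mul1r !lerD2l; apply/andP; split; last exact: le_trans h2 h3.
by apply: le_trans h1; rewrite lerN2.
Qed.

Definition Dinv m (p : 'I_m -> nat) (x : R) : 'M[C]_m := dg (fun j => (x ^+ p j)^-1).

(** Leading term of the large eigenvalue attached to [j] for a curve in normal form. *)
Definition wt m (p : 'I_m -> nat) (g : 'I_m -> R) (x : R) j := g j / (x ^+ p j) ^+ 2.

Lemma qf_wt m (p : 'I_m -> nat) g x z :
  qf (dg g) (Dinv p x *m z) = \sum_i wt p g x i * cabs (z i 0) ^+ 2.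
Proof.
rewrite qf_dg; apply: eq_bigr => i _.
by rewrite dg_mulE cabsM cabsR exprMn real_normK ?num_real // /wt exprVn mulrA.
Qed.

(** The curve is differentiated as the inverse of the polynomial curve [D]. The factor [- x^-1] is
    what will dominate the derivative of a normal form and make its large eigenvalues decrease. *)
Lemma hasD_Dinv m (p : 'I_m -> nat) x : 0 < x ->
  hasD (Dinv p) x (- (x^-1)%:C *: (dg (fun j => (p j)%:R) *m Dinv p x)).
Proof.
move=> x0; pose D y := \sum_j (y ^+ p j)%:C *: (delta_mx j j : 'M[C]_m).
have DE y : D y = dg (fun j => y ^+ p j).
  apply/matrixP => i j; rewrite /D summxE !mxE (bigD1 i) //= !mxE eqxx /=.
  rewrite big1 ?addr0; last by move=> k ki; rewrite !mxE eq_sym (negbTE ki) mulr0.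
  by rewrite [i == j]eq_sym; case: eqP; rewrite ?mulr1 ?mulr0 ?mulr1n.
have DI y : 0 < y -> Dinv p y *m D y = 1%:M.
  by move=> y0; rewrite DE dgM dg1 // => j; rewrite mulVf // expf_neq0 // gt_eqF.
have DU y : 0 < y -> D y \in unitmx.
  by move=> y0; have /mulmx1_unit[] := DI y y0.
have DV y : 0 < y -> invmx (D y) = Dinv p y.
  by move=> y0; rewrite -[RHS](mulmxK (DU y y0)) DI // mul1mx.
have hD : hasD D x (\sum_j ((p j)%:R * x ^+ (p j).-1)%:C *: delta_mx j j).
  by apply: hasD_sum => j; exact: hasD_monomial.
have := hasD_inv (DU x x0) hD; rewrite (DV x x0).
set M := - _; suff -> : M = - (x^-1)%:C *: (dg (fun j => (p j)%:R) *m Dinv p x).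
  apply: hasD_ext x0 _ => y; rewrite ltr_norml => /andP[h _]; apply: DV.
  by move: h; rewrite ltrBrDl addrN.
rewrite /M.
have -> : \sum_j ((p j)%:R * x ^+ (p j).-1)%:C *: delta_mx j j =
    (x^-1)%:C *: (D x *m dg (fun j => (p j)%:R)).
  rewrite DE dgM; apply/matrixP => i j; rewrite summxE !mxE (bigD1 i) //= !mxE eqxx /=.
  rewrite big1 ?addr0; last by move=> k ki; rewrite !mxE eq_sym (negbTE ki) mulr0.
  rewrite [_ == i]eq_sym; case: eqP => _; rewrite ?mulr1 ?mulr1n ?mulr0n ?mulr0 //.
  rewrite -rmorphM /= mulrCA; congr (_%:C); rewrite mulrC.
  by case: (p i) => [|k] /=; rewrite ?mulr0 // exprSr -mulrA (mulrA x) mulfV ?mul1r // gt_eqF.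
by rewrite -scalemxAr -scalemxAl mulmxA (DI x x0) mul1mx scaleNr.
Qed.

(* Only [x > 0] is constrained: for [x < 0] the normal form is stated for
   [fun x => Q (- x)]. *)
Definition normal_form N m (Q : R -> 'M[C]_N) (p : 'I_m -> nat) (g : 'I_m -> R) :=
  exists e Z B W, [/\ 0 < e, C11 Z, C11 B, C11 W &
    [/\ forall x, 0 < x < e -> herm (B x), forall x, 0 < x < e -> herm (W x),
       (Z 0)^t* *m Z 0 = 1%:M, B 0 = dg g &
       forall x, 0 < x < e ->
         Q x = Z x *m Dinv p x *m B x *m Dinv p x *m (Z x)^t* + W x]].

Lemma normal_form_qf N m (Z : 'M[C]_(N, m)) (Di B : 'M[C]_m) W y : Di^t* = Di ->
  qf (Z *m Di *m B *m Di *m Z^t* + W) y = qf B (Di *m (Z^t* *m y)) + qf W y.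
Proof. by move=> hD; rewrite qfD; congr (_ + _); rewrite /qf !adjM hD adjK !mulmxA. Qed.

Lemma normal_form_herm N m (Q : R -> 'M[C]_N) (p : 'I_m -> nat) g :
  normal_form Q p g -> exists2 e, 0 < e & forall x, 0 < x < e -> herm (Q x).
Proof.
move=> [e [ Z [B [W [e0 _ _ _ [hB hW _ _ hQ]]]]]]; exists e => // x xe.
have hD : (Dinv p x)^t* = Dinv p x by exact: adj_dg.
move: (hB x xe) (hW x xe); rewrite /herm (hQ x xe) => h1 h2.
by rewrite adjD !adjM adjK h1 h2 hD !mulmxA.
Qed.

Lemma kernel_basis k N (M : 'M[C]_(k, N)) : exists r (V : 'M[C]_(N, r)),
  [/\ (N - k <= r)%N, M *m V = 0 & forall c : 'cV_r, c != 0 -> V *m c != 0].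
Proof.
pose B := row_base (kermx M^T); exists (\rank (kermx M^T)), B^T; split.
- by rewrite mxrank_ker mxrank_tr leq_sub2l // rank_leq_row.
- apply: trmx_inj; rewrite trmx_mul trmxK trmx0; apply/sub_kermxP.
  by rewrite eq_row_base.
move=> c; apply: contra => /eqP h; rewrite -(inj_eq trmx_inj) trmx0.
have : row_free B by exact: row_base_free.
by move=> /row_free_inj hi; apply/eqP/hi; rewrite mul0mx -[B]trmxK -trmx_mul h trmx0.
Qed.

Lemma wt_ge m (p : 'I_m -> nat) g x j : (0 < p j)%N -> 0 < g j -> 0 < x <= 1 ->
  g j <= x * wt p g x j.
Proof.
move=> p0 g0 /andP[x0 x1]; rewrite /wt mulrCA ler_pMr // ler_pdivlMr; last first.
  by rewrite exprn_gt0 // exprn_gt0.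
rewrite mul1r -exprM; case: (p j) p0 => // k _.
by rewrite mulSn addSn exprS ler_piMr ?exprn_ile1 ?(ltW x0).
Qed.

(** On the kernel of the rows of [Z^H] indexed by [S], of codimension at most [#|S|], only weights
    outside [S] contribute, and these are at most [wt p g x j]; then [count_upper] applies. The
    bounded term [W] costs a relative error [O(x)] only, since [wt p g x j] is at least of order
    [x^-1]. *)
Lemma normal_form_upper N m (Q : R -> 'M[C]_N) (p : 'I_m -> nat) g :
  (forall j, (0 < p j)%N) -> (forall j, 0 < g j) -> normal_form Q p g ->
  exists e K, [/\ 0 < e, 0 <= K & forall x, 0 < x < e -> forall j (S : {pred 'I_m}) th,
    (forall i, i \notin S -> wt p g x i <= wt p g x j) ->
    wt p g x j * (1 + K * x) < th -> (ncge (Q x) th <= #|S|)%N].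
Proof.
move=> p0 g0 hnf; have [e4 e40 hQh] := normal_form_herm hnf.
have [e0 [ Z [B [W [e00 hO hB hW [hBh hWh Z0 B0 hQ]]]]]] := hnf.
have [e1 [K1 [e10 K10 h1]]] := diag_perturb g0 hB B0.
have [e2 [K2 [e20 K20 h2]]] := isometry_perturb hO Z0.
have [e3 [K3 [W1 [e30 e31 K30 h3]]]] := C11_lip hW.
have [c c0 hc] := @finite_gap _ _ predT g (fun i _ => g0 i).
pose K4 := K3 * N%:R / c; have K40 : 0 <= K4.
  by rewrite divr_ge0 ?mulr_ge0 // ltW.
exists (Num.min (Num.min e0 e1) (Num.min (Num.min e2 e3) e4)), (K1 + K2 + K1 * K2 + K4); split.
- by rewrite !lt_min e00 e10 e20 e30 e40.
- by rewrite !addr_ge0 // mulr_ge0.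
move=> x; rewrite !lt_min => /andP[x0 /andP[/andP[xe0 xe1] /andP[/andP[xe2 xe3] xe4]]] j S th hS hth.
have x1 : x <= 1 by apply: ltW; exact: lt_le_trans xe3 e31.
have {}h1 := h1 x (introT andP (conj x0 xe1)).
have [{}h2 _] := h2 x (introT andP (conj x0 xe2)).
have [_ hW1 _ _] := h3 x (introT andP (conj x0 xe3)).
have [r [V [hr hV hV0]]] := kernel_basis (rowsub (@enum_val _ S) ((Z x)^t*)).
suff : (ncge (Q x) th + r <= N)%N.
  by move=> h; rewrite -(leq_add2r r); apply: leq_trans h _; rewrite -leq_subLR.
apply: (count_upper (V := V)); first by apply: hQh; rewrite x0 xe4.
move=> b b0; set y := V *m b; have y0 : 0 < sq y by rewrite sq_gt0 hV0.
set z := (Z x)^t* *m y; have hz i : i \in S -> z i 0 = 0.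
  move=> Si; have := congr1 (fun M : 'cV_ _ => M (enum_rank_in Si i) 0) (congr1 (mulmxr b) hV).
  rewrite /= mul0mx -mulmxA [RHS]mxE mxE => e; rewrite -[RHS]e /z mxE.
  by apply: eq_bigr => k _; rewrite !mxE enum_rankK_in.
have w0 : 0 < wt p g x j by rewrite divr_gt0 // !exprn_gt0.
have hw : qf (dg g) (Dinv p x *m z) <= wt p g x j * sq z.
  rewrite qf_wt /sq mulr_sumr ler_sum // => i _.
  have [/hz->|/hS h] := boolP (i \in S); first by rewrite cabs0 expr0n !mulr0.
  by rewrite ler_wpM2r ?sqr_ge0.
have hw0 : 0 <= qf (dg g) (Dinv p x *m z).
  rewrite qf_wt sumr_ge0 // => i _; rewrite mulr_ge0 ?sqr_ge0 //.
  by rewrite divr_ge0 ?exprn_ge0 ?exprn_ge0 ?(ltW x0) ?(ltW (g0 i)).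
have hWy : qf (W x) y <= wt p g x j * (K4 * x) * sq y.
  apply: le_trans (ler_norm _) _; apply: le_trans (qf_le _ _) _.
  apply: (@le_trans _ _ (K3 * (N%:R * sq y))).
    by rewrite ler_pM ?nrm_ge0 ?sqr_ge0 ?nrm_le_sq.
  rewrite mulrA ler_wpM2r ?sq_ge0 //.
  have := wt_ge (p0 j) (g0 j) (introT andP (conj x0 x1)); have := hc j isT.
  have : 0 <= K3 * N%:R by rewrite mulr_ge0.
  rewrite /K4; move: (wt p g x j) (K3 * N%:R) => w k k0 cj wj.
  have -> : w * (k / c * x) = k * ((x * w) / c) by ring.
  by rewrite ler_peMr // ler_pdivlMr // mul1r; exact: le_trans wj.
rewrite hQ ?x0 // normal_form_qf ?adj_dg // -/z.
have hB1 : qf (B x) (Dinv p x *m z) <= (1 + K1 * x) * (wt p g x j * ((1 + K2 * x) * sq y)).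
  have := h1 (Dinv p x *m z); rewrite ler_norml => /andP[_ hb].
  rewrite lerBlDl in hb; apply: le_trans hb _.
  rewrite -[X in X + _]mul1r -mulrDl ler_pM // ?addr_ge0 ?mulr_ge0 // ?(ltW x0) //.
  by apply: le_trans hw _; rewrite ler_wpM2l ?(ltW w0) //; exact: h2.
apply: (@le_lt_trans _ _ (wt p g x j * (1 + (K1 + K2 + K1 * K2 + K4) * x) * sq y)); last first.
  by rewrite ltr_pM2r.
apply: le_trans (lerD hB1 hWy) _.
have : 0 <= K1 * K2 * (1 - x) * x by rewrite !mulr_ge0 // ?(ltW x0) // subr_ge0.
move: w0 y0; move: (wt p g x j) (sq y); clear => w s w0 s0 h.
have := mulr_ge0 (ltW w0) (mulr_ge0 (ltW s0) h); rewrite -subr_ge0 => h'.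
rewrite -subr_ge0; apply: le_trans h' _; rewrite le_eqVlt; apply/orP; left; apply/eqP; ring.
Qed.

(** The test space is spanned by the columns of [Z x] indexed by [S]. These are nearly orthonormal,
    so the coordinates of [Z^H y] in [S] carry almost the whole length of [y], and each of them has
    weight at least [wt p g x j]. *)
Lemma normal_form_lower N m (Q : R -> 'M[C]_N) (p : 'I_m -> nat) g :
  (forall j, (0 < p j)%N) -> (forall j, 0 < g j) -> normal_form Q p g ->
  exists e K, [/\ 0 < e, 0 <= K & forall x, 0 < x < e -> forall j (S : {pred 'I_m}) th,
    (forall i, i \in S -> wt p g x j <= wt p g x i) ->
    th < wt p g x j * (1 - K * x) -> (#|S| <= ncgt (Q x) th)%N].
Proof.
move=> p0 g0 hnf; have [e4 e40 hQh] := normal_form_herm hnf.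
have [e0 [ Z [B [W [e00 hO hB hW [hBh hWh Z0 B0 hQ]]]]]] := hnf.
have [e1 [K1 [e10 K10 h1]]] := diag_perturb g0 hB B0.
have [e2 [K2 [e20 K20 h2]]] := isometry_perturb hO Z0.
have [e3 [K3 [W1 [e30 e31 K30 h3]]]] := C11_lip hW.
have [c c0 hc] := @finite_gap _ _ predT g (fun i _ => g0 i).
pose K4 := K3 * N%:R / c; have K40 : 0 <= K4.
  by rewrite divr_ge0 ?mulr_ge0 // ltW.
have K5 : 0 < 2 * (K1 + K2 + 1) by rewrite mulr_gt0 // ltr_wpDl // addr_ge0.
pose e5 := (2 * (K1 + K2 + 1))^-1; have e50 : 0 < e5 by rewrite invr_gt0.
exists (Num.min (Num.min e0 e1) (Num.min (Num.min e2 e3) (Num.min e4 e5))), (K1 + 2 * K2 + K4); split.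
- by rewrite !lt_min e00 e10 e20 e30 e40.
- by rewrite !addr_ge0 // mulr_ge0.
move=> x; rewrite !lt_min => /andP[x0 /andP[/andP[xe0 xe1] /andP[/andP[xe2 xe3] /andP[xe4 xe5]]]] j S th hS hth.
have x1 : x <= 1 by apply: ltW; exact: lt_le_trans xe3 e31.
have {xe5}xe5 : (K1 + K2) * x <= 1 / 2.
  have : x * (2 * (K1 + K2 + 1)) < 1 by rewrite -ltr_pdivlMr // div1r.
  by move: x0; move: (K1 + K2) => k; clear; nra.
have K1x : 0 <= K1 * x by rewrite mulr_ge0 // ltW.
have K2x : 0 <= K2 * x by rewrite mulr_ge0 // ltW.
have {}h1 := h1 x (introT andP (conj x0 xe1)).
have [_ {}h2] := h2 x (introT andP (conj x0 xe2)).
have [_ hW1 _ _] := h3 x (introT andP (conj x0 xe3)).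
pose E : 'M[C]_(m, #|S|) := colsub (@enum_val _ S) 1%:M.
have hE : E^t* *m E = 1%:M.
  apply/matrixP => i k; rewrite !mxE (bigD1 (enum_val i)) //= !mxE eqxx conjC1 mul1r.
  rewrite big1 ?addr0 ?(inj_eq enum_val_inj) // => l li.
  by rewrite !mxE (negbTE li) conjC0 mul0r.
apply: (count_lower (V := Z x *m E)); first by apply: hQh; rewrite x0 xe4.
move=> b b0; rewrite -mulmxA; set y := Z x *m (E *m b).
have sb : sq (E *m b) = sq b by exact: sq_unitary.
have b1 : 0 < sq b by rewrite sq_gt0.
have /andP[yl yu] := h2 (E *m b); rewrite sb in yl yu.
have y0 : 0 < sq y.
  apply: lt_le_trans yl; rewrite mulr_gt0 //; move: xe5 K1x K2x.
  by rewrite mulrDl; lra.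
set z := (Z x)^t* *m y.
(* Expand [0 <= sq (E^t* *m z - b)]: the mixed term is [- 2 * sq y], and
   [sq b <= (1 + 2 * K2 * x) * sq y] because [K2 * x <= 1 / 2]. *)
have hz : (1 - 2 * K2 * x) * sq y <= sq (E^t* *m z).
  have e1' : complex.Re ((b^t* *m (E^t* *m z)) 0 0) = sq y.
    by rewrite [RHS]sqE /z {2}/y !adjM !mulmxA.
  have := sq_ge0 (E^t* *m z - b); rewrite sqB e1'.
  have : sq b <= (1 + 2 * K2 * x) * sq y.
    have : (1 + 2 * K2 * x) * ((1 - K2 * x) * sq b) <= (1 + 2 * K2 * x) * sq y.
      by rewrite ler_wpM2l // addr_ge0 // -mulrA mulr_ge0.
    apply: le_trans; rewrite mulrA ler_peMl ?(ltW b1) //.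
    have : K2 * x <= 1 / 2 by apply: le_trans xe5; rewrite mulrDl lerDr.
    by move: K2x; rewrite -mulrA; move: (K2 * x) => k; clear; nra.
  by move: (sq y) (sq _) (sq _) (2 * K2 * x); clear; move=> a d f g; lra.
have w0 : 0 < wt p g x j by rewrite divr_gt0 // !exprn_gt0.
have hw : wt p g x j * sq (E^t* *m z) <= qf (dg g) (Dinv p x *m z).
  have -> : sq (E^t* *m z) = \sum_(i in S) cabs (z i 0) ^+ 2.
    rewrite /sq (big_enum_val (A := S)) /=; apply: eq_bigr => i _; congr (cabs _ ^+ 2).
    have hEe l : (E^t*) i l = (l == enum_val i)%:R.
      by rewrite !mxE; case: eqP; rewrite ?conjC1 ?conjC0.
    rewrite mxE (bigD1 (enum_val i)) //= hEe eqxx mul1r big1 ?addr0 //.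
    by move=> l li; rewrite hEe (negbTE li) mul0r.
  rewrite qf_wt mulr_sumr [X in _ <= X](bigID (fun i => i \in S)) /= -[X in X <= _]addr0.
  apply: lerD; last first.
    rewrite sumr_ge0 // => i _; rewrite mulr_ge0 ?sqr_ge0 // divr_ge0 ?sqr_ge0 //.
    exact: ltW.
  by apply: ler_sum => i Si; rewrite ler_wpM2r ?sqr_ge0 // hS.
have hWy : - (wt p g x j * (K4 * x) * sq y) <= qf (W x) y.
  have : `|qf (W x) y| <= wt p g x j * (K4 * x) * sq y.
    apply: le_trans (qf_le _ _) _.
    apply: (@le_trans _ _ (K3 * (N%:R * sq y))).
      by rewrite ler_pM ?nrm_ge0 ?sqr_ge0 ?nrm_le_sq.
    rewrite mulrA ler_wpM2r ?sq_ge0 //.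
    have := wt_ge (p0 j) (g0 j) (introT andP (conj x0 x1)); have := hc j isT.
    have : 0 <= K3 * N%:R by rewrite mulr_ge0.
    rewrite /K4; move: (wt p g x j) (K3 * N%:R) => w k k0 cj wj.
    have -> : w * (k / c * x) = k * ((x * w) / c) by ring.
    by rewrite ler_peMr // ler_pdivlMr // mul1r; exact: le_trans wj.
  by rewrite ler_norml => /andP[].
rewrite hQ ?x0 // normal_form_qf ?adj_dg // -/z.
have hB1 : (1 - K1 * x) * (wt p g x j * ((1 - 2 * K2 * x) * sq y)) <= qf (B x) (Dinv p x *m z).
  have := h1 (Dinv p x *m z); rewrite ler_norml => /andP[hb _].
  rewrite lerBrDr in hb; apply: le_trans hb; set Qz := qf (dg g) _ in hw *.
  have -> : - (K1 * x * Qz) + Qz = (1 - K1 * x) * Qz by ring.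
  rewrite ler_wpM2l //; first by move: xe5 K2x; rewrite mulrDl; lra.
  by apply: le_trans hw; rewrite ler_wpM2l ?(ltW w0).
apply: (@lt_le_trans _ _ (wt p g x j * (1 - (K1 + 2 * K2 + K4) * x) * sq y)).
  by rewrite ltr_pM2r.
apply: le_trans (lerD hB1 hWy).
have h : 0 <= (K1 * x) * (K2 * x) by rewrite mulr_ge0.
move: w0 y0; move: (wt p g x j) (sq y); clear -h => w s w0 s0.
have := mulr_ge0 (ltW w0) (mulr_ge0 (ltW s0) (mulr_ge0 (ler0n _ 2) h)) => h'.
rewrite -subr_ge0; apply: le_trans h' _; rewrite le_eqVlt; apply/orP; left; apply/eqP; ring.
Qed.

(** The product rule for a normal form, evaluated on [y]: terms adjoint to each other have equal
    real parts, whence the factors 2. In the application [a] is [x^-1], and the term in [P *m B] is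
    the dominant, negative one. *)
Lemma derivative_form N m (Z Z1 : 'M[C]_(N, m)) (Di P B B1 : 'M[C]_m)
    (W1 : 'M[C]_N) (a : R) (y : 'cV_N) :
  Di^t* = Di -> P^t* = P -> P *m Di = Di *m P -> B^t* = B ->
  let Di1 := - a%:C *: (P *m Di) in
  let q := Di *m (Z^t* *m y) in
  let r := Di *m (B *m q) in
  qf ((((Z1 *m Di + Z *m Di1) *m B + Z *m Di *m B1) *m Di + Z *m Di *m B *m Di1) *m Z^t*
      + Z *m Di *m B *m Di *m Z1^t* + W1) y =
  2 * complex.Re ((y^t* *m Z1 *m r) 0 0) - 2 * a * qf (P *m B) q + qf B1 q + qf W1 y.
Proof.
move=> hD hP hPD hB Di1 q r.
have hq : q^t* = y^t* *m Z *m Di by rewrite /q !adjM adjK hD.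
have e1 : complex.Re ((r^t* *m Z1^t* *m y) 0 0) = complex.Re ((y^t* *m Z1 *m r) 0 0).
  by rewrite -[RHS]ReJ -adjE (adjM (y^t* *m Z1) r) (adjM (y^t*) Z1) adjK mulmxA.
have e2 : complex.Re ((q^t* *m (B *m P) *m q) 0 0) = qf (P *m B) q.
  by rewrite /qf -[RHS]ReJ -adjE (adjM (q^t* *m _) q) (adjM (q^t*)) adjK (adjM P) hB hP !mulmxA.
have addE (t1 t2 t3 t4 t5 t6 : 'M[C]_1) : complex.Re ((t1 + - a%:C *: t2 + t3 + - a%:C *: t4 + t5 + t6) 0 0) =
  complex.Re (t1 0 0) - a * complex.Re (t2 0 0) + complex.Re (t3 0 0) - a * complex.Re (t4 0 0)
   + complex.Re (t5 0 0) + complex.Re (t6 0 0).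
  by rewrite !mxE !ReD -rmorphN !ReZ !mulNr.
have -> : qf ((((Z1 *m Di + Z *m Di1) *m B + Z *m Di *m B1) *m Di + Z *m Di *m B *m Di1) *m Z^t*
      + Z *m Di *m B *m Di *m Z1^t* + W1) y =
  complex.Re ((y^t* *m Z1 *m r + - a%:C *: (q^t* *m (P *m B) *m q) + q^t* *m B1 *m q +
    - a%:C *: (q^t* *m (B *m P) *m q) + r^t* *m Z1^t* *m y + y^t* *m W1 *m y) 0 0).
  rewrite /qf; congr (complex.Re (fun_of_matrix _ 0 0)).
  have hr : r^t* = y^t* *m Z *m Di *m B *m Di.
    by rewrite /r (adjM Di) (adjM B) hD hB hq.
  have rE : r = Di *m (B *m (Di *m (Z^t* *m y))) by [].
  have qE : q = Di *m (Z^t* *m y) by [].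
  clear e1 e2; clearbody r q; rewrite hr hq rE qE /Di1.
  rewrite !mulmxDl !mulmxDr !mulmxDl -!scalemxAr -!scalemxAl -!scalemxAr -!scalemxAl.
  by rewrite !mulmxA -(mulmxA (y^t* *m Z) P Di) hPD mulmxA.
have fin (u1 u2 u3 u4 u5 u6 : R) : u5 = u1 -> u4 = u2 ->
  u1 - a * u2 + u3 - a * u4 + u5 + u6 = 2 * u1 - 2 * a * u2 + u3 + u6.
  by move=> -> ->; ring.
by rewrite addE; exact: fin e1 e2.
Qed.

(** For an eigenvector [y] at a high level [th], the eigenvalue equation bounds [th * sq y] by a
    multiple of [sq q], and [Z r = th y - W y] bounds [sq r] by a multiple of [th ^ 2 * sq y]. All
    terms of the derivative are then [O(sq q)], uniformly in [th], except the leading one, which is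
    at most a negative multiple of [sq q / x]. *)
Lemma normal_form_derivative N m (Q : R -> 'M[C]_N) (p : 'I_m -> nat) g :
  (forall j, (0 < p j)%N) -> (forall j, 0 < g j) -> normal_form Q p g ->
  exists e th0, [/\ 0 < e, 0 < th0 & forall x, 0 < x < e -> exists Q1, hasD Q x Q1 /\
    forall th, th0 <= th -> exists2 c, 0 < c &
      forall y, Q x *m y = th%:C *: y -> qf Q1 y <= - (c * sq y)].
Proof.
move=> p0 g0 [e0 [ Z [B [W [e00 hO hB hW [hBh hWh Z0 B0 hQ]]]]]].
have [e1 [K1 [e10 K10 h1]]] := diag_perturb g0 hB B0.
have [e2 [K2 [e20 K20 h2]]] := isometry_perturb hO Z0.
have [e3 [K3 [dW [e30 e31 K30 h3]]]] := C11_lip hW.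
have [e4 [K4 [dZ [e40 e41 K40 h4]]]] := C11_lip hO.
have [e5 [K5 [dB [e50 e51 K50 h5]]]] := C11_lip hB.
have [c c0 hc] := diag_lower g0.
pose P := dg (fun j => (p j)%:R : R).
pose G := nrm (dg g) * m%:R; have G0 : 0 <= G by rewrite mulr_ge0 ?nrm_ge0.
have hG q : qf (dg g) q <= G * sq q.
  apply: le_trans (ler_norm _) _; apply: le_trans (qf_le _ _) _.
  by rewrite /G -mulrA ler_wpM2l ?nrm_ge0 ?nrm_le_sq.
pose n' : R := N%:R; pose m' : R := m%:R.
have n'0 : 0 <= n' by []. have m'0 : 0 <= m' by [].
pose T1 := K4 * (n' + 8 * m' * n') / 2.
have T10 : 0 <= T1 by rewrite divr_ge0 // mulr_ge0 // addr_ge0 // !mulr_ge0.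
(* The summands are the multiples of [sq q] that bound, in this order, the term in [dZ], the
   deviation of [B x] from [B 0] in the leading term, the term in [dB] and the term in [dW].
   Requiring [(T + 1) * x <= c] leaves at least [- sq q]. *)
pose T := 8 * T1 * G + 2 * nrm P * K5 * m' + K5 * m' + 4 * G.
have T0 : 0 <= T by rewrite /T !(addr_ge0, mulr_ge0, nrm_ge0).
(* Above this level, [W] is negligible in the eigenvalue equation: it takes at most half of
   [th * sq y], and its norm is at most [th]. *)
pose th0 := 1 + K3 + 2 * K3 * n'; have th00 : 0 < th0 by rewrite /th0 -addrA ltr_wpDr // !(addr_ge0, mulr_ge0).
have [e6 e60 he6] : exists2 e6, 0 < e6 & forall x, x < e6 ->
    [/\ x < 1 / (K1 + 1), x < 1 / (2 * (K2 + 1)) & x < c / (T + 1)].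
  exists (Num.min (1 / (K1 + 1)) (Num.min (1 / (2 * (K2 + 1))) (c / (T + 1)))).
    by rewrite !lt_min !divr_gt0 ?mulr_gt0 // ltr_wpDl //.
  by move=> x; rewrite !lt_min => /andP[? /andP[]].
exists (Num.min (Num.min e0 e1) (Num.min (Num.min e2 e3) (Num.min (Num.min e4 e5) e6))), th0; split=> //.
  by rewrite !lt_min e00 e10 e20 e30 e40 e50.
move=> x; rewrite !lt_min.
move=> /andP[x0 /andP[/andP[xe0 xe1] /andP[/andP[xe2 xe3] /andP[/andP[xe4 xe5] /he6[xK1 xK2 xT]]]]].
have {xK1}xK1 : K1 * x <= 1.
  by move: xK1; rewrite ltr_pdivlMr ?ltr_wpDl //; move: x0 K10; clear; nra.
have {xK2}xK2 : K2 * x <= 1 / 2.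
  by move: xK2; rewrite ltr_pdivlMr ?mulr_gt0 ?ltr_wpDl //; move: x0 K20; clear; nra.
have {xT}xT : (T + 1) * x <= c by move: xT; rewrite ltr_pdivlMr ?ltr_wpDl // mulrC; apply: ltW.
have {}h1 := h1 x (introT andP (conj x0 xe1)).
have [_ {}h2] := h2 x (introT andP (conj x0 xe2)).
have [hDW nW ndW _] := h3 x (introT andP (conj x0 xe3)).
have [hDO nO ndZ _] := h4 x (introT andP (conj x0 xe4)).
have [hDB nB ndB lB] := h5 x (introT andP (conj x0 xe5)).
have hDQ := hasDD (hasDM (hasDM (hasDM (hasDM hDO (hasD_Dinv p x0)) hDB) (hasD_Dinv p x0))
  (hasD_adj hDO)) hDW.
have xd : 0 < Num.min x (e0 - x) by rewrite lt_min x0 subr_gt0.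
eexists; split.
  apply: hasD_ext xd _ hDQ => y; rewrite lt_min => /andP[hy1 hy2].
  apply/esym/hQ; move: hy1 hy2; rewrite !ltr_norml => /andP[a1 _] /andP[_ a2].
  by apply/andP; split; [move: a1 | move: a2]; clear; lra.
move=> th hth; have thp : 0 < th by exact: lt_le_trans hth.
exists (th / (4 * G + 1)); first by rewrite divr_gt0 // ltr_wpDl // mulr_ge0.
move=> y hy.
rewrite derivative_form ?adj_dg //; last 2 first.
- by rewrite /Dinv !dgM; congr dg; apply/funext => j; rewrite mulrC.
- by apply: hBh; rewrite x0.
set r := Dinv p x *m (B x *m _); set q := Dinv p x *m _.
have eQ : th * sq y = qf (B x) q + qf (W x) y.
  have hD : (Dinv p x)^t* = Dinv p x by exact: adj_dg.
  rewrite -(qf_eigen hy) (hQ x (introT andP (conj x0 xe0))).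
  exact: normal_form_qf.
have hWy (M : 'M[C]_N) : nrm M <= K3 -> qf M y <= K3 * n' * sq y.
  move=> hM; apply: le_trans (ler_norm _) _; apply: le_trans (qf_le _ _) _.
  by rewrite -mulrA ler_pM ?nrm_ge0 ?sqr_ge0 ?nrm_le_sq.
have y0 := sq_ge0 y; have q0 := sq_ge0 q.
have thK : 2 * (K3 * n') <= th /\ K3 <= th /\ 1 <= th.
  move: hth; rewrite /th0; have : 0 <= K3 * n' by rewrite mulr_ge0.
  by move: K30; rewrite -mulrA; move: (K3 * n'); clear; move=> k k0 kn hh; split; [|split]; lra.
have [thK1 [thK2 thK3]] := thK.
have a1 : th * sq y <= 4 * G * sq q.
  have b1 : qf (B x) q <= 2 * (G * sq q).
    have := h1 q; rewrite ler_norml => /andP[_ hb]; rewrite lerBlDl in hb.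
    apply: le_trans hb _; rewrite -[X in X + _]mul1r -mulrDl.
    apply: (@le_trans _ _ (2 * qf (dg g) q)); last by rewrite ler_wpM2l.
    rewrite ler_wpM2r //; last by move: xK1; clear; lra.
    by apply: le_trans (hc q); rewrite mulr_ge0 // ltW.
  have b2 := hWy _ nW; have b3 := ler_wpM2r y0 thK1.
  move: eQ b1 b2 b3; clear; move: (sq y) (sq q) (qf _ _) (qf _ _) (K3 * n') => *; nra.
have a2 : sq r <= 8 * th ^+ 2 * n' * sq y.
  have /andP[b1 _] := h2 r.
  have b2 : sq (Z x *m r) <= 4 * th ^+ 2 * (n' * sq y).
    have -> : Z x *m r = th%:C *: y - W x *m y.
      by rewrite -hy (hQ x (introT andP (conj x0 xe0))) mulmxDl addrK -!mulmxA.
    apply: le_trans (sq_le_nrm _) _.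
    apply: (@le_trans _ _ ((2 * th * nrm y) ^+ 2)).
      rewrite ler_sqr ?nnegrE ?mulr_ge0 ?nrm_ge0 ?(ltW thp) //.
      apply: le_trans (nrmB _ _) _; rewrite nrmZ cabsR gtr0_norm // -mulrA mulr_natl mulr2n.
      rewrite lerD2l; apply: le_trans (nrmM _ _) _; rewrite ler_wpM2r ?nrm_ge0 //.
      exact: le_trans nW thK2.
    have -> : (2 * th * nrm y) ^+ 2 = 4 * th ^+ 2 * nrm y ^+ 2 by ring.
    by rewrite ler_wpM2l ?nrm_le_sq // mulr_ge0 // sqr_ge0.
  have -> : 8 * th ^+ 2 * n' * sq y = 2 * (4 * th ^+ 2 * (n' * sq y)) by ring.
  have {b2}b1 := le_trans b1 b2; have := ler_wpM2r (sq_ge0 r) xK2.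
  by move: b1; clear; move: (4 * _ * _) (K2 * x) (sq r) => a b d; rewrite mulrBl; lra.
have a3 : complex.Re ((y^t* *m dZ x *m r) 0 0) <= T1 * (th * sq y).
  apply: le_trans (ler_Re_cabs _) _; apply: le_trans (cabs_le_nrm _ _ _) _.
  apply: (@le_trans _ _ (K4 * (nrm y * nrm r))).
    rewrite -mulmxA; apply: le_trans (nrmM _ _) _; rewrite nrm_adj mulrCA.
    rewrite ler_wpM2l ?nrm_ge0 //; apply: le_trans (nrmM _ _) _.
    by rewrite ler_wpM2r ?nrm_ge0.
  rewrite /T1 -!mulrA ler_wpM2l //.
  have b1 := nrm_le_sq y; have b2 := nrm_le_sq r; rewrite -/n' -/m' in b1 b2.
  have b3 := ler_wpM2l m'0 a2; have {b2 b3}b2 := le_trans b2 b3.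
  rewrite -(ler_pM2l thp); have b3 := sqr_ge0 (th * nrm y - nrm r).
  have b4 := ler_wpM2l (ltW (mulr_gt0 thp thp)) b1.
  suff : 2 * (th * (nrm y * nrm r)) <= th * (th * (n' * sq y)) + m' * (8 * th ^+ 2 * n' * sq y).
    by clear; move: (nrm y * nrm r) (sq y) => *; nra.
  move: b2 b3 b4; clear; move: (nrm y) (nrm r) (sq y) => a b d b2 b3 b4.
  rewrite [th * (th * _)]mulrA; apply: le_trans (lerD b4 b2).
  rewrite -subr_ge0; apply: le_trans b3 _; rewrite le_eqVlt; apply/orP; left; apply/eqP; ring.
have a4 : c * sq q - nrm P * K5 * m' * x * sq q <= qf (P *m B x) q.
  have -> : P *m B x = P *m dg g + P *m (B x - B 0) by rewrite -B0 -mulmxDr addrC subrK.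
  rewrite qfD; apply: lerD.
    apply: le_trans (hc q) _; rewrite dgM !qf_dg ler_sum // => i _.
    rewrite ler_wpM2r ?sqr_ge0 // ler_peMl ?(ltW (g0 i)) // ler1n p0 //.
  rewrite lerNl; apply: le_trans (ler_norm _) _; rewrite normrN.
  apply: le_trans (qf_le _ _) _.
  have -> : nrm P * K5 * m' * x * sq q = (nrm P * (K5 * x)) * (m' * sq q) by ring.
  rewrite ler_pM ?nrm_ge0 ?sqr_ge0 ?nrm_le_sq //.
  by apply: le_trans (nrmM _ _) _; rewrite ler_wpM2l ?nrm_ge0.
have a5 : qf (dB x) q <= K5 * m' * sq q.
  apply: le_trans (ler_norm _) _; apply: le_trans (qf_le _ _) _.
  by rewrite -mulrA ler_pM ?nrm_ge0 ?sqr_ge0 ?nrm_le_sq.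
have a6 : qf (dW x) y <= 4 * G * sq q.
  apply: le_trans (hWy _ ndW) _; apply: le_trans a1; rewrite ler_wpM2r //.
  by apply: le_trans thK1; rewrite ler_peMl ?mulr_ge0 // ler1n.
have a7 : 2 * x^-1 * qf (P *m B x) q >= (2 * (T + 1) - 2 * nrm P * K5 * m') * sq q.
  have b1 := ler_wpM2r q0 xT.
  rewrite [X in _ <= X]mulrAC ler_pdivlMr //.
  have -> : (2 * (T + 1) - 2 * nrm P * K5 * m') * sq q * x =
      2 * ((T + 1) * x * sq q - nrm P * K5 * m' * x * sq q) by ring.
  by rewrite ler_pM2l //; apply: le_trans a4; rewrite lerD2r.
have a8 : T1 * (th * sq y) <= T1 * (4 * G * sq q) by rewrite ler_wpM2l.
have a9 : th / (4 * G + 1) * sq y <= sq q.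
  have G1 : 0 < 4 * G + 1 by rewrite ltr_wpDl // mulr_ge0.
  rewrite mulrAC ler_pdivrMr // mulrDr mulr1 [sq q * _]mulrC.
  by apply: le_trans a1 _; rewrite lerDl.
apply: (@le_trans _ _ (- sq q)); last by rewrite lerN2.
have b0 : 0 <= sq q * T by rewrite mulr_ge0.
have fin (a b d e s t1 g' w k u : R) : a <= u -> b <= k * s -> d <= 4 * g' * s ->
    (2 * (8 * t1 * g' + w + k + 4 * g' + 1) - w) * s <= e -> u <= t1 * (4 * g' * s) ->
    0 <= s * (8 * t1 * g' + w + k + 4 * g') -> 0 <= s -> 2 * a - e + b + d <= - s.
  by clear; move=> *; lra.
exact: fin a3 a5 a6 a7 a8 b0 q0.
Qed.

End NormalForm.

(** * Crossings of a level by eigenvalue counts *)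

Section Counting.
Variable R : realType.
Local Notation C := R[i].

Section Crossing.
(* [lo x] and [hi x] stand for the numbers of eigenvalues of a Hermitian curve at
   [x] that are [> th] and [>= th]; the hypotheses say that every eigenvalue
   equal to [th] is crossed downwards. *)
Variables (e : R) (lo hi : R -> nat).
Hypothesis lohi : forall x, (lo x <= hi x)%N.
Hypothesis left_ : forall x, 0 < x < e -> exists2 d, 0 < d &
  forall y, 0 < y -> x - d < y < x -> (hi x <= lo y)%N /\ (hi y <= hi x)%N.
Hypothesis right_ : forall x, 0 < x < e -> exists2 d, 0 < d &
  forall y, y < e -> x < y < x + d -> (hi y <= lo x)%N /\ (lo x <= lo y)%N.

(** Continuous induction: [E] collects the points up to which the bound holds. At [s = sup E], the
    hypothesis on the left carries the bound to [s] itself, and the one on the right pushes it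
    beyond [s] unless [y] is reached. *)
Lemma crossing_mono x y : 0 < x -> x < y -> y < e -> (hi y <= lo x)%N.
Proof.
move=> x0 xy ye.
pose E := [set z | x < z <= y /\ forall w, x < w <= z -> (hi w <= lo x)%N]%classic.
have [d d0 hd] := right_ (introT andP (conj x0 (lt_trans xy ye))).
have sE : has_sup E.
  split; last by exists y => z [/andP[]].
  exists (Num.min y (x + d / 2)); split.
    by rewrite lt_min xy ltrDl divr_gt0 // ge_min lexx.
  move=> w /andP[xw]; rewrite le_min => /andP[wy wd].
  have [] // := hd w; first by apply: le_lt_trans ye.
  by rewrite xw (le_lt_trans wd) // ltrD2l ltr_pdivrMr // ltr_pMr // ltr1n.
have Ey z : E z -> z <= y by move=> [/andP[]].
pose s := sup E.
have sy : s <= y by apply: ge_sup; [case: sE | move=> z /Ey].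
have xs : x < s.
  have [[z Ez] _] := sE; case: (Ez) => /andP[xz _] _; apply: lt_le_trans xz _.
  exact: (ub_le_sup sE.2).
have s0 : 0 < s < e by rewrite (lt_trans x0 xs) (le_lt_trans sy ye).
have below w : x < w < s -> (hi w <= lo x)%N.
  move=> /andP[xw ws]; have h : 0 < s - w by rewrite subr_gt0.
  have [z [_ hz] wz] := sup_adherent h sE.
  by apply: hz; rewrite xw ltW //; move: wz; rewrite -/s opprB addrC subrK.
have [d1 d10 hd1] := left_ s0.
have hs : (hi s <= lo x)%N.
  pose w := Num.max ((x + s) / 2) (s - d1 / 2).
  have xw : x < w by rewrite lt_max; apply/orP; left; move: xs; clear; lra.
  have ws : w < s by rewrite gt_max; move: xs d10; clear; move=> *; apply/andP; split; lra.
  have [] := hd1 w; first exact: lt_trans xw.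
    by rewrite ws andbT lt_max; apply/orP; right; move: d10; clear; lra.
  move=> h _; apply: leq_trans h _; apply: leq_trans (lohi _) _.
  by apply: below; rewrite xw ws.
have {}below w : x < w <= s -> (hi w <= lo x)%N.
  rewrite le_eqVlt => /andP[xw /orP[/eqP->//|ws]].
  by apply: below; rewrite xw ws.
have [ys|sy'] := leP y s; first by apply: below; rewrite xy.
have [d2 d20 hd2] := right_ s0.
pose z := Num.min y (s + d2 / 2).
have zs : s < z by rewrite lt_min sy' ltrDl divr_gt0.
suff : E z by move=> Ez; have := ub_le_sup sE.2 Ez; rewrite leNgt zs.
split; first by rewrite (lt_trans xs zs) ge_min lexx.
move=> w /andP[xw]; rewrite le_min => /andP[wy wd].
have [ws|sw] := leP w s; first by apply: below; rewrite xw.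
have [||h _] := hd2 w.
- exact: le_lt_trans ye.
- by rewrite sw (le_lt_trans wd) // ltrD2l ltr_pdivrMr // ltr_pMr // ltr1n.
by apply: leq_trans h _; apply: leq_trans (lohi _) _; apply: below; rewrite xs lexx.
Qed.

(** Branches are numbered from [0], the largest eigenvalue first. On an empty set the supremum is
    [0], which lies outside the interval and therefore never passes for a crossing. *)
Definition crossing j := sup [set x | 0 < x < e /\ (j < hi x)%N]%classic.

(** As a consequence, the number of branches that cross at [x] is [hi x - lo x], the multiplicity of
    the level as an eigenvalue at [x]. *)
Lemma crossingP x j : 0 < x < e -> (crossing j == x) = (lo x <= j < hi x)%N.
Proof.
move=> x0; pose E := [set x | 0 < x < e /\ (j < hi x)%N]%classic.
have bE : has_ubound E by exists e => z [/andP[_ /ltW]].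
apply/eqP/andP => [cx|[h1 h2]].
  have nE : E !=set0.
    have [E0|/set0P //] := eqVneq E set0; exfalso.
    by move: cx x0; rewrite /crossing -/E E0 sup0 => <-; rewrite ltxx.
  have sE : has_sup E by split.
  have [d d0 hd] := left_ x0; have [d' d'0 hd'] := right_ x0; split.
    rewrite leqNgt; apply/negP => h; pose y := Num.min ((x + e) / 2) (x + d' / 2).
    have [x1 xe] := andP x0.
    have xy : x < y by rewrite lt_min ltrDl divr_gt0 // andbT; move: xe; lra.
    have ye : y < e by rewrite gt_min; apply/orP; left; move: xe; lra.
    have yd : y < x + d' by rewrite gt_min; apply/orP; right; move: d'0; lra.
    have [|_ h2] := hd' y ye; first by rewrite xy.
    suff Ey : E y by have := ub_le_sup bE Ey; rewrite -/(crossing j) cx leNgt xy.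
    by split; [rewrite (lt_trans x1 xy)|rewrite (leq_trans h) // (leq_trans h2)].
  rewrite ltnNge; apply/negP => h.
  have [y [y0 hy] yx] := sup_adherent d0 sE.
  have := ub_le_sup bE (conj y0 hy : E y); rewrite -/(crossing j) cx le_eqVlt.
  move=> /orP[/eqP yx'|yx']; first by move: hy; rewrite yx' ltnNge h.
  have [||_ h3] := hd y; first by case/andP: y0.
    by rewrite yx' andbT; move: yx; rewrite -/E -/(crossing j) cx.
  by move: hy; rewrite ltnNge (leq_trans h3 h).
apply/eqP; rewrite eq_le; apply/andP; split; last by apply: ub_le_sup => //; split.
apply: ge_sup; first by exists x; split.
move=> y [/andP[y0 ye] hy]; rewrite leNgt; apply/negP => xy.
have [x1 _] := andP x0; have := crossing_mono x1 xy ye.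
by move=> h; move: hy; rewrite ltnNge (leq_trans h h1).
Qed.

Lemma crossing_between x y j : 0 < x -> x < y -> y < e -> (j < hi x)%N ->
  (hi y <= j)%N -> x <= crossing j <= y.
Proof.
move=> x0 xy ye h1 h2; pose E := [set x | 0 < x < e /\ (j < hi x)%N]%classic.
have Ex : E x by split=> //; rewrite x0 (lt_trans xy ye).
apply/andP; split; first by apply: ub_le_sup => //; exists e => z [/andP[_ /ltW]].
apply: ge_sup; first by exists x.
move=> z [/andP[z0 ze] hz]; rewrite leNgt; apply/negP => yz.
have := crossing_mono (lt_trans x0 xy) yz ze => h3.
by move: hz; rewrite ltnNge (leq_trans h3 (leq_trans (lohi _) h2)).
Qed.

End Crossing.

Section Order.
Variables (m : nat) (p : 'I_m -> nat) (g : 'I_m -> R).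

(* Strict total order along which [wt p g x] is nonincreasing for all small [x]. *)
Definition bef (i j : 'I_m) :=
  (p j < p i)%N || (p i == p j) && ((g j < g i) || (g i == g j) && (i < j)%N).

(** Since [bef] is a strict total order, [pos] is a bijection onto the numbers below [m]; it
    attaches to [j] the number of its branch. *)
Definition pos j := #|[pred i | bef i j]|.

Lemma bef_irr i : bef i i = false.
Proof. by rewrite /bef !ltnn ltxx !eqxx. Qed.

Lemma bef_trans j i k : bef i j -> bef j k -> bef i k.
Proof.
rewrite /bef; case: (ltngtP (p j) (p i)) => //= [h1 _|e1].
  case: (ltngtP (p k) (p j)) => //= [h2 _|e2 _]; first by rewrite (ltn_trans h2 h1).
  by rewrite e2 h1.
rewrite -e1; case: (ltngtP (p k) (p j)) => //= e2.
case: (ltgtP (g j) (g i)) => //= [h1 _|e3 h1].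
  by case: (ltgtP (g k) (g j)) => //= [h2 _|e3 _]; [rewrite (lt_trans h2 h1)|rewrite e3 h1].
rewrite -e3; case: (ltgtP (g k) (g j)) => //= _ h2; exact: ltn_trans h1 h2.
Qed.

Lemma bef_total i j : [|| bef i j, i == j | bef j i].
Proof.
rewrite /bef; case: (ltngtP (p i) (p j)) => //= [e1|e1]; rewrite ?orbT //.
case: (ltgtP (g i) (g j)) => //= [e2|e2]; rewrite ?orbT //.
by case: (ltngtP i j) => //= [e3|/val_inj->]; rewrite ?eqxx ?orbT.
Qed.

Lemma pos_lt i j : bef i j -> (pos i < pos j)%N.
Proof.
move=> h; apply: proper_card; apply/properP; split.
  by apply/fintype.subsetP => k; rewrite !inE => h'; exact: bef_trans h' h.
by exists i; rewrite inE ?bef_irr.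
Qed.

Lemma pos_inj : injective pos.
Proof.
move=> i j h; have := bef_total i j; case/or3P => [/pos_lt|/eqP//|/pos_lt];
  by rewrite h ltnn.
Qed.

Lemma pos_bound j : (pos j < m)%N.
Proof.
rewrite -[X in (_ < X)%N]card_ord; apply: proper_card; apply/properP; split.
  by apply/fintype.subsetP.
by exists j => //; rewrite inE bef_irr.
Qed.

Lemma card_pos_itv a b : (b <= m)%N ->
  #|[pred j | (a <= pos j < b)%N]| = (b - a)%N.
Proof.
move=> bm; pose f j := Ordinal (pos_bound j).
have fi : injective f by move=> i j [] /pos_inj.
have -> : #|[pred j | (a <= pos j < b)%N]| = #|[pred k : 'I_m | (a <= k < b)%N]|.
  have fb : bijective f by exact: injF_bij.
  rewrite -(fintype.card_image fi); apply: eq_card => k; have [f' fK f'K] := fb.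
  apply/fintype.imageP/idP => [[j hj ->]//|hk]; exists (f' k) => //.
  by move: hk; rewrite !inE -{1 2}(f'K k).
rewrite -sum1_card (eq_bigl (fun k : 'I_m => (a <= k < b)%N)) //.
rewrite -(big_mkord (fun k => (a <= k < b)%N) (fun=> 1%N)).
rewrite -big_filter; have -> : [seq k <- index_iota 0 m | (a <= k < b)%N] = index_iota a b.
  rewrite /index_iota subn0; apply: (irr_sorted_eq ltn_trans ltnn).
  - by apply: sorted_filter; [exact: ltn_trans | exact: iota_ltn_sorted].
  - exact: iota_ltn_sorted.
  move=> k; rewrite mem_filter !mem_iota add0n leq0n /=.
  case: (ltnP k b) => hk; rewrite ?andbF ?andbT /=.
    rewrite (leq_trans hk bm) andbT; case: (leqP a k) => //= ak.
    by rewrite subnKC // (leq_trans ak) // ltnW.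
  apply/esym/negbTE/negP => /andP[ak]; have [ab|/ltnW ab] := leqP a b.
    by rewrite subnKC // ltnNge hk.
  by move: ab; rewrite -subn_eq0 => /eqP->; rewrite addn0 ltnNge ak.
by rewrite sum_nat_const_nat muln1.
Qed.

(** When [p j < p i], the quotient of the weights carries at least one factor [x], which beats the
    quotient of the constants once [x < c / (G + 1)]. *)
Lemma bef_wt : (forall j, 0 < g j) -> exists2 e, 0 < e & forall x i j,
  0 < x < e -> bef i j -> wt p g x j <= wt p g x i.
Proof.
move=> g0; have [c c0 hc] := @finite_gap _ _ predT g (fun i _ => g0 i).
pose G := \sum_i g i; have hG i : g i <= G.
  by rewrite /G (bigD1 i) //= lerDl sumr_ge0 // => k _; exact: ltW.
have G0 : 0 <= G by rewrite sumr_ge0 // => k _; exact: ltW.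
have G1 : 0 < G + 1 by rewrite ltr_wpDl.
exists (Num.min 1 (c / (G + 1))); first by rewrite lt_min ltr01 divr_gt0.
move=> x i j; rewrite lt_min ltr_pdivlMr // => /andP[x0 /andP[x1 xc]].
rewrite /bef /wt ler_pdivrMr ?exprn_gt0 // mulrAC ler_pdivlMr ?exprn_gt0 //.
rewrite -!exprM => /orP[h|/andP[/eqP-> h]]; last first.
  by rewrite ler_pM2r ?exprn_gt0 //; case/orP: h => [/ltW|/andP[/eqP->]].
rewrite -{1}(subnK (ltnW h)) mulnDl exprD mulrA ler_pM2r ?exprn_gt0 //.
apply: (@le_trans _ _ (G * x)).
  rewrite ler_pM ?exprn_ge0 ?(ltW x0) ?(ltW (g0 _)) //.
  rewrite -subn_gt0 in h; case: (p i - p j)%N h => // k _.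
  by rewrite mulSn addSn exprS ler_piMr ?exprn_ile1 ?(ltW x0) ?(ltW x1).
apply: le_trans (hc i isT); apply: ltW; apply: le_lt_trans xc.
by rewrite mulrC ler_wpM2l ?(ltW x0) // lerDl.
Qed.

End Order.

(** On the kernel of [Z^H], of codimension at most [m], only the bounded term [W] acts. *)
Lemma normal_form_bound N m (Q : R -> 'M[C]_N) (p : 'I_m -> nat) g :
  normal_form Q p g -> exists e th0, 0 < e /\ forall x th, 0 < x < e -> th0 <= th ->
    (ncge (Q x) th <= m)%N.
Proof.
move=> hnf; have [e4 e40 hQh] := normal_form_herm hnf.
have [e0 [ Z [B [W [e00 hO hB hW [hBh hWh Z0 B0 hQ]]]]]] := hnf.
have [e3 [K3 [W1 [e30 e31 K30 h3]]]] := C11_lip hW.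
exists (Num.min e0 (Num.min e3 e4)), (K3 * N%:R + 1); split.
  by rewrite !lt_min e00 e30.
move=> x th; rewrite !lt_min => /andP[x0 /andP[xe0 /andP[xe3 xe4]]] hth.
have [_ hW1 _ _] := h3 x (introT andP (conj x0 xe3)).
have [r [V [hr hV hV0]]] := kernel_basis ((Z x)^t*).
suff : (ncge (Q x) th + r <= N)%N.
  by move=> h; rewrite -(leq_add2r r); apply: leq_trans h _; rewrite -leq_subLR.
apply: (count_upper (V := V)); first by apply: hQh; rewrite x0 xe4.
move=> b b0; have y0 : 0 < sq (V *m b) by rewrite sq_gt0 hV0.
have hD : (Dinv p x)^t* = Dinv p x by exact: adj_dg.
rewrite (hQ x (introT andP (conj x0 xe0))) (normal_form_qf _ _ _ _ hD) (mulmxA ((Z x)^t*)).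
rewrite hV mul0mx mulmx0 {1}/qf mulmx0 mxE add0r.
apply: le_lt_trans (ler_norm _) _; apply: le_lt_trans (qf_le _ _) _.
apply: (@le_lt_trans _ _ (K3 * (N%:R * sq (V *m b)))).
  by rewrite ler_pM ?nrm_ge0 ?sqr_ge0 ?nrm_le_sq.
by rewrite mulrA ltr_pM2r // (lt_le_trans _ hth) // ltrDl.
Qed.

(** Supplies the two local hypotheses of the crossing argument: the negative derivative moves
    eigenvalues equal to [th] above the level on the left and below it on the right, and
    semicontinuity controls the others. *)
Lemma normal_form_local N m (Q : R -> 'M[C]_N) (p : 'I_m -> nat) g :
  (forall j, (0 < p j)%N) -> (forall j, 0 < g j) -> normal_form Q p g ->
  exists e th0, 0 < e /\ forall x th e', 0 < x < e' -> e' <= e -> th0 <= th ->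
   (exists2 d, 0 < d & forall y, 0 < y -> x - d < y < x ->
      (ncge (Q x) th <= ncgt (Q y) th)%N /\ (ncge (Q y) th <= ncge (Q x) th)%N) /\
   (exists2 d, 0 < d & forall y, y < e' -> x < y < x + d ->
      (ncge (Q y) th <= ncgt (Q x) th)%N /\ (ncgt (Q x) th <= ncgt (Q y) th)%N).
Proof.
move=> p0 g0 hnf; have [e4 e40 hQh] := normal_form_herm hnf.
have [e [th0 [e0 th00 h]]] := normal_form_derivative p0 g0 hnf.
exists (Num.min e e4), th0; split; first by rewrite lt_min e0.
move=> x th e' /andP[x0 xe']; rewrite le_min => /andP[ee ee4] hth.
have xe := lt_le_trans xe' ee; have xe4 := lt_le_trans xe' ee4.
have [Q1 [hQ1 hc]] := h x (introT andP (conj x0 xe)).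
have {hc}[c c0 hc] := hc th hth.
have hx : herm (Q x) by apply: hQh; rewrite x0.
have [K [d [K0 d0 d1 hK]]] := hasD_pos hQ1.
have K1 : 0 < K + 1 by rewrite ltr_wpDl.
have [|||s1 s10 hs1] := @count_perturb_up _ _ (Q x) (- Q1) (fun s => Q (x - s)) th c K
   (Num.min x d) hx c0.
- by rewrite lt_min x0.
- by move=> y /hc; rewrite qfN lerNr.
- move=> s; rewrite lt_min => /andP[s0 /andP[sx sd]]; split.
    by apply: hQh; rewrite subr_gt0 sx /= ltrBlDr (lt_trans xe4) // ltrDl.
  have xs : x - s - x = - s by rewrite addrAC subrr sub0r.
  have [|h' _] := hK (x - s); first by rewrite xs normrN gtr0_norm.
  by move: h'; rewrite xs sqrrN rmorphN scaleNr scalerN.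
have [|||s2 s20 hs2] := @count_perturb_down _ _ (Q x) Q1 (fun s => Q (x + s)) th c K
   (Num.min (e4 - x) d) hx c0.
- by rewrite lt_min subr_gt0 xe4.
- exact: hc.
- move=> s; rewrite lt_min => /andP[s0 /andP[sx sd]]; split.
    by apply: hQh; rewrite addr_gt0 //= -ltrBrDl.
  have xs : x + s - x = s by rewrite addrAC subrr add0r.
  have [|h' _] := hK (x + s); first by rewrite xs gtr0_norm.
  by move: h'; rewrite xs.
have [e5 e50 h5] := ncge_semicont th hx; have [e6 e60 h6] := ncgt_semicont th hx.
have near b y : `|y - x| < b / (K + 1) -> `|y - x| < d -> nrm (Q y - Q x) < b.
  rewrite ltr_pdivlMr // => a1 a2; have [_ a3] := hK y a2; apply: le_lt_trans a3 _.
  by apply: le_lt_trans a1; rewrite mulrC ler_wpM2l // lerDl.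
split.
  exists (Num.min d (Num.min (e5 / (K + 1)) s1)); first by rewrite !lt_min d0 s10 divr_gt0.
  move=> y y0 /andP[]; rewrite ltrBlDr -ltrBlDl !lt_min => /andP[a1 /andP[a2 a3]] yx.
  have nyx : `|y - x| = x - y by rewrite distrC gtr0_norm // subr_gt0.
  have hy : herm (Q y) by apply: hQh; rewrite y0 (lt_trans yx).
  split; last by apply: h5 => //; apply: near; rewrite nyx.
  by have := hs1 (x - y); rewrite subKr; apply; rewrite subr_gt0 yx.
exists (Num.min d (Num.min (e6 / (K + 1)) s2)); first by rewrite !lt_min d0 s20 divr_gt0.
move=> y y0 /andP[yx]; rewrite -ltrBlDl !lt_min => /andP[a1 /andP[a2 a3]].
have nyx : `|y - x| = y - x by rewrite gtr0_norm // subr_gt0.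
have hy : herm (Q y) by apply: hQh; rewrite (lt_trans x0 yx) (lt_le_trans y0).
split; last by apply: h6 => //; apply: near; rewrite nyx.
by have := hs2 (y - x); rewrite (addrC x) subrK; apply; rewrite subr_gt0 yx.
Qed.

(** The two-sided estimate of [th] follows by contraposition: if the level were strictly outside the
    band around [wt p g x j] at [x = mu th j], one of the counting bounds would place branch
    [pos p g j] strictly on one side of the level, so it could not cross there. *)
Theorem normal_form_curves N m (Q : R -> 'M[C]_N) (p : 'I_m -> nat) g :
  (forall j, (0 < p j)%N) -> (forall j, 0 < g j) -> normal_form Q p g ->
  exists e0 K, [/\ 0 < e0, 0 <= K & forall e, 0 < e <= e0 ->
    exists th1 (mu : R -> 'I_m -> R), forall th, th1 <= th ->
      (forall j, [/\ 0 < mu th j < e, wt p g (mu th j) j * (1 - K * mu th j) <= th &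
          th <= wt p g (mu th j) j * (1 + K * mu th j)]) /\
      forall x, 0 < x < e ->
        #|[pred j | mu th j == x]| = (ncge (Q x) th - ncgt (Q x) th)%N].
Proof.
move=> p0 g0 hnf.
have [e1 [th1 [e10 h1]]] := normal_form_local p0 g0 hnf.
have [e2 [th2 [e20 h2]]] := normal_form_bound hnf.
have [e3 [K3 [e30 K30 h3]]] := normal_form_upper p0 g0 hnf.
have [e4 [K4 [e40 K40 h4]]] := normal_form_lower p0 g0 hnf.
have [e5 e50 h5] := bef_wt p g0.
pose K := K3 + K4; have K0 : 0 <= K by rewrite addr_ge0.
have [e6 e60 he6] : exists2 e6, 0 < e6 & forall x, x < e6 ->
    [/\ x < e1, x < e2, x < e3, x < e4 & x < e5].
  exists (Num.min (Num.min e1 e2) (Num.min (Num.min e3 e4) e5)).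
    by rewrite !lt_min e10 e20 e30 e40.
  by move=> x; rewrite !lt_min => /andP[/andP[? ?] /andP[/andP[? ?] ?]].
exists (Num.min (Num.min e6 e1) 1), K; split=> //; first by rewrite !lt_min e60 e10 ltr01.
move=> e /andP[ep]; rewrite !le_min => /andP[/andP[ee6 ee1'] ee1].
have {he6}he x : x < e -> [/\ x < e1, x < e2, x < e3, x < e4 & x < e5].
  by move=> xe; apply: he6; exact: lt_le_trans xe ee6.
pose lo th x := ncgt (Q x) th; pose hi th x := ncge (Q x) th.
pose mu th j := crossing e (hi th) (pos p g j).
have w0 x j : 0 < x -> 0 < wt p g x j by move=> x0; rewrite divr_gt0 // !exprn_gt0.
have upper x th j : 0 < x < e -> wt p g x j * (1 + K * x) < th -> (hi th x <= pos p g j)%N.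
  move=> /andP[x0 xe] hth; have [_ _ xe3 _ xe5] := he x xe.
  apply: (h3 x (introT andP (conj x0 xe3)) j).
    move=> i; rewrite inE => nij; have := bef_total p g i j.
    rewrite (negbTE nij) /= => /orP[/eqP->//|]; apply: h5; by rewrite x0.
  apply: le_lt_trans hth; rewrite ler_wpM2l ?(ltW (w0 _ _ x0)) // lerD2l.
  by rewrite ler_wpM2r ?(ltW x0) // lerDl.
have lower x th j : 0 < x < e -> th < wt p g x j * (1 - K * x) -> (pos p g j < lo th x)%N.
  move=> /andP[x0 xe] hth; have [_ _ _ xe4 xe5] := he x xe.
  have -> : (pos p g j).+1 = #|[pred i | bef p g i j || (i == j)]|.
    rewrite (cardD1 j) inE eqxx orbT add1n; congr _.+1; apply: eq_card => i.
    by rewrite !inE; case: eqVneq => [->|]; rewrite ?bef_irr ?orbF.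
  apply: (h4 x (introT andP (conj x0 xe4)) j).
    by move=> i; rewrite inE => /orP[|/eqP->//]; apply: h5; rewrite x0.
  apply: lt_le_trans hth _; rewrite ler_wpM2l ?(ltW (w0 _ _ x0)) // lerD2l lerN2.
  by rewrite ler_wpM2r ?(ltW x0) // lerDr.
have eh : 0 < e / 2 < e by rewrite divr_gt0 //= ltr_pdivrMr // ltr_pMr // ltr1n.
(* Above [th3], every weight at [e / 2], with its relative error, lies below the level, so all
   crossings occur at or before [e / 2], strictly inside the interval. *)
pose th3 := \sum_j wt p g (e / 2) j * (1 + K * (e / 2)) + 1.
have K2 : 0 < 2 * (K + 1) by rewrite mulr_gt0 // ltr_wpDl.
exists (Num.max (Num.max th1 th2) (Num.max th3 1)), mu => th.
rewrite !ge_max => /andP[/andP[t1 t2] /andP[t3 t4]].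
have lohi x : (lo th x <= hi th x)%N by exact: ncgt_ncge.
have hl x : 0 < x < e -> exists2 d, 0 < d & forall y, 0 < y -> x - d < y < x ->
    (hi th x <= lo th y)%N /\ (hi th y <= hi th x)%N.
  by move=> xe; have [] := h1 x th e xe ee1' t1.
have hr x : 0 < x < e -> exists2 d, 0 < d & forall y, y < e -> x < y < x + d ->
    (hi th y <= lo th x)%N /\ (lo th x <= lo th y)%N.
  by move=> xe; have [] := h1 x th e xe ee1' t1.
have mu0 j : 0 < mu th j < e.
  have th0 : 0 < th by exact: lt_le_trans ltr01 t4.
  (* This [x] is so small that [K * x <= 1 / 2] and [wt p g x j >= 4 * th], so the lower count puts
     the branch above the level at [x]. *)
  pose x := Num.min (e / 4) (Num.min (1 / (2 * (K + 1))) (g j / (4 * th))).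
  have xp : 0 < x by rewrite !lt_min !divr_gt0 // ?mulr_gt0.
  have xh : x < e / 2.
    by rewrite gt_min; apply/orP; left; move: ep; clear; lra.
  have [eh1 eh2] := andP eh; have xe := lt_trans xh eh2.
  have /andP[a b] : x <= mu th j <= e / 2.
    apply: (crossing_between lohi hl hr) => //.
      apply: leq_trans (lohi x); apply: lower; rewrite ?xp //.
      have Kx : K * x <= 1 / 2.
        have : x <= 1 / (2 * (K + 1)) by rewrite ge_min; apply/orP; right; rewrite ge_min lexx.
        by rewrite ler_pdivlMr //; move: xp K0; clear; nra.
      have x1 : x <= 1 by apply: le_trans ee1; exact: ltW.
      have hw := wt_ge (p0 j) (g0 j) (introT andP (conj xp x1)).
      have hg : x * (4 * th) <= g j.
        rewrite -ler_pdivlMr ?mulr_gt0 // ge_min; apply/orP; right.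
        by rewrite ge_min lexx orbT.
      have hww : 4 * th <= wt p g x j by rewrite -(ler_pM2l xp); exact: le_trans hg hw.
      by move: Kx hww th0; move: (K * x) (wt p g x j); clear; move=> k w h1 h2 h3; nra.
    apply: upper => //; apply: lt_le_trans t3; rewrite /th3 (bigD1 j) //= -addrA ltrDl.
    rewrite ltr_wpDl // sumr_ge0 // => i _; rewrite mulr_ge0 ?(ltW (w0 _ _ _)) //.
    by rewrite addr_ge0 // mulr_ge0 // ltW.
  by rewrite (lt_le_trans xp a) (le_lt_trans b eh2).
have muP j x : 0 < x < e -> (mu th j == x) = (lo th x <= pos p g j < hi th x)%N.
  by move=> xe; exact: (crossingP lohi hl hr).
split=> [j|x xe].
  have := muP j _ (mu0 j); rewrite eqxx => /esym/andP[a b]; split=> //.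
    rewrite leNgt; apply/negP => /(lower _ _ _ (mu0 j)).
    by rewrite ltnNge a.
  rewrite leNgt; apply/negP => /(upper _ _ _ (mu0 j)).
  by rewrite leqNgt b.
rewrite (eq_card (B := [pred j | (lo th x <= pos p g j < hi th x)%N])).
  rewrite card_pos_itv //; have [x0 xe'] := andP xe.
  by apply: h2 => //; rewrite x0; have [] := he x xe'.
by move=> j; rewrite !inE muP.
Qed.

End Counting.

(** * Bringing a curve with a diagonal pole into normal form *)

Section NormalFormReduction.
Variable R : realType.
Local Notation C := R[i].

(** The shape taken by a triangular matrix conjugated with [D]. At [x = 0] exactly the entries with
    exponent [0] survive. *)
Definition powmx m n (k : 'I_m -> 'I_n -> nat) (M : 'M[C]_(m, n)) (x : R) : 'M[C]_(m, n) :=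
  \matrix_(i, j) ((x ^+ k i j)%:C * M i j).

Lemma C11_powmx m n k (M : 'M[C]_(m, n)) : C11 (powmx k M).
Proof.
have -> : powmx k M = fun x => \sum_i \sum_j (x ^+ k i j)%:C *: (M i j *: delta_mx i j).
  apply/funext => x; rewrite [LHS]matrix_sum_delta.
  by apply: eq_bigr => i _; apply: eq_bigr => j _; rewrite mxE scalerA.
by apply: C11_sum => i; apply: C11_sum => j; exact: C11_monomial.
Qed.

Lemma Dinv_unit m (p : 'I_m -> nat) (x : R) : x != 0 ->
  Dinv p x *m dg (fun j => x ^+ p j) = 1%:M.
Proof. by move=> x0; rewrite dgM dg1 // => j; rewrite mulVf // expf_neq0. Qed.

Lemma Dinv_unit' m (p : 'I_m -> nat) (x : R) : x != 0 ->
  dg (fun j => x ^+ p j) *m Dinv p x = 1%:M.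
Proof. by move=> x0; apply: mulmx1C; exact: Dinv_unit. Qed.

Lemma mul_dg m n (f : 'I_m -> R) (M : 'M[C]_(m, n)) i j :
  (dg f *m M) i j = (f i)%:C * M i j.
Proof. by rewrite mul_diag_mx !mxE. Qed.

Lemma mul_mx_dg m n (f : 'I_n -> R) (M : 'M[C]_(m, n)) i j :
  (M *m dg f) i j = M i j * (f j)%:C.
Proof. by rewrite mul_mx_diag !mxE. Qed.

(** The point where triangularity matters: the entries of [D^-1 U D] carry the powers
    [x ^ (p j - p i)], which stay bounded at [0] only when the exponents are nonnegative wherever
    [U] does not vanish. *)
Lemma Dinv_conj_left m (p : 'I_m -> nat) (U : 'M[C]_m) x : x != 0 ->
  (forall i j, U i j != 0 -> (p i <= p j)%N) ->
  Dinv p x *m U = powmx (fun i j => p j - p i)%N U x *m Dinv p x.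
Proof.
move=> x0 hU; apply/matrixP => i j; rewrite mul_dg mul_mx_dg mxE.
have [->|/hU h] := eqVneq (U i j) 0; first by rewrite !mulr0 mul0r.
rewrite mulrAC -rmorphM /=; congr (_%:C * _).
by rewrite -{2}(subnK h) exprD invfM mulrA mulfV ?mul1r // expf_neq0.
Qed.

Lemma Dinv_conj_right m (p : 'I_m -> nat) (V : 'M[C]_m) x : x != 0 ->
  (forall i j, V i j != 0 -> (p j <= p i)%N) ->
  V *m Dinv p x = Dinv p x *m powmx (fun i j => p i - p j)%N V x.
Proof.
move=> x0 hV; apply/matrixP => i j; rewrite mul_dg mul_mx_dg mxE.
have [->|/hV h] := eqVneq (V i j) 0; first by rewrite !mulr0 mul0r.
rewrite mulrA -rmorphM mulrC /=; congr (_%:C * _).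
by rewrite -{1}(subnK h) exprD invfM mulrAC mulVf ?mul1r // expf_neq0.
Qed.

Lemma mul_mx_col k m n (M : 'M[C]_(k, m)) (Z : 'M[C]_(m, n)) j : M *m col j Z = col j (M *m Z).
Proof. by rewrite !colE mulmxA. Qed.

(** The two mixed terms, each with a single pole factor [Di], are absorbed by shifting [A] by
    [L B^-1 D]. As [D] vanishes at [x = 0] for positive exponents, the shift leaves the leading data
    untouched. *)
Lemma complete_square N m (A L : 'M[C]_(N, m)) (B Bi Di D : 'M[C]_m) (W : 'M[C]_N) :
  B^t* = B -> Bi^t* = Bi -> D^t* = D -> B *m Bi = 1%:M -> Bi *m B = 1%:M ->
  D *m Di = 1%:M -> Di *m D = 1%:M ->
  A *m Di *m B *m Di *m A^t* + A *m Di *m L^t* + L *m Di *m A^t* + W =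
  (A + L *m Bi *m D) *m Di *m B *m Di *m (A + L *m Bi *m D)^t* + (W - L *m Bi *m L^t*).
Proof.
move=> hB hBi hD e1 e2 e3 e4.
rewrite adjD !adjM hBi hD !mulmxDr !mulmxDl.
have -> : L *m Bi *m D *m Di *m B *m Di *m A^t* = L *m Di *m A^t*.
  by rewrite -(mulmxA (L *m Bi)) e3 mulmx1 -(mulmxA L) e2 mulmx1.
have -> : A *m Di *m B *m Di *m (D *m (Bi *m L^t*)) = A *m Di *m L^t*.
  by rewrite mulmxA -(mulmxA _ Di D) e4 mulmx1 mulmxA -(mulmxA _ B) e1 mulmx1.
have -> : L *m Bi *m D *m Di *m B *m Di *m (D *m (Bi *m L^t*)) = L *m Bi *m L^t*.
  rewrite -(mulmxA (L *m Bi)) e3 mulmx1 -(mulmxA L) e2 mulmx1.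
  by rewrite mulmxA -(mulmxA _ Di D) e4 mulmx1 mulmxA.
move: (A *m Di *m B *m Di *m A^t*) (A *m Di *m L^t*) (L *m Di *m A^t*) (L *m Bi *m L^t*).
by move=> a b c d; mx_ring.
Qed.

Lemma herm_congr m n (X : 'M[C]_(m, n)) (M : 'M[C]_m) : herm M -> herm (X^t* *m M *m X).
Proof. by move=> hM; rewrite /herm !adjM adjK hM mulmxA. Qed.

Lemma herm_congr' m n (X : 'M[C]_(n, m)) (M : 'M[C]_m) : herm M -> herm (X *m M *m X^t*).
Proof. by move=> hM; rewrite /herm !adjM adjK hM mulmxA. Qed.

Lemma sandwich_unitary N m (Y : 'M[C]_(N, m)) (Om Dp D M : 'M[C]_m) :
  Om *m Om^t* = 1%:M -> Om *m Dp = D *m Om -> Dp *m Om^t* = Om^t* *m D ->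
  Y *m Om *m Dp *m (Om^t* *m M *m Om) *m Dp *m (Y *m Om)^t* = Y *m D *m M *m D *m Y^t*.
Proof.
move=> h1 h2 h3; rewrite adjM -(mulmxA Y Om Dp) h2 !mulmxA.
rewrite -(mulmxA _ Om (Om^t*)) h1 mulmx1 -(mulmxA _ Dp (Om^t*)) h3 !mulmxA.
by rewrite -(mulmxA _ Om (Om^t*)) h1 mulmx1.
Qed.

(** With [B] written as [U (Ui B Ui^H) U^H], the factor [U] crosses [D] to the left and joins the
    frame [Z]; then [Vi V] is inserted and [V] crosses [D] back into the middle. In this way the
    frame can be normalized without disturbing the powers in [D], which stands for [D^-1] in the
    application. *)
Lemma sandwich_triangular N m (Z : 'M[C]_(N, m)) (Ux U Ui Vi V V1 D B : 'M[C]_m) :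
  D^t* = D -> D *m U = Ux *m D -> V *m D = D *m V1 -> Vi *m V = 1%:M -> U *m Ui = 1%:M ->
  (Z *m Ux *m Vi) *m D *m (V1 *m (Ui *m B *m Ui^t*) *m V1^t*) *m D *m (Z *m Ux *m Vi)^t* =
  Z *m D *m B *m D *m Z^t*.
Proof.
move=> hD eU eV hV hU.
have e5 : Z *m Ux *m Vi *m D *m V1 = Z *m D *m U.
  by rewrite -!mulmxA -eV (mulmxA Vi) hV mul1mx -eU.
have e6 : V1^t* *m (D *m (Z *m Ux *m Vi)^t*) = (Z *m D *m U)^t*.
  by rewrite -{1}hD -!adjM e5.
have e7 : Ui^t* *m (Z *m D *m U)^t* = D *m Z^t*.
  by rewrite -adjM -(mulmxA (Z *m D)) hU mulmx1 adjM hD.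
transitivity ((Z *m Ux *m Vi *m D *m V1) *m (Ui *m B *m Ui^t*) *m (V1^t* *m (D *m (Z *m Ux *m Vi)^t*))).
  by rewrite !mulmxA.
rewrite e6 e5 (mulmxA _ _ (Ui^t*)) -(mulmxA _ (Ui^t*)) e7 !mulmxA -(mulmxA _ U) hU mulmx1 //.
Qed.

(** Here [U] reduces [B 0] to the identity, [V] orthonormalizes the resulting frame, and [Om]
    diagonalizes what then remains of the middle factor at [0], namely [V0 V0^H]. The last condition
    lets [Om] intertwine the two diagonal poles, for [p] and for [p']. *)
Lemma normal_form_core N m (Q : R -> 'M[C]_N) (A L : R -> 'M[C]_(N, m)) (B : R -> 'M[C]_m)
    (W : R -> 'M[C]_N) (p p' : 'I_m -> nat) (g : 'I_m -> R) (e : R) (U V Om : 'M[C]_m) :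
  0 < e -> C11 A -> C11 L -> C11 B -> C11 W ->
  (forall x, 0 < x < e -> herm (B x)) -> (forall x, 0 < x < e -> herm (W x)) ->
  (forall x, 0 < x < e -> Q x =
     A x *m Dinv p x *m B x *m Dinv p x *m (A x)^t* + A x *m Dinv p x *m (L x)^t*
     + L x *m Dinv p x *m (A x)^t* + W x) ->
  (forall j, (0 < p j)%N) ->
  (forall i j, U i j != 0 -> (p i <= p j)%N) -> (forall i j, V i j != 0 -> (p j <= p i)%N) ->
  U \in unitmx -> V \in unitmx -> B 0 = U *m U^t* ->
  let U0 := powmx (fun i j => p j - p i)%N U 0 in
  let V0 := powmx (fun i j => p i - p j)%N V 0 in
  (A 0 *m U0)^t* *m (A 0 *m U0) = V^t* *m V ->
  Om^t* *m Om = 1%:M -> (V0 *m V0^t*) *m Om = Om *m dg g ->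
  (forall i j, Om i j != 0 -> p i = p' j) ->
  normal_form Q p' g.
Proof.
move=> e0 hA hL hB hW hBh hWh hQ p0 hU hV uU uV B0 U0 V0 hX hOm hg hp.
have uB0 : B 0 \in unitmx by rewrite B0 unitmx_mul uU map_unitmx unitmx_tr.
have [d [K [d0 hK]]] := unitmx_near uB0.
have [e1 [K1 [B1 [e10 _ K10 h1]]]] := C11_lip hB.
have K11 : 0 < K1 + 1 by rewrite ltr_wpDl.
pose D x : 'M[C]_m := powmx (fun i j => p i) 1%:M x.
have DE x : D x = dg (fun j => x ^+ p j).
  by apply/matrixP => i j; rewrite !mxE; case: eqP; rewrite ?mulr1 ?mulr0 ?mulr1n.
pose Z x := (A x + L x *m invmx (B x) *m D x) *m powmx (fun i j => p j - p i)%N U x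
   *m invmx V *m Om.
pose V1 := powmx (fun i j => p i - p j)%N V.
pose BB x := Om^t* *m (V1 x *m (invmx U *m B x *m (invmx U)^t*) *m (V1 x)^t*) *m Om.
pose WW x := W x - L x *m invmx (B x) *m (L x)^t*.
have hOm' : Om *m Om^t* = 1%:M by exact: mulmx1C.
have hBi : C11 (fun x => invmx (B x)) by exact: C11_inv.
exists (Num.min e (Num.min e1 (d / (K1 + 1)))), Z, BB, WW; split.
- by rewrite !lt_min e0 e10 divr_gt0.
- apply: C11M (C11_const _); apply: C11M (C11_const _); apply: C11M (C11_powmx _ _).
  by apply: C11D hA _; apply: C11M (C11_powmx _ _); exact: C11M.
- apply: C11M (C11_const _); apply: C11M; first exact: C11_const.
  apply: C11M (C11_adj (C11_powmx _ _)); apply: C11M; first exact: C11_powmx.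
  by apply: C11M (C11_const _); apply: C11M hB; exact: C11_const.
- by apply: C11B hW _; apply: C11M (C11_adj hL); exact: C11M.
have hunit x : 0 < x < Num.min e (Num.min e1 (d / (K1 + 1))) -> B x \in unitmx.
  rewrite !lt_min ltr_pdivlMr // => /andP[x0 /andP[xe /andP[xe1 xd]]].
  have [_ _ _ hx] := h1 x (introT andP (conj x0 xe1)).
  have [//|//] := hK (B x); apply: le_lt_trans hx _; apply: le_lt_trans xd.
  by rewrite mulrC ler_wpM2l ?(ltW x0) // lerDl.
have hBih x : 0 < x < Num.min e (Num.min e1 (d / (K1 + 1))) -> herm (invmx (B x)).
  move=> xe; have ux := hunit x xe; move: xe; rewrite lt_min => /andP[x0 /andP[xe _]].
  have hx : herm (B x) by apply: hBh; rewrite x0.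
  rewrite /herm -[LHS]mulmx1 -(mulmxV ux) mulmxA -{2}hx -adjM mulmxV // adj1 mul1mx //.
split.
- move=> x; rewrite lt_min => /andP[x0 /andP[xe _]].
  have hx : herm (B x) by apply: hBh; rewrite x0.
  by apply: herm_congr; apply: herm_congr'; exact: herm_congr'.
- move=> x xe; have hi := hBih x xe; move: xe; rewrite lt_min => /andP[x0 /andP[xe _]].
  have hx : herm (W x) by apply: hWh; rewrite x0.
  by rewrite /herm /WW adjB hx !adjM adjK hi mulmxA.
- have -> : Z 0 = A 0 *m U0 *m invmx V *m Om.
    rewrite /Z (_ : D 0 = 0) ?mulmx0 ?addr0 //.
    by rewrite DE; apply/matrixP => i j; rewrite !mxE expr0n eqn0Ngt p0 mul0rn.
  have hVi : V^t* *m (invmx V)^t* = 1%:M by rewrite -adjM mulVmx // adj1.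
  have hVi' : (invmx V)^t* *m V^t* = 1%:M by rewrite -adjM mulmxV // adj1.
  rewrite (adjM _ Om) (adjM _ (invmx V)).
  have -> : Om^t* *m ((invmx V)^t* *m (A 0 *m U0)^t*) *m (A 0 *m U0 *m invmx V *m Om) =
     Om^t* *m ((invmx V)^t* *m ((A 0 *m U0)^t* *m (A 0 *m U0)) *m invmx V) *m Om.
    by rewrite !mulmxA.
  by rewrite hX (mulmxA _ (V^t*) V) hVi' mul1mx mulmxV // mulmx1 hOm.
- have hUi : invmx U *m (U *m U^t*) *m (invmx U)^t* = 1%:M.
    by rewrite mulmxA mulVmx // mul1mx -adjM mulVmx // adj1.
  by rewrite /BB B0 hUi mulmx1 -/V0 -mulmxA hg mulmxA hOm mul1mx.
move=> x xe; have ux := hunit x xe; have hi := hBih x xe.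
move: xe; rewrite lt_min => /andP[x0 /andP[xe _]].
have hx : herm (B x) by apply: hBh; rewrite x0.
have xn : x != 0 by rewrite gt_eqF.
have hD : (D x)^t* = D x by rewrite DE adj_dg.
have e3 : D x *m Dinv p x = 1%:M by rewrite DE Dinv_unit'.
have e4 : Dinv p x *m D x = 1%:M by rewrite DE Dinv_unit.
rewrite (hQ x (introT andP (conj x0 xe))).
rewrite (complete_square _ _ _ hx hi hD (mulmxV ux) (mulVmx ux) e3 e4) -/(WW x).
congr (_ + _); set Z0 := A x + _.
have eD : (Dinv p x)^t* = Dinv p x by exact: adj_dg.
have eD' : (Dinv p' x)^t* = Dinv p' x by exact: adj_dg.
have eOm : Om *m Dinv p' x = Dinv p x *m Om.
  apply/matrixP => i j; rewrite mul_dg mul_mx_dg.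
  by have [->|/hp ->] := eqVneq (Om i j) 0; rewrite ?mulr0 ?mul0r // mulrC.
have eOm' : Dinv p' x *m Om^t* = Om^t* *m Dinv p x by rewrite -eD' -adjM eOm adjM eD.
rewrite (sandwich_unitary _ _ hOm' eOm eOm').
exact/esym/(sandwich_triangular _ _ eD (Dinv_conj_left xn hU) (Dinv_conj_right xn hV) (mulVmx uV) (mulmxV uU)).
Qed.

Lemma qf_delta n (X : 'M[C]_n) i : qf X (delta_mx i 0) = complex.Re (X i i).
Proof.
rewrite /qf -mulmxA -colE; congr (complex.Re _).
rewrite mxE (bigD1 i) //= big1 ?addr0; last first.
  by move=> k ki; rewrite !mxE (negbTE ki) conjC0 mul0r.
by rewrite !mxE !eqxx conjC1 mul1r.
Qed.

(** The Schur complement [Y] of the corner entry is the compression [V^H X V], hence again positive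
    definite. The induction hypothesis is an explicit argument so that the size reads [1 + m], as
    the block operations require. *)
Lemma cholesky_step m (X : 'M[C]_(1 + m)) :
  (forall Y : 'M[C]_m, herm Y -> (forall c, c != 0 -> 0 < qf Y c) ->
  exists L : 'M[C]_m, [/\ L \in unitmx, Y = L *m L^t* & forall i j, L i j != 0 -> (j <= i)%N]) ->
  herm X -> (forall c, c != 0 -> 0 < qf X c) ->
  exists L : 'M[C]_(1 + m),
    [/\ L \in unitmx, X = L *m L^t* & forall i j, L i j != 0 -> (j <= i)%N].
Proof.
move=> IH hX pX; pose d := drsubmx X; pose b := dlsubmx X; pose r := complex.Re (X 0 0).
have r0 : 0 < r.
  rewrite /r -qf_delta; apply: pX; apply/negP => /eqP /matrixP /(_ 0 0) /eqP.
  by rewrite !mxE !eqxx oner_eq0.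
have eX : X = block_mx r%:C%:M (b^t*) b d.
  rewrite -[LHS](@submxK _ 1 m 1 m); congr (block_mx _ _ _ _).
    apply/matrixP => i j; rewrite !ord1 [RHS]mxE eqxx mulr1n !mxE.
    have -> : lshift m 0 = 0 :> 'I_(1 + m) by apply/val_inj.
    apply/esym/RRe_real/CrealP; rewrite -[in RHS]hX adjE //.
  have /(congr1 ursubmx) := hX; rewrite -{1}[X](@submxK _ 1 m 1 m) adj_block block_mxKur.
  by move=> <-.
have hd : herm d.
  have := hX; rewrite /herm {1}eX adj_block {1}eX => /(congr1 drsubmx).
  by rewrite !block_mxKdr.
pose Y := d - (r^-1)%:C *: (b *m b^t*).
have hY : herm Y by rewrite /herm adjB hd adjZr adjM adjK.
have rr : (r^-1)%:C * r%:C = 1 :> C by rewrite -rmorphM mulVf // gt_eqF.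
have pY c : c != 0 -> 0 < qf Y c.
  move=> c0; pose V : 'M[C]_(1 + m, m) := col_mx (- (r^-1)%:C *: b^t*) 1%:M.
  have -> : Y = V^t* *m X *m V.
    rewrite -mulmxA {1}eX /V mul_block_col adj_col_mx mul_row_col adj1 !mulmx1 mul1mx.
    rewrite -scalemxAr -scalemxAr mul_scalar_mx !scalerA !mulNr rr scaleN1r addNr mulmx0 add0r.
    by rewrite /Y addrC scaleNr.
  rewrite qf_congr; apply: pX; apply: contra c0 => /eqP; rewrite /V mul_col_mx mul1mx.
  by move=> /(congr1 dsubmx); rewrite col_mxKd => ->; rewrite linear0.
have [L [uL eL hL]] := IH Y hY pY.
pose q := Num.sqrt r; have q0 : 0 < q by rewrite sqrtr_gt0.
have qq : q%:C * q%:C = r%:C :> C by rewrite -rmorphM -expr2 sqr_sqrtr // ltW.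
have qn : q%:C != 0 :> C by rewrite gt_eqF // ltcR.
exists (block_mx q%:C%:M 0 ((q^-1)%:C *: b) L); split.
- by rewrite unitmxE det_lblock unitrM -!unitmxE uL andbT unitmxE det_scalar1 unitfE.
- rewrite adj_block mulmx_block {1}eX adj0 !mul0mx !mulmx0 !addr0 adj_scalar conjR adjZr.
  rewrite -scalar_mxM qq !mul_scalar_mx !mul_mx_scalar !scalerA -!rmorphM.
  rewrite mulfV ?gt_eqF // !scale1r; congr (block_mx _ _ _ _).
  rewrite -scalemxAl -scalemxAr scalerA -rmorphM -invfM -expr2 sqr_sqrtr ?(ltW r0) //.
  by rewrite -eL /Y addrC subrK.
move=> i j; case: (split_ordP i) => i' ->; case: (split_ordP j) => j' ->.
- by rewrite !ord1.
- by rewrite block_mxEur mxE eqxx.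
- by move=> _ /=; rewrite ord1.
by rewrite block_mxEdr => /hL /=; rewrite !leq_add2l.
Qed.

Lemma cholesky m (X : 'M[C]_m) : herm X -> (forall c, c != 0 -> 0 < qf X c) ->
  exists L : 'M[C]_m, [/\ L \in unitmx, X = L *m L^t* & forall i j, L i j != 0 -> (j <= i)%N].
Proof.
elim: m X => [|m IH] X hX pX; last exact: (@cholesky_step m X IH hX pX).
exists 1%:M; split; first exact: unitmx1; last by move=> [].
by apply/matrixP => -[].
Qed.

Lemma step_unique (c x : R) (a b : nat) :
  0 < c -> 0 < x - c * a%:R < c -> 0 < x - c * b%:R < c -> a = b.
Proof.
move=> c0; wlog ab : a b / (a <= b)%N.
  by move=> h ha hb; case/orP: (leq_total a b) => /h; [|move=> h']; [exact|apply/esym/h'].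
move=> /andP[_ h1] /andP[h2 _]; apply/eqP; rewrite eqn_leq ab /= leqNgt; apply/negP => lt_ab.
have : (a.+1)%:R <= b%:R :> R by rewrite ler_nat.
rewrite -natr1 -(ler_pM2l c0) mulrDr mulr1; move: (c * _) (c * _) h1 h2 => u v; lra.
Qed.

(** When blocks with different [p] share an eigenvalue of [B0], an arbitrary eigenbasis may mix
    them. Adding [c P], with [c] above all eigenvalues of [B0], separates the blocks: the
    eigenvalues of block [r] lie strictly between [c r] and [c r + c], so each eigenvector lives in
    one block. *)
Lemma block_diagonalize m (B0 : 'M[C]_m) (p : 'I_m -> nat) :
  herm B0 -> (forall c, c != 0 -> 0 < qf B0 c) ->
  (forall i j, B0 i j != 0 -> p i = p j) ->
  exists (Om : 'M[C]_m) (g : 'I_m -> R) (p' : 'I_m -> nat),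
    [/\ Om^t* *m Om = 1%:M, B0 *m Om = Om *m dg g, forall j, 0 < g j,
        forall i j, Om i j != 0 -> p i = p' j &
        forall r, #|[pred j | p' j == r]| = #|[pred j | p j == r]|].
Proof.
move=> hB pB hp; pose c := nrm B0 * m%:R + 1.
have c0 : 0 < c by rewrite ltr_wpDl // mulr_ge0 ?nrm_ge0.
have hc y : y != 0 -> qf B0 y < c * sq y.
  rewrite -sq_gt0 => y0; apply: le_lt_trans (ler_norm _) _.
  apply: le_lt_trans (qf_le _ _) _; rewrite /c mulrDl mul1r -mulrA.
  by rewrite ltr_pwDr // ler_wpM2l ?nrm_ge0 ?nrm_le_sq.
pose P := dg (fun i => (p i)%:R : R).
have hT : herm (B0 + c%:C *: P) by rewrite /herm adjD adjZr adj_dg hB.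
have [U [d [hU1 hU2 eT _ _]]] := spectralP hT.
pose w j : 'cV[C]_m := col j (U^t*).
have wj0 j : w j != 0.
  apply/negP => /eqP h; have := congr1 (fun M : 'M[C]_m => M j j) hU2.
  rewrite !mxE eqxx mulr1n => e; have := oner_neq0 C; rewrite -e big1 ?eqxx // => k _.
  have := congr1 (fun M : 'cV[C]_m => M k 0) h; rewrite !mxE => ->.
  by rewrite mulr0.
have weig j : (B0 + c%:C *: P) *m w j = (d j)%:C *: w j.
  rewrite eT /w mul_mx_col -!mulmxA hU2 mulmx1 mul_mx_diag.
  by apply/matrixP => i k; rewrite !mxE mulrC.
pose pr r (x : 'cV[C]_m) : 'cV[C]_m := \col_i (x i 0 *+ (p i == r)).
have prL r (u v : C) (x y : 'cV[C]_m) : pr r (u *: x - v *: y) = u *: pr r x - v *: pr r y.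
  by apply/matrixP => i k; rewrite !mxE mulrnBl -!mulrnAr.
have prB r x : B0 *m pr r x = pr r (B0 *m x).
  apply/matrixP => i k; rewrite !mxE -sumrMnl; apply: eq_bigr => l _; rewrite !mxE.
  have [->|/hp->] := eqVneq (B0 i l) 0; first by rewrite !mul0r mul0rn.
  by rewrite mulrnAr.
have prP r x : P *m pr r x = r%:R *: pr r x.
  apply/matrixP => i k; rewrite mul_dg !mxE; case: eqP => [->|_]; last by rewrite !mulr0.
  by rewrite rmorph_nat.
have preig j r : B0 *m pr r (w j) = (d j - c * r%:R)%:C *: pr r (w j).
  have e1 : B0 *m w j = (d j)%:C *: w j - c%:C *: (P *m w j).
    by rewrite -weig mulmxDl -scalemxAl addrK.
  have prP' : pr r (P *m w j) = r%:R *: pr r (w j).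
    rewrite -prP; apply/matrixP => i k; rewrite [LHS]mxE !mul_dg.
    by rewrite [pr _ _ _ _]mxE mulrnAr.
  rewrite prB e1 prL.
  by rewrite prP' scalerA -scalerBl rmorphB rmorphM rmorph_nat.
have prw j r : pr r (w j) != 0 -> 0 < d j - c * r%:R < c.
  move=> h; have := pB _ h; have := hc _ h; rewrite (qf_eigen (preig j r)).
  by rewrite ltr_pM2r ?pmulr_lgt0 ?sq_gt0 // => -> ->.
have wr j i : w j i 0 != 0 -> pr (p i) (w j) != 0.
  apply: contra => /eqP /matrixP /(_ i 0); rewrite !mxE eqxx mulr1n => ->.
  exact: eqxx.
have ex j : exists i, w j i 0 != 0.
  apply/existsP; apply: contraT; rewrite negb_exists => /forallP h.
  have := wj0 j; suff -> : w j = 0 by rewrite eqxx.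
  by apply/matrixP => i k; rewrite ord1 [RHS]mxE; apply/eqP; have := h i; rewrite negbK.
pose p' j := p (xchoose (ex j)).
have hp' i j : w j i 0 != 0 -> p i = p' j.
  move=> /wr /prw /andP[h1 h2]; have := xchooseP (ex j) => /wr /prw; rewrite -/(p' j) => /andP[h3 h4].
  exact: (step_unique c0 (introT andP (conj h1 h2)) (introT andP (conj h3 h4))).
have hp2 i j : (U^t*) i j != 0 -> p i = p' j by move=> h; apply: hp'; rewrite mxE.
have weq j : pr (p' j) (w j) = w j.
  apply/matrixP => i k; rewrite ord1 [LHS]mxE.
  by have [->|/hp'->] := eqVneq (w j i 0) 0; rewrite ?mul0rn // eqxx.
exists (U^t*), (fun j => d j - c * (p' j)%:R), p'; split=> //.
- by rewrite adjK.
- apply/matrixP => i j; rewrite mul_mx_dg.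
  have := congr1 (fun M : 'cV[C]_m => M i 0) (preig j (p' j)); rewrite weq.
  by rewrite /w mul_mx_col !mxE => ->; rewrite mulrC.
- by move=> j; have := wj0 j; rewrite -{1}weq => /prw /andP[].
(* The diagonal matrices of [p] and [p'] are unitarily similar, so each value [r] is taken equally
   often; ranks of the shifted matrices count this. *)
have eP : P = U^t* *m dg (fun j => (p' j)%:R) *m U.
  rewrite -[LHS]mulmx1 -hU1 mulmxA; congr (_ *m _); apply/matrixP => i j.
  rewrite mul_dg mul_mx_dg.
  by have [->|/hp2->] := eqVneq ((U^t*) i j) 0; rewrite ?mulr0 ?mul0r // mulrC.
move=> r; have [uU' uU] := mulmx1_unit hU1.
have rk : \rank (P - r%:R%:M) = \rank (dg (fun j => (p' j)%:R : R) - r%:R%:M).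
  have -> : P - r%:R%:M = U^t* *m (dg (fun j => (p' j)%:R) - r%:R%:M) *m U.
    by rewrite mulmxBr mulmxBl -eP mul_mx_scalar -scalemxAl hU1 scalemx1.
  by rewrite mxrankMfree ?row_free_unit // eqmxMfull ?row_full_unit.
have rd (f : 'I_m -> nat) : \rank (dg (fun j => (f j)%:R : R) - r%:R%:M) = #|[predC [pred j | f j == r]]|.
  have -> : dg (fun j => (f j)%:R : R) - r%:R%:M = diag_mx (\row_j ((f j)%:R - r%:R)).
    by apply/matrixP => i j; rewrite !mxE rmorph_nat mulrnBl.
  rewrite rank_diag_mx; apply: eq_card => j; rewrite !inE mxE subr_eq0 eqr_nat //.
have := cardC [pred j | p' j == r]; rewrite -rd -rk rd -(cardC [pred j | p j == r]).
by move/eqP; rewrite eqn_add2r => /eqP.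
Qed.

End NormalFormReduction.

(** * One set of constants for both signs of [x] *)

Section TwoSided.
Variable R : realType.
Local Notation C := R[i].

Lemma qf_gram_pos N m (X : 'M[C]_(N, m)) : (forall c : 'cV_m, X *m c = 0 -> c = 0) ->
  forall c, c != 0 -> 0 < qf (X^t* *m X) c.
Proof.
move=> h c c0; rewrite /qf -mulmxA -(mulmxA (X^t*)) mulmxA -adjM -sqE sq_gt0.
by apply: contra c0 => /eqP/h/eqP.
Qed.

Lemma herm_gram N m (X : 'M[C]_(N, m)) : herm (X^t* *m X).
Proof. by rewrite /herm adjM adjK. Qed.

Lemma powmx0 m n (k : 'I_m -> 'I_n -> nat) (M : 'M[C]_(m, n)) i j :
  powmx k M 0 i j = M i j *+ (k i j == 0).
Proof. by rewrite mxE expr0n; case: eqP => _; rewrite ?mul1r ?mul0r. Qed.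

Lemma unitmx_lower m (U U0 : 'M[C]_m) : U \in unitmx ->
  (forall i j, U i j != 0 -> (j <= i)%N) -> (forall i j, U i j = 0 -> U0 i j = 0) ->
  (forall i, U0 i i = U i i) -> U0 \in unitmx.
Proof.
move=> uU hU h0 hd; rewrite unitmxE.
have tr (M : 'M[C]_m) : (forall i j, U i j = 0 -> M i j = 0) -> is_trig_mx M.
  move=> h; apply/is_trig_mxP => i j ij; apply: h; apply/eqP; apply: contraT => /hU.
  by rewrite leqNgt ij.
move: uU; rewrite unitmxE (det_trig (tr _ h0)) (det_trig (tr U (fun i j => id))).
by rewrite (eq_bigr _ (fun i _ => hd i)).
Qed.

Lemma powmx_lower_unit m (U : 'M[C]_m) (k : 'I_m -> 'I_m -> nat) : U \in unitmx ->
  (forall i j, U i j != 0 -> (j <= i)%N) -> (forall i, k i i = 0%N) ->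
  powmx k U 0 \in unitmx.
Proof.
move=> uU hU hk; apply: unitmx_lower uU hU _ _ => i => [j h|]; rewrite powmx0.
  by rewrite h mul0rn.
by rewrite hk.
Qed.

Lemma unitmx_inj m (U : 'M[C]_m) c : U \in unitmx -> U *m c = 0 -> c = 0 :> 'cV_m.
Proof. by move=> uU /(congr1 (mulmx (invmx U))); rewrite mulmxA mulVmx // mul1mx mulmx0. Qed.

Lemma Dinv_opp m (p : 'I_m -> nat) (x : R) :
  Dinv p (- x) = dg (fun j => (-1) ^+ p j) *m Dinv p x.
Proof.
apply/matrixP => i j; rewrite dgM !mxE; congr (_%:C *+ _).
by rewrite (exprNn x) invfM invr_sign.
Qed.

(** Reflection turns [D^-1] into [s D^-1] with the sign matrix [s] of entries [(-1) ^ (p j)], so [B]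
    and [U] are replaced by [s B s] and [s U s]. Entries of [U] between indices of equal [p] do not
    change; hence [U0], [V], [Om] and finally [g] are the same for both signs. *)
Lemma normal_form_two_sided N m (Q : R -> 'M[C]_N) (A L : R -> 'M[C]_(N, m)) (B : R -> 'M[C]_m)
    (W : R -> 'M[C]_N) (p : 'I_m -> nat) (e : R) :
  0 < e -> C11 A -> C11 L -> C11 B -> C11 W ->
  (forall x, `|x| < e -> herm (B x)) -> (forall x, `|x| < e -> herm (W x)) ->
  (forall x, 0 < `|x| < e -> Q x =
     A x *m Dinv p x *m B x *m Dinv p x *m (A x)^t* + A x *m Dinv p x *m (L x)^t*
     + L x *m Dinv p x *m (A x)^t* + W x) ->
  (forall j, (0 < p j)%N) -> (forall i j : 'I_m, (i <= j)%N -> (p j <= p i)%N) ->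
  (forall c : 'cV[C]_m, A 0 *m c = 0 -> c = 0) -> (forall c, c != 0 -> 0 < qf (B 0) c) ->
  exists (p' : 'I_m -> nat) (g : 'I_m -> R),
    [/\ forall j, 0 < g j, forall r : nat, #|[pred j | p' j == r]| = #|[pred j | p j == r]|,
      normal_form Q p' g & normal_form (fun x => Q (- x)) p' g].
Proof.
move=> e0 hA hL hB hW hBh hWh hQ p0 ps Ai Bp.
have [U [uU eU lU]] := cholesky (hBh 0 ltac:(by rewrite normr0)) Bp.
have hU i j : U i j != 0 -> (p i <= p j)%N by move/lU/ps.
pose U0 := powmx (fun i j => p j - p i)%N U 0.
have uU0 : U0 \in unitmx by apply: powmx_lower_unit => // i; rewrite subnn.
have inj0 (c : 'cV_m) : A 0 *m U0 *m c = 0 -> c = 0.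
  by rewrite -mulmxA => /Ai; exact: unitmx_inj.
have [Z [uZ eZ lZ]] := cholesky (herm_gram (A 0 *m U0)) (qf_gram_pos inj0).
(* The Gram matrix [Z Z^H] must be read as [V^H V]. The upper triangular [V] has nonzero entries
   only where [p j <= p i], because [p] is nonincreasing. *)
pose V := Z^t*; have uV : V \in unitmx by rewrite map_unitmx unitmx_tr.
have hV i j : V i j != 0 -> (p j <= p i)%N by rewrite adjE conjC_eq0 => /lZ/ps.
pose V0 := powmx (fun i j => p i - p j)%N V 0.
have V0E : V0 = (powmx (fun i j => p j - p i)%N Z 0)^t*.
  apply/matrixP => i j; rewrite adjE !powmx0 adjE.
  by case: (_ == _); rewrite ?mulr0n ?conjC0.
have uV0 : V0 \in unitmx.
  by rewrite V0E map_unitmx unitmx_tr; apply: powmx_lower_unit => // i; rewrite subnn.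
have hM : herm (V0 *m V0^t*) by rewrite /herm adjM adjK.
have pM c : c != 0 -> 0 < qf (V0 *m V0^t*) c.
  move=> c0; rewrite -{1}[V0]adjK; apply: qf_gram_pos => // y; apply: unitmx_inj.
  by rewrite map_unitmx unitmx_tr.
have V0p i k : V0 i k != 0 -> p i = p k.
  rewrite powmx0; case: (eqVneq (p i - p k)%N 0%N) => [h h1|_]; last by rewrite eqxx.
  have h' := hV _ _ h1.
  by apply/eqP; rewrite eqn_leq h' -subn_eq0 h.
have Mp i j : (V0 *m V0^t*) i j != 0 -> p i = p j.
  move=> h; apply/eqP; apply: contraT => pij; case/negP: h; rewrite mxE big1 // => k _.
  have [->|/V0p ik] := eqVneq (V0 i k) 0; first by rewrite mul0r.
  have [jk|/V0p jk] := eqVneq (V0 j k) 0; first by rewrite adjE jk conjC0 mulr0.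
  by rewrite ik jk eqxx in pij.
have [Om [g [p' [h1 h2 h3 h4 h5]]]] := block_diagonalize hM pM Mp.
exists p', g; split=> //.
  apply: (@normal_form_core _ _ _ Q A L B W p p' g e U V Om).
  - exact: e0.
  - exact: hA.
  - exact: hL.
  - exact: hB.
  - exact: hW.
  - by move=> x /andP[x0 xe]; apply: hBh; rewrite gtr0_norm.
  - by move=> x /andP[x0 xe]; apply: hWh; rewrite gtr0_norm.
  - by move=> x /andP[x0 xe]; apply: hQ; rewrite gtr0_norm // x0.
  - exact: p0.
  - exact: hU.
  - exact: hV.
  - exact: uU.
  - exact: uV.
  - exact: eU.
  - by rewrite eZ /V adjK.
  - exact: h1.
  - exact: h2.
  exact: h4.
pose s := dg (fun j => (-1) ^+ p j : R).
have ss : s *m s = 1%:M by rewrite dgM dg1 // => j; rewrite -expr2 sqrr_sign.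
have sa : s^t* = s by exact: adj_dg.
have us : s \in unitmx by have [] := mulmx1_unit ss.
have sD x : Dinv p x *m s = s *m Dinv p x.
  by rewrite !dgM; apply/matrixP => i j; rewrite !mxE mulrC.
have sUE i j : (s *m U *m s) i j = ((-1) ^+ p i * (-1) ^+ p j)%:C * U i j.
  by rewrite mul_mx_dg mul_dg -mulrA (mulrC (U i j)) mulrA -rmorphM.
have U0E : powmx (fun i j => p j - p i)%N (s *m U *m s) 0 = U0.
  apply/matrixP => i j; rewrite !powmx0 sUE; case: eqP => // h.
  have [->|/hU h'] := eqVneq (U i j) 0; first by rewrite mulr0.
  have -> : p i = p j by apply/eqP; rewrite eqn_leq h' -subn_eq0 h.
  by rewrite -expr2 sqrr_sign mul1r.
apply: (@normal_form_core _ _ _ _ (fun x => A (- x)) (fun x => L (- x) *m s)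
   (fun x => s *m B (- x) *m s) (fun x => W (- x)) p p' g e (s *m U *m s) V Om).
- exact: e0.
- exact: C11_reflect.
- by apply: C11M (C11_const _); exact: C11_reflect.
- by apply: C11M (C11_const _); apply: C11M; [exact: C11_const|exact: C11_reflect].
- exact: C11_reflect.
- move=> x /andP[x0 xe]; rewrite -{2}sa; apply: herm_congr'.
  by apply: hBh; rewrite normrN gtr0_norm.
- by move=> x /andP[x0 xe]; apply: hWh; rewrite normrN gtr0_norm.
- move=> x /andP[x0 xe]; rewrite hQ; last by rewrite normrN gtr0_norm // x0.
  by rewrite Dinv_opp -/s adjM sa -{1 3}(sD x) !mulmxA.
- exact: p0.
- by move=> i j; rewrite sUE mulf_eq0 negb_or => /andP[_ /hU].
- exact: hV.
- by rewrite !unitmx_mul us uU.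
- exact: uV.
- by rewrite oppr0 eU !adjM sa -!mulmxA (mulmxA s s) ss mul1mx.
- by rewrite U0E oppr0 eZ /V adjK.
- exact: h1.
- exact: h2.
exact: h4.
Qed.

End TwoSided.

(** * The resolvent of a matrix with a single eigenvalue *)

Section JordanResolvent.
Variable R : realType.
Local Notation C := R[i].
Local Notation ii := ('i : C).

(** For the nilpotent shift [N], this is the finite series of [- w ^ (- k - 1) N ^ k] for
    [(N - w)^-1], written entry by entry. *)
Lemma shift_inverse q (w : C) : w != 0 ->
  (\matrix_(i < q, j < q) ((j == i.+1 :> nat)%:R - w *+ (i == j))) *m
  (\matrix_(i < q, j < q) (if (i <= j)%N then - (w ^+ (j - i).+1)^-1 else 0)) = 1%:M.
Proof.
move=> w0; apply/matrixP => i k; rewrite !mxE.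
pose F (l : nat) : C := if (l <= k)%N then - (w ^+ (k - l).+1)^-1 else 0.
transitivity (\sum_(j < q) ((j == i.+1 :> nat)%:R * F j - (i == j)%:R * (w * F j))).
  apply: eq_bigr => j _; rewrite !mxE -/(F j) mulrBl; congr (_ - _).
  by case: (i == j); rewrite ?mulr1n ?mulr0n ?mul1r ?mul0r.
rewrite sumrB [X in _ - X](bigD1 i) //= eqxx mul1r [X in _ - (_ + X)]big1 ?addr0; last first.
  by move=> j ji; rewrite eq_sym (negbTE ji) mul0r.
have -> : \sum_(j < q) (j == i.+1 :> nat)%:R * F j = F i.+1.
  have [iq|iq] := ltnP i.+1 q.
    rewrite (bigD1 (Ordinal iq)) //= eqxx mul1r big1 ?addr0 // => j ji.
    by rewrite -val_eqE /= in ji; rewrite (negbTE ji) mul0r.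
  rewrite big1 => [|j _]; last first.
    have : (j < i.+1)%N by exact: leq_trans iq.
    by case: eqP => [->|]; rewrite ?ltnn ?mul0r.
  by rewrite /F leqNgt (leq_trans (ltn_ord k) iq).
rewrite /F; case: (ltngtP i k) => [ik|ik|ik].
- rewrite (_ : (i == k) = false) ?mulr0n; last by apply/eqP => e; rewrite e ltnn in ik.
  rewrite -(subnSK ik) (exprS _ (k - i.+1).+1) invfM mulrN mulrA mulfV // mul1r subrr //.
- rewrite mulr0 subrr (_ : (i == k) = false) //; apply/eqP => e; rewrite e ltnn in ik; by [].
by rewrite (ord_inj ik) eqxx sub0r subnn expr1 mulrN opprK mulfV.
Qed.

Lemma sqr_ii : ii ^+ 2 = -1. Proof. by rewrite ?complexiE ?sqrCi // -complexiE sqr_i. Qed.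

Lemma ii_neq0 : ii != 0.
Proof. by apply/eqP => h; have := sqr_ii; rewrite h expr0n /= => /eqP; rewrite eq_sym oppr_eq0 oner_eq0. Qed.

(** With [w = i x], the entries [- w ^ (r - c - 1)] of the inverse block on and above the diagonal
    extend to the rank-one matrix [- x ^ (- q) a b]. The spurious entries below the diagonal have
    nonnegative exponents and are cancelled by the regular part [blk_r]. *)
Definition blk_a q (x : R) : 'cV[C]_q := powmx (fun r _ => r : nat) (\col_(r < q) ii ^+ r) x.
Definition blk_b q (x : R) : 'rV[C]_q :=
  powmx (fun _ c => q.-1 - c)%N (\row_(c < q) (ii ^+ (q.-1 - c) / ii ^+ q)) x.
Definition blk_r q (x : R) : 'M[C]_q :=
  powmx (fun r c => r - c.+1)%N (\matrix_(r < q, c < q) (ii ^+ (r - c.+1) *+ (c < r))) x.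

Lemma jordan_block_inverse q (z : C) (x : R) : x != 0 ->
  (jordan_block z q - (z + ii * x%:C)%:M) *m
    (blk_r q x - ((x ^+ q)^-1)%:C *: (blk_a q x *m blk_b q x)) = 1%:M.
Proof.
move=> x0; have w0 : ii * x%:C != 0.
  by rewrite mulf_neq0 ?ii_neq0 // -(rmorph0 (real_complex R)) (inj_eq (@complexI R)).
have xk k : (x ^+ k)%:C * ii ^+ k = (ii * x%:C) ^+ k by rewrite mulrC rmorphXn exprMn.
rewrite -[RHS](shift_inverse q w0); congr (_ *m _); apply/matrixP => i j.
  rewrite !mxE mulrnDl -!addrA; rewrite [LHS]addrCA; congr (_ + _).
  by rewrite opprD addrA subrr add0r.
rewrite !mxE big_ord1 !mxE mulrnAr xk.
have -> : ((x ^+ q)^-1)%:C * ((x ^+ i)%:C * ii ^+ i * ((x ^+ (q.-1 - j))%:C * (ii ^+ (q.-1 - j) / ii ^+ q)))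
   = (ii * x%:C) ^+ i * (ii * x%:C) ^+ (q.-1 - j) / (ii * x%:C) ^+ q.
  rewrite -!xk invfM -fmorphV; ring.
move: (ii * x%:C) w0 => w w0; rewrite -exprD.
have jq := ltn_ord j; have iq := ltn_ord i.
have [ij|ij] := leqP i j.
  have -> : w ^+ q = w ^+ (i + (q.-1 - j)) * w ^+ (j - i).+1.
    by rewrite -exprD; congr (_ ^+ _); lia.
  by rewrite mulr0n sub0r invfM mulrA divff ?mul1r ?expf_neq0.
rewrite mulr1n (_ : i + (q.-1 - j) = q + (i - j.+1))%N; last by lia.
by rewrite exprD mulrAC divff ?mul1r ?subrr // expf_neq0.
Qed.

Lemma mul_mxdiag m (p : 'I_m -> nat) (M N : forall i, 'M[C]_(p i)) :
  \mxdiag_i M i *m \mxdiag_i N i = \mxdiag_i (M i *m N i).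
Proof.
rewrite {2 3}/mxdiag !mxblockEv mul_mxdiag_mxcol; apply/eq_mxcol => i.
rewrite mul_mxrow; apply/eq_mxrow => j; case: eqP => [e|_]; last exact: mulmx0.
by subst j; rewrite !conform_mx_id.
Qed.

Lemma submxcolZ m n (p : 'I_m -> nat) (M : 'M[C]_(\sum_i p i, n)) (z : C) j :
  submxcol (z *: M) j = z *: submxcol M j.
Proof. by apply/matrixP => a b; rewrite !mxE. Qed.

Lemma submxrowZ m n (p : 'I_m -> nat) (M : 'M[C]_(n, \sum_i p i)) (z : C) j :
  submxrow (z *: M) j = z *: submxrow M j.
Proof. by apply/matrixP => a b; rewrite !mxE. Qed.

Section Structure.
Variables (n m : nat) (p : 'I_m -> nat).
Variables (P : 'M[C]_(n, \sum_i p i)) (Z : 'M[C]_(\sum_i p i, n)) (F : 'M[C]_n) (z : C).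
Hypothesis p0 : forall i, (0 < p i)%N.
Hypothesis PZ : P *m Z = 1%:M.
Hypothesis ZP : Z *m P = 1%:M.
Hypothesis FE : F = P *m \mxdiag_i jordan_block z (p i) *m Z.

(** The pole of the resolvent is concentrated in [resA D^-1 resB], with one column and one row per
    Jordan block. At [x = 0] these columns and rows are right and left eigenvectors of [F], on which
    observability and controllability act. *)
Definition resA (x : R) : 'M[C]_(n, m) :=
  \sum_j (submxrow P j *m blk_a (p j) x *m delta_mx 0 j).
Definition resB (x : R) : 'M[C]_(m, n) :=
  \sum_j (delta_mx j 0 *m blk_b (p j) x *m submxcol Z j).
Definition resR (x : R) : 'M[C]_n :=
  \sum_j (submxrow P j *m blk_r (p j) x *m submxcol Z j).

Lemma C11_resA : C11 resA.
Proof.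
apply: C11_sum => j; apply: C11M (C11_const _).
by apply: C11M; [exact: C11_const|exact: C11_powmx].
Qed.

Lemma C11_resB : C11 resB.
Proof.
apply: C11_sum => j; apply: C11M (C11_const _).
by apply: C11M; [exact: C11_const|exact: C11_powmx].
Qed.

Lemma C11_resR : C11 resR.
Proof.
apply: C11_sum => j; apply: C11M (C11_const _).
by apply: C11M; [exact: C11_const|exact: C11_powmx].
Qed.

Lemma resADB (x : R) : resA x *m Dinv p x *m resB x =
  \sum_j submxrow P j *m (((x ^+ p j)^-1)%:C *: (blk_a (p j) x *m blk_b (p j) x)) *m submxcol Z j.
Proof.
rewrite /resA /resB !mulmx_suml; apply: eq_bigr => j _; rewrite mulmx_sumr (bigD1 j) //= big1.
  rewrite addr0 -!mulmxA (mulmxA (delta_mx 0 j)) (mulmxA _ (delta_mx j 0)).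
  have -> : delta_mx 0 j *m Dinv p x *m delta_mx j 0 = ((x ^+ p j)^-1)%:C%:M :> 'M[C]_1.
    apply/matrixP => a b; rewrite !ord1 -rowE -colE !mxE eqxx //.
  by rewrite mul_scalar_mx -scalemxAl -!scalemxAr -!mulmxA.
move=> k kj; rewrite -!mulmxA (mulmxA (delta_mx 0 j)) (mulmxA _ (delta_mx k 0)).
have -> : delta_mx 0 j *m Dinv p x *m delta_mx k 0 = 0 :> 'M[C]_1.
  by apply/matrixP => a b; rewrite !ord1 -rowE -colE !mxE eq_sym (negbTE kj).
by rewrite mul0mx !mulmx0.
Qed.

Lemma conj_mxdiag (M : forall j, 'M[C]_(p j)) :
  P *m \mxdiag_j M j *m Z = \sum_j submxrow P j *m M j *m submxcol Z j.
Proof.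
by rewrite -{1}(submxrowK P) -{1}(submxcolK Z) mul_mxrow_mxdiag mul_mxrow_mxcol.
Qed.

Lemma jordan_resolvent (x : R) : x != 0 ->
  (F - (z + ii * x%:C)%:M) *m (resR x - resA x *m Dinv p x *m resB x) = 1%:M.
Proof.
move=> x0; rewrite resADB -sumrB.
under eq_bigr do rewrite -mulmxBl -mulmxBr.
rewrite -conj_mxdiag FE.
have -> : P *m \mxdiag_i jordan_block z (p i) *m Z - (z + ii * x%:C)%:M =
   P *m \mxdiag_i (jordan_block z (p i) - (z + ii * x%:C)%:M) *m Z.
  by rewrite mxdiagB mxdiagZ mulmxBr mulmxBl mul_mx_scalar -scalemxAl PZ scalemx1.
rewrite -!mulmxA (mulmxA Z) ZP mul1mx (mulmxA (\mxdiag_i _)) mul_mxdiag.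
under eq_mxdiag do rewrite jordan_block_inverse //.
by rewrite mxdiagZ mul1mx.
Qed.

Lemma resA0 (c : 'cV[C]_m) : resA 0 *m c = P *m \mxcol_j (c j 0 *: blk_a (p j) 0).
Proof.
rewrite /resA -[in RHS](submxrowK P) mul_mxrow_mxcol mulmx_suml; apply: eq_bigr => j _.
rewrite -mulmxA -rowE -scalemxAr; apply/matrixP => a b; rewrite ord1 -!mulmxA.
by rewrite [row j c]mx11_scalar mul_mx_scalar -scalemxAr !mxE.
Qed.

Lemma resA_inj (c : 'cV[C]_m) : resA 0 *m c = 0 -> c = 0.
Proof.
rewrite resA0 => /(congr1 (mulmx Z)); rewrite mulmxA ZP mul1mx mulmx0.
move=> h; apply/matrixP => j k; rewrite ord1 [RHS]mxE.
have := congr1 (fun M => submxcol M j) h; rewrite mxcolK => /matrixP /(_ (Ordinal (p0 j)) 0).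
by rewrite !mxE expr0 mulr1 mulr1.
Qed.

Lemma resA_eigen (c : 'cV[C]_m) : F *m (resA 0 *m c) = z *: (resA 0 *m c).
Proof.
rewrite resA0 FE -!mulmxA (mulmxA Z) ZP mul1mx scalemxAr; congr (P *m _).
rewrite mul_mxdiag_mxcol; apply/mxcolP => j.
rewrite submxcolZ !mxcolK.
rewrite -scalemxAr !scalerA mulrC -scalerA; congr (_ *: _).
apply/matrixP => a b; rewrite !mxE (bigD1 (Ordinal (p0 j))) //= big1 ?addr0.
  rewrite !mxE expr0 mulr1 mulr1 expr0n -val_eqE /= addr0.
  by case: eqP => [->|_]; rewrite ?expr0 ?mulr1n ?mulr0n ?mul0r ?mulr0 ?mulr1.
move=> k k0; rewrite !mxE expr0n (_ : k == 0 :> nat = false) ?mul0r ?mulr0 //.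
by apply/negbTE; apply: contra k0 => /eqP k0; apply/eqP/val_inj.
Qed.

Lemma resB0 (r : 'rV[C]_m) : r *m resB 0 = \mxrow_j (r 0 j *: blk_b (p j) 0) *m Z.
Proof.
rewrite /resB -[in RHS](submxcolK Z) mul_mxrow_mxcol mulmx_sumr; apply: eq_bigr => j _.
rewrite !mulmxA -colE; congr (_ *m _).
by rewrite [col j r]mx11_scalar mul_scalar_mx !mxE.
Qed.

Lemma lastP q : (0 < q)%N -> (q.-1 < q)%N. Proof. by case: q. Qed.

Lemma resB_inj (r : 'rV[C]_m) : r *m resB 0 = 0 -> r = 0.
Proof.
rewrite resB0 => /(congr1 (mulmx^~ P)); rewrite -mulmxA ZP mulmx1 mul0mx.
move=> h; apply/matrixP => k j; rewrite ord1 [RHS]mxE.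
have := congr1 (fun M => submxrow M j) h.
rewrite mxrowK => /matrixP /(_ 0 (Ordinal (lastP (p0 j)))).
rewrite !mxE subnn expr0 !mul1r => /eqP; rewrite mulf_eq0 invr_eq0 expf_eq0.
by rewrite (negbTE ii_neq0) andbF orbF => /eqP.
Qed.

Lemma resB_eigen (r : 'rV[C]_m) : r *m resB 0 *m F = z *: (r *m resB 0).
Proof.
rewrite resB0 FE !mulmxA -(mulmxA _ Z) ZP mulmx1 scalemxAl; congr (_ *m Z).
rewrite mul_mxrow_mxdiag; apply/mxrowP => j.
rewrite submxrowZ !mxrowK.
rewrite -scalemxAl !scalerA mulrC -scalerA; congr (_ *: _).
apply/matrixP => a b; rewrite !mxE (bigD1 (Ordinal (lastP (p0 j)))) //= big1 ?addr0.
  rewrite !mxE subnn expr0 !mul1r expr0n -val_eqE /=.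
  rewrite (_ : (b == (p j).-1.+1 :> nat) = false) ?addr0; last first.
    by rewrite prednK //; apply/eqP => e; have := ltn_ord b; rewrite e ltnn.
  rewrite subn_eq0 (_ : ((p j).-1 <= b)%N = ((p j).-1 == b)); last first.
    by apply/idP/eqP => [|->//]; have := ltn_ord b; have := p0 j; lia.
  by case: eqP => [<-|_]; rewrite ?subnn ?mulr0n ?mul0r ?mulr0 ?expr0 ?mul1r ?mulr1n // mulrC.
move=> k k0; rewrite !mxE expr0n (_ : ((p j).-1 - k == 0)%N = false) ?mul0r //.
apply/negbTE; apply: contra k0; rewrite subn_eq0 => k0; apply/eqP/val_inj => /=.
by have := ltn_ord k; have := p0 j; lia.
Qed.

End Structure.
End JordanResolvent.

(** * Factorizations and inverses of saddle matrices *)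

Section Concrete.
Variable R : realType.
Local Notation C := R[i].
Local Notation ii := ('i : C).

Lemma invmx_right n (X Y : 'M[C]_n) : X *m Y = 1%:M -> X \in unitmx /\ invmx X = Y.
Proof.
move=> h; have [uX _] := mulmx1_unit h; split=> //.
by rewrite -[invmx X]mulmx1 -h mulmxA mulVmx // mul1mx.
Qed.

Lemma adj_delta_sandwich n (X : 'M[C]_n) i :
  ((delta_mx i 0 : 'cV[C]_n)^t* *m X *m (delta_mx i 0 : 'cV[C]_n)) 0 0 = X i i.
Proof.
rewrite -mulmxA -colE mxE (bigD1 i) //= big1 ?addr0; last first.
  by move=> k ki; rewrite !mxE (negbTE ki) conjC0 mul0r.
by rewrite !mxE !eqxx conjC1 mul1r.
Qed.

Lemma psdmx_factor n (X : 'M[C]_n) : psdmx X -> exists d : 'M[C]_n, X = d^t* *m d.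
Proof.
move=> [/hermsymmx_herm hX pX]; have [U [d [hU1 hU2 eX _ _]]] := spectralP hX.
have d0 i : 0 <= d i.
  have := pX (U^t* *m delta_mx i 0); rewrite adjM adjK {1}eX.
  have -> : (delta_mx i 0)^t* *m U *m (U^t* *m diag_mx (\row_i (d i)%:C) *m U) *m (U^t* *m delta_mx i 0)
     = (delta_mx i 0)^t* *m diag_mx (\row_i (d i)%:C) *m delta_mx i 0 :> 'M[C]_1.
    by rewrite -!mulmxA (mulmxA U) hU2 mul1mx (mulmxA U) hU2 mul1mx.
  by rewrite adj_delta_sandwich !mxE eqxx mulr1n ler0c.
exists (dg (fun i => Num.sqrt (d i)) *m U); rewrite adjM adj_dg mulmxA -(mulmxA (U^t*)) dgM eX.
congr (_ *m _ *m _); apply/matrixP => i j; rewrite !mxE -expr2 sqr_sqrtr //.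
Qed.

Lemma psdmx_qf0 n (X : 'M[C]_n) x : psdmx X -> qf X x = 0 -> X *m x = 0.
Proof.
move=> /psdmx_factor [d ->]; rewrite /qf -mulmxA -(mulmxA (d^t*)) mulmxA -adjM -sqE => /eqP.
by rewrite sq_eq0 => /eqP ->; rewrite mulmx0.
Qed.

Lemma psdmx_qf_ge0 n (X : 'M[C]_n) x : psdmx X -> 0 <= qf X x.
Proof. by move=> [/hermsymmx_herm hX pX]; have := pX x; rewrite qf_herm // ler0c. Qed.

(** By [saddle_form], the left-hand side is the quotient [- d P^-1 d^H] with [Ni] the inverse of the
    shifted [F]; the right-hand side sorts it by the number of pole factors [D], as
    [normal_form_two_sided] expects. *)
Lemma schur_expand r n m (d1 d2 : 'M[C]_(r, n)) (Rg G : 'M[C]_n) (A : 'M[C]_(n, m))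
    (B : 'M[C]_(m, n)) (D : 'M[C]_m) : D^t* = D -> G^t* = G ->
  let Ni := Rg - A *m D *m B in let L := d2 *m B^t* - d1 *m Rg *m G *m B^t* in
  d1 *m Ni *m G *m Ni^t* *m d1^t* - d1 *m Ni *m d2^t* - d2 *m Ni^t* *m d1^t* =
  (d1 *m A) *m D *m (B *m G *m B^t*) *m D *m (d1 *m A)^t* + (d1 *m A) *m D *m L^t*
  + L *m D *m (d1 *m A)^t*
  + (d1 *m Rg *m G *m Rg^t* *m d1^t* - d1 *m Rg *m d2^t* - d2 *m Rg^t* *m d1^t*).
Proof.
move=> hD hG /=.
have -> : d1 *m (Rg - A *m D *m B) = d1 *m Rg - d1 *m A *m D *m B by rewrite mulmxBr !mulmxA.
have e : (d1 *m (Rg - A *m D *m B))^t* = (d1 *m Rg - d1 *m A *m D *m B)^t*.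
  by rewrite mulmxBr !mulmxA.
rewrite -!(mulmxA _ _ (d1^t*)) -!adjM e.
move: (d1 *m Rg) (d1 *m A) => u a.
have -> : (d2 *m B^t* - u *m G *m B^t*)^t* = B *m d2^t* - B *m (G *m u^t*).
  by rewrite adjB !adjM adjK hG.
have hv : (a *m D *m B)^t* = B^t* *m (a *m D)^t* by rewrite adjM.
have ev : D *m a^t* = (a *m D)^t* by rewrite adjM hD.
have -> : a *m D *m (B *m G *m B^t*) *m D *m a^t* = (a *m D *m B) *m G *m (a *m D *m B)^t*.
  by rewrite -(mulmxA _ D) ev hv !mulmxA.
have -> : a *m D *m (B *m d2^t* - B *m (G *m u^t*)) = (a *m D *m B) *m d2^t* - (a *m D *m B) *m G *m u^t*.
  by rewrite mulmxBr !mulmxA.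
have -> : (d2 *m B^t* - u *m G *m B^t*) *m D *m a^t* = d2 *m (a *m D *m B)^t* - u *m G *m (a *m D *m B)^t*.
  by rewrite -mulmxA ev mulmxBl hv !mulmxA.
move: (a *m D *m B) => v; rewrite (adjB u v) !(mulmxBl, mulmxBr).
by mx_atoms; mx_ring.
Qed.

Lemma inv_saddle n (N G : 'M[C]_n) : N \in unitmx ->
  block_mx 0 (N^t*) N G \in unitmx /\ invmx (block_mx 0 (N^t*) N G) =
   block_mx (- (invmx N *m G *m (invmx N)^t*)) (invmx N) ((invmx N)^t*) 0.
Proof.
move=> uN; apply: invmx_right; rewrite mulmx_block !mul0mx !mulmx0 !add0r !addr0 mulmxV //.
rewrite -adjM mulVmx // adj1 mulmxN !mulmxA mulmxV // mul1mx addNr.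
by rewrite -scalar_mx_block.
Qed.

Lemma saddle_form r n (N G : 'M[C]_n) (d1 d2 : 'M[C]_(r, n)) : N \in unitmx ->
  - (row_mx d1 d2 *m invmx (block_mx 0 (N^t*) N G) *m (row_mx d1 d2)^t*) =
  d1 *m invmx N *m G *m (invmx N)^t* *m d1^t* - d1 *m invmx N *m d2^t*
   - d2 *m (invmx N)^t* *m d1^t*.
Proof.
move=> uN; have [_ ->] := inv_saddle G uN.
rewrite adj_row_mx mul_row_block mul_row_col mulmx0 addr0 mulmxDl !mulmxN mulNmx !mulmxA.
mx_atoms; mx_ring.
Qed.

Lemma sort_index m (p : 'I_m -> nat) : exists f : 'I_m -> 'I_m, bijective f /\
  forall i j : 'I_m, (i <= j)%N -> (p (f j) <= p (f i))%N.
Proof.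
pose s := sort (fun i j => p j <= p i)%N (enum 'I_m).
have ss : size s = m by rewrite size_sort size_enum_ord.
have us : uniq s by rewrite sort_uniq enum_uniq.
have so : sorted (fun i j => p j <= p i)%N s by apply: sort_sorted => i j; exact: leq_total.
pose f (i : 'I_m) := nth i s i.
have lt (i : 'I_m) : (i < size s)%N by rewrite ss.
have fE (x i : 'I_m) : f i = nth x s i by apply: set_nth_default.
exists f; split.
  apply: injF_bij => i j; rewrite (fE i j) => /eqP; rewrite nth_uniq // => /eqP.
  exact: ord_inj.
move=> i j ij; rewrite (fE i j).
apply: (sorted_leq_nth _ _ i so) => //; first by move=> a b c /= h1 h2; exact: leq_trans h2 h1.
by rewrite inE. by rewrite inE.
Qed.

End Concrete.

(** * The normal form of the Hermitian quotient of the pencil *)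

Section ConcreteNormalForm.
Variable R : realType.
Local Notation C := R[i].
Local Notation ii := ('i : C).

Lemma C11_unit_near n (A : R -> 'M[C]_n) : C11 A -> A 0 \in unitmx ->
  exists2 e : R, 0 < e & forall x, `|x| < e -> A x \in unitmx.
Proof.
move=> [e [K [A1 [e0 K0 h]]]] /unitmx_near [d [K' [d0 hd]]].
have K1 : 0 < K + 1 by rewrite ltr_wpDl.
exists (Num.min e (d / (K + 1))); first by rewrite lt_min e0 divr_gt0.
move=> x; rewrite lt_min ltr_pdivlMr // => /andP[xe xd].
have [_ _ _ hx] := h x xe; have [//|//] := hd (A x); apply: le_lt_trans hx _.
by apply: le_lt_trans xd; rewrite mulrC ler_wpM2l // lerDl.
Qed.

Lemma full_rank_inj m n (M : 'M[C]_(m, n)) (u : 'cV[C]_n) :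
  \rank M = n -> M *m u = 0 -> u = 0.
Proof.
move=> rM /(congr1 trmx); rewrite trmx_mul trmx0 => /eqP.
have fM : row_free M^T by rewrite /row_free mxrank_tr rM.
by rewrite mulmx_free_eq0 // trmx_eq0 => /eqP.
Qed.

Lemma full_rank_inj' m n (M : 'M[C]_(m, n)) (u : 'rV[C]_m) :
  \rank M = m -> u *m M = 0 -> u = 0.
Proof.
move=> rM /eqP; have fM : row_free M by rewrite /row_free rM.
by rewrite mulmx_free_eq0 // => /eqP.
Qed.

Definition reidx m (f : 'I_m -> 'I_m) : 'M[C]_m := \matrix_(i, j) (i == f j)%:R.

Lemma mul_reidx n m f (A : 'M[C]_(n, m)) i j : (A *m reidx f) i j = A i (f j).
Proof.
rewrite mxE (bigD1 (f j)) //= mxE eqxx mulr1 big1 ?addr0 // => k kj.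
by rewrite mxE (negbTE kj) mulr0.
Qed.

Lemma reidx_unitary m (f : 'I_m -> 'I_m) : bijective f ->
  (reidx f)^t* *m reidx f = 1%:M /\ reidx f *m (reidx f)^t* = 1%:M.
Proof.
move=> bf; suff h : (reidx f)^t* *m reidx f = 1%:M by split=> //; exact: mulmx1C.
apply/matrixP => i j; rewrite mul_reidx !mxE (bij_eq bf) eq_sym.
by case: (i == j); rewrite ?conjC1 ?conjC0.
Qed.

Lemma Dinv_reidx m (p : 'I_m -> nat) (f : 'I_m -> 'I_m) x : bijective f ->
  reidx f *m Dinv (p \o f) x *m (reidx f)^t* = Dinv p x.
Proof.
move=> bf; have [_ h] := reidx_unitary bf.
suff -> : reidx f *m Dinv (p \o f) x = Dinv p x *m reidx f by rewrite -mulmxA h mulmx1.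
apply/matrixP => i j; rewrite mul_mx_dg mul_reidx !mxE eq_sym.
by case: eqP => [<-|_]; rewrite ?mul1r ?mul0r ?mulr1n.
Qed.

Definition inl1 n1 n2 : 'M[C]_(n1 + n2, n1) := col_mx 1%:M 0.
Definition inr1 n1 n2 : 'M[C]_(n1 + n2, n2) := col_mx 0 1%:M.

Lemma inl1_sandwich n1 n2 (M : 'M[C]_n1) :
  inl1 n1 n2 *m M *m (inl1 n1 n2)^t* = block_mx M 0 0 0.
Proof.
by rewrite /inl1 adj_col_mx adj1 adj0 mul_col_mx mul_col_row !(mulmx1, mulmx0, mul1mx, mul0mx).
Qed.

Lemma inr1_sandwich n1 n2 (M : 'M[C]_n2) :
  inr1 n1 n2 *m M *m (inr1 n1 n2)^t* = block_mx 0 0 0 M.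
Proof.
by rewrite /inr1 adj_col_mx adj1 adj0 mul_col_mx mul_col_row !(mulmx1, mulmx0, mul1mx, mul0mx).
Qed.

Lemma ulsubmx_sandwich n1 n2 (M : 'M[C]_(n1 + n2)) :
  ulsubmx M = (inl1 n1 n2)^t* *m M *m inl1 n1 n2.
Proof.
rewrite -{2}[M]submxK /inl1 adj_col_mx adj1 adj0 mul_row_block mul_row_col.
by rewrite !mul1mx !mul0mx mulmx0 !addr0 mulmx1.
Qed.

Lemma mul_inl1 r n1 n2 (M : 'M[C]_(r, n1 + n2)) : M *m inl1 n1 n2 = lsubmx M.
Proof. by rewrite -{1}[M]hsubmxK mul_row_col mulmx1 mulmx0 addr0. Qed.

Lemma schur_rest_herm r n (d1 d2 : 'M[C]_(r, n)) (X G : 'M[C]_n) : herm G ->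
  herm (d1 *m X *m G *m X^t* *m d1^t* - d1 *m X *m d2^t* - d2 *m X^t* *m d1^t*).
Proof.
move=> hG; rewrite -!(mulmxA _ _ (d1^t*)) -adjM; move: (d1 *m X) => u.
have := herm_congr' u hG; have : (u *m d2^t*)^t* = d2 *m u^t* by rewrite adjM adjK.
have : (d2 *m u^t*)^t* = u *m d2^t* by rewrite adjM adjK.
move: (u *m G *m u^t*) (u *m d2^t*) (d2 *m u^t*) => a b c h1 h2 h3.
by rewrite /herm adjB adjB h1 h2 h3 addrAC.
Qed.

Section Setting.
Variables (n1 n2 : nat) (F11 G11 : 'M[C]_n1) (F22 G22 : 'M[C]_n2) (z0 : C).
Let n := (n1 + n2)%N.
Let Gm : 'M[C]_n := block_mx G11 0 0 G22.

Definition shiftF (x : R) : 'M[C]_n := block_mx F11 0 0 F22 - (z0 + ii * x%:C)%:M.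
(** For imaginary [z0] this is [P(x, 0) = - J (H(0) - z0 - i x)], as shown in [Hbase_shift]. *)
Definition saddle (x : R) : 'M[C]_(n + n) := block_mx 0 ((shiftF x)^t*) (shiftF x) Gm.

Lemma shiftF_block x :
  shiftF x = block_mx (F11 - (z0 + ii * x%:C)%:M) 0 0 (F22 - (z0 + ii * x%:C)%:M).
Proof. by rewrite /shiftF scalar_mx_block opp_block_mx add_block_mx !subr0. Qed.

Variables (d : 'M[C]_(n + n)) (m : nat) (p : 'I_m -> nat).
Variables (P : 'M[C]_(n1, \sum_i p i)) (Z : 'M[C]_(\sum_i p i, n1)).
Hypothesis hG : psdmx Gm.
Hypothesis hctrl : controllable F11 G11.
Hypothesis hobs : observable F11 (D11 (d^t* *m d)).
Hypothesis uF22 : F22 - z0%:M \in unitmx.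
Hypothesis p0 : forall i, (0 < p i)%N.
Hypothesis PZ : P *m Z = 1%:M.
Hypothesis ZP : Z *m P = 1%:M.
Hypothesis FE : F11 = P *m \mxdiag_i jordan_block z0 (p i) *m Z.

Let N22 (x : R) := F22 - (z0 + ii * x%:C)%:M.

Lemma C11_N22 : C11 N22.
Proof.
have -> : N22 = fun x => (F22 - z0%:M) - x%:C *: ii%:M.
  by apply/funext => x; rewrite /N22 raddfD /= opprD addrA scale_scalar_mx mulrC.
by apply: C11B (C11_const _) (C11_id _).
Qed.

Lemma N22_0 : N22 0 \in unitmx.
Proof. by rewrite /N22 mulr0 addr0. Qed.

Let A0 x := inl1 n1 n2 *m resA P x.
Let B0 x := resB Z x *m (inl1 n1 n2)^t*.
Let Rg x := inl1 n1 n2 *m resR P Z x *m (inl1 n1 n2)^t*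
   + inr1 n1 n2 *m invmx (N22 x) *m (inr1 n1 n2)^t*.

Lemma shiftF_inv : exists2 e : R, 0 < e & forall x, 0 < `|x| < e ->
  shiftF x \in unitmx /\ invmx (shiftF x) = Rg x - A0 x *m Dinv p x *m B0 x.
Proof.
have [e e0 he] := C11_unit_near C11_N22 N22_0; exists e => // x /andP[x0 xe].
apply: invmx_right; have -> : Rg x - A0 x *m Dinv p x *m B0 x =
   block_mx (resR P Z x - resA P x *m Dinv p x *m resB Z x) 0 0 (invmx (N22 x)).
  have -> : A0 x *m Dinv p x *m B0 x =
     inl1 n1 n2 *m (resA P x *m Dinv p x *m resB Z x) *m (inl1 n1 n2)^t*.
    by rewrite /A0 /B0 !mulmxA.
  rewrite /Rg !inl1_sandwich inr1_sandwich opp_block_mx !add_block_mx.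
  by rewrite !oppr0 !addr0 !add0r.
rewrite shiftF_block mulmx_block !mulmx0 !mul0mx !addr0 !add0r.
rewrite (jordan_resolvent PZ ZP FE) -?normr_gt0 // mulmxV ?he //.
by rewrite -scalar_mx_block.
Qed.

Lemma G11_herm : herm G11.
Proof.
have [/hermsymmx_herm] := hG; rewrite /herm adj_block => /(congr1 ulsubmx).
by rewrite !block_mxKul.
Qed.

Lemma saddle_normal_form : exists (p' : 'I_m -> nat) (g : 'I_m -> R) (e : R),
  [/\ 0 < e, forall j, 0 < g j,
     forall r : nat, #|[pred j | p' j == r]| = #|[pred j | p j == r]|,
     forall x, 0 < `|x| < e -> shiftF x \in unitmx &
     let Q x := - (d *m invmx (saddle x) *m d^t*) in
     normal_form Q p' g /\ normal_form (fun x => Q (- x)) p' g].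
Proof.
(* The permutation [f] lists the Jordan blocks by nonincreasing size, the order in which lower
   triangular Cholesky factors are compatible with [D]. *)
have [e e0 he] := shiftF_inv; have [f [bf sf]] := sort_index p.
have [S1 S2] := reidx_unitary bf; set S := reidx f in S1 S2.
have hGh : Gm^t* = Gm by have [/hermsymmx_herm] := hG.
pose d1 := lsubmx d; pose d2 := rsubmx d.
pose A x := A0 x *m S; pose B x := S^t* *m B0 x.
have cA : C11 A by apply: C11M (C11_const _); apply: C11M (C11_resA _); exact: C11_const.
have cB : C11 B by apply: C11M; [exact: C11_const|]; apply: C11M (C11_const _); exact: C11_resB.
have cR : C11 Rg.
  apply: C11D; apply: C11M (C11_const _); apply: C11M; first exact: C11_const.
  - exact: C11_resR.
  - exact: C11_const.
  - exact: C11_inv C11_N22 N22_0.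
have cc (r q : nat) (X : 'M[C]_(r, q)) : C11 (fun=> X) by exact: C11_const.
pose p1 := p \o f.
have [|||||||||||p' [g [g0 cp nf1 nf2]]] := @normal_form_two_sided _ (n + n) m
  (fun x => - (d *m invmx (saddle x) *m d^t*)) (fun x => d1 *m A x)
  (fun x => d2 *m (B x)^t* - d1 *m Rg x *m Gm *m (B x)^t*)
  (fun x => B x *m Gm *m (B x)^t*)
  (fun x => d1 *m Rg x *m Gm *m (Rg x)^t* *m d1^t* - d1 *m Rg x *m d2^t* - d2 *m (Rg x)^t* *m d1^t*)
  p1 e e0.
- exact: C11M.
- by apply: C11B; [exact: C11M (cc _ _ _) (C11_adj cB) |
    exact: C11M (C11M (C11M (cc _ _ _) cR) (cc _ _ _)) (C11_adj cB)].
- exact: C11M (C11M cB (cc _ _ _)) (C11_adj cB).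
- apply: C11B; [apply: C11B|].
  + exact: C11M (C11M (C11M (C11M (cc _ _ _) cR) (cc _ _ _)) (C11_adj cR)) (cc _ _ _).
  + exact: C11M (C11M (cc _ _ _) cR) (cc _ _ _).
  + exact: C11M (C11M (cc _ _ _) (C11_adj cR)) (cc _ _ _).
- by move=> x _; exact: herm_congr'.
- by move=> x _; exact: schur_rest_herm.
- move=> x xe; have [ux ix] := he x xe.
  rewrite -(hsubmxK d) saddle_form // ix -(Dinv_reidx p x bf) -/S.
  have -> : A0 x *m (S *m Dinv (p \o f) x *m S^t*) *m B0 x = A x *m Dinv p1 x *m B x.
    by rewrite /A /B !mulmxA.
  exact: (schur_expand _ _ _ _ _ (adj_dg _) hGh).
- by move=> j; exact: p0.
- exact: sf.
(* Observability: [u] satisfies the eigenvector equation of [F11], and [d1] annihilates its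
   embedding, hence [D11] annihilates [u]. *)
- move=> c; rewrite /A /A0 -!mulmxA; set u := resA P 0 *m (S *m c) => hu.
  have u0 : u = 0.
    apply: (full_rank_inj (hobs z0)); rewrite mul_col_mx mulmxBl mul_scalar_mx.
    rewrite (resA_eigen p0 ZP FE) subrr (_ : D11 _ *m u = 0) ?col_mx0 //.
    rewrite /D11 !ulsubmx_sandwich -!mulmxA (mulmxA d) mul_inl1 -/d1 hu.
    by rewrite !mulmx0.
  have /(congr1 (mulmx (S^t*))) := resA_inj p0 ZP u0.
  by rewrite mulmxA S1 mul1mx mulmx0.
(* Controllability: if the form vanished at [c], then [r *m resB Z 0] would satisfy the left
   eigenvector equation of [F11] and be annihilated by [G11]. *)
- move=> c c0; rewrite -{1}(adjK (B 0)) qf_congr lt_neqAle psdmx_qf_ge0 // andbT.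
  apply/negP => /eqP/esym/(psdmx_qf0 hG) h.
  pose r := c^t* *m S^t*.
  have r0 : r *m resB Z 0 = 0.
    apply: (full_rank_inj' (hctrl z0)); rewrite mul_mx_row mulmxBr mul_mx_scalar.
    rewrite (resB_eigen p0 ZP FE) subrr (_ : _ *m G11 = 0) ?row_mx0 //.
    rewrite -[LHS]adjK adjM G11_herm (adjM r).
    have hBc : (B 0)^t* *m c = inl1 n1 n2 *m ((resB Z 0)^t* *m r^t*).
      by rewrite (adjM (S^t*)) (adjM (resB Z 0)) (adjM (c^t*)) !adjK !mulmxA.
    have -> : G11 = (inl1 n1 n2)^t* *m Gm *m inl1 n1 n2.
      by rewrite -ulsubmx_sandwich block_mxKul.
    rewrite -mulmxA -hBc -mulmxA.
    by rewrite h mulmx0 adj0.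
  have := resB_inj p0 ZP r0; rewrite /r -adjM => /(congr1 (fun X : 'rV[C]_m => S^t* *m X^t*)).
  rewrite adjK mulmxA S1 mul1mx adj0 mulmx0 => e1; by rewrite e1 eqxx in c0.
exists p', g, e; split=> // [r|x xe]; last by have [] := he x xe.
rewrite cp; have [f' fK f'K] := bf.
rewrite -(fintype.card_image (bij_inj bf)); apply: eq_card => j.
apply/fintype.imageP/idP => [[i hi ->]|hj]; first by [].
by exists (f' j); rewrite ?f'K // inE /= /p1 /= f'K.
Qed.

End Setting.
End ConcreteNormalForm.

(** * Semisimplicity by elimination in two variables *)

Section Semisimple.
Variable R : realType.
Local Notation C := R[i].
Local Notation ii := ('i : C).

Definition ev2 (q : {poly {poly C}}) (z t : C) : C := q.[t%:P].[z].

Lemma ev2M p q z t : ev2 (p * q) z t = ev2 p z t * ev2 q z t.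
Proof. by rewrite /ev2 !hornerM. Qed.

Lemma ev2D p q z t : ev2 (p + q) z t = ev2 p z t + ev2 q z t.
Proof. by rewrite /ev2 !hornerD. Qed.

(* Elements of [{poly {poly C}}] are polynomials in [t] whose coefficients are
   polynomials in the eigenvalue parameter, the variable of this derivative. *)
Definition dinner (q : {poly {poly C}}) : {poly {poly C}} := map_poly (@deriv C) q.

Lemma dinner_horner q (t : C) : (dinner q).[t%:P] = deriv (q.[t%:P]).
Proof.
rewrite (horner_coef_wide _ (size_poly _ _)) horner_coef linear_sum; apply: eq_bigr => i _.
by rewrite coef_map_id0 ?linear0 //= -polyC_exp derivM derivC mulr0 addr0.
Qed.

Lemma ev2_spec q (z t : C) : (map_poly (horner_eval z) q).[t] = ev2 q z t.
Proof.
have {1}-> : t = horner_eval z t%:P by rewrite /horner_eval hornerC.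
by rewrite horner_map.
Qed.

Variable z0 : C.
Definition pt (x : R) : C := z0 + ii * x%:C.

Lemma pt_inj : injective pt.
Proof. by move=> x y /addrI /(mulfI (ii_neq0 R)) /complexI. Qed.

Lemma line_zero (p : {poly C}) : (forall x, p.[pt x] = 0) -> p = 0.
Proof.
move=> h; apply/eqP; apply: contraT => p0.
have := @max_poly_roots _ p [seq pt n%:R | n <- iota 0 (size p)] p0.
rewrite size_map size_iota ltnn => H; apply: H.
  by apply/allP => _ /mapP [n _ ->]; rewrite rootE h.
rewrite map_inj_uniq ?iota_uniq // => a b /pt_inj /eqP; rewrite eqr_nat => /eqP //.
Qed.

(** The zeros of [b] are the exceptional points of the line; they are allowed because the reductions
    of [q] below may lose finitely many of them. *)
Definition vanishes_on (f q : {poly {poly C}}) := exists2 b : {poly C}, b != 0 &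
  forall x t, b.[pt x] != 0 -> ev2 f (pt x) t = 0 -> ev2 q (pt x) t = 0.

(** Let [z] have multiplicity [k + 1] in [p], hence [k] in its derivative. If [w] did not vanish at
    [z], then the power [k + 1] of the linear factor would divide [h] and so the derivative.
    Removing a common factor of [p] and its derivative thus keeps every root. *)
Lemma multiple_root_drop (p h w y c c' : {poly C}) z : p != 0 ->
  c * p = w * h -> c' * deriv p = y * h -> c'.[z] != 0 -> p.[z] = 0 -> w.[z] = 0.
Proof.
move=> p0 e1 e2 c'z pz; apply/eqP; apply: contraT => wz.
have [k [p1 p1z pE]] := multiplicity_XsubC p z; rewrite p0 /= in p1z.
case: k pE => [|k] pE.
  by move: pz p1z; rewrite pE expr0 mulr1 => h0; rewrite rootE h0 eqxx.
have dh : ('X - z%:P) ^+ k.+1 %| h.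
  have : ('X - z%:P) ^+ k.+1 %| w * h by rewrite -e1 pE mulrA dvdp_mull.
  by rewrite Gauss_dvdpr // coprimep_expl // coprimep_sym coprimep_XsubC rootE.
have : ('X - z%:P) ^+ k.+1 %| c' * deriv p by rewrite e2 dvdp_mull.
have -> : deriv p = (deriv p1 * ('X - z%:P) + p1 *+ k.+1) * ('X - z%:P) ^+ k.
  by rewrite pE derivM deriv_exp derivXsubC mul1r mulrDl -mulrA -exprS mulrnAl mulrnAr.
rewrite exprS mulrA dvdp_mul2r ?expf_neq0 ?polyXsubC_eq0 // dvdp_XsubCl rootE.
rewrite hornerM mulf_eq0 (negbTE c'z) /= hornerD hornerM hornerXsubC subrr mulr0 add0r.
by rewrite hornerMn -mulr_natr mulf_eq0 pnatr_eq0 orbF -rootE (negbTE p1z).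
Qed.

Lemma diag_resolvent s (U Ua : 'M[{poly C}]_s) (th v : 'I_s -> {poly C}) (q0 x : {poly C}) :
  U *m Ua = 1%:M -> Ua *m U = 1%:M -> (forall j, v j * (1 - x * th j) = q0) ->
  let V := Ua *m diag_mx (\row_j v j) *m U in
  V - x *: (Ua *m diag_mx (\row_j th j) *m U *m V) = q0%:M.
Proof.
move=> U2 U1 hv /=.
have -> : Ua *m diag_mx (\row_j th j) *m U *m (Ua *m diag_mx (\row_j v j) *m U) =
    Ua *m (diag_mx (\row_j th j) *m diag_mx (\row_j v j)) *m U.
  by rewrite !mulmxA -(mulmxA _ U Ua) U2 mulmx1.
rewrite scalemxAl scalemxAr -mulmxBl -mulmxBr.
have -> : diag_mx (\row_j v j) - x *: (diag_mx (\row_j th j) *m diag_mx (\row_j v j)) = q0%:M.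
  apply/matrixP => a b; rewrite mul_diag_mx !mxE -(hv a).
  by case: (a == b); rewrite ?mulr1n ?mulr0n ?mulr0 ?subr0 //; ring.
by rewrite mul_mx_scalar -scalemxAl U1 scalemx1.
Qed.

(** The Woodbury formula cleared of denominators: [V] stands for [q0] times the inverse of
    [1 - x Q], and the result is [q0] times the inverse of [Em - x Y d]. *)
Lemma woodbury s (Em Ei Y d Q V : 'M[{poly C}]_s) (q0 x : {poly C}) :
  Em *m Ei = 1%:M -> d *m Ei *m Y = Q -> V - x *: (Q *m V) = q0%:M ->
  (Em - x *: (Y *m d)) *m ((q0%:M + x *: (Ei *m Y *m V *m d)) *m Ei) = q0%:M.
Proof.
move=> eEi eQ hV; rewrite mulmxA.
suff -> : (Em - x *: (Y *m d)) *m (q0%:M + x *: (Ei *m Y *m V *m d)) = q0 *: Em.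
  by rewrite -scalemxAl eEi scalemx1.
have eq : Y *m d *m (Ei *m Y *m V *m d) = Y *m Q *m V *m d by rewrite -eQ !mulmxA.
have eq' : Em *m (Ei *m Y *m V *m d) = Y *m V *m d by rewrite !mulmxA eEi mul1mx.
have eV : Y *m V *m d = q0 *: (Y *m d) + x *: (Y *m Q *m V *m d).
  rewrite -{1}(subrK (x *: (Q *m V)) V) hV mulmxDr mulmxDl mul_mx_scalar -!scalemxAl.
  by rewrite -scalemxAr -scalemxAl !mulmxA.
rewrite mulmxDr mul_mx_scalar mulmxBl -!scalemxAr -!scalemxAl eq eq' eV.
move: (Y *m Q *m V *m d) (Y *m d) => X1 X2.
by apply/matrixP => a b; rewrite !mxE; ring.
Qed.

(** Induction on the degree in [t]. A factor [t - t0] of [q] can be removed, since [f] at [t0] is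
    nonzero and only adds exceptional points. Once no such factor is left, [q] is a nonzero
    polynomial in the eigenvalue parameter for each [t], and dividing by a common factor with its
    derivative loses no root, by [multiple_root_drop]. *)
Lemma vanishes_reduce (f : {poly {poly C}}) : (forall t : C, f.[t%:P] != 0) ->
  forall q, q != 0 -> vanishes_on f q ->
  exists q', [/\ q' != 0, vanishes_on f q' & coprimep q' (dinner q')].
Proof.
move=> hf q; have [n] := ubnP (size q); elim: n q => // n IH q; rewrite ltnS => sq q0 [b b0 hq].
have [[t0 ht0]|ht] := pselect (exists t : C, q.[t%:P] = 0).
  have /factor_theorem [w qE] : root q t0%:P by rewrite rootE ht0.
  have w0 : w != 0 by apply: contraNneq q0 => w0; rewrite qE w0 mul0r.
  apply: (IH w) => //.
    apply: leq_trans sq; rewrite qE size_mul ?polyXsubC_eq0 // size_XsubC addn2 //=.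
  exists (b * f.[t0%:P]); first by rewrite mulf_neq0 ?hf.
  move=> x t; rewrite hornerM mulf_eq0 negb_or => /andP[bx fx] ft; apply/eqP.
  have := hq x t bx ft; rewrite qE ev2M => /eqP; rewrite mulf_eq0 => /orP[//|].
  rewrite /ev2 hornerXsubC -polyCB hornerC subr_eq0 => /eqP e.
  by move: fx; rewrite -e -/(ev2 f (pt x) t) ft eqxx.
have [cp|ncp] := boolP (coprimep q (dinner q)); first by exists q; split=> //; exists b.
pose h := gcdp q (dinner q).
have h0 : h != 0 by rewrite gcdp_eq0 negb_and q0.
have /Pdiv.Idomain.dvdpP [[c w] /= c0 e1] : h %| q := dvdp_gcdl _ _.
have /Pdiv.Idomain.dvdpP [[c' y] /= c'0 e2] : h %| dinner q := dvdp_gcdr _ _.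
have w0 : w != 0.
  apply: contraNneq q0 => w0; move: e1; rewrite w0 mul0r => /eqP.
  by rewrite -mul_polyC mulf_eq0 polyC_eq0 (negbTE c0).
apply: (IH w) => //.
  apply: leq_trans sq; have := congr1 (fun p : {poly {poly C}} => size p) e1.
  rewrite size_scale // size_mul // => ->.
  have : (1 < size h)%N by rewrite ltn_neqAle eq_sym ncp lt0n size_poly_eq0.
  by case: (size h) => [|[|m]] // _; rewrite !addnS ltnS leq_addr.
exists (b * c'); first by rewrite mulf_neq0.
move=> x t; rewrite hornerM mulf_eq0 negb_or => /andP[bx cx] ft.
apply: (@multiple_root_drop q.[t%:P] h.[t%:P] w.[t%:P] y.[t%:P] c c' (pt x)) => //.
- by apply/eqP => e; apply: ht; exists t.
- by rewrite -hornerM -e1 hornerZ.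
- by rewrite -hornerM -e2 hornerZ dinner_horner.
exact: hq.
Qed.

(** The Hermitian matrix [d Em^-1 Y] is diagonalizable, so the poles in [t] of the inverse pencil
    are simple. Each nonzero eigenvalue [th j] gives a zero [t = 1 / th j] of the determinant, where
    [q0] vanishes; hence [q0] cancels all poles. *)
Lemma line_resolvent s (Em Y d : 'M[C]_s) (q0 : {poly C}) : Em \in unitmx ->
  herm (d *m invmx Em *m Y) -> (forall t, \det (Em - t *: (Y *m d)) = 0 -> q0.[t] = 0) ->
  exists W : 'M[{poly C}]_s,
    (map_mx polyC Em - 'X *: map_mx polyC (Y *m d)) *m W = q0%:M.
Proof.
move=> uE hQ hq; have [U [th [U1 U2 eQ _ _]]] := spectralP hQ.
have /fin_all_exists [v hv] j : exists v : {poly C}, v * (1 - (th j)%:C *: 'X) = q0.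
  have [->|thj] := eqVneq (th j) 0; first by exists q0; rewrite scale0r subr0 mulr1.
  have thc : (th j)%:C != 0 :> C by rewrite fmorph_eq0.
  pose y := U^t* *m delta_mx j 0 : 'cV[C]_s.
  have y0 : y != 0.
    apply/negP => /eqP /(congr1 (mulmx U)); rewrite mulmxA U2 mul1mx mulmx0.
    by move=> /matrixP /(_ j 0) /eqP; rewrite !mxE !eqxx oner_eq0.
  have Qy : d *m invmx Em *m Y *m y = (th j)%:C *: y.
    rewrite eQ -!mulmxA (mulmxA U) U2 mul1mx scalemxAr; congr (_ *m _).
    by apply/matrixP => a b; rewrite mul_diag_mx !mxE; case: eqP => [->|]; rewrite ?mulr0.
  pose u := invmx Em *m Y *m y.
  have du : d *m u = (th j)%:C *: y by rewrite -Qy !mulmxA.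
  have : q0.[(th j)%:C^-1] = 0.
    apply: hq; apply/eqP; apply: contraT => dn0.
    have un : Em - (th j)%:C^-1 *: (Y *m d) \in unitmx by rewrite unitmxE unitfE.
    have : u = 0.
      apply: (unitmx_inj un); rewrite mulmxBl -scalemxAl -mulmxA du -scalemxAr scalerA.
      by rewrite mulVf // scale1r /u !mulmxA mulmxV // mul1mx subrr.
    move=> u0; have := du; rewrite u0 mulmx0 => /esym/eqP.
    by rewrite scaler_eq0 (negbTE thc) (negbTE y0).
  move=> /eqP; rewrite -rootE => /factor_theorem [w ->].
  exists (- (th j)%:C^-1 *: w); rewrite -scalerAl scalerAr; congr (_ * _).
  by rewrite scaleNr scalerBr scalerA mulVf // scale1r opprB alg_polyC.
pose cU := map_mx polyC U; pose cUa := map_mx polyC (U^t*).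
have hV : let V := cUa *m diag_mx (\row_j v j) *m cU in
    V - 'X *: (cUa *m diag_mx (\row_j (th j)%:C%:P) *m cU *m V) = q0%:M.
  apply: diag_resolvent => [||j]; rewrite -?map_mxM ?U1 ?U2 ?map_mx1 //.
  by rewrite -(hv j) mulrC -mul_polyC ['X * _]mulrC mulrC.
have eQ' : map_mx polyC d *m map_mx polyC (invmx Em) *m map_mx polyC Y =
   cUa *m diag_mx (\row_j (th j)%:C%:P) *m cU.
  rewrite -!map_mxM eQ !map_mxM; congr (_ *m _ *m _).
  by apply/matrixP => a b; rewrite !mxE; case: (a == b).
have eEi : map_mx polyC Em *m map_mx polyC (invmx Em) = 1%:M.
  by rewrite -map_mxM mulmxV // map_mx1.
rewrite map_mxM.
exact: ex_intro (woodbury eEi eQ' hV).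
Qed.

Lemma poly_punctured (p : {poly C}) : p != 0 ->
  exists2 r : R, 0 < r & forall z, 0 < cabs (z - z0) < r -> p.[z] != 0.
Proof.
move=> p0; have [rs pE] := closed_field_poly_normal p.
exists (\big[Num.min/1]_(x <- rs | x != z0) cabs (x - z0)).
  elim/big_ind: _ => // [x y x0 y0|x xz]; first by rewrite lt_min x0.
  by rewrite cabs_gt0 subr_eq0.
move=> z /andP[z1 z2]; apply/negP => /eqP pz.
have zr : z \in rs.
  have : root p z by rewrite rootE pz.
  by rewrite pE rootZ ?lead_coef_eq0 // root_prod_XsubC.
have : \big[Num.min/1]_(x <- rs | x != z0) cabs (x - z0) <= cabs (z - z0).
  have zz : z != z0 by rewrite -subr_eq0 -cabs_gt0.
  elim: (rs) zr => // x xs IH; rewrite inE big_cons => /orP[/eqP<-|/IH h].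
    by rewrite zz ge_min lexx.
  by case: ifP => // _; rewrite ge_min h orbT.
by rewrite leNgt z2.
Qed.

Section Pencil.
Variables (s : nat) (A B Y d : 'M[C]_s).
Hypothesis hB : B = Y *m d.
Hypothesis hherm : forall x, (pt x)%:M - A \in unitmx ->
  herm (d *m invmx ((pt x)%:M - A) *m Y).

Let D := {poly C}.
Definition pencil : 'M[{poly D}]_s :=
  map_mx polyC (char_poly_mx A) - 'X *: map_mx polyC (map_mx polyC B).
Let f := \det pencil.

Lemma pencil_inner (t : C) :
  map_mx (horner_eval t%:P) pencil = char_poly_mx (A + t *: B).
Proof.
apply/matrixP => i j; rewrite !mxE /horner_eval !(hornerE, hornerC, hornerX).
by rewrite polyCD polyCM mulrC; ring.
Qed.

Lemma pencil_outer (z : C) :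
  map_mx (map_poly (horner_eval z)) pencil =
  map_mx polyC (z%:M - A) - 'X *: map_mx polyC B.
Proof.
apply/matrixP => i j; rewrite !mxE rmorphB rmorphM /= map_polyX !map_polyC /= /horner_eval.
by rewrite !hornerE hornerMn hornerX.
Qed.

Lemma det_pencil_inner (t : C) : f.[t%:P] = char_poly (A + t *: B).
Proof.
have -> : f.[t%:P] = horner_eval t%:P f by [].
by rewrite -det_map_mx pencil_inner.
Qed.

Lemma char_poly_mx_eval (H : 'M[C]_s) z : map_mx (horner_eval z) (char_poly_mx H) = z%:M - H.
Proof.
rewrite /char_poly_mx map_mxB map_scalar_mx /= /horner_eval hornerX; congr (_ - _).
by apply/matrixP => i j; rewrite !mxE hornerC.
Qed.

Lemma ev2_det_pencil z t : ev2 f z t = \det (z%:M - A - t *: B).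
Proof.
rewrite /ev2 det_pencil_inner /char_poly -[LHS]/(horner_eval z _) -det_map_mx char_poly_mx_eval.
by rewrite opprD addrA.
Qed.

(** Let [r] be the remainder of the division by [f]. At all points of the line but finitely many,
    [line_resolvent] makes the specialized [f] divide the specialized [r], whose degree in [t] is
    smaller, so [r] vanishes there. Its coefficients then have infinitely many zeros. *)
Lemma pencil_dvd q (b : D) i j : q != 0 -> b != 0 ->
  (forall x t, b.[pt x] != 0 -> ev2 f (pt x) t = 0 -> ev2 q (pt x) t = 0) ->
  f %| q * \adj pencil i j.
Proof.
move=> q0 b0 hq.
have f0 : f != 0.
  apply: contraNneq (monic_neq0 (char_poly_monic (A + 0 *: B))) => e.
  by rewrite -det_pencil_inner e horner0.
set p := q * _; pose r := p %% f.
have spr x : (b * lead_coef f * char_poly A).[pt x] != 0 -> map_poly (horner_eval (pt x)) r = 0.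
  rewrite !hornerM !mulf_eq0 !negb_or -andbA => /and3P[bx lx ax].
  have uE : (pt x)%:M - A \in unitmx.
    rewrite unitmxE unitfE; move: ax; rewrite /char_poly -[_.[_]]/(horner_eval (pt x) _) -det_map_mx.
    by rewrite char_poly_mx_eval.
  have [|W0] := @line_resolvent s _ Y d (map_poly (horner_eval (pt x)) q) uE (hherm uE).
    by move=> t; rewrite -hB -ev2_det_pencil ev2_spec; exact: hq.
  rewrite -hB -pencil_outer => /(congr1 (mulmx (\adj (map_mx (map_poly (horner_eval (pt x))) pencil)))).
  rewrite mulmxA mul_adj_mx mul_scalar_mx mul_mx_scalar det_map_mx -map_mx_adj => /matrixP /(_ i j).
  rewrite mxE [RHS]mxE [map_mx _ (\adj pencil) i j]mxE => eW.
  have sf : size (map_poly (horner_eval (pt x)) f) = size f by rewrite size_map_poly_id0.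
  apply/eqP; apply: contraT => r0.
  have : map_poly (horner_eval (pt x)) f %| map_poly (horner_eval (pt x)) r.
    have ep : map_poly (horner_eval (pt x)) p = map_poly (horner_eval (pt x)) f * W0 i j.
      by rewrite eW -rmorphM.
    have e : map_poly (horner_eval (pt x)) (lead_coef f ^+ scalp p f)%:P * map_poly (horner_eval (pt x)) p =
        map_poly (horner_eval (pt x)) (p %/ f) * map_poly (horner_eval (pt x)) f + map_poly (horner_eval (pt x)) r.
      by rewrite -!rmorphM -rmorphD mul_polyC Pdiv.Idomain.divp_eq.
    rewrite ep in e.
    have -> : map_poly (horner_eval (pt x)) r = map_poly (horner_eval (pt x)) f *
        (map_poly (horner_eval (pt x)) (lead_coef f ^+ scalp p f)%:P * W0 i j
         - map_poly (horner_eval (pt x)) (p %/ f)).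
      by rewrite mulrBr mulrCA e [X in _ - X]mulrC addrC addKr.
    by rewrite dvdp_mulr.
  move=> /(dvdp_leq r0); rewrite sf leqNgt; case/negP.
  by apply: leq_ltn_trans (size_poly _ _) _; rewrite Pdiv.Idomain.ltn_modp.
have r0 : r = 0.
  apply/polyP => k; rewrite coef0; apply/eqP.
  have [//|rk] := eqVneq r`_k 0.
  have g0 : b * lead_coef f * char_poly A != 0.
    apply: mulf_neq0; last exact: monic_neq0 (char_poly_monic A).
    by apply: mulf_neq0; rewrite ?lead_coef_eq0.
  have : r`_k * (b * lead_coef f * char_poly A) = 0.
    apply: line_zero => x; rewrite hornerM; apply/eqP; rewrite mulf_eq0.
    apply/orP; have [_|/spr/polyP/(_ k)] := eqVneq ((b * lead_coef f * char_poly A).[pt x]) 0.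
      by right.
    by rewrite coef_map coef0 => h; left; apply/eqP.
  by move/eqP; rewrite mulf_eq0 (negbTE rk) (negbTE g0).
by rewrite /dvdp -/r r0.
Qed.

(** The entrywise divisions hold up to nonzero factors in the eigenvalue parameter; [c] is the
    product of these factors. The Bezout identity shows that the roots of [q] in that parameter are
    simple wherever [b] does not vanish. *)
Lemma pencil_multiple : exists (q : {poly D}) (c : D) (W : 'M[{poly D}]_s) (u v : {poly D}) (b : D),
  [/\ c != 0, b != 0, W *m pencil = (c%:P * q)%:M & u * q + v * dinner q = b%:P].
Proof.
have hf t : f.[t%:P] != 0 by rewrite det_pencil_inner monic_neq0 // char_poly_monic.
have f0 : f != 0 by apply: contraNneq (hf 0) => ->; rewrite horner0.
have [|q [q0 [b b0 hq] cq]] := vanishes_reduce hf f0.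
  by exists 1; rewrite ?oner_eq0.
have /Pdiv.Idomain.Bezout_coprimepP [[u v] /= huv] := cq.
have /size_poly1P [cb cb0 ecb] : size (u * q + v * dinner q) == 1%N.
  by rewrite (eqp_size huv) size_poly1.
have key i j : exists cw : D * {poly D}, cw.1 != 0 /\ cw.1 *: (q * \adj pencil i j) = cw.2 * f.
  have /Pdiv.Idomain.dvdpP [[c w] /= c0 e] := pencil_dvd i j q0 b0 hq.
  by exists (c, w).
pose cw (ij : 'I_s * 'I_s) := projT1 (cid (key ij.1 ij.2)).
have hcw ij : (cw ij).1 != 0 /\ (cw ij).1 *: (q * \adj pencil ij.1 ij.2) = (cw ij).2 * f.
  exact: projT2 (cid (key ij.1 ij.2)).
pose c := \prod_ij (cw ij).1.
pose W : 'M[{poly D}]_s := \matrix_(i, j) ((\prod_(kl | kl != (i, j)) (cw kl).1) *: (cw (i, j)).2).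
have eW : f *: W = (c%:P * q) *: \adj pencil.
  apply/matrixP => i j; rewrite mxE [RHS]mxE [W i j]mxE -scalerAr mulrC -(hcw (i, j)).2 /= scalerA mulrC.
  have -> : c = (cw (i, j)).1 * \prod_(kl | kl != (i, j)) (cw kl).1 by rewrite /c (bigD1 (i, j)).
  by rewrite -[RHS]mulrA mul_polyC.
exists q, c, W, u, v, cb; split=> //.
  by apply/prodf_neq0 => ij _; have [] := hcw ij.
have : f *: (W *m pencil) = f *: (c%:P * q)%:M.
  by rewrite scalemxAl eW -scalemxAl mul_adj_mx scale_scalar_mx scale_scalar_mx mulrC.
move=> /matrixP h; apply/matrixP => i j; have := h i j; rewrite mxE [RHS]mxE.
exact: mulfI.
Qed.

(** The radius keeps [z] away from the zeros of [c * b] other than [z0], uniformly in [t]; the point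
    [z0] itself, where these polynomials may vanish, is excluded. *)
Lemma pencil_semisimple : exists2 r : R, 0 < r & forall z, 0 < cabs (z - z0) < r ->
  forall t (a b : 'cV[C]_s), (z%:M - A - t *: B) *m a = 0 ->
  a = (z%:M - A - t *: B) *m b -> a = 0.
Proof.
have [q [c [W [u [v [b [c0 b0 eW huv]]]]]]] := pencil_multiple.
have [r r0 hr] := poly_punctured (mulf_neq0 c0 b0); exists r => // z1 z1r t x y hx hxy.
have := hr _ z1r; rewrite hornerM mulf_eq0 negb_or => /andP[cz bz].
pose p := c * q.[t%:P]; pose Wt := map_mx (horner_eval t%:P) W.
have eWt : Wt *m char_poly_mx (A + t *: B) = p%:M.
  have := congr1 (map_mx (horner_eval t%:P)) eW.
  rewrite map_mxM pencil_inner map_scalar_mx => ->; congr (_%:M).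
  by rewrite /= /horner_eval hornerM hornerC.
have [//|x0] := eqVneq x 0.
pose cc (M : 'M[C]_s) := map_mx polyC M.
pose cx := map_mx polyC x; pose cy := map_mx polyC y.
set H := A + t *: B in eWt.
have Hx : H *m x = z1 *: x.
  apply/eqP; rewrite eq_sym -subr_eq0 -mul_scalar_mx -mulmxBl opprD addrA hx //.
have Hy : H *m y = z1 *: y - x.
  by rewrite {1}hxy -addrA -opprD mulmxBl mul_scalar_mx opprB addrC subrK.
have ex : char_poly_mx H *m cx = ('X - z1%:P) *: cx.
  rewrite mulmxBl mul_scalar_mx -map_mxM Hx map_mxZ scalerBl //.
have ey : char_poly_mx H *m cy = ('X - z1%:P) *: cy + cx.
  by rewrite mulmxBl mul_scalar_mx -map_mxM Hy map_mxB map_mxZ scalerBl opprB addrA addrAC.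
have pz : p.[z1] = 0.
  have := congr1 (mulmx Wt) ex; rewrite mulmxA eWt mul_scalar_mx -scalemxAr => e.
  have /negP := x0; rewrite -(inj_eq (@trmx_inj _ _ _)) => _; apply/eqP; apply: contraT => pz.
  case/negP: x0; apply/eqP/matrixP => i j; have /matrixP/(_ i j)/(congr1 (horner_eval z1)) := e.
  rewrite !mxE /horner_eval !hornerM hornerC hornerXsubC subrr mul0r => /eqP.
  by rewrite -hornerM -/p mulf_eq0 (negbTE pz) => /eqP.
have qz : q.[t%:P].[z1] = 0.
  by move/eqP: pz; rewrite hornerM mulf_eq0 (negbTE cz) => /eqP.
have qd : (deriv q.[t%:P]).[z1] != 0.
  apply/negP => /eqP e; have := congr1 (fun g => ev2 g z1 t) huv.
  rewrite ev2D !ev2M {2}/ev2 qz /ev2 dinner_horner e !mulr0 addr0 hornerC => /esym/eqP.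
  by rewrite (negbTE bz).
have /factor_theorem [p1 pE] : root q.[t%:P] z1 by rewrite rootE qz.
have p1z : p1.[z1] != 0.
  by move: qd; rewrite pE derivM derivXsubC hornerD !hornerM hornerXsubC subrr mulr0 add0r hornerC mulr1.
(* A Jordan chain gives a polynomial vector with image divisible by the square of the linear factor,
   while [c * q] has only a simple root at [z1]: cancelling one factor and evaluating at [z1] leaves
   [x = 0]. *)
have e2 : char_poly_mx H *m (('X - z1%:P) *: cy - cx) = ('X - z1%:P) ^+ 2 *: cy.
  by rewrite mulmxBr -scalemxAr ey ex scalerDr addrK scalerA.
have := congr1 (mulmx Wt) e2; rewrite mulmxA eWt mul_scalar_mx -scalemxAr => e3.
apply/matrixP => i j; rewrite [RHS]mxE.
have /matrixP/(_ i j) := e3; rewrite mxE [in X in _ * X]mxE [X in _ * (X + _)]mxE [X in _ * (_ + X)]mxE.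
rewrite [RHS]mxE [cx _ _]mxE [cy _ _]mxE /p pE => e4.
have : ('X - z1%:P) * (c * p1 * (('X - z1%:P) * (y i j)%:P - (x i j)%:P)) =
       ('X - z1%:P) * (('X - z1%:P) * (Wt *m cy) i j).
  by rewrite mulrA -expr2 -e4; ring.
move=> /(mulfI (negbT (polyXsubC_eq0 z1))) /(congr1 (horner_eval z1)).
rewrite /horner_eval !hornerM hornerD hornerN hornerM hornerXsubC subrr !mul0r add0r !hornerC.
move/eqP; rewrite mulf_eq0 oppr_eq0 mulf_eq0 (negbTE cz) (negbTE p1z) /= => /eqP //.
Qed.

End Pencil.
End Semisimple.

(** * From kernels of the Hermitian pencil to eigenspaces of the quotient *)

Section KernelLink.
Variable R : realType.
Local Notation C := R[i].
Local Notation ii := ('i : C).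

Lemma rank_unit_l m n (U : 'M[C]_m) (X : 'M[C]_(m, n)) : U \in unitmx -> \rank (U *m X) = \rank X.
Proof. by move=> uU; rewrite eqmxMfull // row_full_unit. Qed.

Lemma rank_unit_r m n (U : 'M[C]_n) (X : 'M[C]_(m, n)) : U \in unitmx -> \rank (X *m U) = \rank X.
Proof. by move=> uU; rewrite mxrankMfree // row_free_unit. Qed.

Lemma unitmx_lblock n (X : 'M[C]_n) : block_mx 1%:M 0 X 1%:M \in unitmx.
Proof. by rewrite unitmxE det_lblock !det1 mulr1 unitr1. Qed.

Lemma unitmx_ublock n (X : 'M[C]_n) : block_mx 1%:M X 0 1%:M \in unitmx.
Proof. by rewrite unitmxE det_ublock !det1 mulr1 unitr1. Qed.

(** One block matrix is reduced by elimination in two orders, each leaving one of the two matrices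
    next to an identity block. *)
Lemma rank_one_plus n (X Y : 'M[C]_n) : \rank (1%:M + X *m Y)%R = \rank (1%:M + Y *m X)%R.
Proof.
have : \rank (block_mx 1%:M (- X) Y 1%:M) = (n + \rank (1%:M + Y *m X)%R)%N.
  have -> : block_mx 1%:M (- X) Y 1%:M =
     block_mx 1%:M 0 Y 1%:M *m block_mx 1%:M 0 0 (1%:M + Y *m X) *m block_mx 1%:M (- X) 0 1%:M.
    rewrite !mulmx_block !mulmx0 !mul0mx !mulmx1 !mul1mx !addr0 !add0r.
    by rewrite mul1mx; congr (block_mx _ _ _ _); rewrite mulmxN addrCA addNr addr0.
  rewrite rank_unit_r ?unitmx_ublock // rank_unit_l ?unitmx_lblock //.
  by rewrite rank_diag_block_mx mxrank1.
have -> : block_mx 1%:M (- X) Y 1%:M =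
     block_mx 1%:M (- X) 0 1%:M *m block_mx (1%:M + X *m Y) 0 0 1%:M *m block_mx 1%:M 0 Y 1%:M.
  rewrite !mulmx_block !mulmx0 !mul0mx !mulmx1 !mul1mx !addr0 !add0r mulNmx.
  by rewrite mul1mx addrK.
rewrite rank_unit_r ?unitmx_lblock // rank_unit_l ?unitmx_ublock //.
by rewrite rank_diag_block_mx mxrank1 addnC => /addnI.
Qed.

Lemma rank_update n (P d : 'M[C]_n) (t : R) : P \in unitmx -> t != 0 ->
  \rank (P + t%:C *: (d^t* *m d))%R = \rank (- (d *m invmx P *m d^t*) - (t^-1)%:C%:M)%R.
Proof.
move=> uP t0.
have -> : P + t%:C *: (d^t* *m d) = P *m (1%:M + (t%:C *: (invmx P *m d^t*)) *m d).
  by rewrite mulmxDr mulmx1 mulmxA -scalemxAr mulKVmx // scalemxAl.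
rewrite rank_unit_l // rank_one_plus.
have -> : 1%:M + d *m (t%:C *: (invmx P *m d^t*)) =
    (- t%:C) *: (- (d *m invmx P *m d^t*) - (t^-1)%:C%:M).
  rewrite scalerBr scalerN scaleNr opprK -scalemxAr mulmxA addrC; congr (_ + _).
  by rewrite scale_scalar_mx mulNr -rmorphM mulfV // raddfN opprK.
by rewrite mxrank_scale_nz // oppr_eq0 fmorph_eq0.
Qed.

Lemma conjMR (a : R) (z : C) : Num.conj (a%:C * z) = a%:C * Num.conj z.
Proof. by rewrite rmorphM; congr (_ * _); exact: conjR. Qed.

Lemma qf_scale m (X : 'M[C]_m) (a : R) w : qf X (a%:C *: w) = a ^+ 2 * qf X w.
Proof.
by rewrite /qf adjZr -!scalemxAl -scalemxAr scalerA -rmorphM mxE ReZ.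
Qed.

Lemma hasD_reflect m n (A : R -> 'M[C]_(m, n)) x A1 :
  hasD (fun y => A (- y)) (- x) A1 -> hasD A x (- A1).
Proof.
move=> [K [e [e0 hK]]]; exists K, e; split=> // y hy.
have := hK (- y); rewrite (_ : - y - - x = - (y - x)); last by rewrite opprK opprB addrC.
by rewrite normrN sqrrN !opprK rmorphN scaleNr -scalerN => /(_ hy).
Qed.

Lemma det_line_horner m (X Y : 'M[C]_m) z :
  (\det (map_mx polyC X + 'X *: map_mx polyC Y)).[z] = \det (X + z *: Y).
Proof.
rewrite -[LHS]/(horner_eval z _) -det_map_mx; congr (\det _).
have e (Z : 'M[C]_m) : map_mx (horner_eval z) (map_mx polyC Z) = Z.
  by apply/matrixP => i j; rewrite mxE mxE /= /horner_eval hornerC.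
by rewrite map_mxD map_mxZ !e /= /horner_eval hornerX.
Qed.

Section Setting.
Variables (n1 n2 : nat) (F11 G11 : 'M[C]_n1) (F22 G22 : 'M[C]_n2) (z0 : C).
Let n := (n1 + n2)%N.
Let Gm : 'M[C]_n := block_mx G11 0 0 G22.
Variable d : 'M[C]_(n + n).
Hypothesis hG : psdmx Gm.
Let sdl := saddle F11 G11 F22 G22 z0.
Let Q x := - (d *m invmx (sdl x) *m d^t*).

Lemma saddle_herm x : herm (sdl x).
Proof.
have [/hermsymmx_herm hGh _] := hG.
by rewrite /herm /sdl /saddle adj_block adj0 adjK hGh.
Qed.

(** The pencil is affine in [x] with slope [i J]; this ties the form [i J] both to the derivative of
    [Q] and to the orthogonality of kernels at different [x]. *)
Lemma saddle_shift x y : sdl y = sdl x + (y - x)%:C *: (ii *: Jmx n).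
Proof.
have e : shiftF F11 F22 z0 y = shiftF F11 F22 z0 x - ((y - x)%:C * ii)%:M.
  rewrite /shiftF -addrA; congr (_ + _); rewrite -opprD -raddfD /=; congr (- _%:M).
  by rewrite -addrA; congr (_ + _); rewrite rmorphB; ring.
rewrite /sdl /saddle e adjB adj_scalar /Jmx scalerA scale_block_mx add_block_mx.
rewrite !scaler0 !addr0 scalerN scalemx1; congr (block_mx _ _ _ _).
congr (_ + _); rewrite -raddfN; congr (_%:M).
by rewrite conjMR complexiE conjCi mulrN opprK.
Qed.

Lemma hasD_saddle x : hasD sdl x (ii *: Jmx n).
Proof.
exists 0, 1; split=> // y _; rewrite (saddle_shift x y) mul0r.
by rewrite [sdl x + _]addrC addrK subrr nrm0.
Qed.

Lemma invmx_herm m (X : 'M[C]_m) : herm X -> herm (invmx X).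
Proof.
move=> hX; have [uX|nX] := boolP (X \in unitmx); last by rewrite invmx_out.
rewrite /herm -[LHS]mulmx1 -(mulmxV uX) mulmxA -{2}hX -adjM mulmxV // adj1 mul1mx //.
Qed.

Lemma saddle_quot_herm x : herm (Q x).
Proof. by apply: hermN; apply: herm_congr'; apply: invmx_herm; exact: saddle_herm. Qed.

Lemma saddle_unit x : shiftF F11 F22 z0 x \in unitmx -> sdl x \in unitmx.
Proof. by move=> /(inv_saddle Gm)[]. Qed.

Lemma hasD_quot x : sdl x \in unitmx -> hasD Q x
   ((invmx (sdl x) *m d^t*)^t* *m (ii *: Jmx n) *m (invmx (sdl x) *m d^t*)).
Proof.
move=> ux; have h := hasD_inv ux (hasD_saddle x).
have hi := invmx_herm (saddle_herm x).
have := hasDN (hasDM (hasDM (hasD_const d x) h) (hasD_const (d^t*) x)).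
rewrite mulmx0 addr0 mul0mx add0r mulmxN mulNmx opprK; congr (hasD _ _ _).
by rewrite adjM adjK hi !mulmxA.
Qed.

(** A kernel vector satisfies [v = - t X (d v)] with [X = P^-1 d^H], while the derivative of [Q] is
    [X^H (i J) X]; hence the positive factor [t ^ 2]. *)
Lemma kernel_derivative x (t : R) v Q1 : sdl x \in unitmx -> t != 0 -> v != 0 ->
  (sdl x + t%:C *: (d^t* *m d)) *m v = 0 -> hasD Q x Q1 ->
  [/\ d *m v != 0, Q x *m (d *m v) = (t^-1)%:C *: (d *m v) &
     qf (ii *: Jmx n) v = t ^+ 2 * qf Q1 (d *m v)].
Proof.
move=> ux t0 v0 hv hQ1.
have tc : t%:C != 0 :> C by rewrite fmorph_eq0.
have ev : v = (- t)%:C *: (invmx (sdl x) *m d^t* *m (d *m v)).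
  have : sdl x *m v = - (t%:C *: (d^t* *m d *m v)).
    by apply/eqP; rewrite -addr_eq0 scalemxAl -mulmxDl hv.
  move=> /(congr1 (mulmx (invmx (sdl x)))); rewrite mulmxA mulVmx // mul1mx => {1}->.
  by rewrite mulmxN -scalemxAr rmorphN scaleNr !mulmxA.
have y0 : d *m v != 0 by apply: contraNneq v0 => y0; rewrite ev y0 mulmx0 scaler0.
have ey : d *m v = (- t)%:C *: (d *m invmx (sdl x) *m d^t* *m (d *m v)).
  by rewrite {1}ev -scalemxAr !mulmxA.
split=> //.
  rewrite {2}ey mulNmx; move: (_ *m (d *m v)) => w.
  by rewrite scalerA -rmorphM mulrN mulVf // rmorphN scaleNr scale1r.
rewrite -(hasD_unique (hasD_quot ux) hQ1) qf_congr {1}ev qf_scale sqrrN //.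
Qed.

Lemma kernel_definite m (p : 'I_m -> nat) g e : (forall j, (0 < p j)%N) -> (forall j, 0 < g j) ->
  normal_form Q p g -> normal_form (fun x => Q (- x)) p g -> 0 < e ->
  (forall x, 0 < `|x| < e -> shiftF F11 F22 z0 x \in unitmx) ->
  exists e1 t1, [/\ 0 < e1, 0 < t1 & forall t x v, 0 < t < t1 -> 0 < `|x| < e1 -> v != 0 ->
    (sdl x + t%:C *: (d^t* *m d)) *m v = 0 ->
    (0 < x -> qf (ii *: Jmx n) v < 0) /\ (x < 0 -> 0 < qf (ii *: Jmx n) v)].
Proof.
move=> p0 g0 nf1 nf2 e0 hu.
have [e1 [th1 [e10 th10 h1]]] := normal_form_derivative p0 g0 nf1.
have [e2 [th2 [e20 th20 h2]]] := normal_form_derivative p0 g0 nf2.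
exists (Num.min e (Num.min e1 e2)), (Num.min th1^-1 th2^-1).
split; [by rewrite !lt_min e0 e10|by rewrite lt_min !invr_gt0 th10|].
move=> t x v; rewrite !lt_min => /andP[t0 /andP[tt1 tt2]] /andP[x0 /andP[xe /andP[xe1 xe2]]] v0 hv.
have ux : sdl x \in unitmx by apply: saddle_unit; apply: hu; rewrite x0.
have tn : t != 0 by rewrite gt_eqF.
have ht1 : th1 <= t^-1 by rewrite -(invrK th1) lef_pV2 ?posrE ?invr_gt0 // ltW.
have ht2 : th2 <= t^-1 by rewrite -(invrK th2) lef_pV2 ?posrE ?invr_gt0 // ltW.
have t2 : 0 < t ^+ 2 by rewrite exprn_gt0.
split=> hx.
  have [Q1 [hQ1 hc]] := h1 x (introT andP (conj hx (le_lt_trans (ler_norm _) xe1))).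
  have [y0 Qy ->] := kernel_derivative ux tn v0 hv hQ1.
  have [c c0 /(_ _ Qy) h] := hc _ ht1.
  rewrite pmulr_rlt0 //; apply: le_lt_trans h _.
  by rewrite oppr_lt0 mulr_gt0 // sq_gt0.
have hx' : 0 < - x < e2 by rewrite oppr_gt0 hx /= -(ltr0_norm hx).
have [Q1 [hQ1 hc]] := h2 _ hx'.
have hQ1' : hasD Q x (- Q1). by exact: hasD_reflect.
have [y0 Qy ->] := kernel_derivative ux tn v0 hv hQ1'.
have [c c0] := hc _ ht2; rewrite opprK => /(_ _ Qy) h.
rewrite qfN pmulr_rgt0 // oppr_gt0; apply: le_lt_trans h _.
by rewrite oppr_lt0 mulr_gt0 // sq_gt0.
Qed.

Lemma kernel_rank x (t : R) : sdl x \in unitmx -> t != 0 ->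
  ((n + n) - \rank (sdl x + t%:C *: (d^t* *m d))%R = ncge (Q x) t^-1 - ncgt (Q x) t^-1)%N.
Proof.
move=> ux t0; rewrite rank_update // -/(Q x).
have := rank_sub_herm t^-1 (saddle_quot_herm x); have := ncgt_ncge (Q x) t^-1.
have := rank_leq_row (Q x - (t^-1)%:C%:M); rewrite -/n.
move: (\rank _) (ncge _ _) (ncgt _ _) => a b c; lia.
Qed.

Hypothesis hctrl : controllable F11 G11.
Hypothesis hobs : observable F11 (D11 (d^t* *m d)).
Hypothesis uF22 : F22 - z0%:M \in unitmx.

(** The imaginary part of the form at [v] is [sq (d *m v)], because [sdl 0] is Hermitian. A kernel
    vector is thus annihilated by [d] and by [sdl 0]; controllability then kills its lower half and
    observability its upper half. *)
Lemma saddle0_imaginary_unit : sdl 0 + ii *: (d^t* *m d) \in unitmx.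
Proof.
apply: unitmx_ker => v hv.
have hP : sdl 0 *m v = - (ii *: (d^t* *m d *m v)).
  by apply/eqP; rewrite -addr_eq0 scalemxAl -mulmxDl hv.
have dv : d *m v = 0.
  apply/eqP; rewrite -sq_eq0; apply/eqP.
  have := qf_herm v (saddle_herm 0); rewrite -mulmxA hP mulmxN -scalemxAr !mulmxA.
  rewrite -mulmxA -(mulmxA (v^t*)) mulmxA -adjM => e.
  have := congr1 (fun M : C => complex.Im M) e.
  rewrite mxE [in X in X -> _]mxE -sqC /=; lra.
have P0 : sdl 0 *m v = 0 by rewrite hP -mulmxA dv mulmx0 scaler0 oppr0.
pose u := usubmx v; pose w := dsubmx v; pose N := shiftF F11 F22 z0 0.
have [Nw NuGw] : N^t* *m w = 0 /\ N *m u + Gm *m w = 0.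
  have := P0; rewrite -[v]vsubmxK /sdl /saddle mul_block_col mul0mx add0r => h.
  split; first by have := congr1 usubmx h; rewrite col_mxKu linear0.
  by have := congr1 dsubmx h; rewrite col_mxKd linear0.
have eGw : Gm *m w = - (N *m u) by apply/eqP; rewrite -addr_eq0 addrC NuGw.
have wN : w^t* *m N = 0 by rewrite -[N]adjK -adjM Nw adj0.
have Gw : Gm *m w = 0.
  by apply: (psdmx_qf0 hG); rewrite /qf -mulmxA eGw mulmxN mulmxA wN mul0mx oppr0 mxE.
have Nu : N *m u = 0 by rewrite -[LHS]opprK -eGw Gw oppr0.
have NE : N = block_mx (F11 - z0%:M) 0 0 (F22 - z0%:M).
  by rewrite /N shiftF_block mulr0 addr0.
pose u1 := usubmx u; pose w1 := usubmx w.
have [Nu1 u2] : (F11 - z0%:M) *m u1 = 0 /\ dsubmx u = 0.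
  move: Nu; rewrite NE -[u]vsubmxK mul_block_col !mul0mx addr0 add0r -/u1 => h.
  split; first by have := congr1 usubmx h; rewrite col_mxKu linear0.
  by apply: (unitmx_inj uF22); have := congr1 dsubmx h; rewrite col_mxKd linear0 col_mxKd.
have [wN1 w2] : w1^t* *m (F11 - z0%:M) = 0 /\ dsubmx w = 0.
  move: wN; rewrite NE -[w]vsubmxK adj_col_mx mul_row_block !mulmx0 addr0 add0r -/w1 => h.
  split; first by have := congr1 lsubmx h; rewrite row_mxKl linear0.
  rewrite col_mxKd -[dsubmx w]adjK; have /= h2 := congr1 rsubmx h.
  rewrite row_mxKr linear0 in h2; have := congr1 (mulmx^~ (invmx (F22 - z0%:M))) h2.
  by rewrite -mulmxA mulmxV // mulmx1 mul0mx => ->; rewrite adj0.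
have G1 : G11 *m w1 = 0.
  have := congr1 usubmx Gw; rewrite -[w]vsubmxK mul_block_col !mul0mx addr0 col_mxKu linear0.
  by rewrite -/w1.
have w10 : w1 = 0.
  rewrite -[w1]adjK (_ : w1^t* = 0) ?adj0 //; apply: (full_rank_inj' (hctrl z0)).
  rewrite mul_mx_row -[z0%:M - F11]opprB mulmxN wN1 oppr0.
  by rewrite -{1}(G11_herm hG) -adjM G1 adj0 row_mx0.
have vE : v = inl1 R n n *m (inl1 R n1 n2 *m u1).
  rewrite -[v]vsubmxK -/u -/w -[u]vsubmxK u2 -[w]vsubmxK w2 -/u1 -/w1 w10.
  by rewrite /inl1 !mul_col_mx !mul1mx !mul0mx col_mx0.
have u10 : u1 = 0.
  apply: (full_rank_inj (hobs z0)); rewrite mul_col_mx -[z0%:M - F11]opprB mulNmx Nu1 oppr0.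
  rewrite (_ : D11 _ *m u1 = 0) ?col_mx0 // /D11 !ulsubmx_sandwich -!mulmxA -vE dv.
  by rewrite !mulmx0.
by rewrite vE u10 !mulmx0.
Qed.

(** The determinant is a polynomial in [t] that is nonzero at [t = i], so its zeros do not
    accumulate at [0]. *)
Lemma saddle0_unit : exists2 t1 : R, 0 < t1 & forall t : R, 0 < t < t1 ->
  sdl 0 + t%:C *: (d^t* *m d) \in unitmx.
Proof.
pose p : {poly C} := \det (map_mx polyC (sdl 0) + 'X *: map_mx polyC (d^t* *m d)).
have pE z : p.[z] = \det (sdl 0 + z *: (d^t* *m d)) by exact: det_line_horner.
have p0 : p != 0.
  apply: contraTneq saddle0_imaginary_unit => e.
  by rewrite unitmxE -pE e horner0 unitr0.
have [r r0 hr] := @poly_punctured R 0 p p0; exists r => // t /andP[t0 tr].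
rewrite unitmxE unitfE -pE; apply: hr.
by rewrite subr0 cabsR gtr0_norm // t0.
Qed.

End Setting.
End KernelLink.

(** * Semisimple matrices, Sylvester equations and localization of spectra *)

Section SpectralStructure.
Variable R : realType.
Local Notation C := R[i].

(** Absence of Jordan chains of length two; in this form the property passes directly along
    injective intertwining maps. *)
Definition semisimple m (A : 'M[C]_m) := forall z (a b : 'cV[C]_m),
  (z%:M - A) *m a = 0 -> a = (z%:M - A) *m b -> a = 0.

Lemma horner_mx_XsubC m (A : 'M[C]_m.+1) z : horner_mx A ('X - z%:P) = A - z%:M.
Proof. by rewrite rmorphB /= horner_mx_X horner_mx_C. Qed.

Lemma semisimple_reduce m (A : 'M[C]_m.+1) z q : semisimple A ->
  horner_mx A (q * ('X - z%:P) * ('X - z%:P)) = 0 -> horner_mx A (q * ('X - z%:P)) = 0.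
Proof.
move=> sA; rewrite -mulrA (mulrC q (_ * _)) -mulrA (mulrC q) !rmorphM /= horner_mx_XsubC.
move: (horner_mx A q) => X h; apply/matrixP => i j; rewrite [RHS]mxE.
have : col j ((A - z%:M) * X) = 0.
  apply: (sA z _ (- col j X)).
    rewrite mul_mx_col -[z%:M - A]opprB mulNmx [_ *m (_ * _)]h linearN /= linear0 oppr0 //.
  by rewrite mulmxN mul_mx_col -linearN /= -mulNmx opprB.
by move=> /matrixP/(_ i 0); rewrite !mxE.
Qed.

Lemma semisimple_undup m (A : 'M[C]_m.+1) s q : semisimple A ->
  horner_mx A (q * \prod_(x <- s) ('X - x%:P)) = 0 ->
  horner_mx A (q * \prod_(x <- undup s) ('X - x%:P)) = 0.
Proof.
move=> sA; elim: s q => // x s IH q; rewrite big_cons /=; case: ifP => xs; last first.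
  by rewrite mulrA => /IH; rewrite big_cons mulrA.
move=> h; apply: IH; move: h; rewrite (big_rem x) //= => h.
rewrite mulrCA mulrC; apply: semisimple_reduce => //.
by move: h; congr (horner_mx A _ = 0); ring.
Qed.

Lemma semisimple_diag m (A : 'M[C]_m) : semisimple A ->
  exists (P : 'M[C]_m) (d : 'rV[C]_m), P \in unitmx /\ A *m P = P *m diag_mx d.
Proof.
case: m A => [|m] A sA.
  by exists 1%:M, 0; split; [exact: unitmx1|apply/matrixP => -[]].
have [r rE] := closed_field_poly_normal (mxminpoly A).
have : diagonalizable A.
  apply/diagonalizableP; exists (undup r); first exact: undup_uniq.
  rewrite dvd_mxminpoly -[X in horner_mx A X]mul1r; apply/eqP/semisimple_undup => //.
  by rewrite mul1r; move: rE; rewrite (monicP (mxminpoly_monic A)) scale1r => <-; exact: mx_root_minpoly.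
move=> [P uP /diagonalizable_forPex[d /(simmxP uP) h]].
exists (invmx P), d; split; first by rewrite unitmx_inv.
by rewrite -[A](mulKmx uP) h !mulmxA -(mulmxA _ P) mulmxV // mulmx1.
Qed.

Lemma diag_char_poly m (A P : 'M[C]_m) d : P \in unitmx -> A *m P = P *m diag_mx d ->
  char_poly A = \prod_i ('X - (d 0 i)%:P).
Proof.
move=> uP h; have -> : \prod_i ('X - (d 0 i)%:P) = char_poly (diag_mx d).
  rewrite char_poly_trig; first by apply: eq_bigr => i _; rewrite mxE eqxx.
  by apply/is_trig_mxP => i j ij; rewrite mxE -val_eqE (ltn_eqF ij).
pose cP := map_mx polyC P.
have e : char_poly_mx A *m cP = cP *m char_poly_mx (diag_mx d).
  by rewrite mulmxBl mulmxBr mul_scalar_mx mul_mx_scalar -!map_mxM h.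
have := congr1 determinant e; rewrite !det_mulmx mulrC => /mulfI; apply.
by rewrite det_map_mx polyC_eq0 -unitfE -unitmxE.
Qed.

Lemma diag_mup m (A P : 'M[C]_m) d z : P \in unitmx -> A *m P = P *m diag_mx d ->
  mup z (char_poly A) = (m - \rank (A - z%:M)%R)%N.
Proof.
move=> uP h; rewrite (diag_char_poly uP h) -(big_map (fun i => d 0 i) predT (fun x => 'X - x%:P)).
rewrite mu_prod_XsubC count_map.
have -> : \rank (A - z%:M)%R = #|[pred i | d 0 i != z]|.
  have -> : A - z%:M = P *m diag_mx (d - const_mx z) *m invmx P.
    have -> : diag_mx (d - const_mx z) = diag_mx d - z%:M.
      by rewrite linearB /= diag_const_mx.
    by rewrite mulmxBr mulmxBl -h mulmxK // mul_mx_scalar -scalemxAl mulmxV // scalemx1.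
  rewrite rank_unit_r ?unitmx_inv // rank_unit_l // rank_diag_mx.
  by apply: eq_card => i; rewrite !inE !mxE subr_eq0.
have e : (#|[pred i | d 0%R i == z]| + #|[pred i | d 0%R i != z]| = m)%N.
  by rewrite -[RHS]card_ord -(cardC [pred i | d 0 i == z]).
by rewrite -(canRL (addnK _) e) -[LHS]sum1_count -sum1_card.
Qed.

Lemma eigenspace_rank m (A : 'M[C]_m) z : \rank (eigenspace A z) = (m - \rank (A - z%:M)%R)%N.
Proof. by rewrite mxrank_ker. Qed.

Lemma eigen_decomposition m (A P : 'M[C]_m) d : P \in unitmx -> A *m P = P *m diag_mx d ->
  forall y : 'cV[C]_m, exists (Y : 'I_m -> 'cV[C]_m) (z : 'I_m -> C),
   [/\ y = \sum_i Y i, forall i, A *m Y i = z i *: Y i &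
     forall i j, i != j -> Y i != 0 -> Y j != 0 -> z i != z j].
Proof.
move=> uP h y; pose c := invmx P *m y.
(* A representative of the indices that share the eigenvalue [d 0 j]. The component [Y i] collects
   the coordinates represented by [i], so distinct nonzero components have distinct eigenvalues. *)
pose r j := odflt j [pick i | d 0 i == d 0 j].
have rE i j : d 0 i = d 0 j -> r i = r j.
  move=> e; rewrite /r; have -> : [pick k | d 0 k == d 0 i] = [pick k | d 0 k == d 0 j].
    by apply: eq_pick => k; rewrite e.
  by case: pickP => // /(_ j); rewrite eqxx.
have rd j : d 0 (r j) = d 0 j by rewrite /r; case: pickP => [i /eqP|] //.
pose Y i := P *m (\col_j (c j 0 *+ (r j == i))).
exists Y, (fun i => d 0 i); split.
- rewrite -mulmx_sumr; have -> : \sum_i (\col_j (c j 0 *+ (r j == i))) = c.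
    apply/matrixP => j k; rewrite ord1 summxE (bigD1 (r j)) //= mxE eqxx mulr1n big1 ?addr0 //.
    by move=> i ij; rewrite mxE eq_sym (negbTE ij).
  by rewrite /c mulKVmx.
- move=> i; rewrite /Y mulmxA h -mulmxA scalemxAr; congr (_ *m _).
  apply/matrixP => j k; rewrite mul_diag_mx !mxE.
  by case: eqP => [<-|_]; rewrite ?rd ?mulr0n ?mulr0.
move=> i j ij Yi Yj; apply: contraNneq ij => e.
have ne k : Y k != 0 -> exists2 l, r l = k & True.
  move=> Yk; have [/existsP[l /eqP]|] := boolP [exists l, r l == k]; first by exists l.
  rewrite negb_exists => /forallP hl; case/negP: Yk; apply/eqP.
  rewrite /Y (_ : \col_j _ = 0) ?mulmx0 //; apply/matrixP => a b; rewrite !mxE.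
  by rewrite (negbTE (hl a)).
have [a ra _] := ne _ Yi; have [b rb _] := ne _ Yj.
by rewrite -ra -rb; apply/eqP/rE; rewrite -(rd a) -(rd b) ra rb.
Qed.

Lemma unitmx_eigenvalue m (A : 'M[C]_m) z : (A - z%:M \in unitmx) = ~~ eigenvalue A z.
Proof. by rewrite /eigenvalue /eigenspace kermx_eq0 row_free_unit negbK. Qed.

Lemma char_poly_roots m (A : 'M[C]_m) : exists r : seq C,
  char_poly A = \prod_(x <- r) ('X - x%:P) /\ forall x, x \in r -> eigenvalue A x.
Proof.
have [r rE] := closed_field_poly_normal (char_poly A).
exists r; move: rE; rewrite (monicP (char_poly_monic A)) scale1r => rE; split=> // x xr.
by rewrite eigenvalue_root_char rE root_prod_XsubC.
Qed.

(** The characteristic polynomial of [T] annihilates [T], and evaluated at [S] it is invertible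
    because the spectra are disjoint; the intertwining relation moves it across [D]. *)
Lemma sylvester_unique m (S T D : 'M[C]_m) : S *m D = D *m T ->
  (forall z, eigenvalue S z -> eigenvalue T z -> False) -> D = 0.
Proof.
case: m S T D => [|m] S T D h hz; first by apply/matrixP => -[].
have [r [rE re]] := char_poly_roots T.
have hx x : D * (T - x%:M) = (S - x%:M) * D.
  rewrite mulrBr mulrBl; congr (_ - _); first exact/esym.
  by rewrite -[RHS]/(x%:M *m D) -[LHS]/(D *m x%:M) scalar_mxC.
have e (s : seq C) : D * (\prod_(x <- s) (T - x%:M)) = (\prod_(x <- s) (S - x%:M)) * D.
  elim: s => [|x s IH]; first by rewrite !big_nil mulr1 mul1r.
  by rewrite !big_cons mulrA hx -mulrA IH mulrA.
have uS : \prod_(x <- r) (S - x%:M) \in unitmx.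
  rewrite big_seq; elim/big_ind: _ => [|x y ux uy|x xr]; first exact: unitmx1.
    by rewrite unitmx_mul ux uy.
  by rewrite unitmx_eigenvalue; apply/negP => /hz; apply; exact: re.
have := Cayley_Hamilton T; rewrite rE rmorph_prod /=.
rewrite (eq_bigr _ (fun x _ => horner_mx_XsubC T x)) => e0.
by have := e r; rewrite e0 mulr0 => /esym /(congr1 (mulmx (invmx (\prod_(x <- r) (S - x%:M))))); rewrite mulKmx // mulmx0.
Qed.

Lemma nilpotent_of_spectrum m (A : 'M[C]_m) z0 :
  (forall z, eigenvalue A z -> z = z0) -> (A - z0%:M) ^+ m = 0.
Proof.
case: m A => [|m] A h; first by apply/matrixP => -[].
have [r [rE re]] := char_poly_roots A.
have rz : r = nseq m.+1 z0.
  have : size r = m.+1.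
    have := size_char_poly A; rewrite rE size_prod_XsubC => -[] //.
  move=> <-; apply/all_pred1P; apply/allP => x /re /h ->; exact: eqxx.
have pn k : \prod_(x <- nseq k z0) (A - x%:M) = (A - z0%:M) ^+ k.
  by elim: k => [|k IH]; rewrite ?big_nil ?big_cons ?expr0 // exprS -IH.
have := Cayley_Hamilton A; rewrite rE rz rmorph_prod.
by rewrite (eq_bigr _ (fun x _ => horner_mx_XsubC A x)) pn.
Qed.

Lemma nrm_exp m (A : 'M[C]_m) (c : R) k : 0 <= c -> nrm A <= c ->
  nrm (A ^+ k) <= nrm (1 : 'M[C]_m) * c ^+ k.
Proof.
move=> c0 hA; elim: k => [|k IH]; first by rewrite !expr0 mulr1.
rewrite !exprS mulrCA; apply: le_trans (nrmM _ _) _.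
by apply: ler_pM; rewrite ?nrm_ge0.
Qed.

Lemma nrm_exp_diff m (A B : 'M[C]_m) (c : R) k : 1 <= c -> nrm A <= c -> nrm B <= c ->
  nrm (A ^+ k - B ^+ k) <= k%:R * nrm (1 : 'M[C]_m) * c ^+ k * nrm (A - B).
Proof.
move=> c1 hA hB; have c0 : 0 <= c by exact: le_trans c1.
elim: k => [|k IH]; first by rewrite !expr0 subrr nrm0 !mul0r.
have -> : A ^+ k.+1 - B ^+ k.+1 = A * (A ^+ k - B ^+ k) + (A - B) * B ^+ k.
  by rewrite mulrBr mulrBl -!exprS addrA subrK.
have h1 := le_trans (nrmM A (A ^+ k - B ^+ k)) (ler_pM (nrm_ge0 _) (nrm_ge0 _) hA IH).
have h2 := le_trans (nrmM (A - B) (B ^+ k)) (ler_wpM2l (nrm_ge0 _) (nrm_exp k c0 hB)).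
apply: le_trans (nrmD _ _) _; apply: le_trans (lerD h1 h2) _.
have ck : c ^+ k <= c ^+ k.+1 by rewrite exprS ler_peMl // exprn_ge0.
have fin (u a v w dl n : R) : 0 <= a -> 0 <= dl -> v <= w -> u * v = w ->
    u * (n * a * v * dl) + dl * (a * v) <= (n + 1) * a * w * dl.
  move=> a0 d0 hc e; have := mulr_ge0 a0 d0; rewrite -subr_ge0 in hc.
  by move=> /(mulr_ge0 hc) h; rewrite -e; rewrite -e in h; lra.
rewrite -natr1; apply: fin; rewrite ?nrm_ge0 // -exprS //.
Qed.

(** By Cayley-Hamilton [(A0 - z0) ^ m = 0], so [(A - z0) ^ m] has norm [O(nrm (A - A0))]; applied to
    an eigenvector of [A], it bounds [|z - z0| ^ m]. *)
Lemma spectrum_near m (A0 : 'M[C]_m) z0 (r : R) : (forall z, eigenvalue A0 z -> z = z0) ->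
  0 < r -> exists2 e : R, 0 < e & forall A, nrm (A - A0) < e ->
   forall z, eigenvalue A z -> cabs (z - z0) < r.
Proof.
move=> h r0; have N0 := nilpotent_of_spectrum h.
pose c := nrm (A0 - z0%:M) + 1; have c1 : 1 <= c by rewrite lerDr nrm_ge0.
have c0 : 0 <= c by exact: le_trans c1.
have [M M0 hM] : exists2 M : R, 0 < M & forall A : 'M[C]_m, nrm (A - z0%:M) <= c ->
    nrm ((A - z0%:M) ^+ m) <= nrm (A - A0) * M.
  exists (m%:R * nrm (1 : 'M[C]_m) * c ^+ m + 1).
    by rewrite ltr_wpDl // mulr_ge0 ?exprn_ge0 // mulr_ge0 ?nrm_ge0.
  move=> A hA; have h0 : nrm (A0 - z0%:M) <= c by rewrite lerDl.
  have := nrm_exp_diff m c1 hA h0; rewrite N0 subr0 opprB addrA subrK => h1.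
  by apply: le_trans h1 _; rewrite mulrC ler_wpM2l ?nrm_ge0 // lerDl.
have rm : 0 < r ^+ m by rewrite exprn_gt0.
have cE A : nrm (A - A0) < 1 -> nrm (A - z0%:M) <= c.
  move=> hA; rewrite -[A](subrK A0) -addrA; apply: le_trans (nrmD _ _) _.
  by rewrite /c [leRHS]addrC; exact: lerD (ltW hA) (lexx _).
move: c c1 c0 hM cE => c _ _ hM cE.
exists (Num.min 1 (r ^+ m / M)); first by rewrite lt_min ltr01 divr_gt0.
move=> A; rewrite lt_min.
rewrite (ltr_pdivlMr _ _ M0).
move=> /andP[hA1 hA2].
move=> z /eigenvalueP [v hv v0].
have vk k : v *m (A - z0%:M) ^+ k = (z - z0) ^+ k *: v.
  elim: k => [|k IH]; first by rewrite !expr0 mulmx1 scale1r.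
  by rewrite exprS mulmxA mulmxBr hv mul_mx_scalar -scalerBl -scalemxAl IH scalerA -exprS.
have := nrmM v ((A - z0%:M) ^+ m); rewrite vk nrmZ cabsX mulrC.
have nv : 0 < nrm v by rewrite nrm_gt0.
rewrite ler_pM2l // => h1; rewrite ltNge; apply/negP => h2.
have h3 : r ^+ m <= cabs (z - z0) ^+ m by rewrite lerXn2r ?nnegrE ?cabs_ge0 // ltW.
have : r ^+ m < r ^+ m; last by rewrite ltxx.
exact: le_lt_trans (le_trans h3 (le_trans h1 (hM _ (cE _ hA1)))) hA2.
Qed.

End SpectralStructure.

(** * The Riccati graph and the symplectic square root *)

Section BlockReduction.
Variable R : realType.
Local Notation C := R[i].
Local Notation ii := ('i : C).

Lemma mul_Jmx m q (a b : 'M[C]_(m, q)) (c e : 'M[C]_(m, q)) :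
  Jmx m *m block_mx a b c e = block_mx c e (- a) (- b).
Proof. by rewrite /Jmx mulmx_block !mul0mx !mul1mx !mulNmx !mul1mx !add0r !addr0. Qed.

Lemma adj_Jmx m : (Jmx m : 'M[C]_(m + m))^t* = - Jmx m.
Proof.
by rewrite /Jmx adj_block !adj0 adjN !adj1 opp_block_mx !oppr0 opprK.
Qed.

Lemma mul_JmxJ m : Jmx m *m Jmx m = - 1%:M :> 'M[C]_(m + m).
Proof. by rewrite {2}/Jmx mul_Jmx scalar_mx_block opp_block_mx !oppr0. Qed.

Section Embeddings.
Variables n1 n2 : nat.
Let E1 := inl1 R n1 n2.
Let E2 := inr1 R n1 n2.

Lemma inl1_gram : E1^t* *m E1 = 1%:M.
Proof. by rewrite /E1 /inl1 adj_col_mx adj1 adj0 mul_row_col mul1mx mul0mx addr0. Qed.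

Lemma inr1_gram : E2^t* *m E2 = 1%:M.
Proof. by rewrite /E2 /inr1 adj_col_mx adj1 adj0 mul_row_col mul1mx mul0mx add0r. Qed.

Lemma inl1_inr1 : E1^t* *m E2 = 0.
Proof. by rewrite /E1 /E2 /inl1 /inr1 adj_col_mx adj1 adj0 mul_row_col mulmx0 mul0mx addr0. Qed.

Lemma inl1_inr1_sum : E1 *m E1^t* + E2 *m E2^t* = 1%:M.
Proof.
have := @inl1_sandwich R n1 n2 1%:M; have := @inr1_sandwich R n1 n2 1%:M.
rewrite !mulmx1 /E1 /E2 => -> ->; rewrite add_block_mx !addr0 add0r.
by rewrite -scalar_mx_block.
Qed.

Lemma ursubmx_sandwich (M : 'M[C]_(n1 + n2)) : ursubmx M = E1^t* *m M *m E2.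
Proof.
rewrite -{2}[M]submxK /E1 /E2 /inl1 /inr1 adj_col_mx adj1 adj0 mul_row_block mul_row_col.
by rewrite !mul1mx !mul0mx mulmx0 !addr0 add0r mulmx1.
Qed.

Lemma dlsubmx_sandwich (M : 'M[C]_(n1 + n2)) : dlsubmx M = E2^t* *m M *m E1.
Proof.
rewrite -{2}[M]submxK /E1 /E2 /inl1 /inr1 adj_col_mx adj1 adj0 mul_row_block mul_row_col.
by rewrite !mul1mx !mul0mx mulmx0 !add0r addr0 mulmx1.
Qed.

Lemma drsubmx_sandwich (M : 'M[C]_(n1 + n2)) : drsubmx M = E2^t* *m M *m E2.
Proof.
rewrite -{2}[M]submxK /E1 /E2 /inl1 /inr1 adj_col_mx adj1 adj0 mul_row_block mul_row_col.
by rewrite !mul1mx !mul0mx mulmx0 !add0r mulmx1.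
Qed.

Lemma block_sandwich p q r s (X : 'M[C]_(p, q)) (Y : 'M[C]_(r, s)) (a b c e : 'M[C]_(p, r)) :
  (block_mx X 0 0 X)^t* *m block_mx a b c e *m block_mx Y 0 0 Y =
  block_mx (X^t* *m a *m Y) (X^t* *m b *m Y) (X^t* *m c *m Y) (X^t* *m e *m Y).
Proof. by rewrite adj_block !adj0 !mulmx_block !mul0mx !mulmx0 !addr0 !add0r. Qed.

End Embeddings.

Lemma adj_sandwich p q r s (X : 'M[C]_(p, q)) (M : 'M[C]_(r, p)) (Y : 'M[C]_(r, s)) :
  X^t* *m M^t* *m Y = (Y^t* *m M *m X)^t*.
Proof. by rewrite (adjM (Y^t* *m M)) (adjM (Y^t*)) adjK mulmxA. Qed.

Lemma ulsubmx0 p q r s : ulsubmx (0 : 'M[C]_(p + q, r + s)) = 0.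
Proof. by apply/matrixP => i j; rewrite !mxE. Qed.

Lemma ursubmx0 p q r s : ursubmx (0 : 'M[C]_(p + q, r + s)) = 0.
Proof. by apply/matrixP => i j; rewrite !mxE. Qed.

Lemma dlsubmx0 p q r s : dlsubmx (0 : 'M[C]_(p + q, r + s)) = 0.
Proof. by apply/matrixP => i j; rewrite !mxE. Qed.

Lemma drsubmx0 p q r s : drsubmx (0 : 'M[C]_(p + q, r + s)) = 0.
Proof. by apply/matrixP => i j; rewrite !mxE. Qed.

Section AbstractRiccati.
Variables (N m1 m2 : nat) (T1 : 'M[C]_(N, m1)) (T2 : 'M[C]_(N, m2)).
Variables (H J : 'M[C]_N) (A1 J1 : 'M[C]_m1) (A2 J2 : 'M[C]_m2).
Variables (X12 : 'M[C]_(m1, m2)) (X21 Y : 'M[C]_(m2, m1)).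
Hypothesis gram11 : T1^t* *m T1 = 1%:M.
Hypothesis gram22 : T2^t* *m T2 = 1%:M.
Hypothesis gram12 : T1^t* *m T2 = 0.
Hypothesis gram21 : T2^t* *m T1 = 0.
Hypothesis gram_sum : T1 *m T1^t* + T2 *m T2^t* = 1%:M.
Hypothesis J_T1 : J *m T1 = T1 *m J1.
Hypothesis J_T2 : J *m T2 = T2 *m J2.
Hypothesis H_T1 : H *m T1 = T1 *m A1 + T2 *m X21.
Hypothesis H_T2 : H *m T2 = T1 *m X12 + T2 *m A2.
Hypothesis hY : X21 + A2 *m Y = Y *m (A1 + X12 *m Y).

Let U := T1 + T2 *m Y.
Let K := A1 + X12 *m Y.

Lemma invgraph_invariant : H *m U = U *m K.
Proof.
rewrite /U mulmxDr (mulmxA H T2) H_T1 H_T2 (mulmxDl T1) -(mulmxA T2) -hY /K.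
rewrite !mulmxDr !mulmxDl !mulmxA; mx_atoms; mx_ring.
Qed.

Lemma invgraph_form : U^t* *m J *m U = J1 + Y^t* *m J2 *m Y.
Proof.
rewrite /U adjD adjM -mulmxA mulmxDr (mulmxA J T2) J_T1 J_T2 mulmxDl !mulmxDr.
rewrite !mulmxA gram11 gram12 -(mulmxA (Y^t*) _ T1) -(mulmxA (Y^t*) _ T2) gram21 gram22.
by rewrite mul1mx !mulmx0 !mul0mx mulmx1 addr0 add0r.
Qed.

Lemma invgraph_inj r (a : 'M[C]_(m1, r)) : U *m a = 0 -> a = 0.
Proof.
move=> /(congr1 (mulmx (T1^t*))); rewrite mulmx0 mulmxA /U mulmxDr mulmxA gram11 gram12.
by rewrite mul0mx addr0 mul1mx.
Qed.

(** For an eigenvector with components [a] and [b], the Riccati equation makes [b - Y a] a kernel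
    vector of [z - (A2 - Y X12)]. Where this matrix is invertible, the eigenvector lies on the graph
    of [Y]. *)
Lemma invgraph_kernel z (x : 'cV[C]_N) : z%:M - (A2 - Y *m X12) \in unitmx ->
  H *m x = z *: x -> exists2 a, x = U *m a & K *m a = z *: a.
Proof.
move=> uz hx; pose a := T1^t* *m x; pose b := T2^t* *m x.
have xE : x = T1 *m a + T2 *m b by rewrite /a /b !mulmxA -mulmxDl gram_sum mul1mx.
have hHx : H *m x = T1 *m (A1 *m a + X12 *m b) + T2 *m (X21 *m a + A2 *m b).
  rewrite {1}xE mulmxDr !mulmxA H_T1 H_T2 !mulmxDl !mulmxDr !mulmxA; mx_atoms; mx_ring.
have [ha hb] : A1 *m a + X12 *m b = z *: a /\ X21 *m a + A2 *m b = z *: b.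
  move: hHx; move: (A1 *m a + X12 *m b) (X21 *m a + A2 *m b) => p q; rewrite hx => e; split.
    have := congr1 (mulmx (T1^t*)) e.
    by rewrite mulmxDr !(mulmxA (T1^t*)) gram11 gram12 mul1mx mul0mx addr0 -scalemxAr.
  have := congr1 (mulmx (T2^t*)) e.
  by rewrite mulmxDr !(mulmxA (T2^t*)) gram21 gram22 mul1mx mul0mx add0r -scalemxAr.
move: a b xE ha hb {hHx} => a b xE ha hb.
have bY : b = Y *m a.
  apply/eqP; rewrite -subr_eq0; apply/eqP; apply: (unitmx_inj uz).
  have e : X21 *m a + A2 *m Y *m a = Y *m A1 *m a + Y *m X12 *m Y *m a.
    by have := congr1 (mulmx^~ a) hY; rewrite !mulmxDr !mulmxDl !mulmxA.
  have e2 : Y *m A1 *m a + Y *m X12 *m b = z *: (Y *m a).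
    by rewrite scalemxAr -ha mulmxDr !mulmxA.
  rewrite mulmxBl mul_scalar_mx scalerBr -hb -e2 mulmxBl !mulmxBr !mulmxA.
  move: e; move: (X21 *m a) (A2 *m Y *m a) (Y *m A1 *m a) (Y *m X12 *m Y *m a).
  move: (A2 *m b) (Y *m X12 *m b) => u1 u2 u3 u4 u5 u6 e.
  have -> : u3 = u5 + u6 - u4 by rewrite -e addrK.
  by mx_ring.
have xU : x = U *m a by rewrite xE bY /U mulmxDl !mulmxA.
by exists a => //; rewrite /K mulmxDl -mulmxA -bY ha.
Qed.

End AbstractRiccati.

(** Together with [emb2], the columns of the permutation that interchanges the two middle blocks.
    Both maps are isometric and intertwine the matrices [Jmx]. *)
Definition emb1 n1 n2 : 'M[C]_((n1 + n2) + (n1 + n2), n1 + n1) :=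
  block_mx (inl1 R n1 n2) 0 0 (inl1 R n1 n2).
Definition emb2 n1 n2 : 'M[C]_((n1 + n2) + (n1 + n2), n2 + n2) :=
  block_mx (inr1 R n1 n2) 0 0 (inr1 R n1 n2).

Section Embedding2.
Variables n1 n2 : nat.
Let n := (n1 + n2)%N.
Let T1 := emb1 n1 n2.
Let T2 := emb2 n1 n2.

Lemma emb11 : T1^t* *m T1 = 1%:M.
Proof.
by rewrite /T1 adj_block !adj0 mulmx_block !mul0mx !mulmx0 !addr0 !add0r inl1_gram -scalar_mx_block.
Qed.

Lemma emb22 : T2^t* *m T2 = 1%:M.
Proof.
by rewrite /T2 adj_block !adj0 mulmx_block !mul0mx !mulmx0 !addr0 !add0r inr1_gram -scalar_mx_block.
Qed.

Lemma emb12 : T1^t* *m T2 = 0.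
Proof.
by rewrite /T1 /T2 adj_block !adj0 mulmx_block !mul0mx !mulmx0 !addr0 !add0r inl1_inr1 block_mx0.
Qed.

Lemma emb21 : T2^t* *m T1 = 0.
Proof. by rewrite -[LHS]adjK adjM adjK emb12 adj0. Qed.

Lemma emb_sum : T1 *m T1^t* + T2 *m T2^t* = 1%:M.
Proof.
rewrite /T1 /T2 !adj_block !adj0 !mulmx_block !mul0mx !mulmx0 !addr0 !add0r add_block_mx !addr0.
by rewrite inl1_inr1_sum -scalar_mx_block.
Qed.

Lemma J_emb1 : Jmx n *m T1 = T1 *m Jmx n1.
Proof. by rewrite /T1 mul_Jmx /Jmx mulmx_block !mul0mx !mulmx0 !mulmxN !mulmx1 !addr0 !add0r oppr0. Qed.

Lemma J_emb2 : Jmx n *m T2 = T2 *m Jmx n2.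
Proof. by rewrite /T2 mul_Jmx /Jmx mulmx_block !mul0mx !mulmx0 !mulmxN !mulmx1 !addr0 !add0r oppr0. Qed.

Lemma emb1_J : T1^t* *m Jmx n = Jmx n1 *m T1^t*.
Proof.
apply: oppr_inj; rewrite -mulmxN -mulNmx -!adj_Jmx -!adjM; congr (_^t*).
exact: J_emb1.
Qed.

Lemma emb2_J : T2^t* *m Jmx n = Jmx n2 *m T2^t*.
Proof.
apply: oppr_inj; rewrite -mulmxN -mulNmx -!adj_Jmx -!adjM; congr (_^t*).
exact: J_emb2.
Qed.

End Embedding2.

Section Reduction.
Variables (n1 n2 : nat) (F11 G11 : 'M[C]_n1) (F22 G22 : 'M[C]_n2).
Let n := (n1 + n2)%N.
Variable Delta : 'M[C]_(n + n).
Hypothesis hDelta : herm Delta.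
Let T1 := emb1 n1 n2.
Let T2 := emb2 n1 n2.

Definition Hbase : 'M[C]_(n + n) := block_mx (block_mx F11 0 0 F22) (block_mx G11 0 0 G22)
   0 (- (block_mx F11 0 0 F22)^t*).
Definition Hpert (t : R) : 'M[C]_(n + n) := Hbase + t%:C *: (Jmx n *m Delta).

Lemma Delta_block : Delta = block_mx (ulsubmx Delta) ((dlsubmx Delta)^t*) (dlsubmx Delta) (drsubmx Delta).
Proof.
rewrite -{1}[Delta]submxK; congr (block_mx _ _ _ _).
have := hDelta; rewrite /herm -{1}[Delta]submxK adj_block => /(congr1 ursubmx).
by rewrite block_mxKur.
Qed.

Lemma Delta_emb11 : T1^t* *m Delta *m T1 = block_mx (D11 Delta) ((D31 Delta)^t*) (D31 Delta) (D33 Delta).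
Proof.
rewrite {1}Delta_block /T1 /emb1 block_sandwich /D11 /D31 /D33 adj_sandwich.
by rewrite -!ulsubmx_sandwich.
Qed.

Lemma Delta_emb22 : T2^t* *m Delta *m T2 = block_mx (D22 Delta) ((D42 Delta)^t*) (D42 Delta) (D44 Delta).
Proof.
rewrite {1}Delta_block /T2 /emb2 block_sandwich /D22 /D42 /D44 adj_sandwich.
by rewrite -!drsubmx_sandwich.
Qed.

Lemma Delta_emb21 : T2^t* *m Delta *m T1 = block_mx (D21 Delta) ((D32 Delta)^t*) (D41 Delta) (D43 Delta).
Proof.
rewrite {1}Delta_block /T1 /T2 /emb1 /emb2 block_sandwich /D21 /D32 /D41 /D43 adj_sandwich.
by rewrite -!dlsubmx_sandwich -ursubmx_sandwich.
Qed.

Lemma base11 : T1^t* *m Hbase *m T1 = block_mx F11 G11 0 (- F11^t*).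
Proof.
rewrite /T1 /emb1 /Hbase block_sandwich -!ulsubmx_sandwich adj_block !block_mxKul ulsubmx0.
by rewrite opp_block_mx block_mxKul.
Qed.

Lemma base22 : T2^t* *m Hbase *m T2 = block_mx F22 G22 0 (- F22^t*).
Proof.
rewrite /T2 /emb2 /Hbase block_sandwich -!drsubmx_sandwich adj_block !block_mxKdr drsubmx0.
by rewrite opp_block_mx block_mxKdr.
Qed.

Lemma base12 : T1^t* *m Hbase *m T2 = 0.
Proof.
rewrite /T1 /T2 /emb1 /emb2 /Hbase block_sandwich -!ursubmx_sandwich adj_block !adj0 !block_mxKur ursubmx0.
by rewrite opp_block_mx block_mxKur oppr0 block_mx0.
Qed.

Lemma base21 : T2^t* *m Hbase *m T1 = 0.
Proof.
rewrite /T1 /T2 /emb1 /emb2 /Hbase block_sandwich -!dlsubmx_sandwich adj_block !adj0 !block_mxKdl dlsubmx0.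
by rewrite opp_block_mx block_mxKdl oppr0 block_mx0.
Qed.

Lemma Hpert_sandwich p q (X : 'M[C]_(n + n, p + p)) (Y : 'M[C]_(n + n, q)) t :
  X^t* *m Jmx n = Jmx p *m X^t* ->
  X^t* *m Hpert t *m Y = X^t* *m Hbase *m Y + t%:C *: (Jmx p *m (X^t* *m Delta *m Y)).
Proof.
by move=> hX; rewrite /Hpert mulmxDr mulmxDl -scalemxAr -scalemxAl !mulmxA hX.
Qed.

Lemma Hpert11 t : T1^t* *m Hpert t *m T1 = H1 F11 G11 Delta t.
Proof.
rewrite (Hpert_sandwich _ _ (emb1_J n1 n2)) base11 Delta_emb11 mul_Jmx scale_block_mx add_block_mx.
by rewrite add0r /H1 scalerN; congr (block_mx _ _ _ _); rewrite adjD adjZr opprD scalerN.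
Qed.

Lemma Hpert22 t : T2^t* *m Hpert t *m T2 = H2 F22 G22 Delta t.
Proof.
rewrite (Hpert_sandwich _ _ (emb2_J n1 n2)) base22 Delta_emb22 mul_Jmx scale_block_mx add_block_mx.
by rewrite add0r /H2 scalerN; congr (block_mx _ _ _ _); rewrite adjD adjZr opprD scalerN.
Qed.

Lemma Lmx_emb : Jmx n2 *m (T2^t* *m Delta *m T1) = Lmx Delta.
Proof. by rewrite Delta_emb21 mul_Jmx. Qed.

Lemma Hpert21 t : T2^t* *m Hpert t *m T1 = t%:C *: Lmx Delta.
Proof. by rewrite (Hpert_sandwich _ _ (emb2_J n1 n2)) base21 Lmx_emb add0r. Qed.

Lemma Hpert12 t : T1^t* *m Hpert t *m T2 = t%:C *: J1LJ2 Delta.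
Proof.
rewrite (Hpert_sandwich _ _ (emb1_J n1 n2)) base12 add0r; congr (_ *: _).
rewrite /J1LJ2 -Lmx_emb (adjM (Jmx n2)) adj_Jmx mulmxN mulmxN mulNmx -!mulmxA mul_JmxJ !mulmxN mulmx1 opprK.
by rewrite (mulmxA _ Delta T1) -adj_sandwich hDelta mulmxA.
Qed.

Lemma Hpert_emb1 t : Hpert t *m T1 = T1 *m H1 F11 G11 Delta t + T2 *m (t%:C *: Lmx Delta).
Proof.
rewrite -Hpert11 -Hpert21 -[LHS]mul1mx -(emb_sum n1 n2) mulmxDl -/T1 -/T2.
by rewrite !mulmxA.
Qed.

Lemma Hpert_emb2 t : Hpert t *m T2 = T1 *m (t%:C *: J1LJ2 Delta) + T2 *m H2 F22 G22 Delta t.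
Proof.
rewrite -Hpert12 -Hpert22 -[LHS]mul1mx -(emb_sum n1 n2) mulmxDl -/T1 -/T2.
by rewrite !mulmxA.
Qed.

End Reduction.

Lemma unitmx_Jmx m : (Jmx m : 'M[C]_(m + m)) \in unitmx.
Proof.
have h : Jmx m *m (- Jmx m) = 1%:M :> 'M[C]_(m + m) by rewrite mulmxN mul_JmxJ opprK.
by have [] := mulmx1_unit h.
Qed.

Lemma eigenvalue_not_unit m (A : 'M[C]_m) z : (eigenvalue A z) = (A - z%:M \notin unitmx).
Proof. by rewrite unitmx_eigenvalue negbK. Qed.

(* [J^-1 S^H J] is another square root of [X] with spectrum in the right half-plane,
   so it is [S]. *)
Lemma sqrt_symplectic m (X S J : 'M[C]_m) : J \in unitmx -> J^t* = - J -> J *m J = - 1%:M ->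
  (J *m X)^t* = - (J *m X) -> principal_sqrtmx X S ->
  S \in unitmx /\ S^t* *m J *m S = J *m X.
Proof.
move=> uJ Ja JJ JXa [SS hS].
have uS : S \in unitmx.
  have -> : S = S - 0%:M by rewrite raddf0 subr0.
  by rewrite unitmx_eigenvalue; apply/negP => /hS; rewrite ltxx.
split=> //.
have XaJ : X^t* *m J = J *m X.
  by move: JXa; rewrite adjM Ja mulmxN => /oppr_inj.
have [S' S'S' JS] : exists2 S', S' *m S' = X & J *m S' = S^t* *m J.
  exists (- (J *m S^t* *m J)).
    rewrite mulNmx mulmxN opprK -!mulmxA (mulmxA J J) JJ mulNmx mul1mx.
    by rewrite !mulmxN (mulmxA (S^t*)) -adjM SS XaJ mulmxA JJ mulNmx mul1mx opprK.
  by rewrite mulmxN !mulmxA JJ mulNmx mul1mx mulNmx opprK.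
have S'eig z : eigenvalue S' z -> 0 < complex.Re z.
  rewrite eigenvalue_not_unit => hz; rewrite -ReJ; apply: hS.
  rewrite eigenvalue_not_unit; apply: contra hz => h.
  have : (S - (Num.conj z)%:M)^t* \in unitmx by rewrite map_unitmx unitmx_tr.
  rewrite adjB adj_scalar conjCK => h2.
  have : J *m (S' - z%:M) \in unitmx.
    by rewrite mulmxBr JS scalar_mxC -mulmxBl unitmx_mul h2.
  by rewrite unitmx_mul => /andP[].
(* The roots satisfy [S (S - S') = (S - S') (- S')], and the spectra of [S] and [- S'] are separated
   by the imaginary axis. *)
have SE : S = S'.
  apply/eqP; rewrite -subr_eq0; apply/eqP; apply: (@sylvester_unique _ _ S (- S')).
    by rewrite mulmxBr mulmxN mulmxBl SS S'S' opprB addrC.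
  move=> z /hS z1; rewrite eigenvalue_not_unit => h2.
  have : 0 < complex.Re (- z).
    apply: S'eig; rewrite eigenvalue_not_unit; apply: contra h2 => h3.
    rewrite (_ : - S' - z%:M = - (S' - (- z)%:M)); last by rewrite raddfN opprD opprK.
    by rewrite -scaleN1r unitmxZ // unitrN unitr1.
  by rewrite ReN oppr_gt0 ltNge ltW.
by rewrite -JS -SE -mulmxA SS.
Qed.

End BlockReduction.

(** * The perturbed Hamiltonian matrix seen through the Hermitian pencil *)

Section PerturbedPencil.
Variable R : realType.
Local Notation C := R[i].
Local Notation ii := ('i : C).

Lemma conj_ii : Num.conj ii = - ii. Proof. by rewrite complexiE conjCi. Qed.

Section Pencil.
Variables (n1 n2 : nat) (F11 G11 : 'M[C]_n1) (F22 G22 : 'M[C]_n2).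
Let n := (n1 + n2)%N.
Variables (d : 'M[C]_(n + n)) (z0 : C).
Hypothesis z0i : Num.conj z0 = - z0.
Hypothesis hG : psdmx (block_mx G11 0 0 G22).
Let Delta := d^t* *m d.
Let sdl := saddle F11 G11 F22 G22 z0.
Let Hb : 'M[C]_(n + n) := Hbase F11 G11 F22 G22.
Let Hp := Hpert F11 G11 F22 G22 Delta.

(** Since [z0] is imaginary, [- F^H - z0 - i x] is minus the adjoint of [F - z0 - i x], which turns
    the product with [J] into a Hermitian matrix. *)
Lemma Hbase_shift x : Jmx n *m (Hb - (pt z0 x)%:M) = - sdl x.
Proof.
rewrite /Hb /Hbase scalar_mx_block opp_block_mx add_block_mx !subr0 ?add0r mul_Jmx.
rewrite /sdl /saddle /shiftF -/(pt z0 x) [RHS]opp_block_mx oppr0.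
congr block_mx.
rewrite adjB adj_scalar opprB addrC -raddfN; congr (_%:M + _).
by rewrite /pt rmorphD /= z0i mulrC conjMR conj_ii mulrN opprD mulrC.
Qed.

Lemma Hpert_shift x t : Jmx n *m (Hp t - (pt z0 x)%:M) = - (sdl x + t%:C *: Delta).
Proof.
rewrite /Hp /Hpert addrAC mulmxDr Hbase_shift -scalemxAr mulmxA mul_JmxJ mulNmx mul1mx scalerN.
by rewrite opprD.
Qed.

Lemma Hpert_kernel x t (v : 'cV[C]_(n + n)) : Hp t *m v = pt z0 x *: v <-> (sdl x + t%:C *: Delta) *m v = 0.
Proof.
have e : (sdl x + t%:C *: Delta) *m v = - (Jmx n *m (Hp t *m v - pt z0 x *: v)).
  have -> : Hp t *m v - pt z0 x *: v = (Hp t - (pt z0 x)%:M) *m v by rewrite mulmxBl mul_scalar_mx.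
  by rewrite mulmxA Hpert_shift mulNmx opprK.
split=> [h|h]; first by rewrite e h subrr mulmx0 oppr0.
apply/eqP; rewrite -subr_eq0; apply/eqP; apply: (unitmx_inj (unitmx_Jmx R n)).
by apply/eqP; rewrite -oppr_eq0 -e h.
Qed.

Lemma Hpert_rank x t : \rank (Hp t - (pt z0 x)%:M)%R = \rank (sdl x + t%:C *: Delta)%R.
Proof.
rewrite -(rank_unit_l (Hp t - (pt z0 x)%:M) (unitmx_Jmx R n)) Hpert_shift.
by rewrite -scaleN1r mxrank_scale_nz // oppr_eq0 oner_eq0.
Qed.

Lemma pencil_herm x : (pt z0 x)%:M - Hb \in unitmx ->
  herm (d *m invmx ((pt z0 x)%:M - Hb) *m (Jmx n *m d^t*)).
Proof.
set E := _ - Hb => uE.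
have e : sdl x = Jmx n *m E by rewrite /E -opprB mulmxN Hbase_shift opprK.
have us : sdl x \in unitmx by rewrite e unitmx_mul unitmx_Jmx.
have -> : d *m invmx E *m (Jmx n *m d^t*) = - (d *m invmx (sdl x) *m d^t*).
  have h0 : invmx E *m Jmx n = - invmx (sdl x).
    have h : sdl x *m (- (invmx E *m Jmx n)) = 1%:M.
      by rewrite e mulmxN -mulmxA mulKVmx // mul_JmxJ opprK.
    by have [_ ->] := invmx_right h; rewrite opprK.
  by rewrite mulmxA -(mulmxA d) h0 mulmxN mulNmx.
by apply: hermN; apply: herm_congr'; apply: invmx_herm (saddle_herm F11 F22 z0 hG x).
Qed.

Lemma Hpert_semisimple : exists2 r : R, 0 < r & forall z, 0 < cabs (z - z0) < r ->
  forall (t : R) (a b : 'cV[C]_(n + n)), (z%:M - Hp t) *m a = 0 ->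
  a = (z%:M - Hp t) *m b -> a = 0.
Proof.
have hB : Jmx n *m Delta = (Jmx n *m d^t*) *m d by rewrite /Delta mulmxA.
have [r r0 h] := @pencil_semisimple R z0 _ Hb (Jmx n *m Delta) (Jmx n *m d^t*) d hB pencil_herm.
exists r => // z zr t a b; have := h z zr t%:C a b.
by rewrite /Hp /Hpert -/Hb opprD addrA.
Qed.

(** Both matrices are Hermitian and differ by [(y - x) i J]; sandwiching the difference between the
    two kernel vectors leaves [0]. *)
Lemma kernel_orthogonal x y t (X Y : 'cV[C]_(n + n)) : x != y ->
  (sdl x + t%:C *: Delta) *m X = 0 -> (sdl y + t%:C *: Delta) *m Y = 0 ->
  X^t* *m (ii *: Jmx n) *m Y = 0.
Proof.
move=> xy hX hY.
have hh : herm (sdl x + t%:C *: Delta).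
  by rewrite /herm adjD adjZr (saddle_herm F11 F22 z0 hG) herm_gram.
have hX' : X^t* *m (sdl x + t%:C *: Delta) = 0 by rewrite -hh -adjM hX adj0.
have : X^t* *m ((sdl y + t%:C *: Delta) *m Y) = 0 by rewrite hY mulmx0.
rewrite /sdl (saddle_shift _ _ _ _ _ x y) -/sdl addrAC mulmxDl mulmxDr mulmxA hX' mul0mx add0r.
rewrite -scalemxAl -scalemxAr mulmxA => /eqP; rewrite scaler_eq0 => /orP[|/eqP//].
by rewrite fmorph_eq0 subr_eq0 eq_sym (negbTE xy).
Qed.

End Pencil.

Lemma qf_orthogonal_sum (I : finType) m (M : 'M[C]_m) (X : I -> 'cV[C]_m) :
  (forall i j, i != j -> (X i)^t* *m M *m X j = 0) ->
  qf M (\sum_i X i) = \sum_i qf M (X i).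
Proof.
move=> h; rewrite /qf.
have -> : (\sum_i X i)^t* *m M *m (\sum_i X i) = \sum_i (X i)^t* *m M *m X i.
  rewrite mulmx_sumr; apply: eq_bigr => j _.
  have -> : (\sum_i X i)^t* = \sum_i (X i)^t*.
    by elim/big_ind2: _ => [|A A' B B' <- <-|//]; rewrite ?adj0 ?adjD.
  rewrite !mulmx_suml (bigD1 j) //= big1 ?addr0 // => i ij; exact: h.
by rewrite summxE Re_sum.
Qed.

Lemma kernel_basis' p (A : 'M[C]_p) : exists k (X : 'M[C]_(p, k)),
  [/\ k = (p - \rank A)%N, A *m X = 0 & \rank X = k].
Proof.
exists (\rank (kermx A^T)), (row_base (kermx A^T))^T; split.
- by rewrite mxrank_ker mxrank_tr.
- apply: trmx_inj; rewrite trmx_mul trmxK trmx0; apply/eqP.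
  by rewrite -sub_kermx eq_row_base.
by rewrite mxrank_tr; have /eqP -> := row_base_free (kermx A^T).
Qed.

Lemma rank_inj m k (X : 'M[C]_(m, k)) : (forall c : 'cV[C]_k, X *m c = 0 -> c = 0) -> \rank X = k.
Proof.
move=> h; rewrite -mxrank_tr; apply/eqP; rewrite -[_ == _]/(row_free X^T) -kermx_eq0.
apply/eqP/row_matrixP => i; rewrite row0; apply: trmx_inj; rewrite trmx0; apply: h.
by apply: trmx_inj; rewrite trmx_mul trmxK trmx0 -row_mul mulmx_ker row0.
Qed.

Lemma nullity_ge p k (A : 'M[C]_p) (X : 'M[C]_(p, k)) : A *m X = 0 -> \rank X = k ->
  (k <= p - \rank A)%N.
Proof.
by move=> /mulmx0_rank_max h rX; rewrite rX in h; rewrite leq_subRL ?(leq_trans (leq_addr _ _) h).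
Qed.

Lemma nullity_transfer p q (A : 'M[C]_p) (B : 'M[C]_q) (W : 'M[C]_(q, p)) :
  (forall a : 'cV[C]_p, W *m a = 0 -> a = 0) ->
  (forall a : 'cV[C]_p, A *m a = 0 -> B *m (W *m a) = 0) ->
  (forall x : 'cV[C]_q, B *m x = 0 -> exists2 a, x = W *m a & A *m a = 0) ->
  (p - \rank A = q - \rank B)%N.
Proof.
move=> Wi h1 h2; apply/eqP; rewrite eqn_leq; apply/andP; split.
  have [k [X [<- AX rX]]] := kernel_basis' A.
  apply: (@nullity_ge _ _ B (W *m X)).
    apply/matrixP => i j; rewrite [RHS]mxE.
    have c0 : col j (0 : 'M[C]_(p, k)) = 0 by apply/matrixP => ? ?; rewrite !mxE.
    by have := h1 (col j X); rewrite mul_mx_col AX !mul_mx_col c0 => /(_ erefl)/matrixP/(_ i 0); rewrite !mxE.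
  apply: rank_inj => c; rewrite -mulmxA => /Wi; exact: full_rank_inj.
have [k [X [<- BX rX]]] := kernel_basis' B.
have /fin_all_exists2 [f fX fA] j : exists2 a, col j X = W *m a & A *m a = 0.
  by apply: h2; rewrite mul_mx_col BX; apply/matrixP => i l; rewrite !mxE.
pose Y := \matrix_(i, j) f j i 0.
have cY j : col j Y = f j by apply/matrixP => i l; rewrite ord1 !mxE.
have XE : X = W *m Y.
  by apply/matrixP => i j; have := fX j; rewrite -cY mul_mx_col => /matrixP/(_ i 0); rewrite !mxE.
apply: (@nullity_ge _ _ A Y).
  by apply/matrixP => i j; have := fA j; rewrite -cY mul_mx_col => /matrixP/(_ i 0); rewrite !mxE.
apply: rank_inj => c Yc; apply: (full_rank_inj rX); rewrite XE -mulmxA Yc mulmx0 //.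
Qed.

End PerturbedPencil.

(** * Transport between [H(t)] and [Ht(t)] *)

Section ReductionExistence.
Variable R : realType.
Local Notation C := R[i].
Local Notation ii := ('i : C).

Lemma near0_ge (P : R -> Prop) : (\forall t \near (0 : R), 0 <= t -> P t) ->
  exists2 e : R, 0 < e & forall t, 0 <= t < e -> P t.
Proof.
move=> /nbhs_ballP[e /= e0 h]; exists e => // t /andP[t0 te]; apply: (h t) => //.
by rewrite /ball /= sub0r normrN ger0_norm.
Qed.

Lemma nrm_le_mx_norm m n (A : 'M[C]_(m, n)) (c : R) : mx_norm A <= c%:C ->
  nrm A <= (m * n)%:R * c.
Proof.
move=> hA; apply: nrm_le_card => i j; rewrite -lecR -normCE.
apply: le_trans hA; rewrite mx_normE.
exact: (le_bigmax _ (fun ij : 'I_m * 'I_n => `|A ij.1 ij.2|%:nng) (i, j)).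
Qed.

Lemma unitmxN m (A : 'M[C]_m) : (- A \in unitmx) = (A \in unitmx).
Proof. by rewrite -scaleN1r unitmxZ // unitrN unitr1. Qed.

Lemma eigenvalue_block_ut m (A B : 'M[C]_m) z :
  eigenvalue (block_mx A B 0 (- A^t*)) z -> eigenvalue A z \/ eigenvalue (- A^t*) z.
Proof.
rewrite !eigenvalue_not_unit scalar_mx_block opp_block_mx add_block_mx !oppr0 !addr0.
by rewrite !unitmxE det_ublock unitrM negb_and => /orP.
Qed.

Lemma eigenvalue_adj m (A : 'M[C]_m) z : eigenvalue (- A^t*) z -> eigenvalue A (- Num.conj z).
Proof.
rewrite !eigenvalue_not_unit; apply: contra => h.
have -> : - A^t* - z%:M = - (A - (- Num.conj z)%:M)^t*.
  by rewrite adjB adj_scalar rmorphN /= conjCK opprB addrC raddfN.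
by rewrite unitmxN map_unitmx unitmx_tr.
Qed.

Lemma mul_lt_of_lt_div (a b t : R) : 0 <= a -> 0 < b -> t < b / (a + 1) -> 0 <= t -> t * a < b.
Proof.
move=> a0 b0; have a1 : 0 < a + 1 by rewrite ltr_wpDl.
rewrite (ltr_pdivlMr _ _ a1) => h t0; apply: le_lt_trans h.
by rewrite ler_wpM2l // lerDl.
Qed.

Section Reduction.
Variables (n1 n2 : nat) (F11 G11 : 'M[C]_n1) (F22 G22 : 'M[C]_n2).
Let n := (n1 + n2)%N.
Variables (Delta : 'M[C]_(n + n)) (Ht : R -> 'M[C]_(n1 + n1)) (z0 : C).
Hypothesis hDelta : herm Delta.
Hypothesis z0i : Num.conj z0 = - z0.
Hypothesis hF11 : forall z, eigenvalue F11 z -> z = z0.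
Hypothesis hF22 : ~ (eigenvalue F22 z0 \/ eigenvalue (- F22^t*) z0).
Hypothesis hHt : is_Htilde1 F11 G11 F22 G22 Delta Ht.

Let Hp := Hpert F11 G11 F22 G22 Delta.
Let H10 : 'M[C]_(n1 + n1) := block_mx F11 G11 0 (- F11^t*).
Let H20 : 'M[C]_(n2 + n2) := block_mx F22 G22 0 (- F22^t*).

Lemma H1_lip t : 0 <= t -> nrm (H1 F11 G11 Delta t - H10) <=
  t * nrm (block_mx (D31 Delta) (D33 Delta) (- D11 Delta) (- (D31 Delta)^t*)).
Proof.
move=> t0; rewrite -[X in X * _](ger0_norm t0) -cabsR -nrmZ le_eqVlt; apply/orP; left; apply/eqP.
congr (nrm _); rewrite /H1 /H10 opp_block_mx add_block_mx scale_block_mx !scalerN oppr0 addr0 opprK.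
by rewrite [_ - F11]addrAC subrr add0r [_ - G11]addrAC subrr add0r adjD adjZr opprD addrAC addNr add0r.
Qed.

Lemma H2_lip t : 0 <= t -> nrm (H2 F22 G22 Delta t - H20) <=
  t * nrm (block_mx (D42 Delta) (D44 Delta) (- D22 Delta) (- (D42 Delta)^t*)).
Proof.
move=> t0; rewrite -[X in X * _](ger0_norm t0) -cabsR -nrmZ le_eqVlt; apply/orP; left; apply/eqP.
congr (nrm _); rewrite /H2 /H20 opp_block_mx add_block_mx scale_block_mx !scalerN oppr0 addr0 opprK.
by rewrite [_ - F22]addrAC subrr add0r [_ - G22]addrAC subrr add0r adjD adjZr opprD addrAC addNr add0r.
Qed.

Lemma H10_spec z : eigenvalue H10 z -> z = z0.
Proof.
move=> /eigenvalue_block_ut[/hF11 //|/eigenvalue_adj/hF11 e].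
by have := congr1 Num.conj e; rewrite rmorphN /= conjCK z0i => /oppr_inj.
Qed.

Lemma H20_unit : z0%:M - H20 \in unitmx.
Proof.
rewrite -unitmxN opprB; have [//|h] := boolP (H20 - z0%:M \in unitmx).
by case: hF22; apply: eigenvalue_block_ut; rewrite eigenvalue_not_unit; exact: h.
Qed.

(* [W] is the graph [[I; Y]] of the Riccati solution times [S^-1]. *)
Lemma riccati_reduction : exists2 r1 : R, 0 < r1 & forall r2 : R, 0 < r2 ->
  exists2 t0 : R, 0 < t0 & forall t, 0 < t < t0 ->
  exists W : 'M[C]_(n + n, n1 + n1),
  [/\ Hp t *m W = W *m Ht t, W^t* *m Jmx n *m W = Jmx n1,
      forall a : 'cV[C]_(n1 + n1), W *m a = 0 -> a = 0,
      forall z (x : 'cV[C]_(n + n)), cabs (z - z0) < r1 -> Hp t *m x = z *: x ->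
        exists2 a, x = W *m a & Ht t *m a = z *: a &
      forall z, eigenvalue (Ht t) z -> cabs (z - z0) < r2].
Proof.
have [Y [S [[/near0_ge[ta ta0 hric] [c /near0_ge[tb tb0 hY]]] /near0_ge[tc tc0 hS] /near0_ge[td td0 hE]]]] := hHt.
have [e2 [K2 [e20 h2]]] := unitmx_near H20_unit.
pose N1 := nrm (1%:M : 'M[C]_(n2 + n2)).
have N10 : 0 < N1 + 1 by rewrite ltr_wpDl ?nrm_ge0.
(* Half of the margin [e2] is spent on [z - z0], which fixes this radius before [r2] is given; the
   other half is spent on [t] through [u2]. *)
exists (e2 / 2 / (N1 + 1)); first by rewrite !divr_gt0.
move=> r2 r20; have [e1 e10 h1] := spectrum_near H10_spec r20.
pose cY := ((n2 + n2) * (n1 + n1))%:R * `|c|.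
have cY0 : 0 <= cY by rewrite mulr_ge0 ?ler0n.
pose L := nrm (J1LJ2 Delta).
pose B1 := nrm (block_mx (D31 Delta) (D33 Delta) (- D11 Delta) (- (D31 Delta)^t*)).
pose B2 := nrm (block_mx (D42 Delta) (D44 Delta) (- D22 Delta) (- (D42 Delta)^t*)).
have L0 : 0 <= L by exact: nrm_ge0.
have B10 : 0 <= B1 by exact: nrm_ge0.
have B20 : 0 <= B2 by exact: nrm_ge0.
have c10 : 0 <= B1 + L * cY by rewrite addr_ge0 ?mulr_ge0.
have c20 : 0 <= B2 + L * cY by rewrite addr_ge0 ?mulr_ge0.
pose u1 := e1 / (B1 + L * cY + 1); pose u2 := e2 / 2 / (B2 + L * cY + 1).
have u10 : 0 < u1 by rewrite divr_gt0 // ltr_wpDl.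
have u20 : 0 < u2 by rewrite !divr_gt0 // ltr_wpDl.
exists (Num.min ta (Num.min tb (Num.min tc (Num.min td (Num.min 1 (Num.min u1 u2)))))).
  by rewrite !lt_min ta0 tb0 tc0 td0 ltr01 u10 u20.
move=> t /andP[t0]; rewrite !lt_min => /and5P[tta ttb ttc ttd /and3P[tt1 ttu1 ttu2]].
have t0' := ltW t0.
have {}hric := hric t (introT andP (conj t0' tta)).
have {}hY := hY t (introT andP (conj t0' ttb)).
have {}hS := hS t (introT andP (conj t0' ttc)).
have {}hE := hE t (introT andP (conj t0' ttd)).
have nY : nrm (Y t) <= cY.
  apply: le_trans (nrm_le_mx_norm hY) _; rewrite /cY ler_wpM2l ?ler0n //.
  apply: (le_trans (ler_norm _)); rewrite normrM (ger0_norm t0') ler_piMr ?normr_ge0 //.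
  exact: ltW.
move: (Y t) (S t) hric hS hE nY => {hY} Yt St hric hS hE nY.
have nX : nrm (t%:C *: J1LJ2 Delta) = t * L by rewrite nrmZ cabsR ger0_norm.
pose X12 := t%:C *: J1LJ2 Delta; pose A1 := H1 F11 G11 Delta t; pose A2 := H2 F22 G22 Delta t.
have hYt : t%:C *: Lmx Delta + A2 *m Yt = Yt *m (A1 + X12 *m Yt).
  rewrite mulmxDr /X12 -scalemxAl -scalemxAr mulmxA.
  move: hric; rewrite -/A1 -/A2; move: (t%:C *: Lmx Delta) (A2 *m Yt) (Yt *m A1) (t%:C *: _) => a b c' e h.
  apply/eqP; rewrite -subr_eq0 -h; apply/eqP; mx_ring.
pose U := emb1 R n1 n2 + emb2 R n1 n2 *m Yt.
pose K := A1 + X12 *m Yt.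
have HU : Hp t *m U = U *m K.
  exact: (invgraph_invariant (Hpert_emb1 F11 G11 F22 G22 hDelta t) (Hpert_emb2 F11 G11 F22 G22 hDelta t) hYt).
have JU : U^t* *m Jmx n *m U = Jmx n1 + Yt^t* *m Jmx n2 *m Yt.
  exact: (invgraph_form Yt (emb11 R n1 n2) (emb22 R n1 n2) (emb12 R n1 n2) (emb21 R n1 n2)
    (J_emb1 R n1 n2) (J_emb2 R n1 n2)).
have JX : Jmx n1 *m (1%:M - Jmx n1 *m Yt^t* *m Jmx n2 *m Yt) = Jmx n1 + Yt^t* *m Jmx n2 *m Yt.
  by rewrite mulmxBr mulmx1 !mulmxA mul_JmxJ !mulNmx mul1mx opprK.
have [uS SJS] : St \in unitmx /\ St^t* *m Jmx n1 *m St = Jmx n1 + Yt^t* *m Jmx n2 *m Yt.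
  rewrite -JX; apply: (sqrt_symplectic _ (adj_Jmx R n1) (mul_JmxJ R n1) _ hS).
    exact: unitmx_Jmx.
  rewrite JX adjD adj_Jmx (adjM (Yt^t* *m _)) (adjM (Yt^t*)) adjK adj_Jmx mulNmx mulmxN opprD.
  by rewrite mulmxA.
have hKE : Ht t = St *m K *m invmx St by rewrite hE /K /X12 -scalemxAl.
exists (U *m invmx St); split.
- by rewrite mulmxA HU hKE !mulmxA mulmxKV.
- rewrite adjM -!mulmxA (mulmxA (Jmx n)) (mulmxA (U^t*)) (mulmxA (U^t*)) JU -SJS.
  rewrite -!mulmxA mulmxV // mulmx1 mulmxA -adjM mulmxV // adj1 mul1mx //.
- move=> a; rewrite -mulmxA.
  move=> /(invgraph_inj (emb11 R n1 n2) (emb12 R n1 n2)) e.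
  by rewrite -(mulKVmx uS a) e mulmx0.
- move=> z x zr hx.
  have uz : z%:M - (A2 - Yt *m X12) \in unitmx.
    have [] // := h2 (z%:M - (A2 - Yt *m X12)).
    rewrite (_ : _ - _ - _ = (z - z0)%:M - (A2 - H20) + Yt *m X12); last first.
      have key (a b c' d' e' : 'M[C]_(n2 + n2)) : a - (b - c') - (d' - e') = (a - d') - (b - e') + c'.
        mx_ring.
      by rewrite [(z - z0)%:M]raddfB /= key.
    apply: (le_lt_trans (nrmD _ _)); apply: (@le_lt_trans _ _ ((cabs (z - z0) * N1 + t * B2) + t * (L * cY))).
      apply: lerD.
        apply: (le_trans (nrmB _ _)); apply: lerD; last exact: H2_lip.
        by rewrite -scalemx1 nrmZ.
      apply: (le_trans (nrmM _ _)); rewrite nX mulrC -mulrA ler_wpM2l // ler_wpM2l //.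
    rewrite -addrA -mulrDr [e2]splitr; apply: ltrD.
      by apply: mul_lt_of_lt_div => //; [exact: nrm_ge0|rewrite divr_gt0|exact: cabs_ge0].
    by apply: mul_lt_of_lt_div => //; rewrite divr_gt0.
  have [a xU Ka] := invgraph_kernel (emb11 R n1 n2) (emb22 R n1 n2) (emb12 R n1 n2) (emb21 R n1 n2)
    (emb_sum R n1 n2) (Hpert_emb1 F11 G11 F22 G22 hDelta t) (Hpert_emb2 F11 G11 F22 G22 hDelta t) hYt uz hx.
  exists (St *m a); first by rewrite -mulmxA mulKmx.
  by rewrite hKE -!mulmxA mulKmx // Ka -scalemxAr.
move=> z hz; apply: (h1 K).
  rewrite /K addrAC; apply: (le_lt_trans (nrmD _ _)).
  apply: (@le_lt_trans _ _ (t * B1 + t * (L * cY))); last first.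
    by rewrite -mulrDr; apply: mul_lt_of_lt_div.
  apply: lerD; first exact: H1_lip.
  by apply: (le_trans (nrmM _ _)); rewrite nX -mulrA ler_wpM2l // ler_wpM2l.
move: hz; rewrite !eigenvalue_not_unit; apply: contra => uK.
have -> : Ht t - z%:M = St *m (K - z%:M) *m invmx St.
  by rewrite hKE mulmxBr mulmxBl scalar_mxC mulmxK.
by rewrite !unitmx_mul uS uK unitmx_inv.
Qed.

End Reduction.
End ReductionExistence.

(** * Asymptotics of a branch and definiteness on invariant subspaces *)

Section Assembly.
Variable R : realType.
Local Notation C := R[i].
Local Notation ii := ('i : C).

Lemma near0_right (P : R -> Prop) : (exists2 e : R, 0 < e & forall t, 0 < t < e -> P t) ->
  \forall t \near (0 : R)^'+, P t.
Proof.
move=> [e e0 h]; near=> t; apply: h; apply/andP; split; near: t.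
  exact: nbhs_right_gt.
exact: nbhs_right_lt.
Unshelve. all: by end_near. Qed.

Lemma cabs_ii : cabs ii = 1.
Proof. by rewrite /cabs /= expr0n expr1n add0r sqrtr1. Qed.

Lemma pt_near (z0 : C) x : cabs (pt z0 x - z0) = `|x|.
Proof. by rewrite /pt addrC addKr cabsM cabs_ii mul1r cabsR. Qed.

(** First [mu <= 2 y], since the upper bound is at most [2 y ^ N]. Comparing [mu ^ N] with
    [mu y ^ (N - 1)] then turns the relative error [K mu] into the absolute error [K mu y], at most
    [2 K y ^ 2]. *)
Lemma root_estimate (N : nat) (y mu K : R) : (0 < N)%N -> 0 < y -> 0 < mu -> 0 <= K ->
  K * mu <= 1 -> y ^+ N * (1 - K * mu) <= mu ^+ N -> mu ^+ N <= y ^+ N * (1 + K * mu) ->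
  `|mu - y| <= 2 * K * y ^+ 2.
Proof.
case: N => // N _ y0 m0 K0 Km hlo hhi.
have yN : 0 < y ^+ N by exact: exprn_gt0.
have m2 : mu <= 2 * y.
  rewrite leNgt; apply/negP => h.
  have : (2 * y) ^+ N.+1 < mu ^+ N.+1 by rewrite ltrXn2r ?nnegrE // ?mulr_ge0 ?ltW.
  rewrite ltNge => /negP; apply; apply: (le_trans hhi).
  rewrite exprMn mulrC ler_wpM2r ?exprn_ge0 ?(ltW y0) //.
  apply: (@le_trans _ _ 2); first by lra.
  by rewrite exprS ler_peMr // exprn_ege1 // ler1n.
have ub : K * mu * y <= 2 * K * y ^+ 2.
  have -> : 2 * K * y ^+ 2 = K * (2 * y) * y by ring.
  by rewrite ler_wpM2r ?(ltW y0) // ler_wpM2l.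
apply: le_trans ub; rewrite -(ler_pM2r yN).
have [ym|my] := leP y mu.
  rewrite ger0_norm ?subr_ge0 //.
  have h : mu * y ^+ N <= mu ^+ N.+1.
    by rewrite exprS ler_wpM2l ?(ltW m0) // lerXn2r ?nnegrE ?(ltW y0) ?(ltW m0).
  move: hhi h; rewrite (exprS y); move: (mu ^+ N.+1) (y ^+ N) => a b; lra.
rewrite ltr0_norm ?subr_lt0 // opprB.
have h : mu ^+ N.+1 <= mu * y ^+ N.
  by rewrite exprS ler_wpM2l ?(ltW m0) // lerXn2r ?nnegrE ?(ltW y0) ?(ltW m0) ?(ltW my).
move: hlo h; rewrite (exprS y); move: (mu ^+ N.+1) (y ^+ N) => a b; lra.
Qed.

Lemma powR_root (x : R) (N : nat) : (0 < N)%N -> 0 <= x -> (x `^ N%:R^-1) ^+ N = x.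
Proof.
move=> N0 x0; rewrite -powR_mulrn ?powR_ge0 // -powRrM mulVf ?pnatr_eq0 -?lt0n //.
by rewrite powRr1.
Qed.

(* A branch of [g t (1 + O(mu)) = mu ^ (2 rho)]. *)
Definition branch (g : R) (rho : nat) (K t mu : R) :=
  [/\ 0 < mu, K * mu <= 1, t * g * (1 - K * mu) <= mu ^+ (2 * rho) &
      mu ^+ (2 * rho) <= t * g * (1 + K * mu)].

(** For [y] the root of order [2 rho] of [t g], the error [y ^ 2] is the root of order [rho], which
    is the order of the remainder in the theorem. *)
Lemma branch_estimate g rho K t mu : (0 < rho)%N -> 0 < g -> 0 <= K -> 0 < t ->
  branch g rho K t mu ->
  `|mu - (t * g) `^ (2 * rho)%:R^-1| <= 2 * K * g `^ rho%:R^-1 * t `^ rho%:R^-1.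
Proof.
move=> r0 g0 K0 t0 [m0 Km hlo hhi]; have tg : 0 < t * g by rewrite mulr_gt0.
have r20 : (0 < 2 * rho)%N by rewrite muln_gt0.
have e := powR_root r20 (ltW tg).
have := @root_estimate (2 * rho) ((t * g) `^ (2 * rho)%:R^-1) mu K r20.
rewrite e powR_gt0 // => /(_ isT m0 K0 Km hlo hhi) h; apply: (le_trans h).
rewrite -[_ ^+ 2]powR_mulrn ?powR_ge0 // -powRrM.
have -> : ((2 * rho)%:R^-1 * 2%:R : R) = rho%:R^-1.
  by rewrite natrM; field; rewrite pnatr_eq0 -lt0n.
by rewrite powRM ?(ltW t0) ?(ltW g0) // -[leRHS]mulrA [t `^ _ * _]mulrC.
Qed.

Lemma branch_of_wt (g : R) rho K t mu : 0 < t -> 0 < mu -> K * mu <= 1 ->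
  g / (mu ^+ rho) ^+ 2 * (1 - K * mu) <= t^-1 -> t^-1 <= g / (mu ^+ rho) ^+ 2 * (1 + K * mu) ->
  branch g rho K t mu.
Proof.
move=> t0 m0 Km; have m2 : 0 < (mu ^+ rho) ^+ 2 by rewrite !exprn_gt0.
have e : mu ^+ (2 * rho) = (mu ^+ rho) ^+ 2 by rewrite mulnC exprM.
rewrite /branch e; move: (_ ^+ 2) m2 => M M0.
have key X : t * M * (g / M * X) = t * g * X.
  by field; rewrite gt_eqF.
have tM : 0 < t * M by rewrite mulr_gt0.
have tMV : t * M * t^-1 = M by rewrite mulrC mulrA mulVf ?gt_eqF // mul1r.
move=> h1 h2; split=> //; rewrite -key.
  by rewrite -[leRHS]tMV ler_pM2l.
by rewrite -[leLHS]tMV ler_pM2l.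
Qed.

Lemma semisimple_mup m (A : 'M[C]_m) z : semisimple A ->
  mup z (char_poly A) = (m - \rank (A - z%:M)%R)%N.
Proof. by move=> /semisimple_diag[P [d [uP h]]]; exact: diag_mup uP h. Qed.

Lemma semisimple_eigenvalueP m (A : 'M[C]_m) z : semisimple A -> eigenvalue A z ->
  semisimple_eigenvalue A z.
Proof. by move=> sA hz; split; rewrite // (semisimple_mup z sA) eigenspace_rank. Qed.

Lemma semisimple_restrict m q (A : 'M[C]_m) (B : 'M[C]_q) (V : 'M[C]_(m, q)) :
  (forall c : 'cV[C]_q, V *m c = 0 -> c = 0) -> A *m V = V *m B -> semisimple A -> semisimple B.
Proof.
move=> Vi AV sA z a b za ab; apply: Vi.
have e (c : 'cV[C]_q) : (z%:M - A) *m (V *m c) = V *m ((z%:M - B) *m c).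
  by rewrite !mulmxA; congr (_ *m _); rewrite mulmxBl mulmxBr AV scalar_mxC.
by apply: (sA z _ (V *m b)); rewrite e ?za ?mulmx0 -?ab.
Qed.

Lemma char_poly_eigenvalue m (A : 'M[C]_m) (lam : 'I_m -> C) z :
  char_poly A = \prod_i ('X - (lam i)%:P) -> eigenvalue A z -> exists i, z = lam i.
Proof.
move=> e; rewrite eigenvalue_root_char e -(big_map lam predT (fun x => 'X - x%:P)).
by rewrite root_prod_XsubC => /mapP[i _ ->]; exists i.
Qed.

Lemma kernel_sum_definite (I : finType) m (M : 'M[C]_m) (X : I -> 'cV[C]_m) :
  (forall i j, i != j -> (X i)^t* *m M *m X j = 0) ->
  (forall i, X i != 0 -> 0 < qf M (X i)) -> \sum_i X i != 0 -> 0 < qf M (\sum_i X i).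
Proof.
move=> ho hd hX; have [i0 Xi0] : exists i, X i != 0.
  apply/existsP; apply: contraNT hX => /existsPn h; rewrite big1 // => i _.
  by have := h i; rewrite negbK => /eqP.
have q0 i : 0 <= qf M (X i).
  by have [->|/hd/ltW //] := eqVneq (X i) 0; rewrite /qf mulmx0 mxE.
rewrite (qf_orthogonal_sum ho) (bigD1 i0) //=; apply: ltr_wpDr (hd _ Xi0).
exact: sumr_ge0.
Qed.

Lemma qf_scale_congr m q r (M : 'M[C]_m) (M1 : 'M[C]_q) (W : 'M[C]_(m, q)) (V : 'M[C]_(q, r)) a b c :
  W^t* *m M *m W = M1 ->
  qf (a *: (b *: (V^t* *m M1 *m V))) c = qf (a *: (b *: M)) (W *m (V *m c)).
Proof.
have key k (N : 'M[C]_k) (y : 'cV[C]_k) :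
    y^t* *m (a *: (b *: N)) *m y = a *: (b *: (y^t* *m N *m y)).
  by rewrite -!scalemxAr -!scalemxAl.
by move=> <-; rewrite /qf !key !adjM !mulmxA.
Qed.

Section Definiteness.
Variables (n1 n2 : nat) (F11 G11 : 'M[C]_n1) (F22 G22 : 'M[C]_n2).
Let n := (n1 + n2)%N.
Variables (d : 'M[C]_(n + n)) (z0 : C) (t : R) (A : 'M[C]_(n1 + n1)) (W : 'M[C]_(n + n, n1 + n1)).
Hypothesis z0i : Num.conj z0 = - z0.
Hypothesis hG : psdmx (block_mx G11 0 0 G22).
Let Delta := d^t* *m d.
Let sdl := saddle F11 G11 F22 G22 z0.
Hypothesis HW : Hpert F11 G11 F22 G22 Delta t *m W = W *m A.
Hypothesis JW : W^t* *m Jmx n *m W = Jmx n1.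
Hypothesis Wi : forall a : 'cV[C]_(n1 + n1), W *m a = 0 -> a = 0.
Hypothesis sA : semisimple A.

(** The vector [V *m c] splits into eigenvectors of [A] with distinct eigenvalues. Their images
    under [W] lie in kernels of the pencil at distinct points, hence are orthogonal for [i J], and
    the form is definite on each. The factor [sg] lets one argument serve both signs. *)
Lemma invariant_definite q (lam : 'I_q -> C) (x : 'I_q -> R) (V : 'M[C]_(n1 + n1, q)) (sg : C) :
  (forall i, lam i = pt z0 (x i)) ->
  (forall i v, v != 0 -> (sdl (x i) + t%:C *: Delta) *m v = 0 -> 0 < qf (sg *: (ii *: Jmx n)) v) ->
  invariant_basis A lam V -> forall c : 'cV[C]_q, c != 0 ->
  0 < qf (sg *: (ii *: (V^t* *m Jmx n1 *m V))) c.
Proof.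
move=> hlam hdef [rV [B [AV cB]]] c c0.
have Vi (a : 'cV[C]_q) : V *m a = 0 -> a = 0 by exact: full_rank_inj.
have sB := semisimple_restrict Vi AV sA.
have [P [d' [uP BP]]] := semisimple_diag sB.
have [Y [z [cE BY zz]]] := eigen_decomposition uP BP c.
pose X i := W *m (V *m Y i).
have X0 i : X i != 0 -> Y i != 0 by apply: contraNneq => h; rewrite /X h !mulmx0.
have hz i : Y i != 0 -> exists j, z i = lam j.
  move=> Yi; apply: (char_poly_eigenvalue cB); rewrite eigenvalue_not_unit.
  apply: contra Yi => u; apply/eqP; apply: (unitmx_inj u).
  by rewrite mulmxBl mul_scalar_mx BY subrr.
have hX i j : z i = lam j -> (sdl (x j) + t%:C *: Delta) *m X i = 0.
  move=> e; apply/(Hpert_kernel _ _ _ _ _ z0i); rewrite -hlam -e.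
  by rewrite -/Delta /X (mulmxA _ W) HW -(mulmxA W) (mulmxA A) AV -(mulmxA V) BY -!scalemxAr.
have ho i j : i != j -> (X i)^t* *m (sg *: (ii *: Jmx n)) *m X j = 0.
  move=> ij; have [Xi|/X0 Yi] := eqVneq (X i) 0; first by rewrite Xi adj0 !mul0mx.
  have [Xj|/X0 Yj] := eqVneq (X j) 0; first by rewrite Xj mulmx0.
  have [a za] := hz _ Yi; have [b zb] := hz _ Yj.
  have xab : x a != x b.
    by apply: contraNneq (zz _ _ ij Yi Yj) => e; rewrite za zb !hlam e.
  rewrite -scalemxAr -scalemxAl (kernel_orthogonal hG xab (hX _ _ za) (hX _ _ zb)).
  by rewrite scaler0.
have XE : \sum_i X i = W *m (V *m c) by rewrite cE !mulmx_sumr.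
have -> : qf (sg *: (ii *: (V^t* *m Jmx n1 *m V))) c = qf (sg *: (ii *: Jmx n)) (\sum_i X i).
  by rewrite XE; exact: qf_scale_congr JW.
apply: kernel_sum_definite => //.
  by move=> i Xi; have [j zj] := hz _ (X0 _ Xi); apply: (hdef j) => //; exact: hX.
rewrite XE; apply: contraNneq c0 => h; apply/eqP; apply: Vi; exact: Wi.
Qed.

Lemma form_herm q (V : 'M[C]_(n1 + n1, q)) : herm (ii *: (V^t* *m Jmx n1 *m V)).
Proof.
rewrite /herm adjZ conj_ii adjM (adjM (V^t*)) adjK adj_Jmx mulNmx mulmxN scalerN scaleNr opprK.
by rewrite mulmxA.
Qed.

End Definiteness.

End Assembly.

(** * Eigenvalues of [H(t)] on the imaginary axis *)

Section Curves.
Variable R : realType.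
Local Notation C := R[i].
Local Notation ii := ('i : C).

Section Setting.
Variables (n1 n2 : nat) (F11 G11 : 'M[C]_n1) (F22 G22 : 'M[C]_n2).
Let n := (n1 + n2)%N.
Variables (d : 'M[C]_(n + n)) (z0 : C) (m : nat) (p : 'I_m -> nat).
Variables (P : 'M[C]_(n1, \sum_i p i)) (Z : 'M[C]_(\sum_i p i, n1)).
Hypothesis z0i : Num.conj z0 = - z0.
Hypothesis hG : psdmx (block_mx G11 0 0 G22).
Let Delta := d^t* *m d.
Let sdl := saddle F11 G11 F22 G22 z0.
Let Hp := Hpert F11 G11 F22 G22 Delta.
Hypothesis hctrl : controllable F11 G11.
Hypothesis hobs : observable F11 (D11 Delta).
Hypothesis uF22 : F22 - z0%:M \in unitmx.
Hypothesis p0 : forall i, (0 < p i)%N.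
Hypothesis PZ : P *m Z = 1%:M.
Hypothesis ZP : Z *m P = 1%:M.
Hypothesis FE : F11 = P *m \mxdiag_i jordan_block z0 (p i) *m Z.

(** The curves [Q(x)] and [Q(- x)] have normal forms with the same [p'] and [g]. At the level
    [1 / t], [mup] records the crossings of the first and [mum] those of the reflected one, which is
    why [mum] is compared with [- x]. *)
Lemma pencil_curves (r : R) : 0 < r ->
  exists (p' : 'I_m -> nat) (g : 'I_m -> R) (e Kp Km t1 : R) (mup mum : R -> 'I_m -> R),
  [/\ [/\ 0 < e <= r, 0 < t1, 0 <= Kp & 0 <= Km],
     forall j, (0 < p' j)%N /\ 0 < g j,
     forall rho : nat, #|[pred j | p' j == rho]| = #|[pred j | p j == rho]| &
     forall t, 0 < t < t1 ->
     [/\ forall j, mup t j < e /\ branch (g j) (p' j) Kp t (mup t j),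
        forall j, mum t j < e /\ branch (g j) (p' j) Km t (mum t j),
        forall x, `|x| < e -> ((n + n) - \rank (Hp t - (pt z0 x)%:M)%R =
          #|[pred j | mup t j == x]| + #|[pred j | mum t j == - x]|)%N &
        forall x (v : 'cV[C]_(n + n)), 0 < `|x| < e -> v != 0 ->
          (sdl x + t%:C *: Delta) *m v = 0 ->
          (0 < x -> qf (ii *: Jmx n) v < 0) /\ (x < 0 -> 0 < qf (ii *: Jmx n) v)]].
Proof.
move=> r0.
have [p' [g [eu [eu0 g0 hp hu [nfp nfm]]]]] := saddle_normal_form hG hctrl hobs uF22 p0 PZ ZP FE.
have p'0 j : (0 < p' j)%N.
  have : (0 < #|[pred i | p' i == p' j]|)%N by apply/card_gt0P; exists j; rewrite inE.
  by rewrite hp => /fintype.card_gt0P; case=> i; rewrite inE => /eqP <-.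
have [ed [td [ed0 td0 hdef]]] := kernel_definite hG p'0 g0 nfp nfm eu0 hu.
have [ts ts0 hs] := saddle0_unit hG hctrl hobs uF22.
have [ep [Kp [ep0 Kp0 hcp]]] := normal_form_curves p'0 g0 nfp.
have [em [Km [em0 Km0 hcm]]] := normal_form_curves p'0 g0 nfm.
(* The last two bounds give [K * mu <= 1] on both families, as [branch] demands. *)
pose e := Num.min (Num.min (Num.min r eu) (Num.min ed ep)) (Num.min em (Num.min (Kp + 1)^-1 (Km + 1)^-1)).
have e0 : 0 < e by rewrite !lt_min r0 eu0 ed0 ep0 em0 !invr_gt0 !ltr_wpDl.
have [er eeu eed eep [eem eKp eKm]] :
    [/\ e <= r, e <= eu, e <= ed, e <= ep & [/\ e <= em, e <= (Kp + 1)^-1 & e <= (Km + 1)^-1]].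
  have := lexx e; rewrite {2}/e !le_min.
  by move=> /andP[/andP[/andP[? ?] /andP[? ?]] /and3P[? ? ?]].
have [thp [mup hmup]] := hcp e (introT andP (conj e0 eep)).
have [thm [mum hmum]] := hcm e (introT andP (conj e0 eem)).
have Kle (K mu : R) : 0 <= K -> e <= (K + 1)^-1 -> 0 < mu < e -> K * mu <= 1.
  move=> K0 eK /andP[m0 me]; have K1 : 0 < K + 1 by rewrite ltr_wpDl.
  apply: (@le_trans _ _ ((K + 1) * (K + 1)^-1)); last by rewrite mulfV // gt_eqF.
  apply: ler_pM; rewrite ?(ltW m0) ?lerDl //.
  exact: ltW (lt_le_trans me eK).
(* Below this bound the level [1 / t] exceeds both thresholds [thp] and [thm]. *)
pose t1 := Num.min (Num.min td ts) (`|thp| + `|thm| + 1)^-1.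
have th0 : 0 < `|thp| + `|thm| + 1 by rewrite ltr_wpDl // addr_ge0.
exists p', g, e, Kp, Km, t1, (fun t => mup t^-1), (fun t => mum t^-1); split=> //.
  by rewrite e0 er /t1 !lt_min td0 ts0 invr_gt0 th0.
move=> t /andP[t0]; rewrite !lt_min => /andP[/andP[ttd tts] tth].
have htV : `|thp| + `|thm| + 1 < t^-1.
  by rewrite -[ltLHS]invrK ltf_pV2 // ?posrE ?invr_gt0.
have htp : thp <= t^-1.
  apply: ltW; apply: le_lt_trans htV; by rewrite -addrA ler_wpDr ?ler_norm // addr_ge0.
have htm : thm <= t^-1.
  apply: ltW; apply: le_lt_trans htV; by rewrite [`|thp| + _]addrC -addrA ler_wpDr ?ler_norm // addr_ge0.
have [bp cp] := hmup _ htp; have [bm cm] := hmum _ htm.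
have tn0 : t != 0 by rewrite gt_eqF.
split.
- move=> j; have [me lo hi] := bp j; have /andP[m0 ?] := me; split=> //.
  by apply: branch_of_wt => //; exact: Kle.
- move=> j; have [me lo hi] := bm j; have /andP[m0 ?] := me; split=> //.
  by apply: branch_of_wt => //; exact: Kle.
- move=> x xe; rewrite /Hp (Hpert_rank _ _ _ _ _ z0i) -/sdl.
  have hux : x != 0 -> sdl x \in unitmx.
    move=> x0; apply: saddle_unit; apply: hu; rewrite normr_gt0 x0.
    exact: lt_le_trans eeu.
  have mup0 j : 0 < mup t^-1 j by have [/andP[]] := bp j.
  have mum0 j : 0 < mum t^-1 j by have [/andP[]] := bm j.
  have cp0 : x <= 0 -> #|[pred j | mup t^-1 j == x]| = 0%N.
    by move=> x0; apply: eq_card0 => j; rewrite !inE gt_eqF // (le_lt_trans x0).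
  have cm0 : 0 <= x -> #|[pred j | mum t^-1 j == - x]| = 0%N.
    move=> x0; apply: eq_card0 => j; rewrite !inE gt_eqF // (le_lt_trans _ (mum0 j)) //.
    by rewrite oppr_le0.
  have [x0|x0|x0] := ltgtP x 0.
  + rewrite cp0 ?ltW // add0n cm; last by rewrite oppr_gt0 x0 -ltr0_norm.
    by rewrite kernel_rank ?opprK // hux // lt_eqF.
  + rewrite cm0 ?ltW // addn0 cp; last by rewrite x0 -(gtr0_norm x0).
    by rewrite kernel_rank // hux // gt_eqF.
  (* At [x = 0] no branch value occurs, all being positive, and the nullity vanishes by
     [saddle0_unit]. *)
  rewrite cp0 ?x0 // -?x0 cm0 ?x0 // mxrank_unit ?subnn //.
  by apply: hs; rewrite t0 tts.
move=> x v /andP[x0 xe]; apply: (hdef t x v); first by rewrite t0 ttd.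
by rewrite x0 (lt_le_trans xe).
Qed.

End Setting.

Lemma big_nat_fiber (I : finType) (p : I -> nat) k (f : I -> nat) : (forall j, (0 < p j <= k)%N) ->
  (\sum_(1 <= rho < k.+1) \sum_(j | p j == rho) f j = \sum_j f j)%N.
Proof.
move=> hp; rewrite (exchange_big_dep predT) //=; apply: eq_bigr => j _.
rewrite big_mkcond (bigD1_seq (p j)) ?iota_uniq ?mem_index_iota ?ltnS //= eqxx big1 ?addn0 //.
by move=> i; rewrite eq_sym => /negbTE ->.
Qed.

Lemma sum_nth (T : Type) (x0 : T) (l : seq T) q (f : T -> nat) : size l = q ->
  (\sum_(i < q) f (nth x0 l i) = \sum_(x <- l) f x)%N.
Proof. by move=> <-; rewrite (big_nth x0) big_mkord. Qed.

End Curves.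

(** * Regrouping the branches by Jordan block size *)

Section BranchIndex.
Variable R : realType.
Local Notation C := R[i].
Local Notation ii := ('i : C).
Variables (m : nat) (p : 'I_m -> nat).

(** Listing a fiber lets its branches be indexed by ['I_(s rho)] through [nth]; for [1 <= rho <= k]
    the list has length [s rho] in the application, so the default value [1] is not reached. *)
Definition fiber rho : seq 'I_m := enum [pred j | p j == rho].

Lemma size_fiber rho : size (fiber rho) = #|[pred j | p j == rho]|.
Proof. by rewrite /fiber -cardE. Qed.

Lemma fiber_nth rho i : (i < size (fiber rho))%N ->
  exists2 j, p j = rho & forall (f : 'I_m -> R), nth 1 (map f (fiber rho)) i = f j.
Proof.
move=> hi; have j0 : 'I_m by case: (fiber rho) hi.
exists (nth j0 (fiber rho) i) => [|f]; last exact: nth_map.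
by have := mem_nth j0 hi; rewrite mem_enum inE => /eqP.
Qed.

Lemma fiber_count k (s : nat -> nat) (mup mum : 'I_m -> R) (x : R) :
  (forall j, (0 < p j <= k)%N) ->
  (forall r, (0 < r <= k)%N -> #|[pred j | p j == r]| = s r) ->
  (\sum_(1 <= rho < k.+1) \sum_(i < s rho)
    ((nth 1%R (map mup (fiber rho)) i == x) + (nth 1%R (map mum (fiber rho)) i == - x)%R) =
  #|[pred j | mup j == x]| + #|[pred j | mum j == (- x)%R]|)%N.
Proof.
move=> hp hs; under eq_big_nat => rho hrho.
  have sr (f : 'I_m -> R) : size (map f (fiber rho)) = s rho by rewrite size_map size_fiber hs.
  rewrite big_split /= (sum_nth 1%R (fun y => y == x) (sr mup)) (sum_nth 1%R (fun y => y == (- x)%R) (sr mum)).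
  rewrite !big_map -!big_split /= big_enum.
  over.
rewrite (big_nat_fiber _ hp) big_split /= -!sum1_card [in RHS]big_mkcond [X in (_ + X)%N = _]big_mkcond /=.
by rewrite [X in (_ = _ + X)%N]big_mkcond; congr (_ + _)%N; apply: eq_bigr => j _; rewrite inE; case: eqP.
Qed.

End BranchIndex.

(** * Points of the imaginary axis and the final statement *)

Lemma shift_pt (R : realType) (alpha y w : R) :
  pt ('i * alpha%:C) y - 'i * (alpha + w)%:C = 'i * (y - w)%:C.
Proof. by rewrite /pt rmorphD rmorphB /= mulrBr mulrDr opprD addrACA subrr add0r. Qed.

Lemma Re_pt (R : realType) (alpha y : R) : complex.Re (pt ('i * alpha%:C) y) = 0.
Proof. by rewrite /pt -mulrDr -rmorphD /= !mul0r mulr0 subr0. Qed.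

Lemma imaginary_pt (R : realType) (alpha : R) (z : R[i]) : complex.Re z = 0 ->
  z = pt ('i * alpha%:C) (complex.Im z - alpha).
Proof.
case: z => a b /= ->; rewrite /pt -mulrDr -rmorphD /= addrC subrK; apply/eqP.
by rewrite eq_complex /= !mul0r mulr0 subr0 mul1r add0r !eqxx.
Qed.

Lemma bigO_branch (R : realType) (alpha c t0 : R) (lam : R -> R[i]) (y w f : R -> R) :
  0 < t0 -> (forall t, 0 < t < t0 -> lam t = pt ('i * alpha%:C) (y t)) ->
  (forall t, 0 < t < t0 -> `|y t - w t| <= c * f t) ->
  bigO_at_right0 (fun t => lam t - 'i * (alpha + w t)%:C) f.
Proof.
move=> t00 hl hy; exists c; apply: near0_right; exists t0 => // t ht.
by rewrite hl // shift_pt normCE cabsM cabs_ii mul1r cabsR lecR hy.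
Qed.

Theorem lemma3p3 (R : realType) (n1 n2 : nat)
  (F11 G11 : 'M[R[i]]_n1) (F22 G22 : 'M[R[i]]_n2)
  (Delta : 'M[R[i]]_((n1 + n2) + (n1 + n2)))
  (Ht : R -> 'M[R[i]]_(n1 + n1))
  (alpha : R) (k : nat) (s : nat -> nat)
  (hG : psdmx (block_mx G11 0 0 G22))
  (hsep : forall z : R[i],
     ~ ((eigenvalue F11 z \/ eigenvalue (- F11^t*) z) /\
        (eigenvalue F22 z \/ eigenvalue (- F22^t*) z)))
  (hDelta : psdmx Delta)
  (hHt : is_Htilde1 F11 G11 F22 G22 Delta Ht)
  (hctrl : controllable F11 G11)
  (hobs : observable F11 (D11 Delta))
  (hspec : forall z : R[i], eigenvalue F11 z <-> z = 'i * alpha%:C)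
  (hjordan : single_jordan_structure F11 ('i * alpha%:C) k s) :
  (\forall t \near (0 : R)^'+, forall z : R[i],
     eigenvalue (Ht t) z -> semisimple_eigenvalue (Ht t) z) /\
  exists (gamma : forall rho : nat, 'I_(s rho) -> R)
         (lamp lamm : forall rho : nat, 'I_(s rho) -> R -> R[i]),
    [/\ forall (rho : nat) (i : 'I_(s rho)), (1 <= rho <= k)%N ->
          [/\ 0 < gamma rho i,
              bigO_at_right0
                (fun t => lamp rho i t
                   - 'i * (alpha + (t * gamma rho i) `^ (2 * rho)%:R^-1)%:C)
                (fun t => t `^ rho%:R^-1) &
              bigO_at_right0
                (fun t => lamm rho i t
                   - 'i * (alpha - (t * gamma rho i) `^ (2 * rho)%:R^-1)%:C)
                (fun t => t `^ rho%:R^-1)],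
        \forall t \near (0 : R)^'+,
          forall (rho : nat) (i : 'I_(s rho)), (1 <= rho <= k)%N ->
            complex.Re (lamp rho i t) = 0 /\ complex.Re (lamm rho i t) = 0,
        \forall t \near (0 : R)^'+, forall z : R[i], complex.Re z = 0 ->
          mup z (char_poly (Ht t)) =
            (\sum_(1 <= rho < k.+1)
               \sum_(i < s rho)
                  ((lamp rho i t == z) + (lamm rho i t == z)))%N &
        \forall t \near (0 : R)^'+, forall rho : nat, (1 <= rho <= k)%N ->
          (forall Vp : 'M[R[i]]_(n1 + n1, s rho),
             invariant_basis (Ht t) (fun i => lamp rho i t) Vp ->
             negdefmx ('i *: (Vp^t* *m Jmx n1 *m Vp))) /\
          (forall Vm : 'M[R[i]]_(n1 + n1, s rho),
             invariant_basis (Ht t) (fun i => lamm rho i t) Vm ->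
             posdefmx ('i *: (Vm^t* *m Jmx n1 *m Vm)))].
Proof.
pose z0 : R[i] := 'i * alpha%:C.
have z0i : Num.conj z0 = - z0 by rewrite /z0 mulrC conjMR conj_ii mulrN.
have ez0 : eigenvalue F11 z0 by apply/hspec.
have nF22 : ~ (eigenvalue F22 z0 \/ eigenvalue (- F22^t*) z0).
  by move=> h; apply: (hsep z0); split=> //; left.
have uF22 : F22 - z0%:M \in unitmx.
  by rewrite unitmx_eigenvalue; apply/negP => h; apply: nF22; left.
have [d dE] := psdmx_factor hDelta; rewrite {}dE in hDelta hHt hobs.
have [m [p [P [Z [pk ps PZ ZP FE]]]]] := hjordan.
have p0 i : (0 < p i)%N by have /andP[] := pk i.
have hherm : herm (d^t* *m d) by exact: herm_gram.
have [r1 r10 hred] := riccati_reduction hherm z0i (fun z => proj1 (hspec z)) nF22 hHt.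
have [rs rs0 hss] := Hpert_semisimple F11 F22 d z0i hG.
have rmin : 0 < Num.min r1 rs by rewrite lt_min r10 rs0.
have [p' [g [e [Kp [Km [t1 [mup [mum [[/andP[e0]] ]]]]]]]]] :=
  pencil_curves z0i hG hctrl hobs uF22 p0 PZ ZP FE rmin.
rewrite le_min => /andP[er1 ers] t10 Kp0 Km0 hpg hcard hcur.
have [t2 t20 hW] := hred e e0.
have p's r : (0 < r <= k)%N -> #|[pred j | p' j == r]| = s r by move=> hr; rewrite hcard ps.
have p'k j : (0 < p' j <= k)%N.
  have : (0 < #|[pred i | p' i == p' j]|)%N by apply/card_gt0P; exists j; rewrite inE.
  by rewrite hcard => /fintype.card_gt0P; case=> i; rewrite inE => /eqP <-.
pose t3 := Num.min t1 t2; have t30 : 0 < t3 by rewrite lt_min t10.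
(* The same data, enriched with the semisimplicity of [Ht t], which is pulled back from [Hpert]
   along the injective [W]. *)
have {hW}hW t : 0 < t < t3 -> exists W : 'M[R[i]]_((n1 + n2) + (n1 + n2), n1 + n1),
    [/\ Hpert F11 G11 F22 G22 (d^t* *m d) t *m W = W *m Ht t, W^t* *m Jmx (n1 + n2) *m W = Jmx n1,
      forall a : 'cV[R[i]]_(n1 + n1), W *m a = 0 -> a = 0,
      forall z (x : 'cV[R[i]]_((n1 + n2) + (n1 + n2))), cabs (z - z0) < r1 ->
        Hpert F11 G11 F22 G22 (d^t* *m d) t *m x = z *: x ->
        exists2 a, x = W *m a & Ht t *m a = z *: a &
      (forall z, eigenvalue (Ht t) z -> cabs (z - z0) < e) /\ semisimple (Ht t)].
  rewrite lt_min => /andP[t0 /andP[tt1 tt2]].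
  have [W [HW JW Wi Wk Ws]] := hW t (introT andP (conj t0 tt2)).
  exists W; split=> //; split=> // z a b za ab; apply: Wi.
  have We c : (z%:M - Hpert F11 G11 F22 G22 (d^t* *m d) t) *m (W *m c) = W *m ((z%:M - Ht t) *m c).
    by rewrite !mulmxA; congr (_ *m _); rewrite mulmxBl mulmxBr HW scalar_mxC.
  have [ez|nez] := boolP (eigenvalue (Ht t) z); last first.
    suff -> : a = 0 by rewrite mulmx0.
    apply: unitmx_inj za; rewrite -unitmxN opprB unitmx_eigenvalue //.
  have ze := Ws z ez.
  (* The punctured disc of [Hpert_semisimple] leaves out [z0]; there the count at [x = 0] is zero,
     so [z0] is no eigenvalue of [Hpert]. *)
  have [zz|zz] := eqVneq z z0.
    have [hp hm hn _] := hcur t (introT andP (conj t0 tt1)).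
    have z1 : pt z0 0 = z by rewrite /pt mulr0 addr0 zz.
    have cp : #|[pred j | mup t j == 0]| = 0%N.
      by apply: eq_card0 => j; rewrite !inE gt_eqF //; have [_ []] := hp j.
    have cm : #|[pred j | mum t j == 0]| = 0%N.
      by apply: eq_card0 => j; rewrite !inE gt_eqF //; have [_ []] := hm j.
    have := hn 0; rewrite normr0 z1 oppr0 cp cm => /(_ e0).
    move=> /eqP; rewrite subn_eq0 => hr.
    apply: (full_rank_inj (M := Hpert F11 G11 F22 G22 (d^t* *m d) t - z%:M)).
      by apply/eqP; rewrite eqn_leq rank_leq_row hr.
    by rewrite -opprB mulNmx We za mulmx0 oppr0.
  apply: (hss z _ t _ (W *m b)); rewrite ?We ?za ?mulmx0 -?ab //.
  by rewrite cabs_gt0 subr_eq0 zz (lt_le_trans ze).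
have hidx rho (i : 'I_(s rho)) : (1 <= rho <= k)%N ->
    exists2 j, p' j = rho & forall f : 'I_m -> R, nth 1 (map f (fiber p' rho)) i = f j.
  by move=> hrho; apply: fiber_nth; rewrite size_fiber p's.
have hc t : 0 < t < t3 -> 0 < t < t1.
  by rewrite lt_min => /andP[-> /andP[-> _]].
split.
  apply: near0_right; exists t3 => // t /hW[W [_ _ _ _ [_ sA]]] z; exact: semisimple_eigenvalueP.
(* The constants come from the common [g] of both normal forms; the sign in the third witness undoes
   the reflection in the definition of [mum]. *)
exists (fun rho i => nth 1 (map g (fiber p' rho)) i).
exists (fun rho i t => pt z0 (nth 1 (map (mup t) (fiber p' rho)) i)).
exists (fun rho i t => pt z0 (- nth 1 (map (mum t) (fiber p' rho)) i)).
split.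
- move=> rho i hrho; have [j pj hj] := hidx rho i hrho; have [p'j g0] := hpg j.
  rewrite !hj; split=> //.
    apply: (bigO_branch (c := 2 * Kp * g j `^ rho%:R^-1) (y := fun t => mup t j) t30).
      by move=> t _; rewrite hj.
    move=> t ht; have [hp _ _ _] := hcur t (hc t ht); have [_ hb] := hp j.
    by rewrite -pj; apply: branch_estimate hb => //; have /andP[] := ht.
  apply: (bigO_branch (c := 2 * Km * g j `^ rho%:R^-1) (y := fun t => - mum t j) t30).
    by move=> t _; rewrite hj.
  move=> t ht; have [_ hm _ _] := hcur t (hc t ht); have [_ hb] := hm j.
  rewrite opprK addrC distrC -pj; apply: branch_estimate hb => //; by have /andP[] := ht.
- apply: near0_right; exists t3 => // t _ rho i _.
  by rewrite !Re_pt.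
- apply: near0_right; exists t3 => // t ht z Rz.
  have [W [HW JW Wi Wk [Ws sA]]] := hW t ht; have [hp hm hn _] := hcur t (hc t ht).
  pose x := complex.Im z - alpha; have zE : z = pt z0 x by exact: imaginary_pt.
  transitivity (#|[pred j | mup t j == x]| + #|[pred j | mum t j == (- x)%R]|)%N; last first.
    rewrite -(fiber_count (p := p') (mup t) (mum t) x p'k p's).
    apply: eq_bigr => rho _; apply: eq_bigr => i _.
    by rewrite zE !(inj_eq (@pt_inj R z0)) eqr_oppLR.
  rewrite (semisimple_mup z sA).
  (* Beyond distance [e] both sides vanish: the spectrum of [Ht t] is confined to the disc of radius
     [e], and all branch values are below [e]. *)
  have [xe|ex] := ltP `|x| e.
    rewrite -hn // -zE.
    apply: (nullity_transfer (W := W)) => // [a za|v zv].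
      have : Ht t *m a = z *: a by apply/eqP; rewrite -subr_eq0 -mul_scalar_mx -mulmxBl za.
      rewrite mulmxBl mul_scalar_mx (mulmxA _ W) HW -(mulmxA W) => ->.
      by rewrite -scalemxAr subrr.
    have hv : Hpert F11 G11 F22 G22 (d^t* *m d) t *m v = z *: v.
      by apply/eqP; rewrite -subr_eq0 -mul_scalar_mx -mulmxBl zv.
    have [|a va ha] := Wk z v _ hv; first by rewrite zE pt_near (lt_le_trans xe).
    by exists a => //; rewrite mulmxBl mul_scalar_mx ha subrr.
  have -> : #|[pred j | mup t j == x]| = 0%N.
    apply: eq_card0 => j; rewrite !inE; apply: contraTF ex => /eqP <-.
    by have [me [m0 _ _ _]] := hp j; rewrite -ltNge gtr0_norm.
  have -> : #|[pred j | mum t j == - x]| = 0%N.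
    apply: eq_card0 => j; rewrite !inE; apply: contraTF ex => /eqP; rewrite -normrN => <-.
    by have [me [m0 _ _ _]] := hm j; rewrite -ltNge gtr0_norm.
  rewrite mxrank_unit ?subnn // unitmx_eigenvalue; apply/negP => /Ws.
  by rewrite zE pt_near ltNge ex.
apply: near0_right; exists t3 => // t ht rho hrho.
have [W [HW JW Wi Wk [Ws sA]]] := hW t ht; have [hp hm _ hd] := hcur t (hc t ht).
(* On kernel vectors the form [i J] is negative for [x > 0] and positive for [x < 0]; so [lamp] is
   treated with [sg = -1] and [lamm] with [sg = 1]. *)
split=> V hV; (split; first exact/hermsymmx_herm/form_herm) => v v0;
    rewrite (qf_herm _ (form_herm _)) -(rmorph0 (real_complex R)) ltcR.
  rewrite -oppr_gt0 -qfN -scaleN1r.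
  apply: (invariant_definite z0i hG HW JW Wi sA _ _ hV v0) => // i w w0.
  have [j _ ->] := hidx rho i hrho; have [me [m0 _ _ _]] := hp j => hw.
  have [|h _] := hd (mup t j) w _ w0 hw; first by rewrite normr_gt0 gt_eqF // gtr0_norm.
  by rewrite scaleN1r qfN oppr_gt0 h.
rewrite -[X in qf X]scale1r.
apply: (invariant_definite z0i hG HW JW Wi sA _ _ hV v0) => // i w w0.
have [j _ ->] := hidx rho i hrho; have [me [m0 _ _ _]] := hm j => hw.
have [|_ h] := hd (- mum t j) w _ w0 hw; first by rewrite normrN normr_gt0 gt_eqF // gtr0_norm.
by rewrite scale1r h // oppr_lt0.
Qed.
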